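(* Assume ZFC together with the diamond axiom $\diamondsuit$. Then there is a non-separable $C^{\ast}$-algebra $A$ with discrete spectrum $\widehat{A}$ whose Banach space dual $A^{\ast}$ does not have the weak fixed point property (and, a fortiori, does not have the weak$^{\ast}$ fixed point property).
   Context: The diamond axiom $\diamondsuit$ is Jensen's principle: there exist sets $S_\alpha\subset\alpha$ for $\alpha<\omega_1$ such that for every $S\subset\omega_1$ the set $\{\alpha<\omega_1: S\cap\alpha=S_\alpha\}$ is stationary in $\omega_1$. The spectrum $\widehat{A}$ of a $C^{\ast}$-algebra $A$ is the set of unitary equivalence classes of irreducible $\ast$-representations of $A$, endowed with the inverse image of the Jacobson (hull-kernel) topology on the set of primitive ideals under the map $\pi\mapsto\ker\pi$. A non-empty bounded closed convex subset $K$ of a Banach space $E$ has the fixed point property if every non-expansive map $T:K\to K$ (i.e. $\|Tx-Ty\|\le\|x-y\|$ for all $x,y\in K$) has a fixed point. A Banach space $E$ has the weak fixed point property if every non-empty weakly compact convex subset of $E$ has the fixed point property. A dual Banach space $E$ has the weak$^{\ast}$ fixed point property if every non-empty weak$^{\ast}$ compact convex subset of $E$ has the fixed point property. The weak$^{\ast}$ topology on $A^{\ast}$ is $\sigma(A^{\ast},A)$. *)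

(* Defs.v *)
From HB Require Import structures.
From mathcomp Require Import all_boot all_order all_algebra.
From mathcomp Require Import all_classical wochoice all_reals all_analysis.
From mathcomp Require Import complex.

Set Implicit Arguments.
Unset Strict Implicit.
Unset Printing Implicit Defensive.

Import Order.TTheory GRing.Theory Num.Theory.
Import numFieldNormedType.Exports.

Local Open Scope classical_set_scope.
Local Open Scope complex_scope.
Local Open Scope ring_scope.

(* The order type omega_1: an uncountable well-order all of whose proper
   initial segments are countable. *)
Definition is_omega1 d (W : orderType d) : Prop :=
  [/\ well_order (<=%O : rel W),
      ~ countable [set: W] &
      forall a : W, countable [set b : W | (b < a)%O]].

(* The second clause is closure in the order topology, stated at limit points
   of [C]: the existence of some [b < a] excludes the least element, and
   successors satisfy it vacuously. *)
Definition club d (W : orderType d) (C : set W) : Prop :=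
  (forall a, exists2 c, C c & (a < c)%O) /\
  (forall a, (exists b, (b < a)%O) ->
     (forall b, (b < a)%O -> exists c, [/\ C c, (b < c)%O & (c < a)%O]) ->
     C a).

Definition stationary d (W : orderType d) (S : set W) : Prop :=
  forall C, club C -> C `&` S !=set0.

Definition diamond : Prop :=
  exists d (W : orderType d), is_omega1 W /\
    exists S_ : W -> set W,
      (forall a, S_ a `<=` [set b | (b < a)%O]) /\
      (forall S : set W,
         stationary [set a | S `&` [set b | (b < a)%O] = S_ a]).

(* Not assumed unital. *)
HB.mixin Record isCStarAlgebra (R : realType) A
    & CompleteNormedModule R[i] A := {
  cmul : A -> A -> A ;
  cstar : A -> A ;
  cmulA : associative cmul ;
  cmulDl : left_distributive cmul +%R ;
  cmulDr : right_distributive cmul +%R ;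
  cmulZl : forall (k : R[i]) x y, cmul (k *: x) y = k *: cmul x y ;
  cmulZr : forall (k : R[i]) x y, cmul x (k *: y) = k *: cmul x y ;
  cstarK : involutive cstar ;
  cstarD : {morph cstar : x y / x + y} ;
  cstarZ : forall (k : R[i]) x, cstar (k *: x) = k^*%C *: cstar x ;
  cstarM : forall x y, cstar (cmul x y) = cmul (cstar y) (cstar x) ;
  cnormM : forall x y, `|cmul x y| <= `|x| * `|y| ;
  cnorm_star : forall x, `|cmul (cstar x) x| = `|x| ^+ 2
}.

#[short(type="cstarAlgType")]
HB.structure Definition CStarAlgebra (R : realType) :=
  {A of CompleteNormedModule R[i] A & isCStarAlgebra R A}.

Definition separable (T : topologicalType) : Prop :=
  exists2 D : set T, countable D & dense D.

(* The inner product is linear in its first argument; its positive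
   definiteness follows from [inner_norm].  The carrier is a bare
   [completeNormedModType], like the one underlying a [cstarAlgType], so that
   Hilbert spaces range over a universe at least as large as that of
   C*-algebras: representations such as the GNS ones are never left out. *)
Record hilbertType (R : realType) := Hilbert {
  hilbert_sort :> completeNormedModType R[i] ;
  inner : hilbert_sort -> hilbert_sort -> R[i] ;
  innerDl : forall x y z, inner (x + y) z = inner x z + inner y z ;
  innerZl : forall (k : R[i]) x y, inner (k *: x) y = k * inner x y ;
  inner_sym : forall x y, inner y x = (inner x y)^*%C ;
  inner_norm : forall x, inner x x = `|x| ^+ 2
}.

Definition star_representation (R : realType) (A : cstarAlgType R)
    (H : hilbertType R) (pi : A -> H -> H) : Prop :=
  [/\ forall a, linear (pi a) /\ continuous (pi a),
      forall (k : R[i]) a b x, pi (k *: a + b) x = k *: pi a x + pi b x,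
      forall a b x, pi (cmul a b) x = pi a (pi b x) &
      forall a x y, inner (pi a x) y = inner x (pi (cstar a) y)].

Definition closed_subspace (R : realType) (H : hilbertType R) (V : set H) :=
  [/\ V 0, forall (k : R[i]) x y, V x -> V y -> V (k *: x + y) & closed V].

(* The first clause rules out the zero representation, in particular the
   one on a one-dimensional space, whose kernel is not a primitive ideal. *)
Definition irreducible_representation (R : realType) (A : cstarAlgType R)
    (H : hilbertType R) (pi : A -> H -> H) : Prop :=
  (exists a x, pi a x <> 0) /\
  (forall V : set H, closed_subspace V ->
     (forall a x, V x -> V (pi a x)) -> V = [set 0] \/ V = setT).

Record irrep (R : realType) (A : cstarAlgType R) := Irrep {
  irrep_space : hilbertType R ;
  irrep_map :> A -> irrep_space -> irrep_space ;
  irrep_star : star_representation irrep_map ;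
  irrep_irreducible : irreducible_representation irrep_map }.

Definition unitarily_equivalent (R : realType) (A : cstarAlgType R)
    (pi rho : irrep A) : Prop :=
  exists u : irrep_space pi -> irrep_space rho,
    [/\ linear u, forall x y, inner (u x) (u y) = inner x y,
        range u = setT & forall a x, u (pi a x) = rho a (u x)].

Definition irrep_ker (R : realType) (A : cstarAlgType R) (pi : irrep A) :
  set A := [set a | forall x, pi a x = 0].

Record primitive_ideal (R : realType) (A : cstarAlgType R) := PrimitiveIdeal {
  ideal_set : set A ;
  ideal_primitive : exists pi : irrep A, ideal_set = irrep_ker pi }.

Definition hull (R : realType) (A : cstarAlgType R) (I : set A) :
  set (primitive_ideal A) := [set P | I `<=` ideal_set P].

Definition kernel_of (R : realType) (A : cstarAlgType R)
  (F : set (primitive_ideal A)) : set A := [set a | forall P, F P -> ideal_set P a].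

(* In the hull-kernel topology the closure of [F] is [hull (kernel_of F)]. *)
Definition jacobson_open (R : realType) (A : cstarAlgType R)
  (U : set (primitive_ideal A)) : Prop := hull (kernel_of (~` U)) `<=` ~` U.

Lemma jacobson_openT (R : realType) (A : cstarAlgType R) :
  jacobson_open [set: primitive_ideal A].
Proof.
move=> [P [pi EP]] /= h _; have [[a [x nz]] _] := irrep_irreducible pi.
suff : P a by rewrite EP => /(_ x).
by apply: h => Q; rewrite setCT.
Qed.

Lemma linear_fun0 (R : realType) (V W : normedModType R[i]) (f : V -> W) :
  linear f -> f 0 = 0.
Proof.
move=> lf; have := lf 1 0 0; rewrite !scale1r addr0 => /eqP.
by rewrite -subr_eq subrr => /eqP <-.
Qed.

Lemma irrep_ker_prime (R : realType) (A : cstarAlgType R) (pi : irrep A)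
    (I J : set A) :
  (forall a b, I a -> I (cmul a b)) ->
  (forall a b, I a -> J b -> irrep_ker pi (cmul a b)) ->
  I `<=` irrep_ker pi \/ J `<=` irrep_ker pi.
Proof.
move=> Ir IJ; have [linpi _ piM _] := irrep_star pi.
have [_ irr] := irrep_irreducible pi.
have pi0 a : pi a 0 = 0 by apply: linear_fun0; exact: (linpi a).1.
pose V := [set x | forall a, I a -> pi a x = 0].
have [| |V0|VT] := irr V.
- split.
  + by move=> a _; exact: pi0.
  + by move=> k x y Vx Vy a Ia; rewrite (linpi a).1 Vx// Vy// scaler0 addr0.
  + have -> : V = \bigcap_(a in I) (pi a @^-1` [set 0]) by [].
    apply: closed_bigI => a _; apply: preimage_closed.
      by move=> x _; exact: (linpi a).2.
    by apply: accessible_closed_set1; apply: hausdorff_accessible;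
      exact: norm_hausdorff.
- by move=> a x Vx b Ib; rewrite -piM; apply: Vx; exact: Ir.
- right=> b Jb x; have : V (pi b x) by move=> a Ia; rewrite -piM IJ.
  by rewrite V0.
- left=> a Ia x; suff : V x by apply.
  by rewrite VT.
Qed.

Lemma jacobson_openI (R : realType) (A : cstarAlgType R) :
  setI_closed (@jacobson_open R A).
Proof.
move=> U V oU oV P; rewrite /hull /= => hP.
have kerM (F : set (primitive_ideal A)) a b :
    kernel_of F a -> kernel_of F (cmul a b) /\ kernel_of F (cmul b a).
  move=> Fa; split=> -[Q [rho EQ]] FQ; rewrite /= EQ => x;
    have [linr _ rM _] := irrep_star rho; rewrite rM;
    have /= := Fa _ FQ; rewrite /= EQ => ker_a; rewrite ker_a//.
  by apply: linear_fun0; exact: (linr b).1.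
have [pi EP] := ideal_primitive P.
have : kernel_of (~` U) `<=` ideal_set P \/ kernel_of (~` V) `<=` ideal_set P.
  rewrite EP; apply: irrep_ker_prime => [a b Ua|a b Ua Vb].
    by have [] := kerM _ _ b Ua.
  rewrite -EP; apply: (hP (cmul a b)) => Q; rewrite setCI => -[] HQ.
  - by have [h _] := kerM _ _ b Ua; exact: h.
  - by have [_ h] := kerM _ _ a Vb; exact: h.
by case=> [/(oU P) nU|/(oV P) nV] [UP VP]; [exact: nU|exact: nV].
Qed.

Lemma jacobson_open_bigU (R : realType) (A : cstarAlgType R) (I : Type)
    (U : I -> set (primitive_ideal A)) :
  (forall i, jacobson_open (U i)) -> jacobson_open (\bigcup_i U i).
Proof.
move=> oU P hP [i _]; apply: (oU i) => a ka; apply: (hP a) => Q nQ.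
by apply: ka => UQ; apply: nQ; exists i.
Qed.

HB.instance Definition _ (R : realType) (A : cstarAlgType R) :=
  gen_eqMixin (primitive_ideal A).
HB.instance Definition _ (R : realType) (A : cstarAlgType R) :=
  gen_choiceMixin (primitive_ideal A).
HB.instance Definition _ (R : realType) (A : cstarAlgType R) :=
  isOpenTopological.Build (primitive_ideal A)
    (@jacobson_openT R A) (@jacobson_openI R A) (@jacobson_open_bigU R A).

(* Unitary equivalence classes are plain predicates rather than [set]s:
   the type of irreducible representations lies in too large a universe. *)
Record spectrum (R : realType) (A : cstarAlgType R) := Spectrum {
  spectrum_class : irrep A -> Prop ;
  spectrum_classP : exists pi, spectrum_class = unitarily_equivalent pi }.

Definition spectrum_repr (R : realType) (A : cstarAlgType R)
  (c : spectrum A) : irrep A := projT1 (cid (spectrum_classP c)).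

Definition spectrum_ker (R : realType) (A : cstarAlgType R) (c : spectrum A) :
    primitive_ideal A :=
  PrimitiveIdeal (ex_intro _ (spectrum_repr c) erefl).

(* [spectrum_ker] does not depend on the representative. *)
Lemma spectrum_kerE (R : realType) (A : cstarAlgType R) (c : spectrum A)
    (pi : irrep A) : spectrum_class c pi -> ideal_set (spectrum_ker c) = irrep_ker pi.
Proof.
rewrite /= /spectrum_repr; case: cid => rho /= -> [u [lu iu su equ]].
have u0 : u 0 = 0 by apply: linear_fun0; exact: lu.
have uz x : u x = 0 -> x = 0.
  move=> ux; have := iu x x; rewrite !inner_norm ux normr0 expr0n /=.
  by move=> /esym/eqP; rewrite sqrf_eq0 normr_eq0 => /eqP.
apply/seteqP; split=> a ka x.
  have [y _ <-] : range u x by rewrite su.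
  by rewrite -equ ka u0.
by apply: uz; rewrite equ ka.
Qed.

Definition spectrum_open (R : realType) (A : cstarAlgType R)
  (U : spectrum A -> Prop) : Prop :=
  exists2 V : set (primitive_ideal A), open V &
    forall c, U c <-> V (spectrum_ker c).

Definition discrete_spectrum (R : realType) (A : cstarAlgType R) : Prop :=
  forall U : spectrum A -> Prop, spectrum_open U.

Section Dual.
Variables (R : realType) (E : normedModType R[i]).

Definition bounded_functional : {pred E -> R[i]^o} :=
  mem [set f : E -> R[i]^o | linear f /\ continuous f].

Record dual := Dual {
  functional :> E -> R[i]^o ;
  functionalP : functional \in bounded_functional }.

HB.instance Definition _ := [isSub for functional].
HB.instance Definition _ := [Choice of dual by <:].

Lemma bounded_functional_submod : submod_closed bounded_functional.
Proof.
split.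
  apply/mem_set; split; last exact: cst_continuous.
  by move=> k x y; rewrite /= scaler0 addr0.
move=> k f g /set_mem[lf cf] /set_mem[lg cg]; apply/mem_set; split.
  move=> l x y; rewrite !fctE /= lf lg !scalerDr !scalerA (mulrC k l).
  by rewrite addrACA.
by move=> x; apply: cvgD; [apply: cvgZr; exact: cf|exact: cg].
Qed.

HB.instance Definition _ := GRing.isSubmodClosed.Build R[i] (E -> R[i]^o)
  bounded_functional bounded_functional_submod.
HB.instance Definition _ := [SubChoice_isSubLmodule of dual by <:].

Lemma functional_linear (f : dual) : linear f.
Proof. by have /set_mem[] := functionalP f. Qed.

Lemma functional_continuous (f : dual) : continuous f.
Proof. by have /set_mem[] := functionalP f. Qed.

HB.instance Definition _ (f : dual) :=
  GRing.isLinear.Build R[i] E R[i]^o *:%R f (functional_linear f).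

End Dual.

Section DualNorm.
Variables (R : realType) (E : normedModType R[i]).

Definition unit_ball_values (f : dual E) : set R :=
  [set r | exists2 x : E, `|x| <= 1 & `|f x| = r%:C].

Definition dual_norm (f : dual E) : R[i] := (sup (unit_ball_values f))%:C.

Lemma has_sup_unit_ball_values (f : dual E) : has_sup (unit_ball_values f).
Proof.
split; first by exists 0, 0; rewrite ?normr0 ?linear0 ?normr0.
have [_ /(_ _ 1)] := bounded_funP f; case.
  by apply/linear_bounded_continuous; exact: functional_continuous.
move=> M Mb; exists (complex.Re M) => r [x x1 fxr].
have := Mb _ x1; rewrite fxr => rM.
have Mr : M \is Num.real.
  by rewrite -(subrK r%:C M) realD ?complex_real// ger0_real// subr_ge0.
by rewrite -lecR RRe_real.
Qed.

Lemma dual_norm_le (f : dual E) (M : R) :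
  (forall x, `|x| <= 1 -> `|f x| <= M%:C) -> dual_norm f <= M%:C.
Proof.
move=> fM; rewrite lecR; apply: ge_sup.
  by have [] := has_sup_unit_ball_values f.
by move=> r [x x1 fxr]; rewrite -lecR -fxr; exact: fM.
Qed.

Lemma le_dual_norm (f : dual E) (x : E) : `|f x| <= dual_norm f * `|x|.
Proof.
have [->|x0] := eqVneq x 0; first by rewrite linear0 !normr0 mulr0.
have nx : 0 < `|x| by rewrite normr_gt0.
rewrite -ler_pdivrMr// -[in X in _ / X](normr_id x) -normfV mulrC -normrM.
rewrite -[_ * f x]/(`|x|^-1 *: f x) -linearZ.
set y := _ *: x; rewrite -(RRe_real (normr_real (f y))) lecR.
apply: sup_upper_bound; first exact: has_sup_unit_ball_values.
exists y; last by rewrite RRe_real// normr_real.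
by rewrite normrZ normfV normr_id mulVf// gt_eqF.
Qed.

Lemma dual_norm_ge0 (f : dual E) : 0 <= dual_norm f.
Proof.
rewrite ler0c; apply: sup_upper_bound; first exact: has_sup_unit_ball_values.
by exists 0; rewrite ?normr0 ?linear0 ?normr0.
Qed.

Lemma dual_normD (f g : dual E) : dual_norm (f + g) <= dual_norm f + dual_norm g.
Proof.
rewrite -rmorphD; apply: dual_norm_le => x x1.
rewrite (le_trans (ler_normD _ _))// rmorphD lerD//;
  by rewrite (le_trans (le_dual_norm _ _))// ler_piMr// dual_norm_ge0.
Qed.

Lemma dual_normZ (k : R[i]) (f : dual E) :
  dual_norm (k *: f) = `|k| * dual_norm f.
Proof.
have le (l : R[i]) (g : dual E) : dual_norm (l *: g) <= `|l| * dual_norm g.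
  rewrite -(RRe_real (normr_real l)) -rmorphM; apply: dual_norm_le => x x1.
  rewrite rmorphM; move: (RRe_real (normr_real l)) => /= ->.
  rewrite [X in X <= _](_ : _ = `|l| * `|g x|) ?ler_wpM2l//; last first.
    exact: normrM.
  by rewrite (le_trans (le_dual_norm _ _))// ler_piMr// dual_norm_ge0.
apply/le_anti; rewrite le/=.
have [->|k0] := eqVneq k 0; first by rewrite normr0 mul0r dual_norm_ge0.
rewrite -ler_pdivlMl ?normr_gt0// -normfV.
by rewrite -[X in dual_norm X](scalerK k0) le.
Qed.

Lemma dual_norm0_eq0 (f : dual E) : dual_norm f = 0 -> f = 0.
Proof.
move=> f0; apply/val_inj/funext => x; apply/eqP.
by have := le_dual_norm f x; rewrite f0 mul0r normr_le0.
Qed.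

HB.instance Definition _ := Lmodule_isNormed.Build R[i] (dual E)
  dual_normD dual_normZ dual_norm0_eq0.

End DualNorm.

(* Maps [C -> C] are given by maps [E -> E] that preserve [C]; their values
   outside [C] are irrelevant. *)
Definition fixed_point_property (K : numFieldType) (E : normedModType K)
    (C : set E) : Prop :=
  forall T : E -> E, (forall x, C x -> C (T x)) ->
    (forall x y, C x -> C y -> `|T x - T y| <= `|x - y|) ->
    exists2 x, C x & T x = x.

Section WeakTopologies.
Variables (R : realType) (E : normedModType R[i]).

(* sigma(E, E^* ) *)
Definition weak_space : topologicalType :=
  initial_topology
    (fun x : E => (fun f : dual E => f x) : {ptws dual E -> R[i]^o}).

(* sigma(E^*, E) *)
Definition weak_star_space : topologicalType :=
  initial_topology
    (fun f : dual E => (f : E -> R[i]^o) : {ptws E -> R[i]^o}).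

Definition weak_fixed_point_property : Prop :=
  forall C : set E, C !=set0 -> compact (C : set weak_space) ->
    convex_set C -> fixed_point_property C.

(* A property of the dual Banach space [dual E] with predual [E]. *)
Definition weak_star_fixed_point_property : Prop :=
  forall C : set (dual E), C !=set0 -> compact (C : set weak_star_space) ->
    convex_set C -> fixed_point_property C.

End WeakTopologies.

(* Main.v *)
Require Import Defs.
From HB Require Import structures.
From mathcomp Require Import all_boot all_order all_algebra.
From mathcomp Require Import all_classical all_reals all_analysis.
From mathcomp Require Import complex.
From mathcomp Require Import lra ring zify.

Set Implicit Arguments.
Unset Strict Implicit.
Unset Printing Implicit Defensive.

Import Order.TTheory GRing.Theory Num.Theory.
Import numFieldNormedType.Exports.

Local Open Scope classical_set_scope.
Local Open Scope complex_scope.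
Local Open Scope ring_scope.



(** The algebra is a counterexample to Naimark's problem in the manner of Akemann and Weaver: it is
    non-separable, yet all its irreducible representations are unitarily equivalent. Its spectrum
    then has at most one point and is discrete. It also carries a tracial state whose restriction to
    an abelian subalgebra is a fair coin-tossing measure. This puts an isometric copy of the step
    functions of L^1[0,1] into the dual, and with it Alspach's weakly compact convex set, which has
    an isometric self-map without fixed points.

    The dense *-algebra [crossed] has as basis the decreasing words in the letters [letter W], the
    order omega followed by omega_1. Each letter [lam a] is a self-adjoint unitary that implements,
    on the algebra of the words in smaller letters, an involutive automorphism [th a] preserving the
    trace [tau], the coefficient of the empty word. The finite letters give an infinite tensor
    product of 2 x 2 matrices with its product state f = [fstate]. A letter of omega_1 implements a
    limit of conjugations by v_0 ... v_(n-1) along an increasing sequence of matrix algebras A_n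
    ([tower]). Here v_n commutes with A_n and moves a projection p_n, on which f is almost 1, to an
    orthogonal one. So f has only one extension past the letter ([tower_state_extension]). The
    enlarged algebra again has matrix algebras around every finite set ([tower_locally_matricial])
    and room for further commuting 2 x 2 matrices ([tower_free_qubits]), and the recursion over
    omega_1 goes on ([crossed_tower]).

    Diamond decides which limit is taken. If the guess at stage a is a state g that is [separated]
    from f, then the v_n are chosen so that v_n p_n v_n is almost full for g
    ([linked_tower_exists]). In a representation with a vector of state g, the new letter then leads
    to a vector whose state is f on that stage ([tower_state_vector]), and f on a stage determines f
    everywhere ([state_determined]).

    Suppose that an irreducible representation has no vector with state f. It is disjoint from the
    GNS representation of f, and a joint density theorem ([joint_density]) provides a self-adjoint
    element that nearly exchanges prescribed vectors of the one and nearly fixes a vector of the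
    other. Conjugation of a matrix algebra by the Cayley transform of such an element separates f
    from a vector state g ([separated_vector_state]). Separation reflects to a club of stages, so
    diamond guesses g correctly at a stage where it is visible ([stage_guessed]), and this produces
    the missing vector ([diamond_state_vector]). Two irreducible representations with vectors of the
    same state are equivalent ([irreps_equivalent]).

    Non-separability comes from the omega_1 many letters, at mutual distance at least 1. For the
    fixed points, the functionals [tau (a * x)] with x a step function in the even finite letters
    have the L^1 norm of x ([vector_functional_step]). The step functions between 0 and 1 with mean
    1/2 have an L^2 closure that is closed, convex and bounded in a Hilbert space. Its bounded
    linear image in the dual is compact for the weak and for the weak* topology. A fixed point of
    Alspach's map in it would be an indicator function independent of itself with mean 1/2
    ([alspach_no_fixed_point]). *)

(** * Real sequences with upper limit at most 0 *)

Section NullSequences.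
Variable R : realType.
Implicit Types r s : nat -> R.

(** One-sided on purpose: negative terms are harmless, so an inequality between limits is proved by
    bounding a constant by a null sequence ([null_const]). *)
Definition null r := forall e : R, 0 < e -> exists N, forall n, (N <= n)%N -> r n < e.

Lemma null_le r s : (forall n, r n <= s n) -> null s -> null r.
Proof.
move=> rs ns e e0; have [N h] := ns e e0; exists N => n Nn.
by apply: le_lt_trans (rs n) _; exact: h.
Qed.

Lemma null_le_near r s N0 :
  (forall n, (N0 <= n)%N -> r n <= s n) -> null s -> null r.
Proof.
move=> rs ns e e0; have [N h] := ns e e0; exists (maxn N0 N) => n.
by rewrite geq_max => /andP[n1 n2]; apply: le_lt_trans (rs n n1) _; exact: h.
Qed.

Lemma nullD r s : null r -> null s -> null (fun n => r n + s n).
Proof.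
move=> nr ns e e0; have e2 : 0 < e / 2 by lra.
have [N1 h1] := nr _ e2; have [N2 h2] := ns _ e2.
exists (maxn N1 N2) => n; rewrite geq_max => /andP[n1 n2].
by have := h1 _ n1; have := h2 _ n2; lra.
Qed.

Lemma null0 : null (fun=> 0).
Proof. by move=> e e0; exists 0%N. Qed.

Lemma nullM c r : 0 <= c -> null r -> null (fun n => c * r n).
Proof.
move=> c0 nr e e0; have c1 : 0 < c + 1 by lra.
have [|N h] := nr (e / (c + 1)); first exact: divr_gt0.
exists N => n Nn; have := h n Nn; rewrite ltr_pdivlMr// => h'.
have [rn|rn] := lerP 0 (r n); nra.
Qed.

Lemma null_sum (I : Type) (l : seq I) (P : pred I) (u : I -> nat -> R) :
  (forall i, null (u i)) -> null (fun n => \sum_(i <- l | P i) u i n).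
Proof.
move=> nu; elim: l => [|i l IH].
  by apply: null_le null0 => n; rewrite big_nil.
have [Pi|Pi] := boolP (P i).
  by apply: null_le (nullD (nu i) IH) => n; rewrite big_cons Pi.
by apply: null_le IH => n; rewrite big_cons (negPf Pi).
Qed.

Lemma null_shift r (s : nat -> nat) :
  (forall n, (n <= s n)%N) -> null r -> null (fun n => r (s n)).
Proof.
move=> hs nr e e0; have [N h] := nr e e0; exists N => n Nn.
by apply: h; exact: leq_trans Nn (hs n).
Qed.

Lemma null_const c : null (fun=> c) -> c <= 0.
Proof.
move=> nc; rewrite leNgt; apply/negP => c0; have [N h] := nc _ c0.
by have := h N (leqnn _); rewrite ltxx.
Qed.

Lemma null_geom c : null (fun n => c / 2 ^+ n).
Proof.
move=> e e0; have [N hN] : exists N : nat, `|c| / e < N%:R.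
  exists (Num.bound (`|c| / e)); have := archi_boundP (x := `|c| / e).
  by apply; rewrite divr_ge0// ltW.
exists N => n Nn; apply: le_lt_trans (_ : `|c| / 2 ^+ n < e).
  by rewrite ler_wpM2r ?ler_norm// invr_ge0 exprn_ge0.
rewrite ltr_pdivrMr ?exprn_gt0// mulrC -ltr_pdivrMr//.
apply: lt_trans hN _; apply: le_lt_trans (_ : n%:R < _).
  by rewrite ler_nat.
by rewrite -natrX ltr_nat ltn_expl.
Qed.

Lemma null_inv c : null (fun n => c / n.+1%:R).
Proof.
move=> e e0; have [N hN] : exists N : nat, `|c| / e < N%:R.
  exists (Num.bound (`|c| / e)); have := archi_boundP (x := `|c| / e).
  by apply; rewrite divr_ge0// ltW.
exists N => n Nn; apply: le_lt_trans (_ : `|c| / n.+1%:R < e).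
  by rewrite ler_wpM2r ?ler_norm.
rewrite ltr_pdivrMr// mulrC -ltr_pdivrMr//.
by apply: lt_trans hN _; rewrite ltr_nat ltnS.
Qed.

Lemma nullX2 r : (forall n, 0 <= r n) -> null (fun n => r n ^+ 2) -> null r.
Proof.
move=> r0 nr e e0; have [|N h] := nr (e ^+ 2); first exact: exprn_gt0.
exists N => n Nn; have := h n Nn.
by rewrite ltr_pXn2r// ?nnegrE ?r0 ?ltW.
Qed.

Lemma nullX2r r : (forall n, 0 <= r n) -> null r -> null (fun n => r n ^+ 2).
Proof.
move=> r0 nr e e0; have m0 : 0 < Num.min e 1 by rewrite lt_min e0 /=.
have [N h] := nr _ m0; exists N => n Nn; have := h n Nn; have := r0 n.
rewrite lt_min => r0' /andP[h1 h2]; rewrite expr2; nra.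
Qed.

Lemma null_sqrt r : null r -> null (fun n => Num.sqrt (r n)).
Proof.
move=> nr e e0; have [|N h] := nr (e ^+ 2); first exact: exprn_gt0.
exists N => n Nn; have := h n Nn => hn.
rewrite -(ltr_pXn2r (n := 2))// ?nnegrE ?sqrtr_ge0 ?ltW//.
have [rn|rn] := lerP 0 (r n); first by rewrite sqr_sqrtr.
by rewrite ler0_sqrtr ?ltW// expr0n /= exprn_gt0.
Qed.

End NullSequences.

(** * Real-valued norms and sequential convergence *)

Section RealNorm.
Variable R : realType.
Local Notation C := R[i].

(** Norms over [R[i]] take complex values; their real parts lie in an ordered field, where [lra] and
    suprema are available. *)
Definition nr (V : normedZmodType C) (x : V) : R := complex.Re `|x|.

Section Zmod.
Variable V : normedZmodType C.
Implicit Types x y z : V.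

Lemma nrE x : `|x| = (nr x)%:C.
Proof. by rewrite RRe_real// normr_real. Qed.

Lemma nr_ge0 x : 0 <= nr x.
Proof. by rewrite -ler0c -nrE. Qed.

Lemma nrD x y : nr (x + y) <= nr x + nr y.
Proof. by rewrite -lecR rmorphD /= -!nrE ler_normD. Qed.

Lemma nrN x : nr (- x) = nr x.
Proof. by rewrite /nr normrN. Qed.

Lemma nr_distC x y : nr (x - y) = nr (y - x).
Proof. by rewrite /nr distrC. Qed.

Lemma nrB x y : nr (x - y) <= nr x + nr y.
Proof. by rewrite (le_trans (nrD _ _))// nrN. Qed.

Lemma nr_tri x y z : nr (x - z) <= nr (x - y) + nr (y - z).
Proof. by apply: le_trans (nrD _ _); rewrite addrA subrK. Qed.

Lemma nr_subr x y : nr x - nr y <= nr (x - y).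
Proof. by have := nrD (x - y) y; rewrite subrK; lra. Qed.

Lemma nr_eq0 x : (nr x == 0) = (x == 0).
Proof. by rewrite -(normr_eq0 x) nrE -(inj_eq (@complexI R)). Qed.

Lemma nr0 : nr (0 : V) = 0.
Proof. by apply/eqP; rewrite nr_eq0. Qed.

Lemma nr_le0 x : nr x <= 0 -> x = 0.
Proof. by move=> h; apply/eqP; rewrite -nr_eq0 eq_le h nr_ge0. Qed.

Lemma nr_gt0 x : (0 < nr x) = (x != 0).
Proof. by rewrite lt_def nr_ge0 andbT nr_eq0. Qed.

Lemma nr_sum (I : Type) (l : seq I) (P : pred I) (F : I -> V) :
  nr (\sum_(i <- l | P i) F i) <= \sum_(i <- l | P i) nr (F i).
Proof.
elim/big_rec2: _ => [|i u v _ h]; first by rewrite nr0.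
by apply: le_trans (nrD _ _) _; rewrite lerD2l.
Qed.

Lemma null_nrD (u v : nat -> V) :
  null (fun n => nr (u n)) -> null (fun n => nr (v n)) ->
  null (fun n => nr (u n + v n)).
Proof. by move=> hu hv; apply: null_le (nullD hu hv) => n; exact: nrD. Qed.

Lemma null_eq x : null (fun=> nr x) -> x = 0.
Proof. by move=> /null_const/nr_le0. Qed.

Definition scvg (u : nat -> V) x := null (fun n => nr (u n - x)).

Lemma scvg_unique u x y : scvg u x -> scvg u y -> x = y.
Proof.
move=> ux uy; apply/eqP; rewrite -subr_eq0; apply/eqP/null_eq.
by apply: null_le (nullD ux uy) => n; rewrite (nr_distC (u n)) nr_tri.
Qed.

Lemma scvg_cst x : scvg (fun=> x) x.
Proof. by apply: null_le (@null0 R) => n; rewrite subrr nr0. Qed.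

Lemma scvgD u v x y : scvg u x -> scvg v y -> scvg (fun n => u n + v n) (x + y).
Proof.
move=> ux uy; apply: null_le (nullD ux uy) => n.
by rewrite opprD addrACA nrD.
Qed.

Lemma scvgN u x : scvg u x -> scvg (fun n => - u n) (- x).
Proof. by move=> ux; apply: null_le ux => n; rewrite -opprD nrN. Qed.

Lemma scvgB u v x y : scvg u x -> scvg v y -> scvg (fun n => u n - v n) (x - y).
Proof. by move=> ux uy; apply: scvgD => //; exact: scvgN. Qed.

Lemma scvg_sum (I : Type) (l : seq I) (u : I -> nat -> V) (x : I -> V) :
  (forall i, scvg (u i) (x i)) ->
  scvg (fun n => \sum_(i <- l) u i n) (\sum_(i <- l) x i).
Proof.
move=> ux; elim: l => [|i l IH].
  by apply: null_le (@null0 R) => n; rewrite !big_nil subrr nr0.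
by apply: null_le (scvgD (ux i) IH) => n; rewrite !big_cons.
Qed.

Lemma scvg_ext u v x : (forall n, u n = v n) -> scvg u x -> scvg v x.
Proof. by move=> /funext ->. Qed.

Lemma scvg_shift u x (s : nat -> nat) :
  (forall n, (n <= s n)%N) -> scvg u x -> scvg (fun n => u (s n)) x.
Proof. by move=> hs; exact: null_shift. Qed.

Lemma scvg_nr u x : scvg u x -> forall e, 0 < e ->
  exists N, forall n, (N <= n)%N -> `|nr (u n) - nr x| < e.
Proof.
move=> ux e e0; have [N h] := ux e e0; exists N => n /h.
apply: le_lt_trans; rewrite ler_norml; have := nr_subr (u n) x.
by have := nr_subr x (u n); rewrite (nr_distC x); lra.
Qed.

Lemma scvg_nr_le u x c : scvg u x -> (forall n, nr (u n) <= c) -> nr x <= c.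
Proof.
move=> ux uc; rewrite -subr_le0; apply: null_const; apply: null_le ux => n.
by have := nr_subr x (u n); have := uc n; rewrite (nr_distC x); lra.
Qed.

Lemma scvg_nr_ge u x c : scvg u x -> (forall n, c <= nr (u n)) -> c <= nr x.
Proof.
move=> ux uc; rewrite -subr_le0; apply: null_const; apply: null_le ux => n.
by have := nr_subr (u n) x; have := uc n; lra.
Qed.

End Zmod.

Lemma nrZ (V : normedModType C) (k : C) (x : V) : nr (k *: x) = nr k * nr x.
Proof. by apply: complexI; rewrite rmorphM /= -!nrE normrZ. Qed.

Lemma nrM (k l : C) : nr (k * l) = nr k * nr l.
Proof. by apply: complexI; rewrite rmorphM /= -!nrE normrM. Qed.

Lemma nr1 : nr (1 : C) = 1.
Proof. by apply: complexI; rewrite -nrE normr1. Qed.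

Lemma nrR (x : R) : nr (x%:C : C) = `|x|.
Proof.
apply: complexI; rewrite -nrE; have [x0|x0] := lerP 0 x.
  by rewrite ger0_norm ?ler0c// ger0_norm.
by rewrite ltr0_norm ?ltcR// ltr0_norm// rmorphN.
Qed.

Lemma cjD (x y : C) : conjc (x + y) = conjc x + conjc y.
Proof. exact: (rmorphD conjc). Qed.

Lemma cjN (x : C) : conjc (- x) = - conjc x.
Proof. exact: (rmorphN conjc). Qed.

Lemma cjM (x y : C) : conjc (x * y) = conjc x * conjc y.
Proof. exact: (rmorphM conjc). Qed.

Lemma cji : conjc 'i%C = - 'i%C :> C.
Proof. by apply/eqP; rewrite eq_complex /= oppr0 !eqxx. Qed.

Lemma rcD (x y : R) : (x + y)%:C = x%:C + y%:C :> C.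
Proof. exact: rmorphD. Qed.

Lemma rcN (x : R) : (- x)%:C = - x%:C :> C.
Proof. exact: rmorphN. Qed.

Lemma rcM (x y : R) : (x * y)%:C = x%:C * y%:C :> C.
Proof. exact: rmorphM. Qed.

Lemma rcX (x : R) n : (x ^+ n)%:C = x%:C ^+ n :> C.
Proof. exact: rmorphXn. Qed.

Lemma ltr0c (x : R) : (0 < x%:C :> C) = (0 < x).
Proof. by rewrite -ltcR. Qed.

Lemma nr_conj (k : C) : nr (conjc k) = nr k.
Proof. by case: k => a b; rewrite /nr /= sqrrN. Qed.

Lemma nrV (k : C) : nr k^-1 = (nr k)^-1.
Proof. by apply: complexI; rewrite -nrE normfV nrE fmorphV. Qed.

Lemma nrX (k : C) n : nr (k ^+ n) = nr k ^+ n.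
Proof. by elim: n => [|n IH]; rewrite ?expr0 ?nr1// !exprS nrM IH. Qed.

Lemma Re_le_nr (k : C) : `|complex.Re k| <= nr k.
Proof.
case: k => a b; rewrite /nr /= -sqrtr_sqr ler_sqrt ?lerDl ?sqr_ge0//.
by rewrite addr_ge0 ?sqr_ge0.
Qed.

Lemma Im_le_nr (k : C) : `|complex.Im k| <= nr k.
Proof.
case: k => a b; rewrite /nr /= -sqrtr_sqr ler_sqrt ?lerDr ?sqr_ge0//.
by rewrite addr_ge0 ?sqr_ge0.
Qed.

Lemma cImB (x y : C) : complex.Im (x - y) = complex.Im x - complex.Im y.
Proof. by case: x; case: y. Qed.

Lemma nr_le_ReIm (k : C) : nr k <= `|complex.Re k| + `|complex.Im k|.
Proof.
rewrite {1}[k]complexE; apply: le_trans (nrD _ _) _.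
by rewrite nrM !nrR [nr 'i%C](_ : _ = 1) ?mul1r// /nr /= expr0n expr1n add0r sqrtr1.
Qed.

Lemma cReD (x y : C) : complex.Re (x + y) = complex.Re x + complex.Re y.
Proof. by case: x; case: y. Qed.

Lemma cReN (x : C) : complex.Re (- x) = - complex.Re x.
Proof. by case: x. Qed.

Lemma cReB (x y : C) : complex.Re (x - y) = complex.Re x - complex.Re y.
Proof. by rewrite cReD cReN. Qed.

Lemma cReZ (x : R) (y : C) : complex.Re (x%:C * y) = x * complex.Re y.
Proof. by case: y => a b /=; rewrite mul0r subr0. Qed.

Lemma cRe_conj (x : C) : complex.Re (conjc x) = complex.Re x.
Proof. by case: x. Qed.

Lemma nr_sqr (k : C) : k * conjc k = (nr k ^+ 2)%:C.
Proof.
by rewrite rmorphXn /= -nrE; case: k => a b; rewrite sqr_normc.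
Qed.

Lemma halfC : (2^-1 : C) = (2^-1)%:C.
Proof. by rewrite fmorphV /= rmorph_nat. Qed.

Lemma cj_half : conjc (2^-1 : C) = 2^-1.
Proof. by rewrite halfC conjc_real. Qed.

Lemma half_half : (2^-1 + 2^-1 : C) = 1.
Proof. by field. Qed.

Lemma conj_mul_sqr (k z : C) : conjc k * (k * z) = (nr k ^+ 2)%:C * z.
Proof. by rewrite mulrA (mulrC (conjc k)) nr_sqr. Qed.

Lemma scvgZ (V : normedModType C) (k : C) (u : nat -> V) x :
  scvg u x -> scvg (fun n => k *: u n) (k *: x).
Proof.
move=> ux; apply: null_le (nullM (nr_ge0 k) ux) => n.
by rewrite -scalerBr nrZ.
Qed.

Lemma scvgM (k : C) (u : nat -> C) x :
  scvg u x -> scvg (fun n => k * u n) (k * x).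
Proof.
move=> ux; apply: null_le (nullM (nr_ge0 k) ux) => n.
by rewrite -mulrBr nrM.
Qed.

Lemma scvg_conj (u : nat -> C) x :
  scvg u x -> scvg (fun n => conjc (u n)) (conjc x).
Proof. by move=> ux; apply: null_le ux => n; rewrite -rmorphB nr_conj. Qed.

End RealNorm.

(** * Passage between filters and sequences, boundedness and continuity *)

Section Bridges.
Variable R : realType.
Local Notation C := R[i].

Lemma gt0_cReal (e : C) : 0 < e -> e = (complex.Re e)%:C /\ 0 < complex.Re e.
Proof.
by case: e => a b; rewrite ltcE /= => /andP[/eqP -> h].
Qed.

Lemma ball_nr (V : normedModType C) (x y : V) (e : R) :
  ball x e%:C y = (nr (x - y) < e) :> Prop.
Proof. by rewrite -ball_normE /= nrE ltcR. Qed.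

Definition scauchy (V : normedZmodType C) (u : nat -> V) :=
  forall e : R, 0 < e -> exists N, forall m n, (N <= m)%N -> (N <= n)%N ->
    nr (u m - u n) < e.

Lemma scauchy_geom (V : normedZmodType C) (u : nat -> V) (c : R) :
  (forall n, nr (u n.+1 - u n) <= c / 2 ^+ n) -> scauchy u.
Proof.
move=> h; have h2 m n : (m <= n)%N -> nr (u n - u m) <= c / 2 ^+ m * 2.
  move=> mn; suff : nr (u n - u m) <= c / 2 ^+ m * 2 - c / 2 ^+ n * 2.
    have : 0 <= c / 2 ^+ n by apply: le_trans (h n); exact: nr_ge0.
    lra.
  elim: n mn => [|n IH]; first by rewrite leqn0 => /eqP ->; rewrite !subrr nr0.
  rewrite leq_eqVlt => /predU1P[->|]; first by rewrite !subrr nr0.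
  rewrite ltnS => /IH; have := nr_tri (u n.+1) (u n) (u m); have := h n.
  have -> : c / 2 ^+ n.+1 = c / 2 ^+ n / 2 by rewrite exprSr invfM mulrA.
  lra.
move=> e e0; have [N hN] := null_geom (c * 4) e0; exists N => m n Nm Nn.
have := h2 _ _ Nm; have := h2 _ _ Nn; have := nr_tri (u m) (u N) (u n).
by rewrite (nr_distC (u N)); have := hN N (leqnn _); rewrite mulrAC; lra.
Qed.

Lemma scauchy_cvg (V : completeNormedModType C) (u : nat -> V) :
  scauchy u -> exists x, scvg u x.
Proof.
move=> cu; have : cvg (u @ \oo).
  apply/cauchy_cvgP/cauchy_exP => e /gt0_cReal[-> e0].
  have [N h] := cu _ e0; exists (u N); exists N => // n /= Nn.
  by rewrite ball_nr; exact: h.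
move=> /cvg_ex[x ux]; exists x => e e0.
have := ux (ball x e%:C); rewrite /= nbhs_filterE => h.
have [|N _ hN] := h; first by apply: nbhsx_ballx; rewrite ltr0c.
exists N => n Nn; have := hN n Nn; rewrite /= ball_nr nr_distC; exact.
Qed.

Lemma real_cauchy_cvg (u : nat -> R) :
  (forall e, 0 < e -> exists N, forall m n, (N <= m)%N -> (N <= n)%N ->
     `|u m - u n| < e) ->
  exists x, null (fun n => `|u n - x|).
Proof.
move=> cu; have : cvg ((u : nat -> R^o) @ \oo).
  apply/cauchy_cvgP/cauchy_exP => e e0.
  have [N h] := cu _ e0; exists (u N); exists N => // n /= Nn.
  by rewrite -ball_normE /=; exact: h.
move=> /cvg_ex[x ux]; exists x => e e0.
have := ux (ball x e); rewrite /= nbhs_filterE => h.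
have [|N _ hN] := h; first exact: nbhsx_ballx.
by exists N => n Nn; have := hN n Nn; rewrite -ball_normE /= distrC.
Qed.

Lemma complex_cauchy_cvg (u : nat -> C) : scauchy u -> exists x, scvg u x.
Proof.
move=> cu; have [|a ha] := @real_cauchy_cvg (fun n => complex.Re (u n)).
  move=> e /cu[N h]; exists N => m n Nm Nn; apply: le_lt_trans (h _ _ Nm Nn).
  by rewrite -cReB Re_le_nr.
have [|b hb] := @real_cauchy_cvg (fun n => complex.Im (u n)).
  move=> e /cu[N h]; exists N => m n Nm Nn; apply: le_lt_trans (h _ _ Nm Nn).
  by rewrite -cImB Im_le_nr.
exists (a +i* b)%C; apply: null_le (nullD ha hb) => n.
by apply: le_trans (nr_le_ReIm _) _; rewrite cReB cImB.
Qed.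

Lemma closed_scvg (V : normedModType C) (A : set V) (u : nat -> V) x :
  closed A -> (forall n, A (u n)) -> scvg u x -> A x.
Proof.
move=> cA Au ux; apply: cA => B /nbhs_ballP[e /= /gt0_cReal[-> e0] hB].
have [N h] := ux _ e0; exists (u N); split; first exact: Au.
by apply: hB; rewrite ball_nr nr_distC; exact: h.
Qed.

Lemma scvg_closed (V : normedModType C) (A : set V) :
  (forall u x, (forall n, A (u n)) -> scvg u x -> A x) -> closed A.
Proof.
move=> h x cx.
have H n : exists y, A y /\ nr (y - x) < 1 / n.+1%:R.
  have [|y [Ay By]] := cx (ball x (1 / n.+1%:R)%:C).
    by apply: nbhsx_ballx; rewrite ltr0c divr_gt0.
  by exists y; split => //; move: By; rewrite ball_nr nr_distC.
have [u hu] := choice H; apply: (h u) => [n|]; first exact: (hu n).1.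
by apply: null_le (null_inv 1) => n; rewrite ltW// (hu n).2.
Qed.

Lemma linear_bounded (V W : normedModType C) (f : V -> W) :
  linear f -> continuous f -> exists2 c : R, 0 <= c & forall x, nr (f x) <= c * nr x.
Proof.
move=> lf cf; have f0 := linear_fun0 lf.
have fZ k x : f (k *: x) = k *: f x by have := lf k x 0; rewrite addr0 f0 addr0.
have : nbhs (0 : V) (f @^-1` ball (f 0) (1 : C)).
  by apply: cf; exact: nbhsx_ballx.
move=> /nbhs_ballP[e /= /gt0_cReal[-> e0] hB].
exists (2 / complex.Re e) => [|x]; first by rewrite divr_ge0// ltW.
have [->|x0] := eqVneq x 0; first by rewrite f0 !nr0 mulr0.
have nx : 0 < nr x by rewrite nr_gt0.
set d := complex.Re e in e0 hB *; set k := (d / (2 * nr x))%:C : C.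
have nk : nr k = d / (2 * nr x) by rewrite nrR ger0_norm// divr_ge0// ?ltW// mulr_gt0.
have /hB : ball 0 d%:C (k *: x).
  rewrite ball_nr sub0r nrN nrZ nk invfM mulrA mulfVK ?gt_eqF//; lra.
rewrite -[1]/((1 : R)%:C) /= ball_nr f0 sub0r nrN fZ nrZ nk => h.
have : d * nr (f x) <= 2 * nr x.
  by move: h; rewrite mulrAC ltr_pdivrMr ?mulr_gt0// mul1r => /ltW.
by move=> h'; rewrite mulrAC ler_pdivlMr// mulrC.
Qed.

Lemma bounded_continuous (V W : normedModType C) (f : V -> W) c :
  linear f -> (forall x, nr (f x) <= c * nr x) -> continuous f.
Proof.
move=> lf fc x; apply/cvgrPdist_lt => /= e /gt0_cReal[-> e0].
have c1 : 0 < `|c| + 1 by rewrite ltr_wpDl.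
have d0 : 0 < complex.Re e / (`|c| + 1) by rewrite divr_gt0.
apply/nbhs_ballP; exists (complex.Re e / (`|c| + 1))%:C => /=; first by rewrite ltr0c.
move=> y; rewrite -ball_normE /= !nrE !ltcR ltr_pdivlMr// => h.
have -> : f x - f y = f (x - y) by rewrite -scaleN1r addrC -lf scaleN1r addrC.
apply: le_lt_trans (fc _) _; apply: le_lt_trans h.
rewrite mulrC ler_wpM2l ?nr_ge0//; have := ler_norm c; lra.
Qed.

End Bridges.

(** * Positive semidefinite forms: Cauchy-Schwarz and Riesz without completeness *)

Section Forms.
Variable R : realType.
Local Notation C := R[i].

(** The discriminant of a quadratic polynomial in s, evaluated at s = 1/c, or at a large s if c = 0.
    With d a squared modulus it gives Cauchy-Schwarz for degenerate forms and the error bound in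
    [riesz]. *)
Lemma quadratic_bound (a c d : R) : 0 <= c -> 0 <= d ->
  (forall s, 0 <= a - 2 * s * d + s ^+ 2 * d * c) -> d <= a * c.
Proof.
move=> c0 d0 h; have [c1|c1] := eqVneq c 0.
  rewrite c1 mulr0; rewrite leNgt; apply/negP => d1.
  have := h ((`|a| + 1) / d); rewrite c1 mulr0 addr0 mulrA mulfVK ?gt_eqF//.
  by have := ler_norm a; have := normr_ge0 a; lra.
have c2 : 0 < c by rewrite lt_def c1.
have := h c^-1; rewrite expr2.
have -> : a - 2 * c^-1 * d + c^-1 * c^-1 * d * c = (a * c - d) / c.
  by field.
by rewrite pmulr_lge0 ?invr_gt0// subr_ge0.
Qed.

Variables (E : lmodType C) (B : E -> E -> C).

Record psd_form : Prop := PsdForm {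
  formDl : forall x y z, B (x + y) z = B x z + B y z ;
  formZl : forall k x y, B (k *: x) y = k * B x y ;
  form_sym : forall x y, B y x = (B x y)^*%C ;
  form_ge0 : forall x, 0 <= B x x }.

Definition qn x : R := Num.sqrt (complex.Re (B x x)).

Hypothesis hB : psd_form.

Lemma formDr x y z : B x (y + z) = B x y + B x z.
Proof. rewrite (form_sym hB) formDl// cjD. by rewrite -!(form_sym hB). Qed.

Lemma formZr k x y : B x (k *: y) = k^*%C * B x y.
Proof. by rewrite (form_sym hB) formZl// cjM -(form_sym hB). Qed.

Lemma form0l y : B 0 y = 0.
Proof. by rewrite -(scale0r 0) formZl// mul0r. Qed.

Lemma form0r y : B y 0 = 0.
Proof. by rewrite -(scale0r 0) formZr rmorph0 mul0r. Qed.

Lemma formNl x y : B (- x) y = - B x y.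
Proof. by rewrite -scaleN1r formZl// mulN1r. Qed.

Lemma formNr x y : B x (- y) = - B x y.
Proof. by rewrite -scaleN1r formZr rmorphN rmorph1 mulN1r. Qed.

Lemma formBl x y z : B (x - y) z = B x z - B y z.
Proof. by rewrite formDl// formNl. Qed.

Lemma formBr x y z : B x (y - z) = B x y - B x z.
Proof. by rewrite formDr// formNr. Qed.

Lemma form_suml (I : Type) (l : seq I) (P : pred I) (F : I -> E) y :
  B (\sum_(i <- l | P i) F i) y = \sum_(i <- l | P i) B (F i) y.
Proof.
by elim/big_rec2: _ => [|i u v _ <-]; rewrite ?form0l// formDl.
Qed.

Lemma form_sumr (I : Type) (l : seq I) (P : pred I) (F : I -> E) y :
  B y (\sum_(i <- l | P i) F i) = \sum_(i <- l | P i) B y (F i).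
Proof.
by elim/big_rec2: _ => [|i u v _ <-]; rewrite ?form0r// formDr.
Qed.

Lemma qn_ge0 x : 0 <= qn x. Proof. exact: sqrtr_ge0. Qed.

Lemma form_Re_ge0 x : 0 <= complex.Re (B x x).
Proof. by have := form_ge0 hB x; rewrite lecE /= => /andP[]. Qed.

Lemma qn_sqr x : qn x ^+ 2 = complex.Re (B x x).
Proof. by rewrite sqr_sqrtr// form_Re_ge0. Qed.

Lemma form_xx x : B x x = (qn x ^+ 2)%:C.
Proof.
rewrite qn_sqr; have := form_ge0 hB x; rewrite lecE /= => /andP[/eqP h _].
by move: h; case: (B x x) => a b /= ->.
Qed.

Lemma form_CS x y : nr (B x y) <= qn x * qn y.
Proof.
rewrite -(ler_pXn2r (n := 2))// ?nnegrE ?nr_ge0 ?mulr_ge0 ?qn_ge0//.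
rewrite exprMn; apply: quadratic_bound; rewrite ?sqr_ge0// => s.
have := form_Re_ge0 (x + - (s%:C * B x y) *: y).
rewrite formDl// !formDr !formZl// !formZr (form_sym hB x y) !form_xx.
rewrite !(cjN, cjM, conjc_real, mulNr, mulrN) opprK.
have -> : s%:C * (B x y)^*%C * B x y = (s * nr (B x y) ^+ 2)%:C.
  by rewrite -mulrA (mulrC (B x y)^*%C) nr_sqr rcM.
have -> : s%:C * B x y * (B x y)^*%C = (s * nr (B x y) ^+ 2)%:C.
  by rewrite -mulrA nr_sqr rcM.
have -> : s%:C * B x y * (s%:C * (B x y)^*%C * (qn y ^+ 2)%:C) =
   (s ^+ 2 * nr (B x y) ^+ 2 * qn y ^+ 2)%:C.
  by rewrite (rcM (_ ^+ 2 * _)) (rcM (s ^+ 2)) -nr_sqr (rcX s); ring.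
rewrite -!(rcN, rcD) /=; lra.
Qed.

Lemma qnD x y : qn (x + y) <= qn x + qn y.
Proof.
rewrite -(ler_pXn2r (n := 2))// ?nnegrE ?qn_ge0 ?addr_ge0 ?qn_ge0//.
rewrite qn_sqr formDl// !formDr !form_xx (form_sym hB x y) !cReD cRe_conj /=.
have := form_CS x y; have := Re_le_nr (B x y); have := ler_norm (complex.Re (B x y)).
rewrite sqrrD; lra.
Qed.

Lemma qnZ k x : qn (k *: x) = nr k * qn x.
Proof.
apply/eqP; rewrite -(eqrXn2 (n := 2))// ?qn_ge0 ?mulr_ge0 ?nr_ge0 ?qn_ge0//.
rewrite qn_sqr formZl// formZr form_xx mulrA nr_sqr exprMn.
by rewrite -rcM.
Qed.

Lemma qnN x : qn (- x) = qn x.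
Proof. by rewrite -scaleN1r qnZ nrN nr1 mul1r. Qed.

Lemma qnB x y : qn (x - y) <= qn x + qn y.
Proof. by rewrite -(qnN y) qnD. Qed.

Lemma qn_tri x y z : qn (x - z) <= qn (x - y) + qn (y - z).
Proof. by apply: le_trans (qnD _ _); rewrite addrA subrK. Qed.

Lemma qn_distC x y : qn (x - y) = qn (y - x).
Proof. by rewrite -qnN opprB. Qed.

Lemma qn0 : qn 0 = 0.
Proof. by rewrite /qn form0l sqrtr0. Qed.

Lemma qn_parallelogram x y :
  qn (x + y) ^+ 2 + qn (x - y) ^+ 2 = 2 * qn x ^+ 2 + 2 * qn y ^+ 2.
Proof.
rewrite !qn_sqr !(formDl hB, formDr, formNl, formNr) !(cReD, cReN); lra.
Qed.

(* The sequence minimizes [|x|^2 - 2 Re F(x)]; no completeness is needed. *)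
Lemma riesz (F : E -> C) (c : R) :
  (forall x y, F (x + y) = F x + F y) -> (forall k x, F (k *: x) = k * F x) ->
  (forall x, nr (F x) <= c * qn x) ->
  exists (u : nat -> E) (d : nat -> R), [/\ null d, forall n, 0 <= d n,
    forall e, 0 < e -> exists N, forall m n, (N <= m)%N -> (N <= n)%N ->
      qn (u m - u n) < e &
    forall n x, nr (B x (u n) - F x) <= d n * qn x].
Proof.
move=> FD FZ Fc; pose phi x : R := qn x ^+ 2 - 2 * complex.Re (F x).
have phi_ge x : - c ^+ 2 <= phi x.
  rewrite /phi; have := Fc x; have := Re_le_nr (F x).
  have := ler_norm (complex.Re (F x)); have := qn_ge0 x.
  by have := sqr_ge0 (qn x - c); rewrite sqrrB; lra.
have hi : has_inf (range phi).
  by split; [exists (phi 0), 0|exists (- c ^+ 2) => _ [x _ <-]].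
pose m := inf (range phi).
have m_le x : m <= phi x by apply: ge_inf; [exact: hi.2|exists x].
have H n : exists x, phi x < m + 1 / 2 ^+ n.
  have [|_ [x _ <-] hx] := inf_adherent (eps := 1 / 2 ^+ n) _ hi.
    by rewrite divr_gt0// exprn_gt0.
  by exists x.
have [u hu] := choice H; exists u, (fun n => Num.sqrt (1 / 2 ^+ n)).
split.
- exact/null_sqrt/null_geom.
- by move=> n; exact: sqrtr_ge0.
- move=> e e0.
  (* By the parallelogram law the squared distance is at most [2 phi(u p) + 2 phi(u q) - 4
     phi(midpoint)], and the midpoint has value at least [m]; an excess of e^2/4 at both points
     therefore suffices. *)
  have [N hN] := null_geom 1 (e := e ^+ 2 / 4) ltac:(by rewrite divr_gt0// exprn_gt0).
  exists N => p q Np Nq.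
  have F2 x : F (2^-1 *: x) = 2^-1 * F x by rewrite FZ.
  have := m_le (2^-1 *: (u p + u q)); rewrite /phi qnZ FZ FD.
  have -> : (2^-1 : C) = (2^-1)%:C by rewrite fmorphV /= rmorph_nat.
  rewrite cReZ cReD nrR ger0_norm ?invr_ge0// exprMn.
  have := qn_parallelogram (u p) (u q).
  have := hu p; have := hu q; have := hN p Np; have := hN q Nq; rewrite /phi.
  move=> h1 h2 h3 h4 h5 h6; rewrite -(ltr_pXn2r (n := 2))// ?nnegrE ?qn_ge0 ?ltW//.
  have e4 : 2^-1 ^+ 2 = 1 / 4 :> R by field.
  by rewrite e4 in h6; lra.
- move=> n x; set d := B x (u n) - F x.
  rewrite -(ler_pXn2r (n := 2))// ?nnegrE ?nr_ge0 ?mulr_ge0 ?qn_ge0 ?sqrtr_ge0//.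
  rewrite exprMn sqr_sqrtr ?divr_ge0 ?exprn_ge0//.
  apply: quadratic_bound; rewrite ?sqr_ge0// => s.
  (* The direction of steepest descent: with this multiple of x the linear term of the variation of
     [phi] is -2 s |d|^2. *)
  pose k : C := - (s%:C * d^*%C).
  have := m_le (u n + k *: x); have := hu n; rewrite /phi FD FZ cReD.
  have -> : qn (u n + k *: x) ^+ 2 = qn (u n) ^+ 2 + 2 * complex.Re (k * B x (u n))
     + (nr k * qn x) ^+ 2.
    rewrite [LHS]qn_sqr formDl// !formDr !formZr !formZl// !form_xx !cReD.
    rewrite (form_sym hB x (u n)) -cjM cRe_conj.
    rewrite conj_mul_sqr -rcM exprMn /=; lra.
  have kd : complex.Re (k * B x (u n)) - complex.Re (k * F x) = - (s * nr d ^+ 2).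
    by rewrite -cReB -mulrBr -/d mulNr -mulrA (mulrC _ d) nr_sqr -rcM -rcN.
  have -> : (nr k * qn x) ^+ 2 = s ^+ 2 * nr d ^+ 2 * qn x ^+ 2.
    by rewrite nrN nrM nr_conj nrR !exprMn real_normK ?num_real.
  lra.
Qed.

End Forms.

(** * Hilbert spaces, bounded operators, adjoints and square roots *)

Section Hilbert.
Variable R : realType.
Local Notation C := R[i].

Lemma inner_form (H : hilbertType R) : psd_form (@inner R H).
Proof.
split; [exact: innerDl|exact: innerZl|exact: inner_sym|].
by move=> x; rewrite inner_norm exprn_ge0.
Qed.

Section Inner.
Variable H : hilbertType R.
Implicit Types x y z : H.
Let hB := inner_form H.

Lemma innerDr x y z : inner x (y + z) = inner x y + inner x z.
Proof. exact: (formDr hB). Qed.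
Lemma innerZr k x y : inner x (k *: y) = k^*%C * inner x y.
Proof. exact: (formZr hB). Qed.
Lemma inner0l y : inner 0 y = 0. Proof. exact: (form0l hB). Qed.
Lemma inner0r y : inner y 0 = 0. Proof. exact: (form0r hB). Qed.
Lemma innerNl x y : inner (- x) y = - inner x y. Proof. exact: (formNl hB). Qed.
Lemma innerNr x y : inner x (- y) = - inner x y. Proof. exact: (formNr hB). Qed.
Lemma innerBl x y z : inner (x - y) z = inner x z - inner y z.
Proof. exact: (formBl hB). Qed.
Lemma innerBr x y z : inner x (y - z) = inner x y - inner x z.
Proof. exact: (formBr hB). Qed.

Lemma inner_suml (I : Type) (l : seq I) (P : pred I) (F : I -> H) y :
  inner (\sum_(i <- l | P i) F i) y = \sum_(i <- l | P i) inner (F i) y.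
Proof. exact: (form_suml hB). Qed.

Lemma inner_sumr (I : Type) (l : seq I) (P : pred I) (F : I -> H) y :
  inner y (\sum_(i <- l | P i) F i) = \sum_(i <- l | P i) inner y (F i).
Proof. exact: (form_sumr hB). Qed.

Lemma innerxx x : inner x x = (nr x ^+ 2)%:C.
Proof. by rewrite inner_norm nrE rcX. Qed.

Lemma qn_inner x : qn (@inner R H) x = nr x.
Proof. by rewrite /qn innerxx /= sqrtr_sqr ger0_norm ?nr_ge0. Qed.

Lemma inner_CS x y : nr (inner x y) <= nr x * nr y.
Proof. by rewrite -!qn_inner; exact: (form_CS hB). Qed.

Lemma inner_eq0 x : (forall y, inner x y = 0) -> x = 0.
Proof.
move=> /(_ x); rewrite innerxx => /complexI/eqP.
by rewrite sqrf_eq0 nr_eq0 => /eqP.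
Qed.

Lemma inner_inj x y : (forall z, inner x z = inner y z) -> x = y.
Proof.
move=> h; apply/eqP; rewrite -subr_eq0; apply/eqP/inner_eq0 => z.
by rewrite innerBl h subrr.
Qed.

Lemma scvg_inner (u v : nat -> H) x y : scvg u x -> scvg v y ->
  scvg (fun n => inner (u n) (v n)) (inner x y).
Proof.
move=> ux vy; have [N hN] := vy _ ltr01.
have h : null (fun n => (nr y + 1) * nr (u n - x) + nr x * nr (v n - y)).
  by apply: nullD; apply: nullM => //; rewrite ?addr_ge0 ?nr_ge0.
apply: null_le_near h => n /hN vn; apply: le_trans (_ : _ <=
  nr (inner (u n - x) (v n)) + nr (inner x (v n - y))) _.
  by apply: le_trans (nrD _ _); rewrite innerBl innerBr addrA subrK.
apply: lerD; last exact: inner_CS.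
apply: le_trans (inner_CS _ _) _; rewrite mulrC ler_wpM2r ?nr_ge0//.
by have := nr_subr (v n) y; lra.
Qed.

Lemma nr_pythagoras x y : inner x y = 0 -> nr (x + y) ^+ 2 = nr x ^+ 2 + nr y ^+ 2.
Proof.
move=> xy; apply: complexI; rewrite rcD -!innerxx innerDl !innerDr xy.
by rewrite (inner_sym x y) xy rmorph0 addr0 add0r.
Qed.

End Inner.

Definition bop (V W : normedModType C) (f : V -> W) :=
  linear f /\ exists2 c : R, 0 <= c & forall x, nr (f x) <= c * nr x.

Section Bop.
Variables (V W : normedModType C) (f : V -> W).
Hypothesis hf : bop f.

Lemma bop0 : f 0 = 0. Proof. exact: (linear_fun0 hf.1). Qed.
Lemma bopD x y : f (x + y) = f x + f y.
Proof. by have := hf.1 1 x y; rewrite !scale1r. Qed.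
Lemma bopZ k x : f (k *: x) = k *: f x.
Proof. by have := hf.1 k x 0; rewrite !addr0 bop0 addr0. Qed.
Lemma bopN x : f (- x) = - f x.
Proof. by rewrite -scaleN1r bopZ scaleN1r. Qed.
Lemma bopB x y : f (x - y) = f x - f y.
Proof. by rewrite bopD bopN. Qed.
Lemma bop_sum (I : Type) (l : seq I) (P : pred I) (F : I -> V) :
  f (\sum_(i <- l | P i) F i) = \sum_(i <- l | P i) f (F i).
Proof. by elim/big_rec2: _ => [|i u v _ <-]; rewrite ?bop0 ?bopD. Qed.

Lemma bop_scvg u x : scvg u x -> scvg (fun n => f (u n)) (f x).
Proof.
move=> ux; have [c c0 hc] := hf.2.
by apply: null_le (nullM c0 ux) => n; rewrite -bopB.
Qed.

Lemma bop_continuous : continuous f.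
Proof. by have [c _ hc] := hf.2; exact: bounded_continuous hf.1 hc. Qed.

Lemma closed_ker : closed [set x | f x = 0].
Proof.
apply: scvg_closed => u x hu ux /=; apply: scvg_unique (bop_scvg ux) _.
by apply: scvg_ext (scvg_cst 0) => n; rewrite hu.
Qed.
End Bop.

Lemma bopP (V W : normedModType C) (f : V -> W) :
  linear f -> continuous f -> bop f.
Proof. by move=> lf cf; split => //; exact: linear_bounded. Qed.

Lemma linearP' (V W : lmodType C) (f : V -> W) :
  (forall x y, f (x + y) = f x + f y) -> (forall k x, f (k *: x) = k *: f x) ->
  linear f.
Proof. by move=> fD fZ k x y; rewrite fD fZ. Qed.

Lemma bop_comp (U V W : normedModType C) (f : V -> W) (g : U -> V) :
  bop f -> bop g -> bop (f \o g).
Proof.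
move=> hf hg; split; first by move=> k x y; rewrite /= !(bopD, bopZ).
have [c c0 hc] := hf.2; have [d d0 hd] := hg.2.
exists (c * d); first exact: mulr_ge0.
by move=> x /=; apply: le_trans (hc _) _; rewrite -mulrA ler_wpM2l.
Qed.

Lemma bop_lin (V W : normedModType C) (f g : V -> W) (k l : C) :
  bop f -> bop g -> bop (fun x => k *: f x + l *: g x).
Proof.
move=> hf hg; split.
  move=> m x y; rewrite !(bopD hf, bopZ hf) !(bopD hg, bopZ hg) !scalerDr.
  by rewrite !scalerA (mulrC k) (mulrC l) addrACA.
have [c c0 hc] := hf.2; have [d d0 hd] := hg.2.
exists (nr k * c + nr l * d); first by rewrite addr_ge0 ?mulr_ge0 ?nr_ge0.
move=> x; apply: le_trans (nrD _ _) _; rewrite !nrZ mulrDl -!mulrA.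
by apply: lerD; apply: ler_wpM2l; rewrite ?nr_ge0.
Qed.

Lemma bop_id (V : normedModType C) : bop (fun x : V => x).
Proof. by split=> //; exists 1 => // x; rewrite mul1r. Qed.

(** Riesz for each y gives g; it is bounded since |g y|^2 = <f (g y), y> <= c |g y| |y|. *)
Lemma adjoint_exists (H K : hilbertType R) (f : H -> K) : bop f ->
  exists2 g : K -> H, bop g & forall x y, inner (f x) y = inner x (g y).
Proof.
move=> hf; have [c c0 hc] := hf.2.
have ex y : exists z, forall x, inner (f x) y = inner x z.
  have [|||u [d [d0 _ cu hu]]] := riesz (inner_form H) (F := fun x => inner (f x) y)
      (c := c * nr y).
  - by move=> x z; rewrite bopD// innerDl.
  - by move=> k x; rewrite bopZ// innerZl.
  - move=> x; apply: le_trans (inner_CS _ _) _.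
    by rewrite qn_inner mulrAC ler_wpM2r ?nr_ge0.
  have [z uz] : exists z, scvg u z.
    by apply: scauchy_cvg => e /cu[N h]; exists N => m n ? ?; rewrite -qn_inner h.
  exists z => x; apply: scvg_unique (scvg_inner (scvg_cst x) uz).
  apply: null_le (nullM (nr_ge0 x) d0) => n.
  by rewrite (le_trans (hu n x))// qn_inner mulrC.
have [g hg] := choice ex; exists g => //; split.
  move=> k x y; apply: inner_inj => z; rewrite innerDl innerZl.
  rewrite (inner_sym z) (inner_sym z (g x)) (inner_sym z (g y)) -!hg innerDr innerZr.
  by rewrite cjD cjM conjcK.
exists c => // y; have := hg y (g y); rewrite innerxx => e.
have := inner_CS (f (g y)) y; rewrite e nrR ger0_norm ?sqr_ge0// => h.
have [gy|gy] := ltrP 0 (nr (g y)); last by rewrite (le_trans gy)// mulr_ge0 ?nr_ge0.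
rewrite -(ler_pM2l gy) -expr2; apply: le_trans h _.
by rewrite mulrA (mulrC _ c) ler_wpM2r ?nr_ge0.
Qed.

Section SquareRoot.
Variables (V : completeNormedModType C) (B : V -> V).
Hypotheses (lB : linear B) (B1 : forall x, nr (B x) <= nr x).

(** A solution of X = (B + X^2)/2 satisfies (1 - X)^2 = 1 - B, so the iteration extracts square
    roots with no functional calculus. As it asks only for a contraction on a Banach space, it
    serves Hilbert space operators and elements of a C*-algebra alike. [sqrt_scal] is the scalar
    case B = 1; it dominates all increments. *)
Fixpoint sqrt_iter n (x : V) : V :=
  if n is m.+1 then (2^-1 : C) *: (B x + sqrt_iter m (sqrt_iter m x)) else 0.

Fixpoint sqrt_scal n : R :=
  if n is m.+1 then 2^-1 * (1 + sqrt_scal m ^+ 2) else 0.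

Let s_bnd n : 0 <= sqrt_scal n <= 1.
Proof.
elim: n => [|n /andP[h1 h2]] /=; first by rewrite lexx ler01.
by have := sqr_ge0 (sqrt_scal n); rewrite expr2 => h3; apply/andP; split; nra.
Qed.

Let sS n : sqrt_scal n <= sqrt_scal n.+1.
Proof. by rewrite /=; have := sqr_ge0 (sqrt_scal n - 1); rewrite expr2; lra. Qed.

Let lX n : linear (sqrt_iter n).
Proof.
elim: n => [|n IH] k x y /=; first by rewrite scaler0 addr0.
rewrite lB !IH !scalerDr !scalerA (mulrC k) -!addrA; congr (_ + _).
by rewrite addrCA.
Qed.

Let XB n x y : sqrt_iter n (x - y) = sqrt_iter n x - sqrt_iter n y.
Proof. by rewrite -[x - y]addrC -scaleN1r lX scaleN1r addrC. Qed.

Let nr_half (x : V) : nr ((2^-1 : C) *: x) = 2^-1 * nr x.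
Proof.
have -> : (2^-1 : C) = (2^-1)%:C by rewrite fmorphV /= rmorph_nat.
by rewrite nrZ nrR ger0_norm ?invr_ge0.
Qed.

Let X_bnd n x : nr (sqrt_iter n x) <= sqrt_scal n * nr x.
Proof.
elim: n x => [|n IH] x /=; first by rewrite nr0 mul0r.
rewrite nr_half -mulrA ler_wpM2l ?invr_ge0//; apply: le_trans (nrD _ _) _.
rewrite mulrDl mul1r lerD//; apply: le_trans (IH _) _.
by rewrite expr2 -mulrA ler_wpM2l//; case/andP: (s_bnd n).
Qed.

Let X_diff n x : nr (sqrt_iter n.+1 x - sqrt_iter n x) <=
  (sqrt_scal n.+1 - sqrt_scal n) * nr x.
Proof.
elim: n x => [|n IH] x.
  by apply: le_trans (_ : nr (sqrt_iter 1 x) <= _); [rewrite subr0|rewrite subr0 X_bnd].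
have E m : sqrt_scal m.+1 = 2^-1 * (1 + sqrt_scal m ^+ 2) by [].
have E' m y : sqrt_iter m.+1 y = (2^-1 : C) *: (B y + sqrt_iter m (sqrt_iter m y)) by [].
rewrite (E' n.+1) {2}(E' n x) -scalerBr opprD addrACA subrr add0r nr_half.
have -> : sqrt_scal n.+2 - sqrt_scal n.+1 =
    2^-1 * ((sqrt_scal n.+1 - sqrt_scal n) * (sqrt_scal n.+1 + sqrt_scal n)).
  by rewrite (E n.+1) {2}(E n); ring.
rewrite -mulrA ler_wpM2l ?invr_ge0// mulrDr mulrDl.
move: (sqrt_scal n.+1) (s_bnd n.+1) (sqrt_iter n.+1) IH (XB n.+1) (X_bnd n.+1) (sS n).
move=> s1 /andP[s10 s11] b IH bB b_bnd sS'.
have -> : b (b x) - sqrt_iter n (sqrt_iter n x) =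
   b (b x - sqrt_iter n x) + (b (sqrt_iter n x) - sqrt_iter n (sqrt_iter n x)).
  by rewrite bB addrA subrK.
apply: le_trans (nrD _ _) _; apply: lerD.
  by apply: le_trans (b_bnd _) _; rewrite mulrC mulrAC ler_wpM2r.
by apply: le_trans (IH _) _; rewrite -mulrA ler_wpM2l ?subr_ge0.
Qed.

Let X_diff2 n m x : (n <= m)%N -> nr (sqrt_iter m x - sqrt_iter n x) <=
  (sqrt_scal m - sqrt_scal n) * nr x.
Proof.
move=> /subnK <-; elim: (m - n)%N => [|k IH]; first by rewrite !subrr nr0 mul0r.
rewrite addSn; apply: le_trans (nr_tri _ (sqrt_iter (k + n) x) _) _.
by have := X_diff (k + n) x; rewrite !mulrBl in IH *; lra.
Qed.

Lemma sqrt_iter_cvg : exists X : V -> V, [/\ linear X,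
  forall x, nr (X x) <= nr x,
  forall x, X x = (2^-1 : C) *: (B x + X (X x)) &
  forall x, scvg (fun n => sqrt_iter n x) (X x)].
Proof.
have s_cau e : 0 < e -> exists N, forall m n, (N <= m)%N -> (N <= n)%N ->
    sqrt_scal m - sqrt_scal n < e.
  move=> e0; have hs : has_sup (range sqrt_scal).
    split; first by exists (sqrt_scal 0), 0%N.
    by exists 1 => _ [n _ <-]; case/andP: (s_bnd n).
  have [_ [N _ <-] hN] := sup_adherent e0 hs; exists N => m n Nm Nn.
  have h1 : sqrt_scal m <= sup (range sqrt_scal) by apply: ub_le_sup; [exact: hs.2|exists m].
  have h2 : sqrt_scal N <= sqrt_scal n.
    by move: Nn => /subnK <-; elim: (n - N)%N => // k IH; exact: le_trans IH (sS _).
  lra.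
have cau x : scauchy (fun n => sqrt_iter n x).
  move=> e e0; have n1 : 0 < nr x + 1 by have := nr_ge0 x; lra.
  have [|N hN] := s_cau (e / (nr x + 1)); first exact: divr_gt0.
  exists N => m n; wlog mn : m n / (n <= m)%N => [W|] Nm Nn.
    by case/orP: (leq_total n m) => nm; [|rewrite nr_distC]; exact: W.
  apply: le_lt_trans (X_diff2 _ mn) _; have := hN _ _ Nm Nn.
  rewrite ltr_pdivlMr// => h; apply: le_lt_trans h; rewrite ler_wpM2l//; last lra.
  rewrite subr_ge0; move: mn => /subnK <-; elim: (m - n)%N => // k IH.
  exact: le_trans IH (sS _).
have [X hX] := choice (fun x => scauchy_cvg (cau x)).
have X1 x : nr (X x) <= nr x.
  apply: scvg_nr_le (hX x) _ => n; apply: le_trans (X_bnd _ _) _.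
  by rewrite ler_piMl ?nr_ge0//; case/andP: (s_bnd n).
have lXX : linear X.
  move=> k x y; apply: scvg_unique (hX _) _.
  by apply: scvg_ext (scvgD (scvgZ k (hX x)) (hX y)) => n; rewrite lX.
exists X; split => // x; apply: scvg_unique (scvg_shift leqnSn (hX x)) _.
apply: scvgZ; apply: scvgD; first exact: scvg_cst.
apply: null_le (nullD (hX x) (hX (X x))) => n.
apply: le_trans (nr_tri _ (sqrt_iter n (X x)) _) _; rewrite lerD2r -XB.
apply: le_trans (X_bnd _ _) _.
by rewrite ler_piMl ?nr_ge0//; case/andP: (s_bnd n).
Qed.

End SquareRoot.

End Hilbert.

(** * Schur's lemma *)

Section Schur.
Variable R : realType.
Local Notation C := R[i].

Lemma nr_eq_sqr (H : hilbertType R) (x : H) : complex.Re (inner x x) = nr x ^+ 2.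
Proof. by rewrite innerxx. Qed.

Lemma sqrt_iter_comm (V W : completeNormedModType C) (B : V -> V) (B' : W -> W)
    (S : V -> W) : linear S -> (forall x, S (B x) = B' (S x)) ->
  forall n x, S (sqrt_iter B n x) = sqrt_iter B' n (S x).
Proof.
move=> lS SB; elim=> [|n IH] x /=; first exact: linear_fun0.
have S0 := linear_fun0 lS.
have SZ k y : S (k *: y) = k *: S y by have := lS k y 0; rewrite !addr0 S0 addr0.
have SD y z : S (y + z) = S y + S z by have := lS 1 y z; rewrite !scale1r.
by rewrite SZ SD SB !IH.
Qed.

Variables (H : hilbertType R) (I : Type) (rho : I -> H -> H) (st : I -> I).

Definition irreducible_family := forall V : set H, closed_subspace V ->
  (forall i x, V x -> V (rho i x)) -> V = [set 0] \/ V = setT.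

Hypothesis rhoL : forall i, bop (rho i).
Hypothesis irr : irreducible_family.
Hypothesis stK : involutive st.
Hypothesis rho_st : forall i x y, inner (rho i x) y = inner x (rho (st i) y).

(** Scale D to a contraction D' and let A = |D'|, the square root of D'^2 obtained from
    [sqrt_iter_cvg]. The kernel of |D'| - D' is closed and invariant. If it is everything, D is
    positive. If it is 0, then |D'| + D', whose range lies in it, vanishes and D is negative. *)
Lemma schur_sign (D : H -> H) : bop D ->
  (forall x y, inner (D x) y = inner x (D y)) ->
  (forall i x, D (rho i x) = rho i (D x)) ->
  (forall x, 0 <= complex.Re (inner (D x) x)) \/
  (forall x, complex.Re (inner (D x) x) <= 0).
Proof.
move=> bD saD cD; have [c c0 hc] := bD.2.
have c1 : 0 < c + 1 by lra.
pose k : C := ((c + 1)^-1)%:C.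
pose D' x := k *: D x.
have bD' : bop D'.
  have := bop_lin k 0 bD (bop_id H); congr bop; apply/funext => x.
  by rewrite scale0r addr0.
have D'1 x : nr (D' x) <= nr x.
  have nk : nr k = (c + 1)^-1 by rewrite nrR ger0_norm// invr_ge0 ltW.
  rewrite nrZ nk ler_pdivrMl//.
  by apply: le_trans (hc x) _; rewrite ler_wpM2r ?nr_ge0//; lra.
have saD' x y : inner (D' x) y = inner x (D' y).
  by rewrite innerZl innerZr conjc_real saD.
pose B x := x - D' (D' x).
have bB : bop B.
  have := bop_lin 1 (-1) (bop_id H) (bop_comp bD' bD'); congr bop.
  by apply/funext => x /=; rewrite scale1r scaleN1r.
have B1 x : nr (B x) <= nr x.
  rewrite -(ler_pXn2r (n := 2))// ?nnegrE ?nr_ge0//.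
  have e1 : inner x (D' (D' x)) = inner (D' x) (D' x) by rewrite saD'.
  have e2 : inner (D' (D' x)) x = inner (D' x) (D' x) by rewrite saD'.
  rewrite -nr_eq_sqr innerBl !innerBr !cReB e1 e2 !nr_eq_sqr.
  have : nr (D' (D' x)) ^+ 2 <= nr (D' x) ^+ 2 by rewrite ler_pXn2r// nnegrE nr_ge0.
  have := sqr_ge0 (nr (D' x)); lra.
have [X [lX X1 XE Xlim]] := sqrt_iter_cvg bB.1 B1.
have bX : bop X by split=> //; exists 1 => // x; rewrite mul1r.
have Xcomm S : bop S -> (forall x, S (B x) = B (S x)) -> forall x, S (X x) = X (S x).
  move=> bS SB x; apply: scvg_unique (bop_scvg bS (Xlim x)) _.
  apply: scvg_ext (Xlim (S x)) => n.
  by rewrite (sqrt_iter_comm bS.1 SB).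
have XD x : D' (X x) = X (D' x).
  by apply: Xcomm => // y; rewrite /B bopB.
have Xrho i x : rho i (X x) = X (rho i x).
  apply: Xcomm => // y; rewrite /B /D' !(bopZ bD) (bopB (rhoL i)) !scalerA.
  by rewrite (bopZ (rhoL i)) -!cD.
have XX x : X (X x) = X x + X x - B x.
  have e : (2^-1 + 2^-1 : C) = 1 by field.
  have -> : X x + X x = B x + X (X x).
    by rewrite {1 2}(XE x) -scalerDl e scale1r.
  by rewrite addrAC subrr add0r.
pose A x := x - X x.
have bA : bop A.
  have := bop_lin 1 (-1) (bop_id H) bX; congr bop.
  by apply/funext => x; rewrite scale1r scaleN1r.
have AA x : A (A x) = D' (D' x).
  have E (a b d : H) : a - b - (b - (b + b - (a - d))) = d.
    by rewrite opprB [b + b - _ - b]addrAC addrK addrA subrK opprB addrC subrK.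
  by rewrite /A (bopB bX) XX /B E.
have AD x : A (D' x) = D' (A x) by rewrite /A (bopB bD') XD.
pose P x := A x - D' x.
have bP : bop P.
  have := bop_lin 1 (-1) bA bD'; congr bop.
  by apply/funext => x; rewrite scale1r scaleN1r.
have PQ x : P (A x + D' x) = 0.
  by rewrite /P (bopD bA) (bopD bD') AA AD (addrC (D' (A x))) subrr.
have A_ge0 x : 0 <= complex.Re (inner (A x) x).
  rewrite innerBl cReB nr_eq_sqr subr_ge0; apply: le_trans (ler_norm _) _.
  apply: le_trans (Re_le_nr _) _; apply: le_trans (inner_CS _ _) _.
  by rewrite expr2 ler_wpM2r ?nr_ge0.
have D'E x : complex.Re (inner (D x) x) = (c + 1) * complex.Re (inner (D' x) x).
  by rewrite innerZl cReZ mulrA mulfV ?gt_eqF// mul1r.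
have [||V0|VT] := irr (V := [set x | P x = 0]).
- split; first exact: bop0.
    by move=> l x y /= Px Py; rewrite bP.1 Px Py scaler0 addr0.
  exact: closed_ker.
- move=> i x /=; rewrite /P /A -Xrho -(bopB (rhoL i)) => Px.
  rewrite /D' cD -(bopZ (rhoL i)) -(bopB (rhoL i)).
  by rewrite /D' in Px; rewrite Px bop0.
- right=> x; rewrite D'E; apply: mulr_ge0_le0; first exact: ltW.
  have : [set x | P x = 0] (A x + D' x) by exact: PQ.
  rewrite V0 => /= /eqP; rewrite addrC addr_eq0 => /eqP ->.
  by rewrite innerNl cReN oppr_le0.
- left=> x; rewrite D'E; apply: mulr_ge0; first exact: ltW.
  have : [set x | P x = 0] x by rewrite VT.
  by move=> /= /eqP; rewrite subr_eq0 => /eqP <-.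
Qed.

(** By [schur_sign] applied to D - k, every real k is a lower or an upper bound of the quadratic
    form of D, so the form is constant, equal to the supremum g of the lower bounds. *)
Lemma schur_sa (D : H -> H) : bop D ->
  (forall x y, inner (D x) y = inner x (D y)) ->
  (forall i x, D (rho i x) = rho i (D x)) ->
  exists g : R, forall x, D x = g%:C *: x.
Proof.
move=> bD saD cD.
have [[y y0]|no] := pselect (exists y : H, y <> 0); last first.
  by exists 0 => x; have -> : x = 0; [apply: contrapT => ?; apply: no; exists x|rewrite bop0// scaler0].
have ny : 0 < nr y by rewrite nr_gt0; apply/eqP.
have [c c0 hc] := bD.2.
have Q_le x : `|complex.Re (inner (D x) x)| <= c * nr x ^+ 2.
  apply: le_trans (Re_le_nr _) _; apply: le_trans (inner_CS _ _) _.
  by rewrite expr2 mulrA ler_wpM2r ?nr_ge0.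
pose S : set R := [set g | forall x, g * nr x ^+ 2 <= complex.Re (inner (D x) x)].
have hS : has_sup S.
  split; first by exists (- c) => x; have := Q_le x; rewrite ler_norml => /andP[]; lra.
  exists c => g /(_ y) h; have := Q_le y; rewrite ler_norml => /andP[_ h'].
  by have := le_trans h h'; rewrite ler_pM2r// exprn_gt0.
pose g := sup S.
have lim_le (a b : R) : (forall e, 0 < e -> a <= b + e) -> a <= b.
  move=> h; rewrite leNgt; apply/negP => ba.
  by have := h ((a - b) / 2) ltac:(lra); lra.
have Dc (k : R) : bop (fun x => D x - k%:C *: x).
  have := bop_lin 1 (- k%:C) bD (bop_id H); congr bop.
  by apply/funext => x; rewrite scale1r scaleNr.
have QE x : complex.Re (inner (D x) x) = g * nr x ^+ 2.
  have n0 := sqr_ge0 (nr x).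
  apply/eqP; rewrite eq_le; apply/andP; split; apply: lim_le => e e0;
    have e1 : 0 < e / (nr x ^+ 2 + 1) by rewrite divr_gt0//; lra.
  - pose k := g + e / (nr x ^+ 2 + 1).
    have sak u v : inner (D u - k%:C *: u) v = inner u (D v - k%:C *: v).
      by rewrite innerBl innerBr innerZl innerZr conjc_real saD.
    have ck i u : D (rho i u) - k%:C *: rho i u = rho i (D u - k%:C *: u).
      by rewrite cD (bopB (rhoL i)) (bopZ (rhoL i)).
    have [h|h] := schur_sign (Dc k) sak ck.
    + have : S k by move=> u; have := h u; rewrite innerBl cReB innerZl cReZ nr_eq_sqr subr_ge0.
      move=> /(ub_le_sup hS.2); rewrite -/g /k; lra.
    + have := h x; rewrite innerBl cReB innerZl cReZ nr_eq_sqr /k.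
      have : e / (nr x ^+ 2 + 1) * nr x ^+ 2 <= e.
        by rewrite mulrAC ler_pdivrMr ?ler_wpM2l ?ltW//; lra.
      lra.
  - have [k Sk kg] := sup_adherent e1 hS.
    have := Sk x; have : (g - k) * nr x ^+ 2 <= e.
      apply: le_trans (_ : e / (nr x ^+ 2 + 1) * nr x ^+ 2 <= _).
        by apply: ler_wpM2r => //; rewrite -/g in kg; lra.
      by rewrite mulrAC ler_pdivrMr ?ler_wpM2l ?ltW//; lra.
    lra.
exists g => x; apply/eqP; rewrite -subr_eq0; apply/eqP.
have [N hN] : exists N : H -> H, N = fun x => D x - g%:C *: x by exists (fun x => D x - g%:C *: x).
have -> : D x - g%:C *: x = N x by rewrite hN.
have bN : bop N by rewrite hN.
have N0 u : complex.Re (inner (N u) u) = 0.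
  by rewrite hN innerBl cReB innerZl cReZ nr_eq_sqr QE subrr.
have saN u v : inner (N u) v = inner u (N v).
  by rewrite hN innerBl innerBr innerZl innerZr conjc_real saD.
(* A self-adjoint operator with vanishing quadratic form is 0: its form at x + N x equals 2 |N
   x|^2. *)
have := N0 (x + N x); rewrite (bopD bN) innerDl !innerDr !cReD !N0.
rewrite (saN (N x) x) innerxx /= => h.
by apply/eqP; rewrite -nr_eq0 -sqrf_eq0; apply/eqP; lra.
Qed.

Lemma adjoint_comm (K : hilbertType R) (rho' : I -> K -> K) (f : H -> K) (g : K -> H) :
  (forall i x y, inner (rho' i x) y = inner x (rho' (st i) y)) ->
  (forall x y, inner (f x) y = inner x (g y)) ->
  (forall i x, f (rho i x) = rho' i (f x)) ->
  forall i y, g (rho' i y) = rho i (g y).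
Proof.
move=> st' fg fc i y; apply: inner_inj => z.
rewrite (inner_sym z) (inner_sym z (rho i _)) -fg -{1}(stK i) -st' -fc fg.
by rewrite rho_st stK.
Qed.

Lemma schur (D : H -> H) : bop D ->
  (forall i x, D (rho i x) = rho i (D x)) -> exists g : C, forall x, D x = g *: x.
Proof.
move=> bD cD; have [E bE hE] := adjoint_exists bD.
have cE := adjoint_comm rho_st hE cD.
have hE' x y : inner (E x) y = inner x (D y).
  by rewrite (inner_sym y) -hE -inner_sym.
have [|||a ha] := schur_sa (D := fun x => (1 : C) *: D x + (1 : C) *: E x).
- exact: bop_lin.
- by move=> x y; rewrite !scale1r innerDl innerDr hE hE' addrC.
- by move=> i x; rewrite !scale1r cD cE (bopD (rhoL i)).
have [|||b hb] := schur_sa (D := fun x => 'i%C *: D x + (- 'i%C) *: E x).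
- exact: bop_lin.
- move=> x y; rewrite !(innerDl, innerDr, innerZl, innerZr) hE hE'.
  by rewrite cjN cji opprK addrC.
- by move=> i x; rewrite cD cE (bopD (rhoL i)) !(bopZ (rhoL i)).
exists (2^-1 * (a%:C - 'i%C * b%:C)) => x.
have e1 : a%:C *: x = D x + E x by rewrite -ha !scale1r.
have e2 : ('i%C * b%:C) *: x = E x - D x.
  rewrite -scalerA -hb scalerDr !scalerA mulrN -expr2 sqr_i opprK.
  by rewrite scale1r scaleN1r addrC.
have e : (2^-1 + 2^-1 : C) = 1 by field.
rewrite -scalerA scalerBl e1 e2 opprB addrACA subrr addr0 scalerDr.
by rewrite -scalerDl e scale1r.
Qed.

End Schur.

(** * Abstract unital algebras with involution and their representations *)

HB.mixin Record isStarAlgebra (R : realType) U & GRing.Algebra R[i] U := {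
  adj : U -> U ;
  adjD : {morph adj : x y / x + y} ;
  adjZ : forall (k : R[i]) x, adj (k *: x) = k^*%C *: adj x ;
  adjM : forall x y, adj (x * y) = adj y * adj x ;
  adjK : involutive adj
}.

#[short(type="starAlgType")]
HB.structure Definition StarAlgebra (R : realType) :=
  {U of GRing.Algebra R[i] U & isStarAlgebra R U}.

Section StarAlgebraTheory.
Variables (R : realType) (U : starAlgType R).
Local Notation C := R[i].
Implicit Types a b : U.

Lemma adj0 : adj (0 : U) = 0.
Proof. by have := adjZ 0 (0 : U); rewrite conjc0 !scale0r. Qed.

Lemma adjN a : adj (- a) = - adj a.
Proof. by rewrite -scaleN1r adjZ rmorphN rmorph1 scaleN1r. Qed.

Lemma adjB a b : adj (a - b) = adj a - adj b.
Proof. by rewrite adjD adjN. Qed.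

Lemma adj1 : adj (1 : U) = 1.
Proof. by have := adjM (adj 1) (1 : U); rewrite mulr1 adjK mulr1 => <-. Qed.

Lemma adj_sum (I : Type) (l : seq I) (P : pred I) (F : I -> U) :
  adj (\sum_(i <- l | P i) F i) = \sum_(i <- l | P i) adj (F i).
Proof. by elim/big_rec2: _ => [|i u v _ <-]; rewrite ?adj0 ?adjD. Qed.

End StarAlgebraTheory.

Record starrep (R : realType) (U : starAlgType R) (H : hilbertType R)
    (rho : U -> H -> H) : Prop := StarRep {
  rep1 : forall x, rho 1 x = x ;
  repM : forall a b x, rho (a * b) x = rho a (rho b x) ;
  repDl : forall a b x, rho (a + b) x = rho a x + rho b x ;
  repZl : forall k a x, rho (k *: a) x = k *: rho a x ;
  rep_bop : forall a, bop (rho a) ;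
  rep_adj : forall a x y, inner (rho a x) y = inner x (rho (adj a) y) }.

Section Representations.
Variables (R : realType) (U : starAlgType R) (H : hilbertType R) (rho : U -> H -> H).
Hypothesis hr : starrep rho.
Local Notation C := R[i].

Lemma repDr a x y : rho a (x + y) = rho a x + rho a y.
Proof. exact: (bopD (rep_bop hr a)). Qed.
Lemma repZr a k x : rho a (k *: x) = k *: rho a x.
Proof. exact: (bopZ (rep_bop hr a)). Qed.
Lemma repBr a x y : rho a (x - y) = rho a x - rho a y.
Proof. exact: (bopB (rep_bop hr a)). Qed.
Lemma rep0r a : rho a 0 = 0.
Proof. exact: (bop0 (rep_bop hr a)). Qed.
Lemma rep0l x : rho 0 x = 0.
Proof. by have := repZl hr 0 0 x; rewrite !scale0r. Qed.
Lemma repNl a x : rho (- a) x = - rho a x.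
Proof. by rewrite -scaleN1r (repZl hr) scaleN1r. Qed.
Lemma repBl a b x : rho (a - b) x = rho a x - rho b x.
Proof. by rewrite (repDl hr) repNl. Qed.
Lemma rep_suml (I : Type) (l : seq I) (P : pred I) (F : I -> U) x :
  rho (\sum_(i <- l | P i) F i) x = \sum_(i <- l | P i) rho (F i) x.
Proof. by elim/big_rec2: _ => [|i u v _ <-]; rewrite ?rep0l ?(repDl hr). Qed.
Lemma rep_sumr (I : Type) (l : seq I) (P : pred I) (F : I -> H) a :
  rho a (\sum_(i <- l | P i) F i) = \sum_(i <- l | P i) rho a (F i).
Proof. exact: (bop_sum (rep_bop hr a)). Qed.
Lemma rep_scvg a u x : scvg u x -> scvg (fun n => rho a (u n)) (rho a x).
Proof. exact: (bop_scvg (rep_bop hr a)). Qed.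
Lemma rep_adjr a x y : inner x (rho a y) = inner (rho (adj a) x) y.
Proof. by rewrite (rep_adj hr) adjK. Qed.

Lemma rep_nr a x : nr (rho a x) ^+ 2 = complex.Re (inner (rho (adj a * a) x) x).
Proof. by rewrite (repM hr) (rep_adj hr) adjK nr_eq_sqr. Qed.

Lemma rep_isometry a x : adj a * a = 1 -> nr (rho a x) = nr x.
Proof.
move=> aa; apply/eqP; rewrite -(eqrXn2 (n := 2))// ?nr_ge0//.
by rewrite rep_nr aa (rep1 hr) nr_eq_sqr.
Qed.

Lemma rep_proj_le p x : adj p = p -> p * p = p -> nr (rho p x) <= nr x.
Proof.
move=> ap pp; have [->|] := eqVneq (rho p x) 0; first by rewrite nr0 nr_ge0.
rewrite -nr_gt0 => h; rewrite -(ler_pM2l h) -expr2 rep_nr ap pp.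
apply: le_trans (ler_norm _) _; apply: le_trans (Re_le_nr _) _; exact: inner_CS.
Qed.

Lemma rep_schur : irreducible_family rho -> forall D : H -> H, bop D ->
  (forall a x, D (rho a x) = rho a (D x)) -> exists g : C, forall x, D x = g *: x.
Proof. by move=> irr D bD cD; apply: schur (rep_bop hr) irr (@adjK R U) (rep_adj hr) _ bD cD. Qed.

End Representations.

(** * Self-adjoint density for two disjoint representations *)

Section JointDensity.
Variables (R : realType) (U : starAlgType R).
Local Notation C := R[i].
Variables (H : bool -> hilbertType R) (rho : forall b, U -> H b -> H b).
Hypothesis hr : forall b, starrep (@rho b).
Hypothesis scal : forall b (D : H b -> H b), bop D ->
  (forall a x, D (rho a x) = rho a (D x)) -> exists g : C, forall x, D x = g *: x.
Hypothesis disj : forall b b' (D : H b -> H b'), b != b' -> bop D ->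
  (forall a x, D (rho a x) = rho a (D x)) -> forall x, D x = 0.

Section Vanish.
Variables (I : bool -> finType) (x : forall b, I b -> H b).

Let B (T S : U) : C := \sum_b \sum_(i : I b) inner (rho T (x i)) (rho S (x i)).

Let hB : psd_form B.
Proof.
split.
- move=> S T V; rewrite -big_split; apply: eq_bigr => b _.
  by rewrite -big_split; apply: eq_bigr => i _; rewrite (repDl (hr b)) innerDl.
- move=> k S T; rewrite mulr_sumr; apply: eq_bigr => b _.
  by rewrite mulr_sumr; apply: eq_bigr => i _; rewrite (repZl (hr b)) innerZl.
- move=> S T; rewrite [RHS]rmorph_sum; apply: eq_bigr => b _.
  by rewrite [RHS]rmorph_sum; apply: eq_bigr => i _; rewrite inner_sym.
- move=> S; apply: sumr_ge0 => b _; apply: sumr_ge0 => i _.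
  by rewrite inner_norm exprn_ge0.
Qed.

Let B_ge b (i : I b) S : nr (rho S (x i)) <= qn B S.
Proof.
rewrite -(ler_pXn2r (n := 2))// ?nnegrE ?nr_ge0 ?qn_ge0// (qn_sqr hB).
rewrite -lecR -innerxx.
have -> : (complex.Re (B S S))%:C = B S S by rewrite [RHS](form_xx hB) (qn_sqr hB).
rewrite /B (bigD1 b)//= (bigD1 i)//= -addrA lerDl addr_ge0//.
  by apply: sumr_ge0 => j _; rewrite inner_norm exprn_ge0.
by apply: sumr_ge0 => c _; apply: sumr_ge0 => j _; rewrite inner_norm exprn_ge0.
Qed.

(* [q] is the orthogonal projection, onto the closure of the cyclic subspace
   generated by [x], of the vector with entry [w] in slot [k]. *)
Let isproj b (k : I b) (w : H b) (q : forall b', I b' -> H b') :=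
  (forall T, \sum_b' \sum_(i : I b') inner (rho T (x i)) (q b' i) = inner (rho T (x k)) w) /\
  (exists u : nat -> U, forall b' (i : I b'), scvg (fun n => rho (u n) (x i)) (q b' i)).

Let proj_exists b (k : I b) (w : H b) : exists q, isproj k w q.
Proof.
have [|||u [d [d0 _ cu hu]]] := riesz hB (F := fun T => inner (rho T (x k)) w) (c := nr w).
- by move=> S T; rewrite (repDl (hr b)) innerDl.
- by move=> l S; rewrite (repZl (hr b)) innerZl.
- by move=> S; rewrite mulrC; apply: le_trans (inner_CS _ _) _; rewrite ler_wpM2r ?nr_ge0.
have ex b' (i : I b') : exists z : H b', scvg (fun n => rho (u n) (x i)) z.
  apply: scauchy_cvg => e /cu[N h]; exists N => m n Nm Nn; apply: le_lt_trans (h _ _ Nm Nn).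
  by rewrite -(repBl (hr b')).
pose q b' (i : I b') : H b' := projT1 (cid (ex b' i)).
have hq b' i : scvg (fun n => rho (u n) (x i)) (q b' i) by rewrite /q; case: cid.
exists q; split; last by exists u.
move=> T; apply: (@scvg_unique _ _ (fun n => B T (u n))).
  apply: scvg_sum => b'; apply: scvg_sum => i.
  by apply: scvg_inner (hq b' i); exact: scvg_cst.
apply: null_le (nullM (qn_ge0 B T) d0) => n; rewrite mulrC; exact: hu.
Qed.

Let proj_pairing b (k : I b) w q b' (k' : I b') w' q' : isproj k w q -> isproj k' w' q' ->
  \sum_c \sum_(i : I c) inner (q c i) (q' c i) = inner (q b' k') w'.
Proof.
move=> [_ [u hu]] [h' _]; apply: (@scvg_unique _ _ (fun n => inner (rho (u n) (x k')) w')).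
  apply: scvg_ext (_ : scvg (fun n => \sum_c \sum_(i : I c) inner (rho (u n) (x i)) (q' c i)) _).
    by move=> n; rewrite h'.
  apply: scvg_sum => c; apply: scvg_sum => i.
  by apply: scvg_inner (hu c i) _; exact: scvg_cst.
by apply: scvg_inner (hu b' k') _; exact: scvg_cst.
Qed.

Let sum_inner_ge0 (q : forall b', I b' -> H b') b (i : I b) :
  (nr (q b i) ^+ 2)%:C <= \sum_c \sum_(j : I c) inner (q c j) (q c j).
Proof.
rewrite -innerxx (bigD1 b)//= (bigD1 i)//= -addrA lerDl addr_ge0//.
  by apply: sumr_ge0 => j _; rewrite inner_norm exprn_ge0.
by apply: sumr_ge0 => c _; apply: sumr_ge0 => j _; rewrite inner_norm exprn_ge0.
Qed.

Let proj_zero b (k : I b) q : isproj k 0 q -> forall b' i, q b' i = 0.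
Proof.
move=> pq b' i; have := sum_inner_ge0 q i.
rewrite (proj_pairing pq pq) inner0r lecR => h.
by apply/eqP; rewrite -nr_eq0 -sqrf_eq0 eq_le h sqr_ge0.
Qed.

Let proj_lin b (k : I b) w w' q q' l : isproj k w q -> isproj k w' q' ->
  isproj k (l *: w + w') (fun b' i => l *: q b' i + q' b' i).
Proof.
move=> [h [u hu]] [h' [u' hu']]; split.
  move=> T; rewrite innerDr innerZr -h -h' mulr_sumr -big_split; apply: eq_bigr => c _.
  rewrite mulr_sumr -big_split; apply: eq_bigr => i _.
  by rewrite innerDr innerZr.
exists (fun n => l *: u n + u' n) => b' i.
apply: scvg_ext (scvgD (scvgZ l (hu b' i)) (hu' b' i)) => n.
by rewrite (repDl (hr b')) (repZl (hr b')).
Qed.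

Let proj_unique b (k : I b) w q q' : isproj k w q -> isproj k w q' ->
  forall b' i, q b' i = q' b' i.
Proof.
move=> h h' b' i; have := proj_lin (-1) h h'; rewrite scaleN1r addNr => /proj_zero/(_ b' i).
by rewrite scaleN1r => /eqP; rewrite addrC subr_eq0 => /eqP.
Qed.

Let proj_act b (k : I b) w q a : isproj k w q ->
  isproj k (rho a w) (fun b' i => rho a (q b' i)).
Proof.
move=> [h [u hu]]; split.
  move=> T; rewrite (rep_adjr (hr b)) -(repM (hr b)) -h.
  apply: eq_bigr => c _; apply: eq_bigr => i _.
  by rewrite (rep_adjr (hr c)) -(repM (hr c)).
exists (fun n => a * u n) => b' i.
apply: scvg_ext (rep_scvg (hr b') a (hu b' i)) => n.
by rewrite (repM (hr b')).
Qed.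

(** The projection onto the closure of the vectors (rho T x_i)_i commutes with the action of U. By
    [scal] and [disj] its blocks are scalars g within one representation and 0 between the two. It
    fixes x and kills y, and g is Hermitian; substituting x = g x into the sum moves g onto the
    coefficients of y, where it gives 0. *)
Lemma joint_vanish (y : forall b, I b -> H b) :
  (forall T, \sum_b \sum_(i : I b) inner (rho T (x i)) (y b i) = 0) ->
  forall b (w : H b), \sum_(i : I b) inner w (y b i) *: x i = 0.
Proof.
move=> van b w.
pose q (k : I b) (w : H b) b' (i : I b') : H b' := projT1 (cid (proj_exists k w)) b' i.
have hq k v : isproj k v (q k v) by rewrite /q; case: cid.
have bq (k : I b) b' (i : I b') : bop (fun v => q k v b' i).
  split.
    move=> l v v'; exact: (proj_unique (hq k _) (proj_lin l (hq k v) (hq k v'))).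
  exists 1 => // v; rewrite mul1r.
  have key b'' (j : I b'') : nr (q k v b'' j) ^+ 2 <= nr (q k v b k) * nr v.
    rewrite -lecR; apply: le_trans (sum_inner_ge0 (q k v) j) _.
    rewrite (proj_pairing (hq k v) (hq k v)).
    have := sum_inner_ge0 (q k v) k; rewrite (proj_pairing (hq k v) (hq k v)) => h0.
    rewrite -[X in X <= _]ger0_norm; last by apply: le_trans h0; rewrite ler0c sqr_ge0.
    by rewrite nrE lecR inner_CS.
  have h1 : nr (q k v b k) <= nr v.
    have := key b k; have [h|h] := ltrP 0 (nr (q k v b k)).
      by rewrite expr2 ler_pM2l.
    by move=> _; apply: le_trans h _; exact: nr_ge0.
  rewrite -(ler_pXn2r (n := 2))// ?nnegrE ?nr_ge0//; apply: le_trans (key _ _) _.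
  by rewrite expr2 ler_wpM2r ?nr_ge0.
have cq (k : I b) b' (i : I b') a v : q k (rho a v) b' i = rho a (q k v b' i).
  exact: (proj_unique (hq k _) (proj_act a (hq k v))).
have q0 (k : I b) b' (i : I b') v : b' != b -> q k v b' i = 0.
  by move=> bb; apply: (disj (D := fun v => q k v b' i)) => //; rewrite eq_sym.
have [g hg] : exists g : I b -> I b -> C, forall k v i, q k v b i = g k i *: v.
  have ex k i := scal (bq k b i) (cq k b i).
  by exists (fun k i => projT1 (cid (ex k i))) => k v i; case: cid.
have [->|w0] := eqVneq w 0.
  by apply: big1 => i _; rewrite inner0l scale0r.
have g_sym k i : g k i = (g i k)^*%C.
  have e1 : inner (q k w b i) w = inner w (q i w b k).
    rewrite -(proj_pairing (hq k w) (hq i w)) (inner_sym (q i w b k) w).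
    rewrite -(proj_pairing (hq i w) (hq k w)) rmorph_sum; apply: eq_bigr => c _.
    by rewrite [RHS]rmorph_sum; apply: eq_bigr => j _; rewrite inner_sym.
  move: e1; rewrite !hg innerZl innerZr => /mulIf; apply.
  by rewrite inner_norm sqrf_eq0 normr_eq0.
have xE k : x k = \sum_i (g k i)^*%C *: x i.
  apply: inner_inj => v; have [h _] := hq k v; have := h 1.
  rewrite (rep1 (hr b)) => <-; rewrite (bigD1 b)//= [X in _ + X]big1 ?addr0; last first.
    by move=> c cb; apply: big1 => i _; rewrite q0// inner0r.
  rewrite inner_suml; apply: eq_bigr => i _.
  by rewrite (rep1 (hr b)) hg innerZr innerZl.
have yE k : \sum_i g k i * inner w (y b i) = 0.
  have [_ [u hu]] := hq k w.
  have e : \sum_c \sum_(i : I c) inner (q k w c i) (y c i) = 0.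
    apply: (@scvg_unique _ _ (fun n => 0)); last exact: scvg_cst.
    apply: scvg_ext (_ : scvg (fun n => \sum_c \sum_(i : I c) inner (rho (u n) (x i)) (y c i)) _).
      by move=> n; rewrite van.
    apply: scvg_sum => c; apply: scvg_sum => i.
    by apply: scvg_inner (hu c i) _; exact: scvg_cst.
  rewrite -[RHS]e (bigD1 b)//= [X in _ + X]big1 ?addr0; last first.
    by move=> c cb; apply: big1 => i _; rewrite q0// inner0l.
  by apply: eq_bigr => i _; rewrite hg innerZl.
under eq_bigr => k _ do rewrite (xE k) scaler_sumr.
rewrite exchange_big big1// => i _.
under eq_bigr => k _ do rewrite scalerA -g_sym mulrC.
by rewrite -scaler_suml yE scale0r.
Qed.

End Vanish.

End JointDensity.

Section JointDensityTheorem.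
Variables (R : realType) (U : starAlgType R).
Local Notation C := R[i].
Variables (H : bool -> hilbertType R) (rho : forall b, U -> H b -> H b).
Hypothesis hr : forall b, starrep (@rho b).
Hypothesis scal : forall b (D : H b -> H b), bop D ->
  (forall a x, D (rho a x) = rho a (D x)) -> exists g : C, forall x, D x = g *: x.
Hypothesis disj : forall b b' (D : H b -> H b'), b != b' -> bop D ->
  (forall a x, D (rho a x) = rho a (D x)) -> forall x, D x = 0.
Variables (I : bool -> finType) (e : forall b, I b -> H b) (s : forall b, I b -> I b).
Arguments s {b}.
Hypothesis sK : forall b, involutive (@s b).
Hypothesis e_on : forall b i j, inner (@e b i) (e j) = (i == j)%:R.

(** The least squares problem for T e_i = e_(s i) and T^* e_i = e_(s i) at once. The adjoints enter
    in the opposite order so that the form stays linear in T. *)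
Let B (T S : U) : C := \sum_b \sum_(i : I b)
  (inner (rho T (e i)) (rho S (e i)) + inner (rho (adj S) (e i)) (rho (adj T) (e i))).

Let hB : psd_form B.
Proof.
split.
- move=> S T V; rewrite -big_split; apply: eq_bigr => b _.
  rewrite -big_split; apply: eq_bigr => i _.
  by rewrite adjD !(repDl (hr b)) innerDl innerDr addrACA.
- move=> k S T; rewrite mulr_sumr; apply: eq_bigr => b _.
  rewrite mulr_sumr; apply: eq_bigr => i _.
  by rewrite adjZ !(repZl (hr b)) innerZl innerZr conjcK mulrDr.
- move=> S T; rewrite [RHS]rmorph_sum; apply: eq_bigr => b _.
  rewrite [RHS]rmorph_sum; apply: eq_bigr => i _.
  by rewrite [RHS]rmorphD; congr (_ + _); exact: inner_sym.
- move=> S; apply: sumr_ge0 => b _; apply: sumr_ge0 => i _.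
  by rewrite !inner_norm addr_ge0// exprn_ge0.
Qed.

Let B_ge b (i : I b) S : nr (rho S (e i)) <= qn B S /\ nr (rho (adj S) (e i)) <= qn B S.
Proof.
suff h : (nr (rho S (e i)) ^+ 2)%:C + (nr (rho (adj S) (e i)) ^+ 2)%:C <= B S S.
  have := h; rewrite (form_xx hB) -rcD lecR => h'.
  have h1 := sqr_ge0 (nr (rho S (e i))); have h2 := sqr_ge0 (nr (rho (adj S) (e i))).
  by split; rewrite -(ler_pXn2r (n := 2))// ?nnegrE ?nr_ge0 ?qn_ge0//; lra.
rewrite -!innerxx /B (bigD1 b)//= (bigD1 i)//= -addrA lerDl addr_ge0//.
  by apply: sumr_ge0 => j _; rewrite !inner_norm addr_ge0// exprn_ge0.
apply: sumr_ge0 => c _; apply: sumr_ge0 => j _.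
by rewrite !inner_norm addr_ge0// exprn_ge0.
Qed.

Let nr_e b (i : I b) : nr (e i) = 1.
Proof.
by apply/eqP; rewrite -(eqrXn2 (n := 2))// ?nr_ge0// -nr_eq_sqr e_on eqxx expr1n.
Qed.

Let F (T : U) : C := \sum_b \sum_(i : I b)
  (inner (rho T (e i)) (e (s i)) + inner (e (s i)) (rho (adj T) (e i))).

(** [riesz] yields an approximate least squares solution, with residuals z for T and z' for the
    adjoint that are orthogonal to all (T e, T^* e). [joint_vanish] for the families (e, z') and (z,
    e) relates z' to z. Because s is an involution, the relation says that the residual is
    orthogonal to the target too, so it is 0. Averaging the solution with its adjoint makes it
    self-adjoint. *)
Lemma joint_density (del : R) : 0 < del ->
  exists2 T : U, adj T = T & forall b (i : I b), nr (rho T (e i) - e (s i)) < del.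
Proof.
move=> del0.
have [|||u [d [d0 _ cu hu]]] := riesz hB (F := F) (c := \sum_b \sum_(i : I b) (2 : R)).
- move=> S T; rewrite -big_split; apply: eq_bigr => b _.
  rewrite -big_split; apply: eq_bigr => i _.
  by rewrite adjD !(repDl (hr b)) innerDl innerDr addrACA.
- move=> k S; rewrite mulr_sumr; apply: eq_bigr => b _.
  rewrite mulr_sumr; apply: eq_bigr => i _.
  by rewrite adjZ !(repZl (hr b)) innerZl innerZr conjcK mulrDr.
- move=> S; apply: le_trans (nr_sum _ _ _) _; rewrite mulr_suml; apply: ler_sum => b _.
  apply: le_trans (nr_sum _ _ _) _; rewrite mulr_suml; apply: ler_sum => i _.
  apply: le_trans (nrD _ _) _; have [h1 h2] := B_ge i S.
  have := inner_CS (rho S (e i)) (e (s i)); have := inner_CS (e (s i)) (rho (adj S) (e i)).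
  by rewrite !nr_e; lra.
have ex b (i : I b) : exists z : H b, scvg (fun n => rho (u n) (e i)) z.
  apply: scauchy_cvg => eps /cu[N h]; exists N => m n Nm Nn; apply: le_lt_trans (h _ _ Nm Nn).
  by rewrite -(repBl (hr b)); case: (B_ge i (u m - u n)).
have ex' b (i : I b) : exists z : H b, scvg (fun n => rho (adj (u n)) (e i)) z.
  apply: scauchy_cvg => eps /cu[N h]; exists N => m n Nm Nn; apply: le_lt_trans (h _ _ Nm Nn).
  by rewrite -(repBl (hr b)) -adjB; case: (B_ge i (u m - u n)).
pose p b (i : I b) : H b := projT1 (cid (ex b i)).
have hp b i : scvg (fun n => rho (u n) (e i)) (p b i) by rewrite /p; case: cid.
pose p' b (i : I b) : H b := projT1 (cid (ex' b i)).
have hp' b i : scvg (fun n => rho (adj (u n)) (e i)) (p' b i) by rewrite /p'; case: cid.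
pose z b (i : I b) := p b i - e (s i); pose z' b (i : I b) := p' b i - e (s i).
have FE T : \sum_b \sum_(i : I b)
    (inner (rho T (e i)) (p b i) + inner (p' b i) (rho (adj T) (e i))) = F T.
  apply: (@scvg_unique _ _ (fun n => B T (u n))).
    apply: scvg_sum => b; apply: scvg_sum => i; apply: scvgD; apply: scvg_inner => //;
      exact: scvg_cst.
  apply: null_le (nullM (qn_ge0 B T) d0) => n; rewrite mulrC; exact: hu.
have res T : \sum_b \sum_(i : I b)
    (inner (rho T (e i)) (z b i) + inner (z' b i) (rho (adj T) (e i))) = 0.
  transitivity (F T - F T); last by rewrite subrr.
  rewrite -{1}FE -sumrB; apply: eq_bigr => b _.
  rewrite -sumrB; apply: eq_bigr => i _.
  by rewrite innerBr innerBl opprD addrACA.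
have van := @joint_vanish R U H rho hr scal disj (fun b => (I b + I b)%type)
  (fun b k => match k with inl i => e i | inr i => z' b i end)
  (fun b k => match k with inl i => z b i | inr i => e i end).
have cross b (k : I b) : inner (e k) (z b (s k)) + inner (z' b k) (e (s k)) = 0.
  have /van/(_ b (e k)) : forall T, \sum_b \sum_(i : I b + I b)
     inner (rho T (match i with inl i => e i | inr i => z' b i end))
       (match i with inl i => z b i | inr i => e i end) = 0.
    move=> T; rewrite -[RHS](res T); apply: eq_bigr => c _.
    rewrite big_sumType big_split; congr (_ + _); apply: eq_bigr => i _.
    by rewrite (rep_adj (hr c)).
  rewrite big_sumType /= => /(congr1 (fun v => inner v (e (s k)))).
  rewrite innerDl !inner_suml inner0l => <-; congr (_ + _).
    rewrite (bigD1 (s k))//= big1 => [|i ik]; last first.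
      by rewrite innerZl e_on (negPf ik) mulr0.
    by rewrite innerZl e_on eqxx mulr1 addr0.
  rewrite (bigD1 k)//= big1 => [|i ik]; last first.
    by rewrite innerZl e_on eq_sym (negPf ik) mul0r.
  by rewrite innerZl e_on eqxx mul1r addr0.
have crossS : \sum_b \sum_(i : I b)
    (inner (e (s i)) (z b i) + inner (z' b i) (e (s i))) = 0.
  apply: big1 => b _; rewrite big_split /= (reindex_inj (inv_inj (@sK b))) -big_split /=.
  by apply: big1 => i _; rewrite sK cross.
have lim0 : \sum_b \sum_(i : I b) (inner (p b i) (z b i) + inner (z' b i) (p' b i)) = 0.
  apply: (@scvg_unique _ _ (fun n => 0)); last exact: scvg_cst.
  apply: scvg_ext (_ : scvg (fun n => \sum_b \sum_(i : I b)
    (inner (rho (u n) (e i)) (z b i) + inner (z' b i) (rho (adj (u n)) (e i)))) _).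
    by move=> n; rewrite res.
  apply: scvg_sum => b; apply: scvg_sum => i.
  by apply: scvgD; apply: scvg_inner => //; exact: scvg_cst.
have nul : \sum_b \sum_(i : I b) (inner (z b i) (z b i) + inner (z' b i) (z' b i)) = 0.
  rewrite -[RHS](subrr (0 : C)) -[in X in X - _]lim0 -[in X in _ - X]crossS -sumrB.
  apply: eq_bigr => b _; rewrite -sumrB; apply: eq_bigr => i _.
  by rewrite opprD addrACA -innerBl -innerBr.
have z0 b i : z b i = 0 /\ z' b i = 0.
  have h : (nr (z b i) ^+ 2)%:C + (nr (z' b i) ^+ 2)%:C <= (0 : R)%:C.
    rewrite -[(0 : R)%:C]/(0 : C) -nul -!innerxx (bigD1 b)//= (bigD1 i)//= -addrA lerDl addr_ge0//.
      by apply: sumr_ge0 => j _; rewrite !inner_norm addr_ge0// exprn_ge0.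
    apply: sumr_ge0 => c _; apply: sumr_ge0 => j _.
    by rewrite !inner_norm addr_ge0// exprn_ge0.
  move: h; rewrite -rcD lecR => h.
  have h1 := sqr_ge0 (nr (z b i)); have h2 := sqr_ge0 (nr (z' b i)).
  by split; apply/eqP; rewrite -nr_eq0 -sqrf_eq0 eq_le sqr_ge0 andbT; lra.
have [n hn] : exists n, forall b (i : I b),
    nr (rho (u n) (e i) - e (s i)) < del /\ nr (rho (adj (u n)) (e i) - e (s i)) < del.
  have hs : null (fun n => \sum_b \sum_(i : I b)
      (nr (rho (u n) (e i) - e (s i)) + nr (rho (adj (u n)) (e i) - e (s i)))).
    apply: null_sum => b; apply: null_sum => i; apply: nullD.
      by have := hp b i; have /eqP := (z0 b i).1; rewrite subr_eq0 => /eqP ->.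
    by have := hp' b i; have /eqP := (z0 b i).2; rewrite subr_eq0 => /eqP ->.
  have [N hN] := hs _ del0; exists N => b i; have := hN N (leqnn _).
  rewrite (bigD1 b)//= (bigD1 i)//=.
  set S1 := \sum_(_ | _ != i) _; set S2 := \sum_(_ | _ != b) _.
  have S10 : 0 <= S1 by apply: sumr_ge0 => j _; rewrite addr_ge0 ?nr_ge0.
  have S20 : 0 <= S2.
    by apply: sumr_ge0 => j _; apply: sumr_ge0 => k _; rewrite addr_ge0 ?nr_ge0.
  have := nr_ge0 (rho (u N) (e i) - e (s i)).
  by have := nr_ge0 (rho (adj (u N)) (e i) - e (s i)); split; lra.
exists ((2^-1 : C) *: (u n + adj (u n))).
  by rewrite adjZ adjD adjK addrC cj_half.
move=> b i; rewrite (repZl (hr b)) (repDl (hr b)).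
have -> : (2^-1 : C) *: (rho (u n) (e i) + rho (adj (u n)) (e i)) - e (s i) =
    (2^-1 : C) *: ((rho (u n) (e i) - e (s i)) + (rho (adj (u n)) (e i) - e (s i))).
  rewrite addrACA -opprD scalerBr [_ *: (e (s i) + _)]scalerDr.
  by rewrite -(scalerDl (e (s i))) half_half scale1r.
rewrite halfC.
rewrite nrZ nrR ger0_norm ?invr_ge0//; have [h1 h2] := hn b i.
by have := nrD (rho (u n) (e i) - e (s i)) (rho (adj (u n)) (e i) - e (s i)); lra.
Qed.

End JointDensityTheorem.

(** * Full matrix subalgebras and anticommuting symmetries *)

Section MatrixSubalgebras.
Variables (R : realType) (U : starAlgType R).
Local Notation C := R[i].
Implicit Types (A B : U -> Prop) (x y r s p u v : U).

Record subalg A : Prop := Subalg {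
  sub1 : A 1 ;
  subD : forall x y, A x -> A y -> A (x + y) ;
  subZ : forall (k : C) x, A x -> A (k *: x) ;
  subM : forall x y, A x -> A y -> A (x * y) ;
  subJ : forall x, A x -> A (adj x) }.

Section Subalg.
Variable A : U -> Prop.
Hypothesis hA : subalg A.
Lemma sub0 : A 0.
Proof. by rewrite -(scale0r (1 : U)); apply: subZ => //; exact: sub1. Qed.
Lemma subN x : A x -> A (- x).
Proof. by move=> Ax; rewrite -scaleN1r; exact: subZ. Qed.
Lemma subB x y : A x -> A y -> A (x - y).
Proof. by move=> Ax Ay; apply: subD => //; exact: subN. Qed.
Lemma sub_sum (I : Type) (l : seq I) (P : pred I) (F : I -> U) :
  (forall i, P i -> A (F i)) -> A (\sum_(i <- l | P i) F i).
Proof.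
by move=> h; elim/big_ind: _ => //; [exact: sub0|move=> x y; exact: subD].
Qed.
End Subalg.

Definition commutes x A := forall a, A a -> x * a = a * x.

(** The [a i * adj (a j)] are the matrix units of A, and the [a i] are partial isometries with
    common initial projection r, a column of matrix units when they belong to A. Keeping the column
    makes r a named minimal projection of A. *)
Record frame (I : finType) (a : I -> U) r A : Prop := Frame {
  frame_orth : forall i j, adj (a i) * a j = (i == j)%:R *: r ;
  frame_sum : \sum_i a i * adj (a i) = 1 ;
  frame_span : forall x, A x <->
    exists c : I -> I -> C, x = \sum_i \sum_j c i j *: (a i * adj (a j)) }.

Definition matalg A r := exists (I : finType) (a : I -> U),
  frame a r A /\ forall i, A (a i).

Section Frame.
Variables (I : finType) (a : I -> U) (r : U) (A : U -> Prop).
Hypothesis hf : frame a r A.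

Lemma frame_orthM i j x : adj (a i) * (a j * x) = (i == j)%:R *: (r * x).
Proof. by rewrite mulrA (frame_orth hf) -scalerAl. Qed.

Lemma frame_ar i : a i * r = a i.
Proof.
rewrite -[RHS]mul1r -(frame_sum hf) mulr_suml (bigD1 i)//= big1 ?addr0 => [|j ji].
  by rewrite -mulrA (frame_orth hf) eqxx scale1r.
by rewrite -mulrA (frame_orth hf) (negPf ji) scale0r mulr0.
Qed.

Lemma frame_inhabited : exists i : I, True.
Proof.
apply: contrapT => h; have := frame_sum hf; rewrite big1 => [/eqP|i _].
  by rewrite eq_sym oner_eq0.
by exfalso; apply: h; exists i.
Qed.

Lemma frame_rr : r * r = r.
Proof.
have [i _] := frame_inhabited.
have e : adj (a i) * a i = r by rewrite (frame_orth hf) eqxx scale1r.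
by rewrite -{1}e -mulrA frame_ar.
Qed.

Lemma frame_adjr : adj r = r.
Proof.
have [i _] := frame_inhabited.
have e : adj (a i) * a i = r by rewrite (frame_orth hf) eqxx scale1r.
by rewrite -e adjM adjK.
Qed.

Lemma frame_ra i : r * adj (a i) = adj (a i).
Proof. by rewrite -{2}(frame_ar i) adjM frame_adjr. Qed.

Lemma frame_unit i j : A (a i * adj (a j)).
Proof.
apply/(frame_span hf); exists (fun k l => ((k == i) && (l == j))%:R).
rewrite (bigD1 i)//= [X in _ + X]big1 ?addr0 => [|k ki]; last first.
  by apply: big1 => l _; rewrite (negPf ki) scale0r.
rewrite (bigD1 j)//= [X in _ + X]big1 ?addr0 => [|l lj]; last first.
  by rewrite eqxx (negPf lj) scale0r.
by rewrite !eqxx scale1r.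
Qed.

Lemma frame_subD x y : A x -> A y -> A (x + y).
Proof.
move=> /(frame_span hf)[c ->] /(frame_span hf)[d ->]; apply/(frame_span hf).
exists (fun i j => c i j + d i j); rewrite -big_split; apply: eq_bigr => i _.
by rewrite -big_split; apply: eq_bigr => j _; rewrite scalerDl.
Qed.

Lemma frame_subZ (k : C) x : A x -> A (k *: x).
Proof.
move=> /(frame_span hf)[c ->]; apply/(frame_span hf); exists (fun i j => k * c i j).
rewrite scaler_sumr; apply: eq_bigr => i _.
by rewrite scaler_sumr; apply: eq_bigr => j _; rewrite scalerA.
Qed.

Lemma frame_unitM i j k l :
  (a i * adj (a j)) * (a k * adj (a l)) = (j == k)%:R *: (a i * adj (a l)).
Proof. by rewrite -mulrA frame_orthM -scalerAr frame_ra. Qed.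

Lemma frame_subalg : subalg A.
Proof.
have s0 : A 0.
  by have [i _] := frame_inhabited; rewrite -(scale0r (a i * adj (a i))); apply: frame_subZ; exact: frame_unit.
have ssum (J : finType) (F : J -> U) : (forall i, A (F i)) -> A (\sum_i F i).
  by move=> h; elim/big_ind: _ => //; exact: frame_subD.
split.
- by rewrite -(frame_sum hf); apply: (@ssum) => i; exact: frame_unit.
- exact: frame_subD.
- exact: frame_subZ.
- move=> x y /(frame_span hf)[c ->] /(frame_span hf)[d ->].
  rewrite mulr_suml; apply: (@ssum) => i; rewrite mulr_suml; apply: (@ssum) => j.
  rewrite mulr_sumr; apply: (@ssum) => k; rewrite mulr_sumr; apply: (@ssum) => l.
  rewrite -scalerAl -scalerAr frame_unitM scalerA scalerA; apply: frame_subZ.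
  exact: frame_unit.
- move=> x /(frame_span hf)[c ->]; rewrite adj_sum; apply: (@ssum) => i.
  rewrite adj_sum; apply: (@ssum) => j; rewrite adjZ adjM adjK; apply: frame_subZ.
  exact: frame_unit.
Qed.

Hypothesis frame_mem : forall i, A (a i).

Lemma frame_memr : A r.
Proof.
have [i _] := frame_inhabited; have hA := frame_subalg.
have <- : adj (a i) * a i = r by rewrite (frame_orth hf) eqxx scale1r.
exact: (subM hA (subJ hA (frame_mem i)) (frame_mem i)).
Qed.

Lemma frame_coef i j x : A x -> exists w : C, adj (a i) * x * a j = w *: r.
Proof.
move=> /(frame_span hf)[c ->]; exists (c i j).
rewrite mulr_sumr mulr_suml (bigD1 i)//= [X in _ + X]big1 ?addr0 => [|k ki]; last first.
  rewrite mulr_sumr mulr_suml big1// => l _.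
  by rewrite -scalerAr -scalerAl mulrA (frame_orth hf) eq_sym (negPf ki) !(scale0r, mul0r, scaler0).
rewrite mulr_sumr mulr_suml (bigD1 j)//= [X in _ + X]big1 ?addr0 => [|l lj]; last first.
  by rewrite -scalerAr -scalerAl -!mulrA (frame_orth hf) (negPf lj) !(scale0r, mulr0, scaler0).
rewrite -scalerAr -scalerAl -!mulrA (frame_orth hf) eqxx scale1r mulrA.
by rewrite (frame_orth hf) eqxx scale1r frame_rr.
Qed.

Lemma frame_min x : A x -> exists w : C, r * x * r = w *: r.
Proof.
move=> Ax; have [i _] := frame_inhabited; have hA := frame_subalg.
have e : adj (a i) * a i = r by rewrite (frame_orth hf) eqxx scale1r.
have [|w hw] := @frame_coef i i (a i * x * adj (a i)).
  exact: (subM hA (subM hA (frame_mem i) Ax) (subJ hA (frame_mem i))).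
by exists w; rewrite -hw -!mulrA e !mulrA e.
Qed.

Lemma frame_findim : exists (J : finType) (e : J -> U), (forall j, A (e j)) /\
  (forall x, A x -> exists c : J -> C, x = \sum_j c j *: e j).
Proof.
exists (I * I)%type, (fun k => a k.1 * adj (a k.2)); split=> [k|x].
  exact: frame_unit.
move=> /(frame_span hf)[c ->]; exists (fun k => c k.1 k.2).
by rewrite pair_bigA.
Qed.

Lemma frame_commutes x : (forall i j, x * (a i * adj (a j)) = a i * adj (a j) * x) ->
  commutes x A.
Proof.
move=> h b /(frame_span hf)[c ->]; rewrite mulr_sumr mulr_suml; apply: eq_bigr => i _.
rewrite mulr_sumr mulr_suml; apply: eq_bigr => j _.
by rewrite -scalerAr -scalerAl h.
Qed.

End Frame.

Lemma matalg_subalg A r : matalg A r -> subalg A.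
Proof. by move=> [I [a [/frame_subalg]]]. Qed.

(** A spanning list stands for the whole algebra in the finite-list hypotheses below: containment,
    commutation and orthogonality need to be arranged only for L. *)
Lemma matalg_findim A r : matalg A r -> exists L : seq U,
  [/\ forall x, x \in L -> A x,
   forall B, subalg B -> (forall x, x \in L -> B x) -> forall x, A x -> B x,
   forall x, (forall a, a \in L -> x * a = a * x) -> commutes x A &
   forall x y, (forall a, a \in L -> x * a * y = 0) -> forall a, A a -> x * a * y = 0].
Proof.
move=> [I [a [/frame_findim[J [e [Ae spane]]] _]]].
have eL j : e j \in [seq e j | j <- enum J] by apply/mapP; exists j; rewrite ?mem_enum.
exists [seq e j | j <- enum J]; split.
- by move=> x /mapP[j _ ->].
- move=> B hB LB x /spane[c ->]; apply: sub_sum => // j _.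
  by apply: subZ => //; exact: LB.
- move=> x h b /spane[c ->]; rewrite mulr_sumr mulr_suml; apply: eq_bigr => j _.
  by rewrite -scalerAr -scalerAl h.
- move=> x y h b /spane[c ->]; rewrite mulr_sumr mulr_suml big1// => j _.
  by rewrite -scalerAr -scalerAl h ?scaler0.
Qed.

Lemma matalg_min A r x : matalg A r -> A x -> exists w : C, r * x * r = w *: r.
Proof. by move=> [I [a [h m]]]; exact: frame_min h m _. Qed.

Lemma matalg_r A r : matalg A r -> [/\ A r, adj r = r & r * r = r].
Proof.
by move=> [I [a [h m]]]; split; [exact: frame_memr h m|exact: frame_adjr h|exact: frame_rr h].
Qed.

Record symmetry u : Prop := Symmetry { sym_adj : adj u = u ; sym_sqr : u * u = 1 }.
Record projection p : Prop := Projection { proj_adj : adj p = p ; proj_sqr : p * p = p }.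
(** Such a pair generates a copy of the 2 x 2 matrices, with [specproj u] as a minimal projection
    and v as the flip between the two spectral projections of u. *)
Record qubit u v : Prop := Qubit {
  qubit_u : symmetry u ; qubit_v : symmetry v ; qubit_anti : u * v = - (v * u) }.

Definition specproj u : U := (2^-1 : C) *: (1 + u).

Lemma halfZ x : (2^-1 : C) *: (x + x) = x.
Proof. by rewrite scalerDr -scalerDl half_half scale1r. Qed.

Lemma specproj_proj u : symmetry u -> projection (specproj u).
Proof.
move=> [au uu]; split; first by rewrite adjZ adjD adj1 au cj_half.
rewrite -scalerAl -scalerAr mulrDl !mulrDr mul1r mulr1 uu mul1r (addrC u 1).
by rewrite halfZ.
Qed.

Lemma specproj_u u : symmetry u -> u * specproj u = specproj u.
Proof. by move=> [_ uu]; rewrite -scalerAr mulrDr mulr1 uu addrC. Qed.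

Lemma specproj_comm u v : qubit u v -> specproj u * v = v * (1 - specproj u).
Proof.
move=> [hu hv anti]; have -> : 1 - specproj u = (2^-1 : C) *: (1 - u).
  by rewrite -{1}(halfZ 1) /specproj -scalerBr opprD addrACA subrr add0r.
by rewrite -scalerAl -scalerAr mulrDl mul1r anti mulrBr mulr1.
Qed.

Lemma specproj_anti u v : qubit u v -> specproj u * (v * specproj u) = 0.
Proof.
move=> h; have [hu hv anti] := h.
by rewrite mulrA specproj_comm// -mulrA mulrBl mul1r (proj_sqr (specproj_proj hu)) subrr mulr0.
Qed.

Lemma specproj_flip u v : qubit u v ->
  specproj u + v * specproj u * v = 1 /\ v = v * specproj u + specproj u * v.
Proof.
move=> h; have [hu [av vv] anti] := h; split.
  by rewrite -mulrA specproj_comm// mulrA vv mul1r addrC subrK.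
by rewrite specproj_comm// -mulrDr addrC subrK mulr1.
Qed.

End MatrixSubalgebras.

(** * Tensoring a matrix algebra with 2 x 2 matrices *)

Section QubitExtension.
Variables (R : realType) (U : starAlgType R).
Local Notation C := R[i].
Implicit Types (A B : U -> Prop) (x y r s p u v : U).

(** A tensor M_2: with P = [specproj u], the column of A is multiplied by the column P, v P of the
    matrix algebra of the qubit. The last clause is minimality, used to see that A' stays inside a
    given subalgebra. *)
Lemma matalg_qubit A r u v : matalg A r -> qubit u v -> commutes u A -> commutes v A ->
  exists A', [/\ matalg A' (r * specproj u), forall x, A x -> A' x, A' u, A' v &
    forall B, subalg B -> (forall x, A x -> B x) -> B u -> B v -> forall x, A' x -> B x].
Proof.
move=> mA hq cu cv; have hA := matalg_subalg mA; have [I [a [hf ha]]] := mA.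
have [hu hv anti] := hq; have [av vv] := hv.
set P := specproj u; have [aP PP] : projection P by exact: specproj_proj.
have cP : commutes P A.
  by move=> x Ax; rewrite -scalerAl -scalerAr mulrDl mulrDr mul1r mulr1 cu.
pose w (b : bool) := if b then v else 1.
have cw b : commutes (w b) A by case: b => //= x _; rewrite mulr1 mul1r.
have aw b : adj (w b) = w b by case: b; rewrite /= ?adj1.
pose a' (k : I * bool) := w k.2 * P * a k.1.
have aPw b : adj (w b * P) = P * w b by rewrite adjM aP aw.
have PwP b c : (P * w b) * (w c * P) = (b == c)%:R *: P.
  rewrite -mulrA (mulrA (w b)).
  case: b c => -[] /=; rewrite ?mul1r ?mulr1 ?vv ?mulr0n ?mulr1n ?scale1r ?scale0r ?mul1r //.
  - exact: (specproj_anti hq).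
  - exact: (specproj_anti hq).
have a'a' i b j c : a' (i, b) * adj (a' (j, c)) = (w b * P * w c) * (a i * adj (a j)).
  have Ax : A (a i * adj (a j)) by exact: (frame_unit hf).
  have c1 : a i * adj (a j) * (P * w c) = P * w c * (a i * adj (a j)).
    by rewrite mulrA -cP// -mulrA -cw// mulrA.
  rewrite /a' adjM aPw /=; transitivity (w b * P * (a i * adj (a j) * (P * w c))).
    by rewrite !mulrA.
  by rewrite c1 !mulrA -(mulrA (w b)) PP.
pose A' x := exists c : I * bool -> I * bool -> C,
  x = \sum_i \sum_j c i j *: (a' i * adj (a' j)).
have hf' : frame a' (r * P) A'.
  split => //.
    move=> [i b] [j c]; rewrite /a' adjM aPw /= xpair_eqE.
    transitivity (adj (a i) * ((P * w b) * (w c * P)) * a j); first by rewrite !mulrA.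
    rewrite PwP -scalerAr -scalerAl -mulrA cP; last exact: ha.
    rewrite mulrA (frame_orth hf) -scalerAl scalerA; congr (_ *: _).
    by case: (b == c); case: (i == j); rewrite ?mulr1 ?mulr0n ?mulr0 ?mul0r.
  transitivity (\sum_i \sum_b (w b * P * w b * (a i * adj (a i)))).
    by rewrite pair_bigA; apply: eq_bigr => -[i b] _; rewrite a'a'.
  under eq_bigr => i _ do rewrite big_bool /= mul1r mulr1 -mulrDl addrC
    (specproj_flip hq).1 mul1r.
  exact: frame_sum hf.
have hA' := frame_subalg hf'.
have unit' i b j c : A' (a' (i, b) * adj (a' (j, c))) by exact: frame_unit hf' _ _.
have AA' x : A x -> A' x.
  move=> /(frame_span hf)[c ->]; apply: sub_sum => // i _; apply: sub_sum => // j _.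
  apply: subZ => //; have -> : a i * adj (a j) =
      a' (i, false) * adj (a' (j, false)) + a' (i, true) * adj (a' (j, true)).
    by rewrite !a'a' /= mul1r mulr1 -mulrDl (specproj_flip hq).1 mul1r.
  by apply: subD.
have A'u : A' u.
  have -> : u = \sum_i (a' (i, false) * adj (a' (i, false)) - a' (i, true) * adj (a' (i, true))).
    under eq_bigr => i _ do rewrite !a'a' /= mul1r mulr1 -mulrBl.
    rewrite -mulr_sumr (frame_sum hf) mulr1.
    have -> : v * P * v = 1 - P by rewrite -(specproj_flip hq).1 -/P addrAC subrr add0r.
    have PP2 : P + P = 1 + u by rewrite -scalerDr halfZ.
    by rewrite opprB addrA PP2 addrC addKr.
  by apply: sub_sum => // i _; apply: subB.
have A'v : A' v.
  have -> : v = \sum_i (a' (i, true) * adj (a' (i, false)) + a' (i, false) * adj (a' (i, true))).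
    under eq_bigr => i _ do rewrite !a'a' /= mul1r mulr1 -mulrDl -(specproj_flip hq).2.
    by rewrite -mulr_sumr (frame_sum hf) mulr1.
  by apply: sub_sum => // i _; apply: subD.
have subP B : subalg B -> B u -> B P.
  by move=> hB Bu; apply: subZ => //; apply: subD => //; exact: sub1.
have a'B B : subalg B -> (forall x, A x -> B x) -> B u -> B v -> forall k, B (a' k).
  move=> hB AB Bu Bv k; apply: subM => //; last exact/AB/ha.
  apply: subM => //; last exact: subP.
  by case: k.2 => //=; exact: sub1.
exists A'; split => //.
  by exists (I * bool)%type, a'; split => // k; exact: a'B.
move=> B hB AB Bu Bv x [c ->]; apply: sub_sum => // i _; apply: sub_sum => // j _.
by apply: subZ => //; apply: subM => //; [|apply: subJ => //]; exact: a'B.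
Qed.

End QubitExtension.

(** * Equivalent minimal projections, and projections in a relative commutant *)

Record linked (R : realType) (U : starAlgType R) (A : U -> Prop) (r s y : U) : Prop := Linked {
  link_mem : A y ;
  link_l : r * y = y ;
  link_r : y * adj y = r ;
  link_s : adj y * y = s }.

Section RelativeProjections.
Variables (R : realType) (U : starAlgType R).
Local Notation C := R[i].
Implicit Types (A B : U -> Prop) (x y r s p u v : U).

Variables (A A' : U -> Prop) (I : finType) (a : I -> U) (r y s : U) (r' y' s' : U).
Hypotheses (hf : frame a r A) (ha : forall i, A (a i)).
Hypotheses (mA' : matalg A' r') (AA' : forall x, A x -> A' x).
Hypotheses (ly : linked A r s y) (ly' : linked A' r' s' y').
Variables (t t' : R).
Hypotheses (t0 : 0 < t) (rt : r' * r * r' = t%:C *: r').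
Hypotheses (t'0 : 0 < t') (st : s' * s * s' = t'%:C *: s').

Let hA := frame_subalg hf.
Let hA' := matalg_subalg mA'.
Let Ar : A r := frame_memr hf ha.
Let ar : adj r = r := frame_adjr hf.
Let rr : r * r = r := frame_rr hf.
Let Ar' : A' r'. Proof. by have [] := matalg_r mA'. Qed.
Let ar' : adj r' = r'. Proof. by have [] := matalg_r mA'. Qed.
Let rr' : r' * r' = r'. Proof. by have [] := matalg_r mA'. Qed.

(** The sum over a frame of A commutes with A. For a minimal projection x of a larger matrix algebra
    and the initial projection w of the frame, minimality makes x w x a multiple k x; dividing by k
    makes the sum idempotent ([gen_proj]). *)
Definition relproj (b : I -> U) (x : U) (k : R) := (k^-1)%:C *: \sum_i b i * x * adj (b i).

Let gen_proj (b : I -> U) x (w : U) k : (forall i j, adj (b i) * b j = (i == j)%:R *: w) ->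
  0 < k -> adj x = x -> x * x = x -> x * w * x = k%:C *: x -> projection (relproj b x k).
Proof.
move=> hb k0 ax xx xwx; split.
  rewrite adjZ conjc_real adj_sum; congr (_ *: _); apply: eq_bigr => i _.
  by rewrite !adjM adjK ax mulrA.
rewrite -scalerAl -scalerAr; congr (_ *: _).
have -> : (\sum_i b i * x * adj (b i)) * (\sum_i b i * x * adj (b i)) =
    k%:C *: \sum_i b i * x * adj (b i).
  rewrite mulr_suml scaler_sumr; apply: eq_bigr => i _.
  rewrite mulr_sumr (bigD1 i)//= big1 ?addr0 => [|j ji]; last first.
    rewrite -!mulrA (mulrA (adj (b i))) hb eq_sym (negPf ji) scale0r.
    by rewrite mul0r !mulr0.
  rewrite -!mulrA (mulrA (adj (b i))) hb eqxx scale1r (mulrA w) (mulrA x) (mulrA x) xwx.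
  by rewrite -scalerAl -scalerAr.
by rewrite scalerA -rcM mulVf ?gt_eqF// scale1r.
Qed.

Let ys : y * s = y.
Proof. by rewrite -(link_s ly) mulrA (link_r ly) (link_l ly). Qed.
Let as_ : adj s = s.
Proof. by rewrite -(link_s ly) adjM adjK. Qed.
Let as' : adj s' = s'.
Proof. by rewrite -(link_s ly') adjM adjK. Qed.
Let y's' : y' * s' = y'.
Proof. by rewrite -(link_s ly') mulrA (link_r ly') (link_l ly'). Qed.
Let ss' : s' * s' = s'.
Proof. by rewrite -{1}(link_s ly') -mulrA y's' (link_s ly'). Qed.

Variable b : I -> U.
Hypothesis hb : forall i, b i = a i * y.
Let p := relproj a r' t.
Let q := relproj b s' t'.

Let bb i j : adj (b i) * b j = (i == j)%:R *: s.
Proof.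
rewrite !hb adjM -mulrA (frame_orthM hf) (link_l ly) -scalerAr.
by rewrite (link_s ly).
Qed.

Lemma relproj_p : projection p.
Proof. exact: gen_proj (frame_orth hf) t0 ar' rr' rt. Qed.

Lemma relproj_q : projection q.
Proof. exact: gen_proj bb t'0 as' ss' st. Qed.

Lemma relproj_mem : A' p.
Proof.
apply: subZ => //; apply: sub_sum => // i _.
by apply: subM => //; [apply: subM => //|apply: subJ => //]; exact/AA'/ha.
Qed.

Let pa k : p * a k = (t^-1)%:C *: (a k * r' * r).
Proof.
rewrite -scalerAl; congr (_ *: _); rewrite mulr_suml (bigD1 k)//= big1 ?addr0 => [|j jk].
  by rewrite -!mulrA (frame_orth hf) eqxx scale1r.
by rewrite -!mulrA (frame_orth hf) (negPf jk) scale0r !mulr0.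
Qed.

Let ap k : adj (a k) * p = (t^-1)%:C *: (r * r' * adj (a k)).
Proof.
rewrite -[LHS]adjK adjM adjK (proj_adj relproj_p) pa adjZ conjc_real !adjM ar ar'.
by rewrite mulrA.
Qed.

Lemma relproj_commutes : commutes p A.
Proof.
apply: (frame_commutes hf) => i j.
rewrite mulrA pa -scalerAl -[RHS]mulrA ap -scalerAr; congr (_ *: _).
by rewrite -!mulrA (frame_ra hf) !mulrA (frame_ar hf).
Qed.

Lemma relproj_r : r * p = (t^-1)%:C *: (r * r' * r).
Proof.
have [i _] := frame_inhabited hf.
have e : adj (a i) * a i = r by rewrite (frame_orth hf) eqxx scale1r.
have Aa : A (adj (a i)) by exact: subJ.
rewrite -(relproj_commutes Ar); transitivity (adj (a i) * p * a i).
  by rewrite -(relproj_commutes Aa) -mulrA e.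
by rewrite -mulrA pa -scalerAr !mulrA e.
Qed.

(** Every [r' * (adj (a i) * x * a j) * r'] is a scalar multiple of r', by minimality of r' in A';
    these scalars are the matrix coefficients of z. Thus p is minimal relative to A. *)
Lemma relproj_min x : A' x -> exists2 z, A z & p * x * p = z * p.
Proof.
move=> A'x.
have [w hw] : exists w : I -> I -> C, forall i j,
    r' * (adj (a i) * x * a j) * r' = w i j *: r'.
  have ex i j : exists w : C, r' * (adj (a i) * x * a j) * r' = w *: r'.
    apply: (matalg_min mA'); apply: subM => //; last exact/AA'/ha.
    by apply: subM => //; apply: subJ => //; exact/AA'/ha.
  by exists (fun i j => projT1 (cid (ex i j))) => i j; case: cid.
exists ((t^-1)%:C *: \sum_i \sum_j w i j *: (a i * adj (a j))).
  by apply: subZ => //; apply/(frame_span hf); exists w.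
rewrite {1 2}/p /relproj -!scalerAl -scalerAr; congr (_ *: _).
rewrite mulr_suml mulr_suml scaler_sumr mulr_suml; apply: eq_bigr => i _.
rewrite mulr_sumr scaler_sumr mulr_suml; apply: eq_bigr => j _.
rewrite -scalerAl -[in RHS]mulrA ap -scalerAr scalerA mulrC -scalerA; congr (_ *: _).
rewrite !mulrA (frame_ar hf).
transitivity (a i * (r' * (adj (a i) * x * a j) * r') * adj (a j)).
  by rewrite !mulrA.
by rewrite hw -scalerAr -scalerAl.
Qed.

Let k : C := ((Num.sqrt (t * t'))^-1)%:C.
Let kk : k * k = (t^-1)%:C * (t'^-1)%:C.
Proof.
rewrite -!rcM -invfM -expr2 sqr_sqrtr ?invfM//.
by apply: mulr_ge0; exact: ltW.
Qed.

(** The same averaging applied to the partial isometry y' between s' and r'. The factor (t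
    t')^(-1/2) is the one for which its two squares are the normalized projections p and q. *)
Definition relisom := k *: \sum_i a i * y' * adj (b i).
Let d := relisom.

Let ad : adj d = k *: \sum_i b i * adj y' * adj (a i).
Proof.
rewrite adjZ conjc_real adj_sum; congr (_ *: _); apply: eq_bigr => i _.
by rewrite adjM adjK (adjM (a i) y') mulrA.
Qed.

Lemma relisom_mem : A' d.
Proof.
apply: subZ => //; apply: sub_sum => // i _.
have A'b : A' (b i) by rewrite hb; apply: subM => //; apply: AA' => //; exact: link_mem ly.
apply: subM => //; last exact: subJ.
by apply: subM => //; [exact/AA'/ha|exact: link_mem ly'].
Qed.

Lemma relisom_p : d * adj d = p.
Proof.
rewrite ad -scalerAl -scalerAr scalerA kk -scalerA; congr (_ *: _).
rewrite mulr_suml scaler_sumr; apply: eq_bigr => i _.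
rewrite mulr_sumr (bigD1 i)//= big1 ?addr0 => [|j ji]; last first.
  rewrite -!mulrA (mulrA (adj (b i))) bb eq_sym (negPf ji) scale0r.
  by rewrite mul0r !mulr0.
transitivity ((t'^-1)%:C *: (a i * (y' * (s' * s * s') * adj y') * adj (a i))).
  congr (_ *: _); transitivity (a i * y' * (adj (b i) * b i) * adj y' * adj (a i)).
    by rewrite !mulrA.
  have sy' : s' * adj y' = adj y' by rewrite -{2}y's' adjM as'.
  by rewrite bb eqxx scale1r -{1}y's' -{1}sy' !mulrA.
rewrite st -scalerAr y's' -scalerAl (link_r ly') -scalerAr -scalerAl scalerA -rcM.
by rewrite mulVf ?gt_eqF// scale1r.
Qed.

Lemma relisom_q : adj d * d = q.
Proof.
rewrite ad -scalerAl -scalerAr scalerA kk mulrC -scalerA; congr (_ *: _).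
rewrite mulr_suml scaler_sumr; apply: eq_bigr => i _.
rewrite mulr_sumr (bigD1 i)//= big1 ?addr0 => [|j ji]; last first.
  rewrite -!mulrA (mulrA (adj (a i))) (frame_orth hf) eq_sym (negPf ji) scale0r.
  by rewrite mul0r !mulr0.
transitivity ((t^-1)%:C *: (b i * (adj y' * (r' * r * r') * y') * adj (b i))).
  congr (_ *: _); transitivity (b i * adj y' * (adj (a i) * a i) * y' * adj (b i)).
    by rewrite !mulrA.
  have sy' : adj y' * r' = adj y' by rewrite -{2}(link_l ly') adjM ar'.
  have -> : adj y' * (r' * r * r') * y' = adj y' * r * y'.
    by rewrite !mulrA sy' -(mulrA _ r') (link_l ly').
  by rewrite (frame_orth hf) eqxx scale1r !mulrA.
rewrite rt -scalerAr -scalerAl -(mulrA (adj y')) (link_l ly') (link_s ly') -scalerAr -scalerAl scalerA -rcM.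
by rewrite mulVf ?gt_eqF// scale1r.
Qed.

Lemma relisom_linked : linked A' p q d.
Proof.
split; [exact: relisom_mem| |exact: relisom_p|exact: relisom_q].
rewrite /d /relisom -scalerAr; congr (_ *: _); rewrite mulr_sumr; apply: eq_bigr => i _.
rewrite !mulrA pa -!scalerAl -(mulrA (a i * r')) -{1}(link_l ly') !mulrA.
rewrite -(mulrA (a i)) -(mulrA (a i)) rt -scalerAr -!scalerAl scalerA -rcM.
by rewrite mulVf ?gt_eqF// scale1r -(mulrA (a i) r') (link_l ly').
Qed.

Lemma relisom_commutes : commutes d A.
Proof.
have yb i : y * adj (b i) = adj (a i).
  by rewrite hb adjM mulrA (link_r ly) (frame_ra hf).
have ba i j : adj (b i) * a j = (i == j)%:R *: adj y.
  by rewrite hb adjM -mulrA (frame_orth hf) -scalerAr -{2}(link_l ly) adjM ar.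
apply: (frame_commutes hf) => i j.
rewrite -scalerAl -scalerAr; congr (_ *: _).
rewrite mulr_suml (bigD1 i)//= big1 ?addr0 => [|l li]; last first.
  by rewrite -!mulrA (mulrA (adj (b l))) ba (negPf li) scale0r mul0r !mulr0.
rewrite mulr_sumr (bigD1 j)//= big1 ?addr0 => [|l lj]; last first.
  by rewrite -!mulrA (mulrA (adj (a j))) (frame_orth hf) eq_sym (negPf lj) scale0r mul0r mulr0.
rewrite -!mulrA (mulrA (adj (b i))) ba eqxx scale1r (mulrA (adj (a j))) (frame_orth hf).
by rewrite eqxx scale1r (mulrA (a i) r) (frame_ar hf) hb adjM.
Qed.

Lemma relproj_orth : (forall x, A x -> r' * x * s' = 0) -> p * q = 0.
Proof.
move=> h; rewrite /p /q /relproj -scalerAl -scalerAr mulr_suml big1 ?scaler0// => i _.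
rewrite mulr_sumr big1// => j _.
transitivity (a i * (r' * (adj (a i) * b j) * s') * adj (b j)); first by rewrite !mulrA.
rewrite h ?mulr0 ?mul0r//; apply: subM => //; first by apply: subJ.
by rewrite hb; apply: subM => //; exact: link_mem ly.
Qed.

Lemma relproj_s : s * q = (t'^-1)%:C *: (s * s' * s).
Proof.
have h x : A x -> q * x = x * q.
  move=> Ax; rewrite -relisom_q -mulrA relisom_commutes// mulrA mulrA.
  congr (_ * _); rewrite -[RHS]adjK adjM adjK relisom_commutes ?adjM ?adjK//.
  exact: subJ.
have As : A s by rewrite -(link_s ly); apply: subM => //; [apply: subJ => //|]; exact: link_mem ly.
have [i _] := frame_inhabited hf.
have e : adj (b i) * b i = s by rewrite bb eqxx scale1r.
have Ab : A (b i) by rewrite hb; apply: subM => //; exact: link_mem ly.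
have qb : q * b i = (t'^-1)%:C *: (b i * s' * s).
  rewrite -scalerAl; congr (_ *: _); rewrite mulr_suml (bigD1 i)//= big1 ?addr0 => [|j ji].
    by rewrite -!mulrA bb eqxx scale1r.
  by rewrite -!mulrA bb (negPf ji) scale0r !mulr0.
have Ab' : A (adj (b i)) by exact: subJ.
rewrite -(h _ As); transitivity (adj (b i) * q * b i).
  by rewrite -(h _ Ab') -mulrA e.
by rewrite -mulrA qb -scalerAr !mulrA e.
Qed.

End RelativeProjections.

(** * States and their seminorms *)

Section PositiveFunctionals.
Variables (R : realType) (U : starAlgType R).
Local Notation C := R[i].
Implicit Types (A B : U -> Prop) (x y r s p u v : U) (f g : U -> C).

Record posfun f : Prop := PosFun {
  pfD : forall x y, f (x + y) = f x + f y ;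
  pfZ : forall k x, f (k *: x) = k * f x ;
  pf1 : f 1 = 1 ;
  pf_ge0 : forall x, 0 <= f (adj x * x) }.

(** Hermitian symmetry is automatic over the complex numbers: the form is real at x + y and at x + i
    y. *)
Lemma psd_of_ge0 (E : lmodType C) (B : E -> E -> C) :
  (forall x y z : E, B (x + y) z = B x z + B y z) ->
  (forall x y z : E, B z (x + y) = B z x + B z y) ->
  (forall k (x y : E), B (k *: x) y = k * B x y) ->
  (forall k (x y : E), B x (k *: y) = k^*%C * B x y) ->
  (forall x : E, 0 <= B x x) -> psd_form B.
Proof.
move=> BDl BDr BZl BZr B0; split => // x y.
have re z : complex.Im (B z z) = 0.
  by have := B0 z; rewrite lecE /= => /andP[/eqP].
have e1 := re (x + y); have e2 := re (x + 'i%C *: y).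
rewrite !(BDl, BDr, BZl, BZr) cji in e1 e2.
move: (re x) (re y) e1 e2.
case: (B x x) => a a'; case: (B y y) => b b'; case: (B x y) => c c'; case: (B y x) => d d' /=.
move=> -> ->; rewrite !(mul0r, mulr0, mul1r, addr0, add0r, subr0, sub0r, oppr0) => e1 e2.
by apply/eqP; rewrite eq_complex /=; apply/andP; split; apply/eqP; lra.
Qed.

Definition gnsform f x y : C := f (adj y * x).
Definition gnsnorm f x : R := qn (gnsform f) x.

Section GNSNorm.
Variable f : U -> C.
Hypothesis hf : posfun f.

Lemma gns_psd : psd_form (gnsform f).
Proof.
apply: psd_of_ge0; rewrite /gnsform.
- by move=> x y z; rewrite mulrDr (pfD hf).
- by move=> x y z; rewrite adjD mulrDl (pfD hf).
- by move=> k x y; rewrite -scalerAr (pfZ hf).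
- by move=> k x y; rewrite adjZ -scalerAl (pfZ hf).
- exact: pf_ge0.
Qed.

Local Notation N := (gnsnorm f).

Lemma gnsnormD x y : N (x + y) <= N x + N y. Proof. exact: (qnD gns_psd). Qed.
Lemma gnsnormZ k x : N (k *: x) = nr k * N x. Proof. exact: (qnZ gns_psd). Qed.
Lemma gnsnorm_ge0 x : 0 <= N x. Proof. exact: qn_ge0. Qed.
Lemma gnsnormN x : N (- x) = N x. Proof. exact: (qnN gns_psd). Qed.
Lemma gnsnormB x y : N (x - y) <= N x + N y. Proof. exact: (qnB gns_psd). Qed.
Lemma gnsnorm_sqr x : N x ^+ 2 = complex.Re (f (adj x * x)).
Proof. exact: (qn_sqr gns_psd). Qed.

Lemma gnsnorm1 : N 1 = 1.
Proof.
apply/eqP; rewrite -(eqrXn2 (n := 2))// ?gnsnorm_ge0//.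
by rewrite gnsnorm_sqr adj1 mulr1 (pf1 hf) expr1n.
Qed.

Lemma pfB x y : f (x - y) = f x - f y.
Proof. by rewrite (pfD hf) -scaleN1r (pfZ hf) mulN1r. Qed.

Lemma projC p : projection p -> projection (1 - p).
Proof.
move=> [ap pp]; split; first by rewrite adjB adj1 ap.
by rewrite mulrBl mul1r mulrBr mulr1 pp subrr subr0.
Qed.

Lemma gnsnorm_proj p x : projection p -> N (p * x) <= N x.
Proof.
move=> hp; have [ap pp] := hp; have [aq qq] := projC hp.
rewrite -(ler_pXn2r (n := 2))// ?nnegrE ?gnsnorm_ge0// !gnsnorm_sqr.
rewrite -subr_ge0 -cReB -pfB.
have -> : adj x * x - adj (p * x) * (p * x) = adj ((1 - p) * x) * ((1 - p) * x).
  rewrite !adjM aq ap -!mulrA (mulrA p) pp (mulrA (1 - p)) qq.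
  by rewrite mulrBl mul1r mulrBr.
by rewrite -gnsnorm_sqr sqr_ge0.
Qed.

Lemma gnsnorm_sym u x : symmetry u -> N (u * x) = N x.
Proof.
move=> [au uu]; apply/eqP; rewrite -(eqrXn2 (n := 2))// ?gnsnorm_ge0// !gnsnorm_sqr.
by rewrite adjM au -!mulrA (mulrA u) uu mul1r.
Qed.

Lemma gnsnorm_proj_sqr p : projection p -> complex.Re (f p) = 1 - N (1 - p) ^+ 2.
Proof.
move=> hp; have [aq qq] := projC hp.
by rewrite gnsnorm_sqr aq qq pfB (pf1 hf) cReB /=; lra.
Qed.

Lemma gnsnormM1 p q : projection p -> N (1 - p * q) <= N (1 - p) + N (1 - q).
Proof.
move=> hp; have -> : 1 - p * q = (1 - p) + p * (1 - q).
  by rewrite mulrBr mulr1 addrA subrK.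
by apply: le_trans (gnsnormD _ _) _; rewrite lerD2l gnsnorm_proj.
Qed.

(** w f(r') = N(r r')^2, where both f(r') and N(r r') are close to 1. This makes w real with 1 - 4
    eta <= w <= 1; the lower bound is at least 1/2, whence the constant 8. *)
Lemma rel_scalar r r' (w : C) eta : projection r -> projection r' ->
  r' * r * r' = w *: r' -> N (1 - r) <= eta -> N (1 - r') <= eta -> eta <= 1 / 8 ->
  exists t : R, [/\ 0 < t, t <= 1, w = t%:C & t^-1 - 1 <= 8 * eta].
Proof.
move=> hr hr' hw nr nr' eta8; have [ar rr] := hr; have [ar' rr'] := hr'.
have e0 : 0 <= eta by apply: le_trans nr; exact: gnsnorm_ge0.
have h1 : 1 - 2 * eta <= N (r * r').
  have := gnsnormB 1 (1 - r * r'); rewrite subKr.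
  have := gnsnormM1 r' hr; have := gnsnormD (1 - r * r') (r * r'); rewrite subrK gnsnorm1.
  lra.
have fr' : complex.Re (f r') = 1 - N (1 - r') ^+ 2 by exact: gnsnorm_proj_sqr.
have n1 : N (1 - r') ^+ 2 <= 1 / 64.
  apply: le_trans (_ : (1 / 8) ^+ 2 <= _); last by rewrite expr2; lra.
  by rewrite ler_pXn2r// ?nnegrE ?gnsnorm_ge0//; lra.
have n0 := sqr_ge0 (N (1 - r')).
have fr'E : f r' = (complex.Re (f r'))%:C.
  by have := form_xx gns_psd r'; rewrite /gnsform ar' rr' => ->.
have hE : w * f r' = (N (r * r') ^+ 2)%:C.
  have := form_xx gns_psd (r * r'); rewrite /gnsform adjM ar ar' -!mulrA (mulrA r) rr.
  by rewrite (mulrA r') hw (pfZ hf) => ->.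
pose t := N (r * r') ^+ 2 / complex.Re (f r').
have t1 : 1 - 4 * eta <= t.
  rewrite /t ler_pdivlMr ?fr'; last by lra.
  have : (1 - 2 * eta) ^+ 2 <= N (r * r') ^+ 2.
    by rewrite ler_pXn2r// ?nnegrE ?gnsnorm_ge0//; lra.
  rewrite !expr2; nra.
have t0 : 0 < t by lra.
have t_le1 : t <= 1.
  rewrite /t ler_pdivrMr ?mul1r ?fr'; last by lra.
  have := gnsnorm_proj r' hr; rewrite -(ler_pXn2r (n := 2))// ?nnegrE ?gnsnorm_ge0//.
  by rewrite (gnsnorm_sqr r') ar' rr' fr'.
exists t; split => //.
  apply: (mulIf (_ : (complex.Re (f r'))%:C != 0)).
    by apply/eqP => /(congr1 (@complex.Re R)) /=; rewrite fr'; lra.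
  by rewrite -{1}fr'E hE -rcM mulfVK// fr'; apply/eqP; lra.
rewrite lerBlDr -(ler_pM2r t0) mulVf ?gt_eqF//; nra.
Qed.

(** Put z = 1 - r'/t. Then 1 - p = (1 - p)(1 - r) + r z r, with N(z) <= 9 eta and N(z x) <= 3 N(x),
    so the sum is at most eta + 9 eta + 3 eta. *)
Lemma rel_estimate r r' p t eta : projection r -> projection r' -> projection p ->
  0 < t -> t <= 1 -> t^-1 - 1 <= 8 * eta -> r * p = (t^-1)%:C *: (r * r' * r) -> r * p = p * r ->
  N (1 - r) <= eta -> N (1 - r') <= eta -> eta <= 1 / 8 -> N (1 - p) <= 16 * eta.
Proof.
move=> hr hr' hp t0 t1 te rp pr nr nr' e8.
have e0 : 0 <= eta by apply: le_trans nr; exact: gnsnorm_ge0.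
pose z := 1 - (t^-1)%:C *: r'.
have Nz x : N (z * x) <= 3 * N x.
  rewrite /z mulrBl mul1r -scalerAl; apply: le_trans (gnsnormB _ _) _.
  rewrite gnsnormZ nrR ger0_norm ?invr_ge0 ?(ltW t0)//.
  by have := gnsnorm_proj x hr'; have := gnsnorm_ge0 x; have := gnsnorm_ge0 (r' * x); nra.
have Nz1 : N z <= 9 * eta.
  have -> : z = (1 - r') - (t^-1 - 1)%:C *: r'.
    by rewrite /z rcD rcN scalerBl scale1r opprB addrA subrK.
  apply: le_trans (gnsnormB _ _) _; rewrite gnsnormZ nrR.
  have N1 : N r' <= 1 by have := gnsnorm_proj 1 hr'; rewrite mulr1 gnsnorm1.
  have ti1 : 1 <= t^-1 by rewrite invr_ge1 ?unitf_gt0.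
  have : `|t^-1 - 1| * N r' <= 8 * eta.
    by rewrite ger0_norm ?subr_ge0//; have := gnsnorm_ge0 r'; nra.
  lra.
have -> : 1 - p = (1 - p) * (1 - r) + r * (z * r).
  have -> : r * (z * r) = r - r * p.
    by rewrite rp /z mulrBl mul1r mulrBr (proj_sqr hr) -scalerAl -scalerAr mulrA.
  by rewrite pr mulrBr mulr1 mulrBl mul1r subrK.
apply: le_trans (gnsnormD _ _) _.
have h1 := gnsnorm_proj (1 - r) (projC hp).
have h2 := gnsnorm_proj (z * r) hr.
have h3 : N (z * r) <= N z + N (z * (1 - r)).
  have {1}-> : z * r = z - z * (1 - r) by rewrite mulrBr mulr1 subKr.
  exact: gnsnormB.
have := Nz (1 - r); lra.
Qed.

End GNSNorm.
End PositiveFunctionals.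

(** * Symmetries exchanging two orthogonal projections *)

Section Swaps.
Variables (R : realType) (U : starAlgType R).
Implicit Types (A B : U -> Prop) (x y r s p q d u v J e : U).

Record swapping p q J e : Prop := Swapping {
  sw_p : projection p ; sw_q : projection q ;
  sw_J : adj J = J ; sw_e : projection e ;
  sw_pq : p * q = 0 ; sw_qp : q * p = 0 ;
  sw_JJ : J * J = p + q ; sw_Jp : J * p = q * J ; sw_Jq : J * q = p * J ;
  sw_ep : e * p = 0 ; sw_pe : p * e = 0 ; sw_eq : e * q = 0 ; sw_qe : q * e = 0 ;
  sw_eJ : e * J = 0 ; sw_Je : J * e = 0 ; sw_sum : p + q + e = 1 }.

Lemma linked_swapping A p q d : projection p -> projection q -> p * q = 0 ->
  linked A p q d -> swapping p q (d + adj d) (1 - p - q).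
Proof.
move=> hp hq pq ld; have [ap pp] := hp; have [aq qq] := hq.
have qp : q * p = 0 by rewrite -[LHS]adjK adjM ap aq pq adj0.
have pd : p * d = d by exact: link_l ld.
have dq : d * q = d by rewrite -(link_s ld) mulrA (link_r ld) pd.
have dp : d * p = 0 by rewrite -dq -mulrA qp mulr0.
have qd : q * d = 0 by rewrite -pd mulrA qp mul0r.
have dd : d * d = 0 by rewrite -{1}dq -mulrA qd mulr0.
have d'p : adj d * p = adj d by rewrite -{2}pd adjM ap.
have qd' : q * adj d = adj d by rewrite -{2}dq adjM aq.
have pd' : p * adj d = 0 by rewrite -{1}ap -adjM dp adj0.
have d'q : adj d * q = 0 by rewrite -{1}aq -adjM qd adj0.
have d'd' : adj d * adj d = 0 by rewrite -adjM dd adj0.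
have ae : adj (1 - p - q) = 1 - p - q by rewrite !adjB adj1 ap aq.
have ep : (1 - p - q) * p = 0 by rewrite !mulrBl mul1r pp qp subrr subr0.
have eq : (1 - p - q) * q = 0 by rewrite !mulrBl mul1r qq pq subr0 subrr.
have aJ : adj (d + adj d) = d + adj d by rewrite adjD adjK addrC.
have eJ : (1 - p - q) * (d + adj d) = 0.
  by rewrite !mulrBl mul1r !mulrDr pd pd' qd qd' addr0 add0r addrAC addrK subrr.
split => //.
- split=> //; have E x : x * p = 0 -> x * q = 0 -> x * (1 - p - q) = x.
    by move=> xp xq; rewrite !mulrBr mulr1 xp xq !subr0.
  exact: E.
- by rewrite mulrDl !mulrDr dd d'd' add0r addr0 (link_r ld) (link_s ld).
- by rewrite mulrDl mulrDr dp d'p qd qd'.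
- by rewrite mulrDl mulrDr dq d'q pd pd'.
- by rewrite -[LHS]adjK adjM ap ae ep adj0.
- by rewrite -[LHS]adjK adjM aq ae eq adj0.
- by rewrite -[LHS]adjK adjM ae aJ eJ adj0.
- by rewrite -(addrA 1) -opprD [LHS]addrC subrK.
Qed.

Section Swapping.
Variables (p q J e : U).
Hypothesis h : swapping p q J e.

Lemma swapping_symmetry : symmetry (J + e).
Proof.
split; first by rewrite adjD (sw_J h) (proj_adj (sw_e h)).
rewrite mulrDl !mulrDr (sw_JJ h) (sw_Je h) (sw_eJ h) (proj_sqr (sw_e h)).
by rewrite addr0 add0r (sw_sum h).
Qed.

Lemma swapping_JpJ : J * p * J = q.
Proof. by rewrite (sw_Jp h) -mulrA (sw_JJ h) mulrDr (sw_qp h) add0r (proj_sqr (sw_q h)). Qed.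

Lemma swapping_conj : (J + e) * p * (J + e) = q.
Proof.
rewrite mulrDl (sw_ep h) addr0 mulrDr swapping_JpJ -mulrA (sw_pe h) mulr0.
by rewrite addr0.
Qed.

Variables (v w Y : U).
Hypotheses (hvw : qubit v w) (hY : symmetry Y).
Hypothesis cv : commutes v (fun x => x \in [:: p; q; J; e]).
Hypothesis cw : commutes w (fun x => x \in [:: p; q; J; e]).
Hypothesis cY : commutes Y (fun x => x \in [:: p; q; J; e]).

Let mp : p \in [:: p; q; J; e]. Proof. by rewrite !inE eqxx. Qed.
Let mq : q \in [:: p; q; J; e]. Proof. by rewrite !inE eqxx ?orbT. Qed.
Let mJ : J \in [:: p; q; J; e]. Proof. by rewrite !inE eqxx ?orbT. Qed.
Let me : e \in [:: p; q; J; e]. Proof. by rewrite !inE eqxx ?orbT. Qed.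

Let exy x y : x * e = e * x -> (e * x) * (e * y) = e * (x * y).
Proof.
by move=> xe; rewrite -mulrA (mulrA x) xe -(mulrA e x) (mulrA e e) (proj_sqr (sw_e h)).
Qed.

Let mul0 a x b y : a * b = 0 -> x * b = b * x -> (a * x) * (b * y) = 0.
Proof. by move=> ab xb; rewrite -mulrA (mulrA x) xb -(mulrA b) (mulrA a) ab mul0r. Qed.

Let mul0' a x b : a * b = 0 -> x * b = b * x -> (a * x) * b = 0.
Proof. by move=> ab xb; rewrite -mulrA xb mulrA ab mul0r. Qed.

(** On p + q the pair is p - q and J Y, which anticommute because J exchanges p and q; on e it is
    the given qubit. The symmetry Y commutes with everything here and leaves room for a second
    exchange. *)
Lemma swap_qubit : qubit (p - q + e * v) (J * Y + e * w).
Proof.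
have [[av vv] [aw ww] anti] := hvw; have [aY YY] := hY.
have [ap pp] := sw_p h; have [aq qq] := sw_q h; have [ae ee] := sw_e h.
split.
- split; first by rewrite adjD adjB ap aq adjM av ae cv.
  rewrite !(mulrDl, mulrDr, mulNr, mulrN) exy ?cv// vv mulr1 pp qq (sw_pq h) (sw_qp h).
  rewrite (mul0' (sw_ep h)) ?cv// (mul0' (sw_eq h)) ?cv//.
  rewrite (mulrA p) (mulrA q) (sw_pe h) (sw_qe h) !mul0r !oppr0 opprK !addr0 !add0r.
  exact: (sw_sum h).
- split; first by rewrite adjD !adjM aY aw ae (sw_J h) cY// cw.
  rewrite mulrDl !mulrDr exy ?cw// ww mulr1 (mul0 _ (sw_Je h)) ?cY//.
  rewrite (mul0 _ (sw_eJ h)) ?cw// -mulrA (mulrA Y) cY// -(mulrA J Y) YY mulr1 (sw_JJ h).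
  by rewrite addr0 add0r (sw_sum h).
have e1 : (p - q) * (J * Y + e * w) = (p * J - q * J) * Y.
  rewrite mulrDr !mulrBl !(mulrA _ e) (sw_pe h) (sw_qe h) !mul0r subrr addr0.
  by rewrite !mulrA -mulrBl.
have e2 : (J * Y + e * w) * (p - q) = (q * J - p * J) * Y.
  rewrite mulrDl !mulrBr (mul0' (sw_ep h)) ?cw// (mul0' (sw_eq h)) ?cw// subrr addr0.
  by rewrite -!(mulrA J) !cY// !mulrA (sw_Jp h) (sw_Jq h) -mulrBl.
rewrite mulrDl e1 [X in _ = - X]mulrDr e2 (mulrDr (e * v)) (mulrDl (J * Y)) (mul0 _ (sw_eJ h)) ?cv// (mul0 _ (sw_Je h)) ?cY//.
have -> : e * v * (e * w) = e * (v * w) by apply: exy; exact: cv.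
have -> : e * w * (e * v) = e * (w * v) by apply: exy; exact: cw.
by rewrite !add0r anti mulrN opprD -(mulNr _ Y) opprB.
Qed.

Lemma swap_qubit_fix p'' : (p - q + e * v) * (p * p'') = p * p''.
Proof.
rewrite mulrDl mulrBl (mulrA p) (proj_sqr (sw_p h)) (mulrA q) (sw_qp h) mul0r subr0.
by rewrite (mul0 _ (sw_ep h)) ?cv// addr0.
Qed.

(** J moves the first factor and Y the second. *)
Lemma swap_qubit_conj p'' q'' : Y * p'' * Y = q'' ->
  commutes p'' (fun x => x \in [:: p; q; J; e]) ->
  (J * Y + e * w) * (p * p'') * (J * Y + e * w) = q * q''.
Proof.
move=> hpq cp''.
rewrite mulrDl (mul0 _ (sw_ep h)) ?cw// addr0 mulrDr.
have -> : J * Y * (p * p'') * (e * w) = 0.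
  transitivity (J * Y * (p * p'' * e) * w); first by rewrite !mulrA.
  by rewrite -(mulrA p) cp''// (mulrA p) (sw_pe h) mul0r mulr0 mul0r.
rewrite addr0.
have -> : J * Y * (p * p'') * (J * Y) = (J * p * J) * (Y * p'' * Y).
  transitivity (J * (Y * p) * (p'' * J) * Y); first by rewrite !mulrA.
  rewrite cY// cp''//; transitivity (J * p * (Y * J) * (p'' * Y)); first by rewrite !mulrA.
  by rewrite cY// !mulrA.
by rewrite hpq swapping_JpJ.
Qed.

End Swapping.
End Swaps.

(** * Towers of matrix algebras *)

Lemma dep_choice (S : Type) (P : nat -> S -> Prop) (Q : nat -> S -> S -> Prop) :
  (exists s, P 0%N s) ->
  (forall n s, P n s -> exists s', P n.+1 s' /\ Q n s s') ->
  exists t : nat -> S, forall n, P n (t n) /\ Q n (t n) (t n.+1).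
Proof.
move=> [s0 P0] step.
have H (ns : nat * S) : exists s', P ns.1 ns.2 -> P ns.1.+1 s' /\ Q ns.1 ns.2 s'.
  have [h|h] := pselect (P ns.1 ns.2); last by exists s0.
  by have [s' hs'] := step _ _ h; exists s'.
have [F hF] := choice H.
pose t := fix t n := if n is m.+1 then F (m, t m) else s0.
have Pt n : P n (t n) by elim: n => // n IH; exact: (hF (n, t n) IH).1.
by exists t => n; split=> //; exact: (hF (n, t n) (Pt n)).2.
Qed.

Section Towers.
Variables (R : realType) (U : starAlgType R).
Local Notation C := R[i].
Implicit Types (A B : U -> Prop) (x y r s p q d u v : U) (f g : U -> C).

Lemma linked_projections A r s y : matalg A r -> linked A r s y ->
  [/\ projection r, projection s, A r & A s].
Proof.
move=> mA l; have hA := matalg_subalg mA; have [Ar ar rr] := matalg_r mA.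
have ys : y * s = y by rewrite -(link_s l) mulrA (link_r l) (link_l l).
split=> //.
- split; first by rewrite -(link_s l) adjM adjK.
  by rewrite -{1}(link_s l) -mulrA ys (link_s l).
- by rewrite -(link_s l); apply: subM => //; [apply: subJ => //|]; exact: link_mem l.
Qed.

Lemma linked_min A r s y x : matalg A r -> linked A r s y -> A x ->
  exists w : C, s * x * s = w *: s.
Proof.
move=> mA l Ax; have hA := matalg_subalg mA; have Ay := link_mem l.
have Ay' : A (adj y) by exact: subJ.
have [w hw] := matalg_min mA (subM hA (subM hA Ay Ax) Ay').
have e1 : adj y * r = adj y by rewrite -{2}(link_l l) adjM; have [_ -> _] := matalg_r mA.
exists w; rewrite -(link_s l); transitivity (adj y * (r * (y * x * adj y) * r) * y).
  by rewrite !mulrA e1 -(mulrA _ r y) (link_l l).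
by rewrite hw -scalerAr -scalerAl -mulrA (link_l l).
Qed.

(** Averaging r' and the projection s' linked to it over A transports the link to the commutant of
    A. The estimates for f and g survive up to the factor 16, and r' A s' = 0 becomes p q = 0. *)
Lemma relative_pair A r s y A' r' s' y' f g eta :
  posfun f -> posfun g -> matalg A r -> linked A r s y -> matalg A' r' -> linked A' r' s' y' ->
  (forall x, A x -> A' x) -> (forall x, A x -> r' * x * s' = 0) ->
  gnsnorm f (1 - r) <= eta -> gnsnorm f (1 - r') <= eta ->
  gnsnorm g (1 - s) <= eta -> gnsnorm g (1 - s') <= eta -> eta <= 1 / 8 ->
  exists p q d, [/\ swapping p q (d + adj d) (1 - p - q),
    [/\ A' p, A' q & A' d],
    [/\ commutes p A, commutes q A, commutes d A & commutes (adj d) A],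
    forall x, A' x -> exists2 z, A z & p * x * p = z * p &
    gnsnorm f (1 - p) <= 16 * eta /\ gnsnorm g (1 - q) <= 16 * eta].
Proof.
move=> pf pg mA l mA' l' AA' orth fr fr' gs gs' eta8.
have hA := matalg_subalg mA; have hA' := matalg_subalg mA'.
have [hr hs Ar As] := linked_projections mA l.
have [hr' hs' Ar' As'] := linked_projections mA' l'.
have [w hw] := matalg_min mA' (AA' _ Ar).
have [w' hw'] := linked_min mA' l' (AA' _ As).
have [t [t0 t1 wt te]] := rel_scalar pf hr hr' hw fr fr' eta8.
have [t' [t'0 t'1 wt' te']] := rel_scalar pg hs hs' hw' gs gs' eta8.
rewrite wt in hw; rewrite wt' in hw'.
have [I [a [hf ha]]] := mA.
have hb i : a i * y = a i * y by [].
pose p := relproj a r' t; pose q := relproj (fun i => a i * y) s' t'.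
pose d := relisom a y' t t' (fun i => a i * y).
have hp : projection p := relproj_p hf mA' t0 hw.
have ld : linked A' p q d := relisom_linked hf ha mA' AA' l l' t0 hw t'0 hw' hb.
have hq : projection q.
  split; first by rewrite -(link_s ld) adjM adjK.
  rewrite -(link_s ld); transitivity (adj d * (d * adj d * d)); first by rewrite !mulrA.
  by rewrite (link_r ld) (link_l ld).
have cp : commutes p A := relproj_commutes hf mA' t0 hw.
have cd : commutes d A := relisom_commutes y' hf l t t' hb.
have cd' : commutes (adj d) A.
  by move=> x Ax; rewrite -[LHS]adjK adjM adjK -cd ?adjM ?adjK//; exact: subJ.
have cq : commutes q A.
  by move=> x Ax; rewrite -(link_s ld) -mulrA cd// mulrA cd'// mulrA.
have pq0 : p * q = 0 := relproj_orth hf ha l t t' hb orth.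
have A'd := link_mem ld.
exists p, q, d; split.
- exact: linked_swapping hp hq pq0 ld.
- split=> //; first by rewrite -(link_r ld); apply: subM => //; exact: subJ.
  by rewrite -(link_s ld); apply: subM => //; exact: subJ.
- by split.
- by move=> x A'x; have := relproj_min hf ha mA' AA' t0 hw A'x.
split.
- have e := relproj_r hf ha mA' t0 hw.
  by apply: (rel_estimate pf hr hr' hp t0 t1 te e) => //; rewrite cp.
- have e := relproj_s hf ha mA' l l' t0 hw t'0 hb.
  by apply: (rel_estimate pg hs hs' hq t'0 t'1 te' e) => //; rewrite cq.
Qed.

Variable S : U -> Prop.

(** On finite sets f is approximated by pure states of matrix algebras: r compresses each element of
    A to a scalar, and f is almost 1 on r. *)
Definition locally_matricial f := forall (L : seq U) (eps : R),
  (forall x, x \in L -> S x) -> 0 < eps -> exists A r,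
  [/\ matalg A r, forall x, A x -> S x, forall x, x \in L -> A x & gnsnorm f (1 - r) <= eps].

(** Room for one more tensor factor of 2 x 2 matrices, in which f is almost the pure state at u =
    1. *)
Definition free_qubits f := forall (L : seq U) (eps : R),
  (forall x, x \in L -> S x) -> 0 < eps -> exists u v,
  [/\ S u /\ S v, qubit u v, forall x, x \in L -> u * x = x * u /\ v * x = x * v &
      gnsnorm f (1 - specproj u) <= eps].

(** Quantitative inequivalence of f and g: two equivalent minimal projections of one matrix algebra,
    almost full for f and for g respectively, with zero matrix coefficients of L between them. *)
Definition separated f g := forall (L : seq U) (eps : R),
  (forall x, x \in L -> S x) -> 0 < eps -> exists A r s y,
  [/\ matalg A r /\ linked A r s y, forall x, A x -> S x, forall x, x \in L -> A x,
      forall x, x \in L -> r * x * s = 0 &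
      gnsnorm f (1 - r) <= eps /\ gnsnorm g (1 - s) <= eps].

(** An enumeration of generators: a tower of length omega that absorbs them one by one exhausts
    S. *)
Definition countably_spanned := exists wd : nat -> U, (forall n, S (wd n)) /\
  forall x, S x -> exists n, forall B, subalg B -> (forall k, (k <= n)%N -> B (wd k)) -> B x.

Definition tower_eps (n : nat) : R := (1 / 16) / 2 ^+ n.

(** Since v_k commutes with A_n for k >= n, conjugation by v_0 ... v_(k-1) stabilizes on each A_n;
    the limit is the automorphism of the next letter. As u_n fixes p_n and anticommutes with v_n,
    the latter moves p_n to an orthogonal projection ([tower_pq]), while f stays concentrated on
    p_n. *)
Record tower f (A : nat -> U -> Prop) (r u v p : nat -> U) : Prop := Tower {
  tw_mat : forall n, matalg (A n) (r n) ;
  tw_sub : forall n x, A n x -> S x ;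
  tw_incr : forall n x, A n x -> A n.+1 x ;
  tw_exh : forall x, S x -> exists n, A n x ;
  tw_mem : forall n, [/\ A n.+1 (u n), A n.+1 (v n) & A n.+1 (p n)] ;
  tw_comm : forall n, [/\ commutes (u n) (A n), commutes (v n) (A n) & commutes (p n) (A n)] ;
  tw_qubit : forall n, qubit (u n) (v n) ;
  tw_proj : forall n, projection (p n) ;
  tw_fix : forall n, u n * p n = p n ;
  tw_r : forall n, gnsnorm f (1 - r n) <= tower_eps n ;
  tw_p : forall n, gnsnorm f (1 - p n) <= tower_eps n }.

(** The projections v_n p_n v_n are now almost full for g, so the limit automorphism carries f
    towards g. By [lt_min], compression by p_n reduces A_(n+1) to A_n, hence r_0 p_0 ... p_(n-1) is
    a minimal projection of A_n. *)
Record linked_tower g (A : nat -> U -> Prop) (r v p : nat -> U) (s0 y0 : U) : Prop :=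
  LinkedTower {
  lt_link : linked (A 0%N) (r 0%N) s0 y0 ;
  lt_s0 : gnsnorm g (1 - s0) <= 1 / 16 ;
  lt_min : forall n x, A n.+1 x -> exists2 z, A n z & p n * x * p n = z * p n ;
  lt_q : forall n, gnsnorm g (1 - v n * p n * v n) <= tower_eps n }.

Hypothesis hS : subalg S.
Hypothesis cS : countably_spanned.

Lemma exhaust_tower (wd : nat -> U) (A : nat -> U -> Prop) :
  (forall n, subalg (A n)) -> (forall n x, A n x -> A n.+1 x) -> (forall n, A n.+1 (wd n)) ->
  (forall x, S x -> exists n, forall B, subalg B -> (forall k, (k <= n)%N -> B (wd k)) -> B x) ->
  forall x, S x -> exists n, A n x.
Proof.
move=> sA inc wA gen x /gen[n h]; exists n.+1; apply: h => // k kn.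
have : A k.+1 (wd k) by [].
by move: kn => /subnK <-; elim: (n - k)%N => // j IH /IH; exact: inc.
Qed.

Lemma tower_eps_gt0 n : 0 < tower_eps n.
Proof. by rewrite /tower_eps !divr_gt0// exprn_gt0. Qed.

Lemma tower_epsS n : tower_eps n.+1 = tower_eps n / 2.
Proof. by rewrite /tower_eps exprSr invfM mulrA. Qed.

Lemma tower_eps_le n : tower_eps n <= 1 / 16.
Proof.
elim: n => [|n IH]; first by rewrite /tower_eps expr0 divr1.
by have := tower_eps_gt0 n; rewrite tower_epsS; lra.
Qed.

Lemma free_tower f : posfun f -> locally_matricial f -> free_qubits f ->
  exists (A : nat -> U -> Prop) (r u v p : nat -> U), tower f A r u v p.
Proof.
move=> pf lm fq; have [wd [Swd gen]] := cS.
pose P (n : nat) (st : (U -> Prop) * U) := [/\ matalg st.1 st.2, forall x, st.1 x -> S x &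
  gnsnorm f (1 - st.2) <= tower_eps n].
pose Q (n : nat) (st st' : (U -> Prop) * U) := [/\ forall x, st.1 x -> st'.1 x, st'.1 (wd n) &
  exists uv : U * U, [/\ st'.1 uv.1 /\ st'.1 uv.2, qubit uv.1 uv.2,
    commutes uv.1 st.1 /\ commutes uv.2 st.1 & gnsnorm f (1 - specproj uv.1) <= tower_eps n]].
have [||st hst] := @dep_choice _ P Q.
- have [|A [r [mA AS _ fr]]] := lm [::] (tower_eps 0) _ (tower_eps_gt0 0) => //.
  by exists (A, r); split.
- move=> n [A r] [/= mA AS fr].
  have [L [LA genL comL _]] := matalg_findim mA.
  have [|u [v [[Su Sv] quv cuv fu]]] := fq L (tower_eps n) _ (tower_eps_gt0 n).
    by move=> x /LA/AS.
  have [|A' [r' [mA' A'S LA' fr']]] := lm (u :: v :: wd n :: L) _ _ (tower_eps_gt0 n.+1).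
    by move=> x; rewrite !inE => /or4P[/eqP ->|/eqP ->|/eqP ->|/LA/AS].
  exists (A', r'); split; first by split.
  split => /=.
  + by apply: genL; [exact: matalg_subalg mA'|move=> x xL; apply: LA'; rewrite !inE xL !orbT].
  + by apply: LA'; rewrite !inE eqxx !orbT.
  exists (u, v); split => //=.
  + by split; apply: LA'; rewrite !inE eqxx ?orbT.
  + by split; apply: comL => x /cuv[].
have [uv huv] := choice (fun n => (let: And3 _ _ h := (hst n).2 in h)).
exists (fun n => (st n).1), (fun n => (st n).2), (fun n => (uv n).1), (fun n => (uv n).2),
  (fun n => specproj (uv n).1).
have mA n : matalg (st n).1 (st n).2 by case: (hst n) => -[].
have hA n := matalg_subalg (mA n).
have mem n : (st n.+1).1 (specproj (uv n).1).
  by case: (huv n) => -[h _] _ _ _; apply: subZ => //; apply: subD => //; exact: sub1.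
split=> //.
- by move=> n; case: (hst n) => -[].
- by move=> n; case: (hst n) => _ [].
- apply: exhaust_tower gen => // n; first by case: (hst n) => _ [].
  by case: (hst n) => _ [].
- by move=> n; case: (huv n) => -[].
- move=> n; case: (huv n) => _ _ [cu cv] _; split=> // x Ax.
  by rewrite /specproj -scalerAl -scalerAr mulrDl mulrDr mul1r mulr1 cu.
- by move=> n; case: (huv n).
- by move=> n; case: (huv n) => _ [hu _ _] _ _; exact: specproj_proj.
- by move=> n; case: (huv n) => _ [hu _ _] _ _; exact: specproj_u.
- by move=> n; case: (hst n) => -[].
- by move=> n; case: (huv n).
Qed.

(** Each step uses two relative pairs. The first, p and q in A' over A, leaves a complement e on
    which v must still anticommute with u, so a free qubit is put there. That qubit lies outside A'
    and forces a larger algebra A''. The second pair, p'' and q'' in A'' over A', then makes p p''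
    minimal relative to A inside A''. *)
Lemma linked_tower_exists f g : posfun f -> posfun g -> free_qubits f -> separated f g ->
  exists (A : nat -> U -> Prop) (r u v p : nat -> U) s0 y0, tower f A r u v p /\ linked_tower g A r v p s0 y0.
Proof.
move=> pf pg fq sep; have [wd [Swd gen]] := cS.
(* A relative projection costs 16 eta, and p p'' has two such factors. *)
pose eta n := tower_eps n / 32.
have eta0 n : 0 < eta n by rewrite divr_gt0// tower_eps_gt0.
have eta8 n : eta n <= 1 / 8 by have := tower_eps_le n; rewrite /eta; lra.
have etaS n : eta n.+1 <= eta n.
  by rewrite /eta tower_epsS; have := tower_eps_gt0 n; lra.
pose T := ((U -> Prop) * U * U * U)%type.
pose P (n : nat) (st : T) := let: (A, r, s, y) := st in
  [/\ matalg A r, linked A r s y, forall x, A x -> S x, gnsnorm f (1 - r) <= eta n &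
      gnsnorm g (1 - s) <= eta n].
pose Q (n : nat) (st st' : T) := let: (A, r, s, y) := st in let: (A', r', s', y') := st' in
  [/\ forall x, A x -> A' x, A' (wd n) & exists uvp : U * U * U, let: (u, v, p) := uvp in
   [/\ [/\ A' u, A' v & A' p], [/\ commutes u A, commutes v A & commutes p A],
       [/\ qubit u v, projection p & u * p = p],
       forall x, A' x -> exists2 z, A z & p * x * p = z * p &
       gnsnorm f (1 - p) <= tower_eps n /\ gnsnorm g (1 - v * p * v) <= tower_eps n]].
have [||st hst] := @dep_choice _ P Q.
- have [|A [r [s [y [[mA l] AS _ _ [fr gs]]]]]] := sep [::] (eta 0) _ (eta0 0) => //.
  by exists (A, r, s, y); split.
- move=> n [[[A r] s] y] [mA l AS fr gs].
  have [L [LA genL comL orthL]] := matalg_findim mA.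
  have [|A' [r' [s' [y' [[mA' l'] A'S LA' o' [fr' gs']]]]]] := sep (wd n :: L) (eta n) _ (eta0 n).
    by move=> x; rewrite !inE => /orP[/eqP ->|/LA/AS].
  have hA' := matalg_subalg mA'.
  have AA' x : A x -> A' x.
    by apply: genL => // z zL; apply: LA'; rewrite inE zL orbT.
  have [|p [q [d [sw [A'p A'q A'd] [cp cq cd cd'] min [fp gq]]]]] :=
    relative_pair pf pg mA l mA' l' AA' _ fr fr' gs gs' (eta8 n).
    by apply: orthL => z zL; apply: o'; rewrite inE zL orbT.
  have [L' [L'A' genL' comL' orthL']] := matalg_findim mA'.
  (* This qubit only fills e, away from p; hence the trivial tolerance 1. *)
  have [|v0 [w0 [[Sv Sw] quv cvw _]]] := fq L' 1 _ ltr01.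
    by move=> x /L'A'/A'S.
  have cv0 : commutes v0 A' by apply: comL' => x /cvw[].
  have cw0 : commutes w0 A' by apply: comL' => x /cvw[].
  have [|A'' [r'' [s'' [y'' [[mA'' l''] A''S LA'' o'' [fr'' gs'']]]]]] :=
      sep (v0 :: w0 :: L') (eta n.+1) _ (eta0 n.+1).
    by move=> x; rewrite !inE => /or3P[/eqP ->|/eqP ->|/L'A'/A'S].
  have hA'' := matalg_subalg mA''.
  have A'A'' x : A' x -> A'' x.
    by apply: genL' => // z zL; apply: LA''; rewrite !inE zL !orbT.
  have fr''n := le_trans fr'' (etaS n); have gs''n := le_trans gs'' (etaS n).
  have [|p'' [q'' [d'' [sw'' [A''p A''q A''d] [cp'' cq'' cd'' cd'''] min'' [fp'' gq'']]]]] :=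
    relative_pair pf pg mA' l' mA'' l'' A'A'' _ fr' fr''n gs' gs''n (eta8 n).
    by apply: orthL' => z zL; apply: o''; rewrite !inE zL !orbT.
  pose J := d + adj d; pose e := 1 - p - q; pose Y := (d'' + adj d'') + (1 - p'' - q'').
  have A'J : A' J by apply: subD => //; exact: subJ.
  have A'e : A' e by do 2?[apply: subB => //]; exact: sub1.
  have A''Y : A'' Y.
    apply: subD => //; first by apply: subD => //; exact: subJ.
    by do 2?[apply: subB => //]; exact: sub1.
  have sub4 x : x \in [:: p; q; J; e] -> A' x.
    by rewrite !inE => /or4P[] /eqP ->.
  have cY : commutes Y A'.
    by move=> x A'x; rewrite !(mulrDl, mulrDr, mulNr, mulrN) cd''// cd'''// cp''// cq''// mul1r mulr1.
  have hY : symmetry Y := swapping_symmetry sw''.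
  have YpY : Y * p'' * Y = q'' := swapping_conj sw''.
  have c4 x : commutes x A' -> commutes x (fun z => z \in [:: p; q; J; e]).
    by move=> cx z /sub4/cx.
  have hq := swap_qubit sw quv hY (c4 _ cv0) (c4 _ cw0) (c4 _ cY).
  have hfix := swap_qubit_fix sw (c4 _ cv0) p''.
  have hconj := swap_qubit_conj sw (c4 _ cw0) (c4 _ cY) YpY (c4 _ cp'').
  have A''v0 : A'' v0 by apply: LA''; rewrite !inE eqxx.
  have A''w0 : A'' w0 by apply: LA''; rewrite !inE eqxx orbT.
  have A''u : A'' (p - q + e * v0).
    by apply: subD => //; [apply: subB => //; exact: A'A''|apply: subM => //; exact: A'A''].
  have A''v : A'' (J * Y + e * w0).
    by apply: subD => //; apply: subM => //; exact: A'A''.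
  have A''pp : A'' (p * p'') by apply: subM => //; exact: A'A''.
  have ce : commutes e A.
    by move=> x Ax; rewrite /e !mulrBl !mulrBr cp// cq// mul1r mulr1.
  have cJ : commutes J A by move=> x Ax; rewrite mulrDl mulrDr cd// cd'.
  have cM x z : commutes x A -> commutes z A -> commutes (x * z) A.
    by move=> cx cz a Aa; rewrite -mulrA cz// mulrA cx// mulrA.
  have cAA x : commutes x A' -> commutes x A by move=> cx a /AA'/cx.
  exists (A'', r'', s'', y''); split; first by split.
  split.
  + by move=> x /AA'/A'A''.
  + by apply/A'A''/LA'; rewrite inE eqxx.
  exists (p - q + e * v0, J * Y + e * w0, p * p''); split.
  + by split.
  + have cD x z : commutes x A -> commutes z A -> commutes (x + z) A.
      by move=> cx cz a Aa; rewrite mulrDl mulrDr cx// cz.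
    have cN x : commutes x A -> commutes (- x) A.
      by move=> cx a Aa; rewrite mulNr mulrN cx.
    split; first exact: (cD _ _ (cD _ _ cp (cN _ cq)) (cM _ _ ce (cAA _ cv0))).
      exact: (cD _ _ (cM _ _ cJ (cAA _ cY)) (cM _ _ ce (cAA _ cw0))).
    exact: (cM _ _ cp (cAA _ cp'')).
  + split=> //; split; first by rewrite adjM (proj_adj (sw_p sw)) (proj_adj (sw_p sw'')) cp''.
    by rewrite -mulrA (mulrA p'') cp''// -(mulrA p p'') (proj_sqr (sw_p sw'')) mulrA (proj_sqr (sw_p sw)).
  + move=> x A''x; have [z A'z hz] := min'' x A''x; have [z0 Az0 hz0] := min z A'z.
    exists z0 => //; transitivity (p * (p'' * x * p'') * p).
      by transitivity (p * p'' * x * (p'' * p)); [rewrite cp''|rewrite !mulrA].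
    by rewrite hz -!mulrA cp''// !mulrA hz0.
  have etaE : eta n * 32 = tower_eps n by rewrite /eta divfK.
  split.
  + apply: le_trans (gnsnormM1 pf _ (sw_p sw)) _; rewrite -etaE; lra.
  + rewrite hconj; apply: le_trans (gnsnormM1 pg _ (sw_q sw)) _; rewrite -etaE; lra.
pose A n := (st n).1.1.1; pose r n := (st n).1.1.2; pose s n := (st n).1.2; pose y n := (st n).2.
have stE n : st n = (A n, r n, s n, y n) by rewrite /A /r /s /y; case: (st n) => [[[]]].
have hP n : P n (A n, r n, s n, y n) by rewrite -stE; exact: (hst n).1.
have hQ n : Q n (A n, r n, s n, y n) (A n.+1, r n.+1, s n.+1, y n.+1).
  by rewrite -!stE; exact: (hst n).2.
have [uvp huvp] := choice (fun n => (let: And3 _ _ h := hQ n in h)).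
pose u n := (uvp n).1.1; pose v n := (uvp n).1.2; pose p n := (uvp n).2.
have uvpE n : uvp n = (u n, v n, p n) by rewrite /u /v /p; case: (uvp n) => [[]].
have H n := huvp n.
have le_eta n : eta n <= tower_eps n by rewrite /eta; have := tower_eps_gt0 n; lra.
exists A, r, u, v, p, (s 0%N), (y 0%N); split; split.
- by move=> n; case: (hP n).
- by move=> n; case: (hP n).
- by move=> n; case: (hQ n).
- apply: exhaust_tower gen => n; first by case: (hP n) => /matalg_subalg.
    by case: (hQ n).
  by case: (hQ n).
- by move=> n; have := H n; rewrite uvpE => -[].
- by move=> n; have := H n; rewrite uvpE => -[].
- by move=> n; have := H n; rewrite uvpE => -[_ _ []].
- by move=> n; have := H n; rewrite uvpE => -[_ _ []].
- by move=> n; have := H n; rewrite uvpE => -[_ _ []].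
- by move=> n; case: (hP n) => _ _ _ h _; exact: le_trans h (le_eta n).
- by move=> n; have := H n; rewrite uvpE => -[_ _ _ _ []].
- by case: (hP 0%N).
- case: (hP 0%N) => _ _ _ _ h; apply: le_trans h _.
  exact: le_trans (le_eta _) (tower_eps_le _).
- by move=> n; have := H n; rewrite uvpE => -[].
- by move=> n; have := H n; rewrite uvpE => -[_ _ _ _ []].
Qed.

End Towers.

(** * Finitely supported functions and their inner product *)

Lemma cj_sum (R : realType) (I : Type) (r : seq I) (Q : pred I) (F : I -> R[i]) :
  (\sum_(i <- r | Q i) F i)^*%C = \sum_(i <- r | Q i) (F i)^*%C.
Proof. by elim/big_rec2: _ => [|i u v _ <-]; rewrite ?conjc0 ?cjD. Qed.

Definition linear_map (R : realType) (V W : lmodType R[i]) (F : V -> W) :=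
  forall (k : R[i]) (x y : V), F (k *: x + y) = k *: F x + F y.

Section LinearMap.
Variables (R : realType) (V W : lmodType R[i]) (F : V -> W).
Hypothesis hF : linear_map F.
Lemma lmap0 : F 0 = 0.
Proof. by have /eqP := hF 1 0 0; rewrite !scale1r addr0 -subr_eq subrr => /eqP <-. Qed.
Lemma lmapD x y : F (x + y) = F x + F y.
Proof. by have := hF 1 x y; rewrite !scale1r. Qed.
Lemma lmapZ k x : F (k *: x) = k *: F x.
Proof. by have := hF k x 0; rewrite !addr0 lmap0 addr0. Qed.
Lemma lmapN x : F (- x) = - F x.
Proof. by rewrite -scaleN1r lmapZ scaleN1r. Qed.
Lemma lmapB x y : F (x - y) = F x - F y.
Proof. by rewrite lmapD lmapN. Qed.
Lemma lmap_sum (I : Type) (r : seq I) (Q : pred I) (G : I -> V) :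
  F (\sum_(i <- r | Q i) G i) = \sum_(i <- r | Q i) F (G i).
Proof. by elim/big_rec2: _ => [|i u v _ <-]; rewrite ?lmap0 ?lmapD. Qed.
End LinearMap.

Lemma lmap_comp (R : realType) (V W Z : lmodType R[i]) (F : W -> Z) (G : V -> W) :
  linear_map F -> linear_map G -> linear_map (F \o G).
Proof. by move=> lF lG k x y; rewrite /= lG lF. Qed.

Section FiniteSupport.
Variables (R : realType) (J : choiceType) (P : pred J).
Local Notation C := R[i].

Definition finitely_supported : {pred J -> C^o} :=
  mem [set f : J -> C^o | (forall w, f w != 0 -> P w) /\
    exists s : seq J, forall w, f w != 0 -> w \in s].

Record fspan := Fspan { coef :> J -> C^o ; coefP : coef \in finitely_supported }.

HB.instance Definition _ := [isSub for coef].
Arguments coef : simpl never.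
HB.instance Definition _ := [Choice of fspan by <:].

Lemma finitely_supported_submod : submod_closed finitely_supported.
Proof.
split; first by apply/mem_set; split=> [w|]; [|exists [::] => w]; rewrite eqxx.
move=> k f g /set_mem[Pf [s hs]] /set_mem[Pg [t ht]]; apply/mem_set.
have E w : (k *: f + g) w != 0 -> (f w != 0) || (g w != 0).
  apply: contraR; rewrite negb_or !negbK => /andP[/eqP fw /eqP gw].
  by rewrite !fctE fw gw scaler0 addr0.
split=> [w /E/orP[/Pf|/Pg]//|]; exists (s ++ t) => w /E/orP[/hs|/ht] h.
  by rewrite mem_cat h.
by rewrite mem_cat h orbT.
Qed.

HB.instance Definition _ := GRing.isSubmodClosed.Build C (J -> C^o)
  finitely_supported finitely_supported_submod.
HB.instance Definition _ := [SubChoice_isSubLmodule of fspan by <:].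

Implicit Types (x y : fspan) (w : J).

Lemma coefD x y w : (x + y) w = x w + y w. Proof. by []. Qed.
Lemma coefZ k x w : (k *: x) w = k * x w. Proof. by []. Qed.
Lemma coef0 w : (0 : fspan) w = 0. Proof. by []. Qed.
Lemma coef_dom x w : x w != 0 -> P w.
Proof. by have /set_mem[+ _] := coefP x; apply. Qed.
Lemma fspan_ext x y : (forall w, x w = y w) -> x = y.
Proof. by move=> h; apply/val_inj/funext. Qed.

Lemma supp_ex x : exists s : seq J, uniq s /\ forall w, x w != 0 -> w \in s.
Proof.
have /set_mem[_ [s hs]] := coefP x; exists (undup s); rewrite undup_uniq.
by split=> // w /hs; rewrite mem_undup.
Qed.

Definition supp x : seq J := projT1 (cid (supp_ex x)).
Lemma supp_uniq x : uniq (supp x). Proof. by rewrite /supp; case: cid => s []. Qed.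
Lemma mem_supp x w : x w != 0 -> w \in supp x.
Proof. by rewrite /supp; case: cid => s [_ /=]; exact. Qed.

Definition indic w : J -> C^o := fun v => if P w && (v == w) then 1 else 0.

Lemma indicP w : indic w \in finitely_supported.
Proof.
apply/mem_set; split=> [v|]; last exists [:: w] => v; rewrite /indic;
  by case: ifPn => [/andP[Pw /eqP ->]|]; rewrite ?eqxx// inE.
Qed.

Definition delta w : fspan := Fspan (indicP w).

Lemma deltaE w v : delta w v = if P w && (v == w) then 1 else 0.
Proof. by []. Qed.

Lemma delta_out w : ~~ P w -> delta w = 0.
Proof. by move=> h; apply: fspan_ext => v; rewrite deltaE (negbTE h). Qed.

Section Extension.
Variables (V : lmodType C) (t : J -> V).

Definition lin x : V := \sum_(w <- supp x) x w *: t w.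

Lemma linE x (s : seq J) : uniq s -> (forall w, x w != 0 -> w \in s) ->
  lin x = \sum_(w <- s) x w *: t w.
Proof.
move=> us hs; have E (r : seq J) : \sum_(w <- r) x w *: t w =
    \sum_(w <- [seq v <- r | x v != 0]) x w *: t w.
  rewrite big_filter [LHS](bigID (fun w => x w != 0))/= [X in _ + X]big1 ?addr0// => w.
  by rewrite negbK => /eqP ->; rewrite scale0r.
rewrite /lin E [RHS]E; apply/perm_big/uniq_perm; rewrite ?filter_uniq ?supp_uniq//.
move=> w; rewrite !mem_filter; case: (boolP (x w != 0)) => //= h.
by rewrite mem_supp// hs.
Qed.

Lemma linD x y : lin (x + y) = lin x + lin y.
Proof.
pose s := undup (supp x ++ supp y).
have us : uniq s by exact: undup_uniq.
have sx w : x w != 0 -> w \in s by move=> /mem_supp h; rewrite mem_undup mem_cat h.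
have sy w : y w != 0 -> w \in s by move=> /mem_supp h; rewrite mem_undup mem_cat h orbT.
rewrite !(linE us)//; last first.
  move=> w; rewrite coefD; have [/sx//|] := boolP (x w != 0).
  by rewrite negbK => /eqP ->; rewrite add0r; exact: sy.
by rewrite -big_split; apply: eq_bigr => w _; rewrite coefD scalerDl.
Qed.

Lemma linZ k x : lin (k *: x) = k *: lin x.
Proof.
rewrite (linE (supp_uniq x)) => [|w].
  by rewrite scaler_sumr; apply: eq_bigr => w _; rewrite coefZ scalerA.
by rewrite coefZ mulf_eq0 negb_or => /andP[_ /mem_supp].
Qed.

Lemma lin0 : lin 0 = 0.
Proof. by rewrite -[X in lin X](scale0r (0 : fspan)) linZ scale0r. Qed.

Lemma lin_delta w : P w -> lin (delta w) = t w.
Proof.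
move=> Pw; rewrite (@linE _ [:: w]) => [|//|v].
  by rewrite big_seq1 deltaE Pw eqxx scale1r.
by rewrite deltaE Pw inE /=; case: ifP => //; rewrite eqxx.
Qed.

End Extension.

Lemma coef_sum (I : Type) (r : seq I) (Q : pred I) (F : I -> fspan) w :
  (\sum_(i <- r | Q i) F i) w = \sum_(i <- r | Q i) F i w.
Proof.
have lc : @linear_map R fspan C^o (fun z => z w) by [].
exact: (lmap_sum lc).
Qed.

Lemma lin_linear (V : lmodType C) (t : J -> V) : linear_map (lin t).
Proof. by move=> k x y; rewrite linD linZ. Qed.

Lemma fspan_expand x : x = \sum_(w <- supp x) x w *: delta w.
Proof.
suff : lin delta x = x by [].
apply: fspan_ext => v; rewrite /lin coef_sum (bigID (pred1 v))/= [X in _ + X]big1 ?addr0.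
  have [xv|] := boolP (x v != 0).
    rewrite -big_filter filter_pred1_uniq ?supp_uniq ?mem_supp//.
    by rewrite big_seq1 coefZ deltaE (coef_dom xv) eqxx mulr1.
  rewrite negbK => /eqP xv; rewrite xv big1// => w /eqP ->.
  by rewrite coefZ xv mul0r.
by move=> w; rewrite coefZ deltaE /= eq_sym => /negbTE ->; rewrite andbF mulr0.
Qed.

Lemma lmap_ext (V : lmodType C) (F G : fspan -> V) x : linear_map F -> linear_map G ->
  (forall w, x w != 0 -> F (delta w) = G (delta w)) -> F x = G x.
Proof.
move=> lF lG h; rewrite [x]fspan_expand (lmap_sum lF) (lmap_sum lG); apply: eq_bigr => w _.
rewrite (lmapZ lF) (lmapZ lG); have [->|/h ->//] := eqVneq (x w) 0.
by rewrite !scale0r.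
Qed.

(* Conjugate-linear in [y]. *)
Definition fip x y : C := lin (fun w => (y w)^*%C : C^o) x.

Lemma fip_sum x y (s : seq J) : uniq s -> (forall w, x w != 0 -> w \in s) ->
  fip x y = \sum_(w <- s) x w * (y w)^*%C.
Proof. by move=> us hs; rewrite /fip (linE _ us hs). Qed.

Lemma fip_linear y : @linear_map R fspan C^o (fip ^~ y).
Proof. exact: lin_linear. Qed.

Lemma fip_conj x y : fip y x = (fip x y)^*%C.
Proof.
pose s := undup (supp x ++ supp y).
have us : uniq s by exact: undup_uniq.
have sx w : x w != 0 -> w \in s by move=> /mem_supp h; rewrite mem_undup mem_cat h.
have sy w : y w != 0 -> w \in s by move=> /mem_supp h; rewrite mem_undup mem_cat h orbT.
rewrite (fip_sum _ us)// (fip_sum _ us)// cj_sum; apply: eq_bigr => w _.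
by rewrite cjM conjcK mulrC.
Qed.

Lemma fip_delta w y : fip (delta w) y = (y w)^*%C.
Proof.
have [Pw|Pw] := boolP (P w); first by rewrite /fip lin_delta.
rewrite delta_out// (lmap0 (fip_linear y)).
by apply/esym/eqP; rewrite conjc_eq0; apply: contraR Pw => /coef_dom.
Qed.

Lemma fip_coef x w : fip x (delta w) = x w.
Proof. by rewrite fip_conj fip_delta conjcK. Qed.

Lemma fip_nondeg x y : (forall z, fip x z = fip y z) -> x = y.
Proof. by move=> h; apply: fspan_ext => w; rewrite -!fip_coef. Qed.

Lemma fip_ge0 x : 0 <= fip x x.
Proof.
rewrite (fip_sum x (supp_uniq x)); last exact: mem_supp.
by apply: sumr_ge0 => w _; exact: mul_conjC_ge0.
Qed.

Lemma fip_psd : psd_form fip.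
Proof.
split; first by move=> x y z; exact: (lmapD (fip_linear z)).
- by move=> k x y; exact: (lmapZ (fip_linear y)).
- by move=> x y; exact: fip_conj.
- exact: fip_ge0.
Qed.

Lemma fip_orth x y : (forall w, x w != 0 -> y w = 0) -> fip x y = 0.
Proof.
move=> h; rewrite (fip_sum y (supp_uniq x)); last exact: mem_supp.
rewrite big1// => w _; have [->|/h ->] := eqVneq (x w) 0; first by rewrite mul0r.
by rewrite conjc0 mulr0.
Qed.

End FiniteSupport.
Arguments delta {R J P} w.
Arguments coef {R J P} f w : simpl never, rename.

(** * The iterated crossed product on decreasing words *)

Section CrossedProduct.
Variables (R : realType) (d : Order.disp_t) (X : orderType d).
Local Notation C := R[i].

(** Normal forms: b :: s stands for the product of s followed by the letter b, so the head of the
    list is the largest letter and the rightmost factor. Accordingly [consV b] is right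
    multiplication by b on elements below b. *)
Definition desc : pred (seq X) := sorted (fun a b : X => b < a)%O.
Arguments desc : simpl never.
Definition words := fspan R desc.
Definition wbelow (a : X) : pred (seq X) := all (fun c => c < a)%O.
Definition below a (x : words) := forall w, x w != 0 -> wbelow a w.

Implicit Types (a b c : X) (s w v : seq X) (x y z : words).

Lemma desc_cons b s : desc (b :: s) = wbelow b s && desc s.
Proof. by rewrite /desc /= path_sortedE// => y x z h1 h2; exact: lt_trans h1. Qed.

Lemma wbelow_le a b w : (a <= b)%O -> wbelow a w -> wbelow b w.
Proof. by move=> ab; apply: sub_all => c /= h; exact: lt_le_trans ab. Qed.

Lemma desc_wbelow a b s : (b < a)%O -> desc (b :: s) -> wbelow a (b :: s).
Proof.
move=> ba; rewrite desc_cons => /andP[h _] /=; rewrite ba.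
by apply: wbelow_le h; exact: ltW.
Qed.

Lemma below_le a b x : (a <= b)%O -> below a x -> below b x.
Proof. by move=> ab hx w /hx; exact: wbelow_le. Qed.

Lemma below_lin (V : lmodType C) (t : seq X -> V) (S : V -> Prop) a x :
  S 0 -> (forall (k : C) (u v : V), S u -> S v -> S (k *: u + v)) -> below a x ->
  (forall w, wbelow a w -> desc w -> S (t w)) -> S (lin t x).
Proof.
move=> S0 SD hx h; rewrite /lin; elim: (supp x) => [|w s IH]; first by rewrite big_nil.
rewrite big_cons; have [->|xw] := eqVneq (x w) 0; first by rewrite scale0r add0r.
by apply: (SD) => //; apply: h; [exact: hx|exact: coef_dom xw].
Qed.

Lemma below0 a : below a 0.
Proof. by move=> w; rewrite eqxx. Qed.

Lemma belowZD a k x y : below a x -> below a y -> below a (k *: x + y).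
Proof.
move=> hx hy w; rewrite coefD coefZ; have [->|/hx//] := eqVneq (x w) 0.
by rewrite mulr0 add0r; exact: hy.
Qed.

Lemma below_delta a w : wbelow a w -> below a (delta w).
Proof. by move=> h v; rewrite deltaE; case: ifP => [/andP[_ /eqP ->]|]; rewrite ?eqxx. Qed.

Lemma below_coef a x w : below a x -> ~~ wbelow a w -> x w = 0.
Proof. by move=> h; apply: contraNeq => /h. Qed.

Lemma head_not_below a b s : (a <= b)%O -> ~~ wbelow a (b :: s).
Proof. by move=> ab /=; rewrite ltNge ab. Qed.

Definition consV b x : words := lin (fun s => delta (b :: s)) x.

Lemma consV_linear b : linear_map (consV b). Proof. exact: lin_linear. Qed.

Lemma consV_delta b s : wbelow b s -> consV b (delta s) = delta (b :: s).
Proof.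
move=> bs; rewrite /consV; have [ds|ds] := boolP (desc s); first by rewrite lin_delta.
by rewrite !delta_out ?lin0// desc_cons negb_and ds orbT.
Qed.

Lemma consVE b x w : consV b x w =
  if w is c :: s then if (c == b) && desc w then x s else 0 else 0.
Proof.
rewrite {2}[x]fspan_expand /consV /lin coef_sum.
case: w => [|c s].
  by rewrite big1// => v _; rewrite coefZ deltaE andbF mulr0.
case: ifP => [/andP[/eqP -> h]|h].
  rewrite coef_sum; apply: eq_bigr => v _; rewrite !coefZ !deltaE eqseq_cons eqxx /=.
  case: eqP => [<-|]; rewrite ?andbF//.
  by rewrite h; move: h; rewrite desc_cons => /andP[_ ->].
rewrite big1// => v _; rewrite coefZ deltaE eqseq_cons.
case: ifP => [/and3P[h1 h2 /eqP h3]|]; last by rewrite mulr0.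
by move: h; rewrite h2 (eqP h2) h3 h1.
Qed.

Lemma consV_below a b x : (b < a)%O -> below b x -> below a (consV b x).
Proof.
move=> ba hx [|c s]; rewrite consVE ?eqxx//; case: ifP => [/andP[/eqP -> h] _|]; last by rewrite eqxx.
exact: desc_wbelow.
Qed.

Lemma fip_consV b x y : below b x -> fip (consV b x) (consV b y) = fip x y.
Proof.
move=> hx; apply: (@lmap_ext _ _ _ C^o (fun x => fip (consV b x) _) (fun x => fip x y)).
- exact: lmap_comp (fip_linear _) (consV_linear b).
- exact: fip_linear.
move=> w xw; rewrite (consV_delta (hx _ xw)) !fip_delta consVE eqxx desc_cons hx//=.
by rewrite (coef_dom xw).
Qed.

Variable th : X -> words -> words.

(** Left multiplication by the letter a, as the normal form dictates: a (s b) = (a s) b if a < b, a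
    s a = th a (s) if the head is a, and a w = th a (w) a if w lies below a. *)
Fixpoint Lb a w : words := if w is b :: s then
    if (a < b)%O then consV b (Lb a s) else if a == b then th a (delta s)
    else consV a (th a (delta w))
  else consV a (th a (delta [::])).

Definition L a x := lin (Lb a) x.
Fixpoint Lw w : words -> words := if w is b :: s then fun y => Lw s (L b y) else id.
Definition cmulw x y := lin (fun w => Lw w y) x.
Definition unitw : words := delta [::].
Fixpoint starb w : words := if w is b :: s then L b (starb s) else unitw.

Lemma conj_coefP x : (fun w => (x w)^*%C : C^o) \in finitely_supported desc.
Proof.
have [s [_ hs]] := supp_ex x; apply/mem_set; split=> [w|].
  by rewrite conjc_eq0; exact: coef_dom.
by exists s => w; rewrite conjc_eq0; exact: hs.
Qed.
Definition conjw x : words := Fspan (conj_coefP x).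
Definition starw x := lin starb (conjw x).

Lemma L_linear a : linear_map (L a). Proof. exact: lin_linear. Qed.
Lemma cmulw_linearl y : linear_map (cmulw ^~ y). Proof. exact: lin_linear. Qed.
Lemma Lw_linear w : linear_map (Lw w).
Proof. by elim: w => //= b s IH k x y; rewrite L_linear IH. Qed.
Lemma cmulw_linearr x : linear_map (cmulw x).
Proof.
move=> k y z; rewrite /cmulw /lin scaler_sumr -big_split; apply: eq_bigr => w _.
by rewrite Lw_linear scalerDr !scalerA mulrC.
Qed.

Lemma cmulw_delta w y : desc w -> cmulw (delta w) y = Lw w y.
Proof. exact: lin_delta. Qed.

(** The conditions under which the rewriting rules are consistent: each [th a] restricts to an
    involutive unital automorphism of the algebra below a that is isometric for [fip]. *)
Record good_family : Prop := GoodFamily {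
  th_lin : forall a, linear_map (th a) ;
  th_below : forall a x, below a x -> below a (th a x) ;
  th_unit : forall a, th a unitw = unitw ;
  th_mul : forall a x y, below a x -> below a y -> th a (cmulw x y) = cmulw (th a x) (th a y) ;
  th_inv : forall a x, below a x -> th a (th a x) = x ;
  th_fip : forall a x y, below a x -> below a y -> fip (th a x) (th a y) = fip x y }.

Hypothesis gd : good_family.

Lemma unit_below a : below a unitw. Proof. exact: below_delta. Qed.

Lemma L_gt a x : below a x -> L a x = consV a (th a x).
Proof.
move=> hx; apply: (lmap_ext (L_linear a) (lmap_comp (consV_linear a) (th_lin gd a))) => w xw.
rewrite /L (lin_delta _ (coef_dom xw)) /=; have := hx _ xw.
by case: w {xw} => //= b s /andP[ba _]; rewrite ltNge (ltW ba)/= gt_eqF.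
Qed.

Lemma L_eq a x : below a x -> L a (consV a x) = th a x.
Proof.
move=> hx; apply: (lmap_ext (lmap_comp (L_linear a) (consV_linear a)) (th_lin gd a)) => w xw.
rewrite /= (consV_delta (hx _ xw)) /L lin_delta/= ?ltxx ?eqxx//.
by rewrite desc_cons hx// (coef_dom xw).
Qed.

Lemma L_lt a b x : (a < b)%O -> below b x -> L a (consV b x) = consV b (L a x).
Proof.
move=> ab hx; apply: (lmap_ext (lmap_comp (L_linear a) (consV_linear b))
  (lmap_comp (consV_linear b) (L_linear a))) => w xw.
rewrite /= (consV_delta (hx _ xw)) /L !lin_delta/= ?ab// ?(coef_dom xw)//.
by rewrite desc_cons hx// (coef_dom xw).
Qed.

Lemma Lb_below a b w : (a < b)%O -> desc w -> wbelow b w -> below b (Lb a w).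
Proof.
elim: w b => [|c s IH] b ab; first by move=> _ _; apply: (consV_below ab); exact: th_below (unit_below a).
rewrite desc_cons => /andP[cs ds] /= /andP[cb bs]; have [ac|ca|ac] := ltgtP a c.
- by apply: (consV_below cb); exact: IH.
- by apply: (consV_below ab); apply: th_below => //; apply/below_delta/(desc_wbelow ca); rewrite desc_cons cs.
- by apply: (below_le (ltW ab)); apply: th_below => //; apply: below_delta; rewrite ac.
Qed.

Lemma L_below a b x : (a < b)%O -> below b x -> below b (L a x).
Proof.
move=> ab hx; apply: below_lin (below0 _) (@belowZD b) hx _ => w bw dw.
exact: Lb_below.
Qed.

Lemma Lw_below b w y : wbelow b w -> below b y -> below b (Lw w y).
Proof. by elim: w y => //= a s IH y /andP[ab bs] hy; apply: IH => //; exact: L_below. Qed.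

Lemma cmulw_below b x y : below b x -> below b y -> below b (cmulw x y).
Proof.
move=> hx hy; apply: below_lin (below0 _) (@belowZD b) hx _ => w bw _; exact: Lw_below.
Qed.

Lemma Lw_consV b w y : wbelow b w -> below b y -> Lw w (consV b y) = consV b (Lw w y).
Proof.
elim: w y => //= a s IH y /andP[ab bs] hy.
by rewrite (L_lt ab hy) IH//; exact: L_below.
Qed.

Lemma cmulw_consVr b x y : below b x -> below b y -> cmulw x (consV b y) = consV b (cmulw x y).
Proof.
move=> hx hy; apply: (lmap_ext (cmulw_linearl _) (lmap_comp (consV_linear b) (cmulw_linearl y))) => w xw.
by rewrite /= !cmulw_delta ?(coef_dom xw)// Lw_consV//; exact: hx.
Qed.

Lemma cmulw_consVl b x y : below b x -> cmulw (consV b x) y = cmulw x (L b y).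
Proof.
move=> hx; apply: (lmap_ext (lmap_comp (cmulw_linearl y) (consV_linear b)) (cmulw_linearl _)) => w xw.
have dw := coef_dom xw.
by rewrite /= (consV_delta (hx _ xw)) !cmulw_delta// desc_cons dw (hx _ xw).
Qed.

(** The cases are the branches of [Lb] for the letter a; above a larger head the property passes
    from the tail to the word. *)
Lemma word_ind3 (Q : seq X -> Prop) a :
  (forall w, wbelow a w -> desc w -> Q w) ->
  (forall s, wbelow a s -> desc s -> Q (a :: s)) ->
  (forall c s, (a < c)%O -> wbelow c s -> desc s -> Q s -> Q (c :: s)) ->
  forall w, desc w -> Q w.
Proof.
move=> Qb Qe Qg; elim=> [|c s IH]; first by move=> _; exact: Qb.
move=> dcs; move: (dcs); rewrite desc_cons => /andP[cs ds]; have [ac|ca|ac] := ltgtP a c.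
- by apply: Qg => //; exact: IH.
- by apply: Qb => //; exact: desc_wbelow.
- by rewrite -ac in cs *; exact: Qe.
Qed.

Lemma L_inv a x : L a (L a x) = x.
Proof.
apply: (lmap_ext (lmap_comp (L_linear a) (L_linear a)) (G := id)) => // w /coef_dom; move: w.
apply: (@word_ind3 _ a) => /=.
- move=> w aw dw; have hw := below_delta aw.
  by rewrite (L_gt hw) L_eq ?(th_inv gd)//; exact: th_below.
- move=> s sa ds; have hs := below_delta sa; rewrite -consV_delta//.
  by rewrite (L_eq hs) L_gt ?(th_inv gd)//; exact: th_below.
- move=> c s ac cs ds IH; have hs := below_delta cs; rewrite -consV_delta//.
  by rewrite !(L_lt ac) ?IH//; exact: L_below.
Qed.

Lemma L_cmulw_below a x y : below a x -> L a (cmulw x y) = cmulw (th a x) (L a y).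
Proof.
move=> hx; have htx := th_below gd hx.
apply: (lmap_ext (lmap_comp (L_linear a) (cmulw_linearr x))
  (lmap_comp (cmulw_linearr (th a x)) (L_linear a))) => w /coef_dom; move: w.
apply: (@word_ind3 _ a) => /=.
- move=> w aw dw; have hw := below_delta aw; have hxw := cmulw_below hx hw.
  rewrite (L_gt hxw) (L_gt hw) (th_mul gd)// cmulw_consVr//; exact: th_below.
- move=> s sa ds; have hs := below_delta sa; have hxw := cmulw_below hx hs.
  by rewrite -consV_delta// cmulw_consVr// !L_eq// (th_mul gd).
- move=> c s ac cs ds IH; have hs := below_delta cs.
  have hxc := below_le (ltW ac) hx; have htxc := below_le (ltW ac) htx.
  rewrite -consV_delta// cmulw_consVr// (L_lt ac (cmulw_below hxc hs)) IH (L_lt ac hs).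
  by rewrite cmulw_consVr//; exact: L_below.
Qed.

(** Associativity for a letter on the left. It reduces to the multiplicativity of [th a] through
    [L_cmulw_below] and to [L_inv]; peeling off letters then gives [cmulwA]. *)
Lemma L_cmulw a x y : L a (cmulw x y) = cmulw (L a x) y.
Proof.
apply: (lmap_ext (lmap_comp (L_linear a) (cmulw_linearl y))
  (lmap_comp (cmulw_linearl y) (L_linear a))) => w /coef_dom /= dw; move: w dw y.
apply: (@word_ind3 (fun w => forall y, _) a).
- move=> w aw dw y; have hw := below_delta aw.
  by rewrite (L_cmulw_below _ hw) (L_gt hw) cmulw_consVl//; exact: th_below.
- move=> s sa ds y; have hs := below_delta sa; rewrite -consV_delta//.
  by rewrite (cmulw_consVl _ hs) (L_cmulw_below _ hs) L_inv L_eq.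
- move=> c s ac cs ds IH y; have hs := below_delta cs; rewrite -consV_delta//.
  by rewrite (cmulw_consVl _ hs) IH (L_lt ac hs) cmulw_consVl//; exact: L_below.
Qed.

Lemma cmulwA x y z : cmulw x (cmulw y z) = cmulw (cmulw x y) z.
Proof.
apply: (lmap_ext (cmulw_linearl _)
  (lmap_comp (cmulw_linearl z) (cmulw_linearl y))) => w /coef_dom dw /=.
rewrite !cmulw_delta//; elim: w y {dw} => //= b s IH y.
by rewrite L_cmulw IH.
Qed.

Lemma cmul1w x : cmulw unitw x = x.
Proof. by rewrite cmulw_delta. Qed.

Lemma L_unit b : L b unitw = delta [:: b].
Proof. by rewrite (L_gt (unit_below b)) (th_unit gd) consV_delta. Qed.

Lemma Lw_unit w : desc w -> Lw w unitw = delta w.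
Proof.
elim: w => //= b s IH; rewrite desc_cons => /andP[bs ds].
by rewrite L_unit -consV_delta// Lw_consV// ?IH ?consV_delta//; exact: unit_below.
Qed.

Lemma cmulw1 x : cmulw x unitw = x.
Proof.
apply: (lmap_ext (cmulw_linearl _) (G := id)) => // w /coef_dom dw.
by rewrite cmulw_delta// Lw_unit.
Qed.

Lemma cmulw_letter a x : cmulw (delta [:: a]) x = L a x.
Proof. by rewrite cmulw_delta. Qed.

Lemma cmulw_letterr a x : below a x -> cmulw x (delta [:: a]) = consV a x.
Proof. by move=> hx; rewrite -[delta _]consV_delta// cmulw_consVr ?cmulw1//; exact: unit_below. Qed.

Lemma th_sa a x y : below a x -> below a y -> fip (th a x) y = fip x (th a y).
Proof.
by move=> hx hy; rewrite -{1}(th_inv gd hy) (th_fip gd)//; exact: th_below.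
Qed.

Lemma fip_head a x s : below a x -> fip x (delta (a :: s)) = 0.
Proof. by move=> hx; rewrite fip_coef (below_coef hx)// head_not_below. Qed.

(** Heads above a must agree on both sides, or both inner products vanish ([far]); equal ones cancel
    by [fip_consV]. The remaining pairs vanish on both sides or express that [th a] is self-adjoint
    ([th_sa]). *)
Lemma L_fip_basis a w v : desc w -> desc v -> fip (L a (delta w)) (delta v) = fip (delta w) (L a (delta v)).
Proof.
have sym x y u t : fip x y = 0 -> fip t u = 0 -> fip x y = fip u t.
  by move=> -> e; rewrite fip_conj e conjc0.
have far c s u : (a < c)%O -> wbelow c s -> (if u is c' :: _ then c' != c else true) -> desc u ->
    fip (L a (delta (c :: s))) (delta u) = 0 /\ fip (L a (delta u)) (delta (c :: s)) = 0.
  move=> ac cs cu du; rewrite -consV_delta// (L_lt ac (below_delta cs)); split.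
    by rewrite fip_coef consVE; case: u cu {du} => // c' s' /negbTE ->.
  rewrite consV_delta//; case: u cu du => [|c' s'] cu du.
    by apply: fip_head; apply: L_below => //; exact: unit_below.
  have [cc|cc|cc] := ltgtP c c'; last by rewrite cc eqxx in cu.
    move: (du); rewrite desc_cons => /andP[h _].
    rewrite -(consV_delta h) (L_lt (lt_trans ac cc) (below_delta h)) fip_coef consVE.
    by rewrite lt_eqF.
  by apply: fip_head; apply: L_below => //; apply: below_delta; exact: desc_wbelow.
move=> dw; move: w dw v; apply: (@word_ind3 (fun w => forall v, _) a) => [w aw dw|s as_ ds|c s ac cs ds IH].
- apply: (@word_ind3 (fun v => _) a) => [v av dv|s as_ ds|c s ac cs ds _].
  + rewrite !L_gt; [|exact: below_delta|exact: below_delta].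
    apply: sym; rewrite fip_coef consVE.
      by case: v av {dv} => // c s /= /andP[ca _]; rewrite lt_eqF.
    by case: w aw {dw} => // c s /= /andP[ca _]; rewrite lt_eqF.
  + have hw := below_delta aw; have hs := below_delta as_.
    rewrite -consV_delta// L_eq// (L_gt hw) fip_consV ?th_sa//; exact: th_below.
  + have dcs : desc (c :: s) by rewrite desc_cons cs.
    have [|h1 h2] := far c s w ac cs _ dw; last by exact: sym.
    by case: w aw {dw} => //= b t /andP[ba _]; rewrite lt_eqF// (lt_trans ba).
- apply: (@word_ind3 (fun v => _) a) => [v av dv|t at_ dt|c t ac ct dt _].
  + have hv := below_delta av; have hs := below_delta as_.
    by rewrite -consV_delta// L_eq// (L_gt hv) fip_consV ?th_sa//; exact: th_below.
  + have hs := below_delta as_; have ht := below_delta at_.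
    rewrite -!consV_delta// !L_eq// !consV_delta//.
    by apply: sym; apply: fip_head; exact: th_below.
  + have das : desc (a :: s) by rewrite desc_cons as_.
    by have [|h1 h2] := far c t (a :: s) ac ct _ das; [rewrite lt_eqF|exact: sym].
- move=> v dv; have hs := below_delta cs.
  have dcs : desc (c :: s) by rewrite desc_cons cs.
  have [[t et]|] := pselect (exists t, v = c :: t).
    move: dv; rewrite et desc_cons => /andP[ct dt].
    rewrite -!consV_delta// !(L_lt ac)//; try exact: below_delta.
    by rewrite !fip_consV ?IH//; [exact: L_below].
  move=> nv; have [|h1 h2] := far c s v ac cs _ dv; last exact: sym.
  by case: v nv {dv} => // c' t nv; apply/eqP => e; apply: nv; exists t; rewrite e.
Qed.

Lemma L_fip a x y : fip (L a x) y = fip x (L a y).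
Proof.
have H v : desc v -> forall x, fip (L a x) (delta v) = fip x (L a (delta v)).
  move=> dv z; apply: (@lmap_ext _ _ _ C^o (fun z => fip (L a z) (delta v)) (fun z => fip z _)).
  - exact: lmap_comp (fip_linear _) (L_linear a).
  - exact: fip_linear.
  by move=> w /coef_dom dw; exact: L_fip_basis.
rewrite fip_conj [RHS]fip_conj; congr (_^*%C).
apply: (@lmap_ext _ _ _ C^o (fun y => fip y (L a x)) (fun y => fip (L a y) x)).
- exact: fip_linear.
- exact: lmap_comp (fip_linear _) (L_linear a).
by move=> w /coef_dom dw /=; rewrite fip_conj H// -fip_conj.
Qed.

Lemma conjwZD k x y : conjw (k *: x + y) = k^*%C *: conjw x + conjw y.
Proof.
by apply: fspan_ext => w; rewrite coefD coefZ -[LHS]/((k * x w + y w)^*%C) cjD cjM.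
Qed.

Lemma starwZD k x y : starw (k *: x + y) = k^*%C *: starw x + starw y.
Proof. by rewrite /starw conjwZD (lin_linear starb). Qed.

Lemma starw_delta w : desc w -> starw (delta w) = starb w.
Proof.
move=> dw; rewrite /starw -(lin_delta starb dw); congr lin; apply: fspan_ext => v.
by rewrite -[LHS]/((delta w v)^*%C) deltaE; case: ifP; rewrite ?conjc0 ?conjc1.
Qed.

Lemma cmulw_adj x y z : fip (cmulw x y) z = fip y (cmulw (starw x) z).
Proof.
apply: (@lmap_ext _ _ _ C^o (fun x => fip (cmulw x y) z) (fun x => fip y (cmulw (starw x) z))).
- exact: lmap_comp (fip_linear _) (cmulw_linearl y).
- move=> k u v; rewrite starwZD (lmapD (cmulw_linearl z)) (lmapZ (cmulw_linearl z)).
  by rewrite (formDr (@fip_psd _ _ desc)) (formZr (@fip_psd _ _ desc)) conjcK.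
move=> w /coef_dom dw /=; rewrite starw_delta// cmulw_delta//.
elim: w y z {dw} => [|b s IH] y z /=; first by rewrite cmul1w.
by rewrite IH L_fip L_cmulw.
Qed.

(** [starw x] acts as the adjoint of left multiplication by x, and the form is nondegenerate;
    identities for the star thus follow from those for adjoints. *)
Lemma starwK x : starw (starw x) = x.
Proof.
rewrite -[LHS]cmulw1 -[RHS]cmulw1; apply: fip_nondeg => z.
by rewrite [RHS]cmulw_adj fip_conj [RHS]fip_conj [in RHS]cmulw_adj.
Qed.

Lemma cmulw_adjr x y z : fip (cmulw (starw x) y) z = fip y (cmulw x z).
Proof. by rewrite cmulw_adj starwK. Qed.

Lemma starwM x y : starw (cmulw x y) = cmulw (starw y) (starw x).
Proof.
rewrite -[LHS]cmulw1; apply: fip_nondeg => z.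
by rewrite cmulw_adjr cmulw_adjr -{1}[starw x]cmulw1 cmulw_adjr cmulwA.
Qed.

Lemma starb_below a w : wbelow a w -> below a (starb w).
Proof.
elim: w => [|b s IH] /=; first by move=> _; exact: unit_below.
by move=> /andP[ba /IH h]; exact: L_below.
Qed.

Lemma starw_below a x : below a x -> below a (starw x).
Proof.
move=> hx; apply: (below_lin (S := below a)) (below0 _) (@belowZD a) _ _ => [w|w aw _].
  by rewrite -[X in X != _]/((x w)^*%C) conjc_eq0; exact: hx.
exact: starb_below.
Qed.

Lemma starb_fip w v : desc w -> desc v -> fip (starb w) (starb v) = fip (delta w : words) (delta v).
Proof.
have far b s c t : (b < c)%O -> desc (b :: s) -> desc (c :: t) ->
    fip (starb (b :: s)) (starb (c :: t)) = 0.
  move=> bc db; rewrite desc_cons => /andP[ct dt].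
  rewrite /= -/(starb (b :: s)) (L_gt (starb_below ct)) fip_conj fip_orth ?conjc0// => u.
  rewrite consVE; case: u => [|e u]; rewrite ?eqxx//; case: ifP => [/andP[/eqP -> _] _|]; last by rewrite eqxx.
  by apply: (below_coef (starb_below (desc_wbelow bc db))); exact: head_not_below.
have nil c t : desc (c :: t) -> fip (starb [::]) (starb (c :: t)) = 0.
  rewrite desc_cons => /andP[ct dt].
  rewrite /= (L_gt (starb_below ct)) fip_delta consVE conjc0//.
elim: w v => [|b s IH] [|c t] dw dv //.
- by rewrite nil// fip_delta deltaE andbF conjc0.
- by rewrite fip_conj nil// fip_delta deltaE andbF conjc0.
have [bc|cb|bc] := ltgtP b c.
- by rewrite far// fip_delta deltaE eqseq_cons lt_eqF// andbF conjc0.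
- by rewrite fip_conj far// fip_delta deltaE eqseq_cons gt_eqF// andbF conjc0.
rewrite -bc in dv *; rewrite /= L_fip L_inv IH//; last 2 first.
  by move: dw; rewrite desc_cons => /andP[].
  by move: dv; rewrite desc_cons => /andP[].
rewrite !fip_delta !deltaE eqseq_cons eqxx dv.
by move: dv; rewrite desc_cons => /andP[_ ->].
Qed.

(** The star is an antiunitary of the inner product, because starred basis words are again
    orthonormal ([starb_fip]). This is the trace property in disguise ([trace_comm]). *)
Lemma starw_fip x y : fip (starw x) (starw y) = fip y x.
Proof.
have lin2 u : @linear_map R words C^o (fun z => fip u (starw z)).
  by move=> k v z; rewrite starwZD (formDr (@fip_psd _ _ desc)) (formZr (@fip_psd _ _ desc)) conjcK.
have H v z : desc v -> fip (starb v) (starw z) = fip z (delta v).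
  move=> dv; apply: (@lmap_ext _ _ _ C^o (fun z => fip (starb v) (starw z)) (fun z => fip z _)) => //.
    exact: fip_linear.
  move=> w /coef_dom dw; rewrite starw_delta// starb_fip// !fip_delta !deltaE dv dw eq_sym; exact: erefl.
refine (@lmap_ext _ _ _ C^o (fun u => fip (starw x) (starw u)) (fun u => fip u x) y _ _ _) => //.
  exact: fip_linear.
by move=> w /coef_dom dw; rewrite starw_delta// fip_conj H// -fip_conj.
Qed.

Lemma trace_comm x y : cmulw x y [::] = cmulw y x [::].
Proof.
have E u (v : words) : cmulw u v [::] = fip v (starw u) by rewrite -fip_coef cmulw_adj cmulw1.
by rewrite !E -[fip x _]starw_fip starwK.
Qed.

End CrossedProduct.

(** * Products below a letter depend only on the smaller automorphisms *)

Section Locality.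
Variables (R : realType) (d : Order.disp_t) (X : orderType d).
Local Notation words := (words R X).
Implicit Types (th : X -> words -> words) (a b : X) (x y : words).

Lemma Lb_local th th' a w : th a = th' a -> Lb th a w = Lb th' a w.
Proof. by move=> e; elim: w => /= [|b s ->]; rewrite e. Qed.

Lemma L_local th th' a : th a = th' a -> L th a = L th' a.
Proof.
by move=> e; apply/funext => x; rewrite /L; congr lin; apply/funext => w; exact: Lb_local.
Qed.

Lemma Lw_local th th' a w : (forall b, (b < a)%O -> th b = th' b) -> wbelow a w -> Lw th w = Lw th' w.
Proof.
move=> e; elim: w => //= b s IH /andP[ba /IH es].
by apply/funext => y; rewrite es (L_local (e b ba)).
Qed.

Lemma starb_local th th' a w : (forall b, (b < a)%O -> th b = th' b) -> wbelow a w ->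
  starb th w = starb th' w.
Proof. by move=> e; elim: w => //= b s IH /andP[ba /IH ->]; rewrite (L_local (e b ba)). Qed.

Lemma lin_local (J : choiceType) (P : pred J) (V : lmodType R[i]) (t t' : J -> V) (x : fspan R P) :
  (forall w, x w != 0 -> t w = t' w) -> lin t x = lin t' x.
Proof.
move=> h; rewrite /lin; apply: eq_bigr => w _.
by have [->|/h ->//] := eqVneq (x w) 0; rewrite !scale0r.
Qed.

Lemma cmulw_local th th' a x y : (forall b, (b < a)%O -> th b = th' b) -> below a x ->
  cmulw th x y = cmulw th' x y.
Proof. by move=> e hx; apply: lin_local => w /hx aw; rewrite (Lw_local e aw). Qed.

Lemma starw_local th th' a x : (forall b, (b < a)%O -> th b = th' b) -> below a x ->
  starw th x = starw th' x.
Proof.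
move=> e hx; apply: lin_local => w; rewrite -[X in X != _]/((x w)^*%C) conjc_eq0 => /hx aw.
exact: starb_local e aw.
Qed.

Record good_at th a : Prop := GoodAt {
  at_lin : linear_map (th a) ;
  at_below : forall x, below a x -> below a (th a x) ;
  at_unit : th a (unitw R X) = unitw R X ;
  at_mul : forall x y, below a x -> below a y ->
    th a (cmulw th x y) = cmulw th (th a x) (th a y) ;
  at_inv : forall x, below a x -> th a (th a x) = x ;
  at_fip : forall x y, below a x -> below a y -> fip (th a x) (th a y) = fip x y }.

Lemma good_familyP th : (forall a, good_at th a) <-> good_family th.
Proof.
split=> [h|[h1 h2 h3 h4 h5 h6] a]; last first.
  by split; [exact: h1|exact: h2|exact: h3|exact: h4|exact: h5|exact: h6].
by split=> a; [exact: at_lin|exact: at_below|exact: at_unit|exact: at_mul|exact: at_inv|exact: at_fip].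
Qed.

Lemma good_at_local th th' a : (forall b, (b <= a)%O -> th b = th' b) -> good_at th a -> good_at th' a.
Proof.
move=> e [h1 h2 h3 h4 h5 h6]; have el b : (b < a)%O -> th b = th' b by move=> /ltW/e.
have ea : th a = th' a by exact: e.
rewrite ea in h1 h2 h3 h4 h5 h6; split=> // x y hx hy.
by rewrite -(cmulw_local y el hx) -(cmulw_local (th' a y) el (h2 x hx)); exact: h4.
Qed.

Lemma good_at_id th a : th a = id -> good_at th a.
Proof. by move=> e; split; rewrite e. Qed.

(** Letters from a on act trivially. So the algebra below a belongs to a good family before [th a]
    has been chosen. *)
Definition trunc a th b := if (b < a)%O then th b else id.

Lemma trunc_lt a th b : (b < a)%O -> trunc a th b = th b.
Proof. by rewrite /trunc => ->. Qed.

Lemma good_trunc a th : (forall b, (b < a)%O -> good_at th b) -> good_family (trunc a th).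
Proof.
move=> h; apply/good_familyP => b; have [ba|ab] := boolP (b < a)%O.
  by apply: good_at_local (h b ba) => c cb; rewrite trunc_lt//; exact: le_lt_trans ba.
by apply: good_at_id; rewrite /trunc (negbTE ab).
Qed.

End Locality.

(** * Induction on the largest letter *)

Section Letters.
Variables (R : realType) (d : Order.disp_t) (X : orderType d).
Local Notation words := (words R X).
Local Notation C := R[i].
Implicit Types (a b : X) (x y z : words).

Definition belowS a x := forall w, x w != 0 -> all (fun c => c <= a)%O w.

Lemma lin_closed (V : lmodType C) (t : seq X -> V) (S : V -> Prop) x :
  S 0 -> (forall (k : C) (u v : V), S u -> S v -> S (k *: u + v)) -> (forall w, S (t w)) -> S (lin t x).
Proof.
move=> S0 SD h; rewrite /lin; elim: (supp x) => [|w s IH]; first by rewrite big_nil.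
by rewrite big_cons; apply: SD.
Qed.

Lemma belowS_split a x : belowS a x -> exists y z, [/\ below a y, below a z & x = y + consV a z].
Proof.
move=> hx; pose t1 w : words := if wbelow a w then delta w else 0.
pose t2 w : words := if w is c :: s then if (c == a) && wbelow a s then delta s else 0 else 0.
exists (lin t1 x), (lin t2 x); split.
- apply: lin_closed => [||w]; [exact: below0|exact: belowZD|].
  by rewrite /t1; case: ifP => [/below_delta|_]; [|exact: below0].
- apply: lin_closed => [||w]; [exact: below0|exact: belowZD|].
  case: w => [|c s]; rewrite /t2; first exact: below0.
  by case: ifP => [/andP[_ /below_delta]|_]; [|exact: below0].
apply: (lmap_ext (F := id) (G := fun x => lin t1 x + consV a (lin t2 x))) => //.
  by move=> k u v; rewrite !lin_linear consV_linear scalerDr addrACA.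
move=> w xw; have dw := coef_dom xw; rewrite !lin_delta// /t1 /t2.
have := hx _ xw; case: w dw {xw} => [|c s] dw; first by rewrite (lmap0 (consV_linear a)) addr0.
move=> /= /andP[]; rewrite le_eqVlt => /orP[/eqP ca _|ca].
  rewrite ca in dw *; rewrite ltxx eqxx add0r; move: dw; rewrite desc_cons => /andP[cs _].
  by rewrite cs/= consV_delta.
by have := desc_wbelow ca dw; rewrite /= ca => -> _; rewrite lt_eqF//= (lmap0 (consV_linear a)) addr0.
Qed.

Lemma max_letter x : (exists k : C, x = k *: unitw R X) \/
  exists a, belowS a x /\ exists2 w, x w != 0 & a \in w.
Proof.
pose l := flatten [seq w <- supp x | x w != 0].
have hl a : a \in l -> exists2 w, x w != 0 & a \in w.
  by move=> /flattenP[w]; rewrite mem_filter => /andP[xw _] aw; exists w.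
have lh w a : x w != 0 -> a \in w -> a \in l.
  by move=> xw aw; apply/flattenP; exists w => //; rewrite mem_filter xw mem_supp.
have [l0|[a [al ma]]] : l = [::] \/ exists a, a \in l /\ forall b, b \in l -> (b <= a)%O.
- elim: (l) => [|c r [->|[a [ar ma]]]]; [by left|right; exists c|right].
    by split=> [|b]; rewrite inE// => /eqP ->.
  have [ca|ac] := leP c a.
    by exists a; split=> [|b]; rewrite inE ?ar ?orbT// => /orP[/eqP -> //|/ma].
  exists c; split=> [|b]; rewrite inE ?eqxx// => /orP[/eqP -> //|/ma h].
  exact: le_trans h (ltW ac).
- left; exists (x [::]); apply: fspan_ext => -[|c s]; rewrite coefZ deltaE/= ?mulr1//.
  rewrite mulr0; apply/eqP; rewrite -[_ == _]negbK; apply/negP => h.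
  by have := lh _ c h (mem_head _ _); rewrite l0.
- right; exists a; split; last exact: hl.
  by move=> w xw; apply/allP => b /(lh _ _ xw)/ma.
Qed.

Lemma words_ind (wfX : well_founded (fun a b : X => (a < b)%O)) a0 (P : words -> Prop) :
  (forall x, below a0 x -> P x) ->
  (forall a, (a0 <= a)%O -> (forall x, below a x -> P x) -> forall x, belowS a x -> P x) ->
  forall x, P x.
Proof.
move=> P0 PS; have Pa : forall a x, belowS a x -> P x.
  elim/(well_founded_ind wfX) => a IH x hx; have [aa0|a0a] := ltP a a0.
    by apply: P0 => w /hx; apply: sub_all => c; move=> /le_lt_trans; apply.
  apply: (PS a) => // y hy; have [[k ->]|[b [hb [w yw bw]]]] := max_letter y.
    apply: P0 => w; rewrite coefZ; case: w => [//|c s]; rewrite deltaE/= mulr0.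
    by rewrite eqxx.
  by apply: (IH b) => //; have /allP := hy _ yw; apply.
move=> x; have [[k ->]|[b [hb _]]] := max_letter x; last exact: Pa hb.
apply: P0 => w; rewrite coefZ; case: w => [//|c s]; rewrite deltaE/= mulr0.
by rewrite eqxx.
Qed.

End Letters.

(** * The crossed product as an algebra with involution and trace *)

Definition crossed (R : realType) d (X : orderType d) (th : X -> words R X -> words R X)
  (gd : good_family th) : Type := words R X.

Section CrossedAlgebra.
Variables (R : realType) (d : Order.disp_t) (X : orderType d).
Local Notation words := (words R X).
Variables (th : X -> words -> words) (gd : good_family th).
Local Notation C := R[i].
Local Notation U := (crossed gd).

HB.instance Definition _ := GRing.Lmodule.on U.

Lemma unitw_neq0 : (unitw R X : U) != 0.
Proof.
apply/eqP => e; have : (unitw R X) [::] = 0 by rewrite [unitw _ _]e.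
by rewrite deltaE => /eqP; rewrite oner_eq0.
Qed.

HB.instance Definition _ := @GRing.Zmodule_isNzRing.Build U (unitw R X) (cmulw th)
  (cmulwA gd) (cmul1w th) (cmulw1 gd)
  (fun x y z => lmapD (cmulw_linearl th z) x y) (fun x y z => lmapD (cmulw_linearr th x) y z)
  unitw_neq0.
HB.instance Definition _ := @GRing.Lmodule_isLalgebra.Build C U
  (fun k x y => esym (lmapZ (cmulw_linearl th y) k x)).
HB.instance Definition _ := @GRing.Lalgebra_isAlgebra.Build C U
  (fun k x y => esym (lmapZ (cmulw_linearr th x) k y)).

Let starD : {morph (starw th : U -> U) : x y / x + y}.
Proof. by move=> x y; have := starwZD th 1 x y; rewrite conjc1 !scale1r. Qed.
Let starZ (k : C) (x : U) : (starw th (k *: x) : U) = k^*%C *: (starw th x : U).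
Proof.
have s0 : starw th 0 = 0.
  have /eqP := starwZD th 1 0 0; rewrite conjc1 scaler0 addr0 scale1r.
  by rewrite -subr_eq subrr eq_sym => /eqP.
by have := starwZD th k x 0; rewrite s0 !addr0; apply.
Qed.

HB.instance Definition _ := @isStarAlgebra.Build R U (starw th) starD starZ (starwM gd) (starwK gd).

Implicit Types (a b : X) (x y z : U).

Lemma crossed_mulE x y : x * y = cmulw th x y. Proof. by []. Qed.
Lemma crossed_adjE x : adj x = starw th x. Proof. by []. Qed.

Definition lam a : U := delta [:: a].

Lemma below_subalg a : subalg (below a : U -> Prop).
Proof.
split; first exact: unit_below.
- by move=> x y hx hy; have := belowZD (k := 1) hx hy; rewrite scale1r.
- by move=> k x hx; have := belowZD (k := k) hx (below0 a); rewrite addr0.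
- by move=> x y; exact: cmulw_below.
- by move=> x; exact: starw_below.
Qed.

Lemma lam_below a b : (a < b)%O -> below b (lam a).
Proof. by move=> ab; apply: below_delta; rewrite /= ab. Qed.

Lemma lam_mulr a x : below a x -> x * lam a = consV a x.
Proof. by move=> hx; rewrite crossed_mulE cmulw_letterr. Qed.

Lemma lam_symmetry a : symmetry (lam a).
Proof.
split; first by rewrite crossed_adjE starw_delta//= L_unit.
by rewrite crossed_mulE cmulw_letter /lam -(L_unit gd) L_inv.
Qed.

Lemma lam_comm a x : below a x -> lam a * x = (th a x : U) * lam a.
Proof.
by move=> hx; rewrite lam_mulr; [rewrite crossed_mulE cmulw_letter (L_gt gd)|exact: th_below].
Qed.

Lemma belowS_decomp a x : belowS a x -> exists y z, [/\ below a y, below a z & x = y + z * lam a].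
Proof. by move=> /belowS_split[y [z [hy hz ->]]]; exists y, z; rewrite lam_mulr. Qed.

Lemma th_starw a x : below a x -> th a (adj x) = adj (th a x : U).
Proof.
move=> hx; have [al ll] := lam_symmetry a.
have hax : below a (adj x) := starw_below gd hx.
have htx : below a (th a x) := th_below gd hx.
have E y : below a y -> (th a y : U) = lam a * y * lam a.
  by move=> hy; rewrite lam_comm// -mulrA ll mulr1.
by rewrite (E _ hax) (E _ hx) !adjM al mulrA.
Qed.

Definition tau x : C := x [::].

Lemma tauC x y : tau (x * y) = tau (y * x). Proof. exact: trace_comm. Qed.

Lemma tau_fip x y : tau (adj y * x) = fip x y.
Proof.
rewrite /tau -fip_coef -[adj y * x]/(cmulw th (starw th y) x) (cmulw_adjr gd).
by rewrite -[delta [::]]/(unitw R X) cmulw1.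
Qed.

Variable h : U -> C.
Hypothesis lh : @linear_map R U C^o h.
Variable a0 : X.

Definition expects a := (forall y, below a y -> h (y * lam a) = 0) \/
  (forall x, below a x -> th a x = x) /\ (forall y, below a y -> h (y * lam a) = h y).

Hypothesis wfX : well_founded (fun a b : X => (a < b)%O).

Lemma posfun_letters : h 1 = 1 -> (forall x, below a0 x -> 0 <= h (adj x * x)) ->
  (forall a, (a0 <= a)%O -> expects a) -> posfun h.
Proof.
move=> h1 h0 hs; split=> //; [exact: lmapD lh|exact: lmapZ lh|].
apply: (words_ind wfX (a0 := a0)) => // a aa IH x /belowS_decomp[y [z [hy hz ->]]].
have [al ll] := lam_symmetry a; have sA := below_subalg a.
have hyz := subM sA (subJ sA hy) hz; have hzy := subM sA (subJ sA hz) hy.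
have htz : below a (th a z : U) := th_below gd hz.
have htzy : below a (th a (adj z * y) : U) := th_below gd hzy.
have e1 : lam a * (adj z * z) * lam a = adj (th a z : U) * (th a z : U).
  have hzz := subM sA (subJ sA hz) hz.
  rewrite (lam_comm hzz).
  rewrite -mulrA ll mulr1 -[adj z * z]/(cmulw th (starw th z) z) (th_mul gd (starw_below gd hz) hz).
  by rewrite -[starw th z]/(adj z) th_starw.
have E : adj (y + z * lam a) * (y + z * lam a) =
    (adj y * y + adj (th a z : U) * (th a z : U)) + (adj y * z * lam a + (th a (adj z * y) : U) * lam a).
  rewrite adjD adjM al mulrDl !mulrDr -e1 -(lam_comm hzy) !mulrA.
  by rewrite -!addrA; congr (_ + _); rewrite [RHS]addrC addrA.
have hD := lmapD lh; rewrite E hD [X in _ + X]hD hD.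
have p1 := IH _ hy; have p2 := IH _ htz.
case: (hs a aa) => [h0'|[tid hid]].
  by rewrite !h0'// addr0 addr0 addr_ge0.
rewrite !hid//; move: p2; rewrite !tid// => p2.
have := IH _ (subD sA hy hz); rewrite adjD mulrDl !mulrDr !hD.
by rewrite [X in 0 <= _ + X]addrC addrACA.
Qed.

End CrossedAlgebra.

Lemma symmetryM (R : realType) (U : starAlgType R) (u v : U) :
  symmetry u -> symmetry v -> u * v = v * u -> symmetry (u * v).
Proof.
move=> [au uu] [av vv] c; split; first by rewrite adjM au av c.
by rewrite -mulrA (mulrA v) -c -mulrA vv mulr1 uu.
Qed.

(* [u P = P] makes [1 - P] dominate [1 - specproj u]. *)
Lemma gnsnorm_specproj (R : realType) (U : starAlgType R) (f : U -> R[i]) (u P : U) :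
  posfun f -> symmetry u -> u * P = P -> gnsnorm f (1 - specproj u) <= gnsnorm f (1 - P).
Proof.
move=> pf hu uP; have hq := projC (specproj_proj hu).
have e : (1 - specproj u) * P = 0.
  by rewrite mulrBl mul1r /specproj -scalerAl mulrDl mul1r uP halfZ subrr.
have -> : 1 - specproj u = (1 - specproj u) * (1 - P) by rewrite [RHS]mulrBr mulr1 e subr0.
exact: gnsnorm_proj.
Qed.

(** * Adjoining the symmetry that implements a tower *)

Section TowerStep.
Variables (R : realType) (U : starAlgType R).
Local Notation C := R[i].
Implicit Types (x y z c : U) (h : U -> C).
Variables (S : U -> Prop) (f : U -> C).
Variables (A : nat -> U -> Prop) (r u v p : nat -> U).
Hypothesis pf : posfun f.
Hypothesis tw : tower S f A r u v p.

Lemma tower_subalg n : subalg (A n).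
Proof. exact: matalg_subalg (tw_mat tw n). Qed.

Lemma tower_mono m n x : (m <= n)%N -> A m x -> A n x.
Proof. by move=> /subnK <- h; elim: (n - m)%N => // k IH; exact: tw_incr tw _ _ IH. Qed.

Lemma tower_common x y : S x -> S y -> exists n, A n x /\ A n y.
Proof.
move=> /(tw_exh tw)[m hm] /(tw_exh tw)[n hn]; exists (maxn m n).
by split; [apply: tower_mono hm|apply: tower_mono hn]; rewrite ?leq_maxl ?leq_maxr.
Qed.

Lemma tower_seq (L : seq U) n0 : (forall x, x \in L -> S x) ->
  exists2 n, (n0 <= n)%N & forall x, x \in L -> A n x.
Proof.
elim: L => [|y L IH] h; first by exists n0.
have [n n0n hn] := IH (fun x xL => h x (@mem_behead _ (y :: L) x xL)).
have [m hm] := tw_exh tw (h y (mem_head _ _)).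
exists (maxn m n); first by rewrite (leq_trans n0n)// leq_maxr.
move=> x; rewrite inE => /orP[/eqP ->|/hn hx]; last by apply: tower_mono hx; exact: leq_maxr.
by apply: tower_mono hm; exact: leq_maxl.
Qed.

Definition wprod := fix w n : U := if n is m.+1 then w m * v m else 1.

Lemma tower_v_sym n : symmetry (v n). Proof. by case: (tw_qubit tw n). Qed.
Lemma tower_u_sym n : symmetry (u n). Proof. by case: (tw_qubit tw n). Qed.

Lemma wprod_mem n : A n (wprod n).
Proof.
elim: n => [|n IH]; first exact: sub1 (tower_subalg 0).
apply: subM; [exact: tower_subalg|exact: tw_incr tw _ _ IH|by case: (tw_mem tw n)].
Qed.

Lemma wprodSl n : wprod n.+1 = v n * wprod n.
Proof. by case: (tw_comm tw n) => _ cv _; rewrite /= cv//; exact: wprod_mem. Qed.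

Lemma wprod_sym n : symmetry (wprod n).
Proof.
elim: n => [|n IH]; first by split; rewrite /= ?adj1 ?mulr1.
by apply: symmetryM IH (tower_v_sym n) _; rewrite -wprodSl.
Qed.

Lemma wprod_sqr n : wprod n * wprod n = 1. Proof. by case: (wprod_sym n). Qed.

(** The factors v_k with k >= m commute with A_m and cancel, so the conjugations have a pointwise
    limit on the union of the tower. *)
Lemma wprod_stable m n x : (m <= n)%N -> A m x ->
  wprod n * x * wprod n = wprod m * x * wprod m.
Proof.
move=> /subnK <- hx; elim: (n - m)%N => // k IH.
have hk : A (k + m)%N x by apply: tower_mono hx; exact: leq_addl.
case: (tw_comm tw (k + m)) => _ cv _; rewrite addSn {2}wprodSl /= -(mulrA (wprod _)) cv//.
rewrite !mulrA -(mulrA (wprod _ * x)); have [_ ->] := tower_v_sym (k + m); rewrite mulr1.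
exact: IH.
Qed.

Let q n := v n * p n * v n.

Lemma wprod_p n : wprod n.+1 * p n * wprod n.+1 = q n.
Proof.
case: (tw_comm tw n) => _ _ cp; rewrite {1}wprodSl /=.
transitivity (v n * (wprod n * (p n * wprod n)) * v n); first by rewrite !mulrA.
by rewrite (cp _ (wprod_mem n)) (mulrA (wprod n)) wprod_sqr mul1r.
Qed.

(** u fixes p on both sides and anticommutes with v, so p v p = - p v p. *)
Lemma tower_pq n : p n * q n = 0.
Proof.
have [ap pp] := tw_proj tw n; have up := tw_fix tw n.
have [[au _] _ anti] := tw_qubit tw n.
have pu : p n * u n = p n by rewrite -[LHS]adjK adjM ap au up ap.
suff e : p n * v n * p n = 0 by rewrite /q !mulrA e mul0r.
have : p n * v n * p n = - (p n * v n * p n).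
  transitivity (p n * v n * (u n * p n)); first by rewrite up.
  rewrite !mulrA -(mulrA (p n)) -[v n * u n]opprK -anti.
  by rewrite mulrN mulNr mulrA pu.
by move/eqP; rewrite -subr_eq0 opprK -mulr2n -scaler_nat scaler_eq0 pnatr_eq0 => /eqP.
Qed.

Variable l : U.
Hypothesis hl : symmetry l.
Hypothesis hw : forall n x, A n x -> l * x = wprod n * x * wprod n * l.

Lemma tower_twist n x : A n x -> (wprod n * l) * x = x * (wprod n * l).
Proof.
by move=> hx; rewrite -mulrA (hw hx) !mulrA wprod_sqr mul1r.
Qed.

Lemma tower_twist_sym n : symmetry (wprod n * l).
Proof.
by apply: symmetryM (wprod_sym n) hl _; rewrite (hw (wprod_mem n)) wprod_sqr mul1r.
Qed.

(** [wprod n * l] commutes with A_n, but l also carries the next factor v_n, which changes the sign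
    of u_n. So l lies in A_n tensor M_2, from which [tower_locally_matricial] follows. *)
Lemma tower_twist_qubit n : qubit (u n) (wprod n * l).
Proof.
have [hu hv anti] := tw_qubit tw n; have [_ vv] := hv.
split=> //; first exact: tower_twist_sym.
have [hAu _ _] := tw_mem tw n; case: (tw_comm tw n) => cu _ _.
have key : wprod n.+1 * u n * wprod n.+1 = - u n.
  rewrite {1}wprodSl /=; transitivity (v n * (wprod n * (u n * wprod n)) * v n); first by rewrite !mulrA.
  rewrite cu; last exact: wprod_mem.
  rewrite (mulrA (wprod n)) wprod_sqr mul1r -[v n * u n]opprK -anti mulNr -mulrA vv mulr1.
  by [].
rewrite -(mulrA (wprod n) l) (hw hAu) key mulNr mulrN opprK !mulrA cu//; exact: wprod_mem.
Qed.

Lemma tower_q_twist n : l * p n = q n * l.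
Proof. by have [_ _ hp] := tw_mem tw n; rewrite (hw hp) wprod_p. Qed.

Lemma tower_v_twist n : l * v n = v n * l.
Proof.
have [_ hv _] := tw_mem tw n; rewrite (hw hv); congr (_ * _).
have [_ vv] := tower_v_sym n.
transitivity (wprod n * (v n * v n) * (wprod n * v n)); first by rewrite /= !mulrA.
by rewrite vv mulr1 mulrA wprod_sqr mul1r.
Qed.

(** Conjugation by l changes the sign of u_n through v_n and that of u_(n+1) through v_(n+1); the
    product is unchanged. *)
Lemma tower_uu_twist n : l * (u n * u n.+1) = u n * u n.+1 * l.
Proof.
have [hAu hAv _] := tw_mem tw n; have [hAu1 hAv1 _] := tw_mem tw n.+1.
have [cu cv _] := tw_comm tw n; have [cu1 cv1 _] := tw_comm tw n.+1.
have hu : A n.+2 (u n * u n.+1) by apply: subM => //; [exact: tower_subalg|exact: tw_incr tw _ _ hAu].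
rewrite (hw hu); congr (_ * _).
have [_ [_ vv] anti] := tw_qubit tw n; have [_ [_ vv1] anti1] := tw_qubit tw n.+1.
have vuv m : v m * u m * v m = - u m.
  have [_ [_ wv] a] := tw_qubit tw m.
  by rewrite -[v m * u m]opprK -a mulNr -mulrA wv mulr1.
have e1 : v n.+1 * (u n * u n.+1) * v n.+1 = - (u n * u n.+1).
  transitivity (u n * (v n.+1 * u n.+1 * v n.+1)); last by rewrite vuv mulrN.
  by rewrite !mulrA (cv1 _ hAu).
have e2 : v n * (u n * u n.+1) * v n = - (u n * u n.+1).
  transitivity ((v n * u n * v n) * u n.+1); last by rewrite vuv mulNr.
  by rewrite -!mulrA (cu1 _ hAv).
have e3 : wprod n * (u n * u n.+1) * wprod n = u n * u n.+1.
  have hwn := wprod_mem n; have hwn1 : A n.+1 (wprod n) by exact: tw_incr tw _ _ hwn.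
  transitivity (wprod n * (u n * (u n.+1 * wprod n))); first by rewrite !mulrA.
  by rewrite (cu1 _ hwn1) (mulrA (u n)) (cu _ hwn) !mulrA wprod_sqr mul1r.
rewrite {1}(wprodSl n.+1) (wprodSl n) -[wprod n.+2]/(wprod n * v n * v n.+1).
transitivity (v n.+1 * (v n * (wprod n * (u n * u n.+1) * wprod n) * v n) * v n.+1); first by rewrite !mulrA.
by rewrite e3 e2 mulrN mulNr e1 opprK.
Qed.

Variable S' : U -> Prop.
Hypothesis hS' : subalg S'.
Hypothesis SS' : forall x, S x -> S' x.
Hypothesis S'l : S' l.
Hypothesis S'dec : forall x, S' x -> exists y z, [/\ S y, S z & x = y + z * l].

Lemma tower_dec_seq (L : seq U) n0 : (forall x, x \in L -> S' x) ->
  exists2 n, (n0 <= n)%N & forall x, x \in L -> exists y z, [/\ A n y, A n z & x = y + z * l].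
Proof.
elim: L => [|x L IH] h; first by exists n0.
have [n n0n hn] := IH (fun y yL => h y (@mem_behead _ (x :: L) y yL)).
have [y [z [Sy Sz e]]] := S'dec (h x (mem_head _ _)).
have [m [hy hz]] := tower_common Sy Sz.
have m1 : (m <= maxn m n)%N by exact: leq_maxl.
have n1 : (n <= maxn m n)%N by exact: leq_maxr.
exists (maxn m n); first exact: leq_trans n1.
move=> t; rewrite inE => /orP[/eqP ->|/hn [y' [z' [hy' hz' e']]]].
  by exists y, z; split=> //; [exact: tower_mono hy|exact: tower_mono hz].
by exists y', z'; split=> //; [exact: tower_mono hy'|exact: tower_mono hz'].
Qed.

Lemma tower_eps_small (e : R) : 0 < e -> exists n0, forall n, (n0 <= n)%N -> tower_eps R n + tower_eps R n <= e.
Proof.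
move=> e0; have e2 : 0 < e / 2 by lra.
have [N hN] := null_geom (1 / 16) e2; exists N => n /hN; rewrite -/(tower_eps R n); lra.
Qed.

Lemma tower_locally_matricial : locally_matricial S' f.
Proof.
move=> L e LS' e0; have [n0 hn0] := tower_eps_small e0.
have [n n0n hn] := tower_dec_seq n0 LS'.
have [cu _ _] := tw_comm tw n; have [Su Sv _] := tw_mem tw n.
have [A' [mA' AA' A'u A'w minA']] := matalg_qubit (tw_mat tw n) (tower_twist_qubit n) cu (@tower_twist n).
have sA' := matalg_subalg mA'; have [_ ll] := hl.
have AS' x : A n x -> S' x by move=> /(tw_sub tw)/SS'.
have A'l : A' l.
  by rewrite -[l]mul1r -(wprod_sqr n) -mulrA; apply: subM => //; apply: AA'; exact: wprod_mem.
exists A', (r n * specproj (u n)); split=> //.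
- apply: (minA' S' hS' AS'); first by apply: SS'; exact: (tw_sub tw Su).
  by apply: subM => //; apply: AS'; exact: wprod_mem.
- move=> x /hn[y [z [hy hz ->]]]; apply: subD => //; first exact: AA'.
  by apply: subM => //; exact: AA'.
have [_ ar rr] := matalg_r (tw_mat tw n).
apply: le_trans (gnsnormM1 pf _ (Projection ar rr)) _; apply: le_trans (hn0 n n0n).
apply: lerD (tw_r tw n) _; apply: le_trans (gnsnorm_specproj pf (tower_u_sym n) (tw_fix tw n)) _.
exact: tw_p tw n.
Qed.

(** u_n anticommutes with l, but u_n u_(n+1) and v_n commute with l and with A_n and anticommute
    with each other. The projection p_(n+1) p_n witnesses that f is almost 1 on the positive part of
    u_n u_(n+1). *)
Lemma tower_free_qubits : free_qubits S' f.
Proof.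
move=> L e LS' e0; have [n0 hn0] := tower_eps_small e0.
have [n n0n hn] := tower_dec_seq n0 LS'.
have [hAu hAv hAp] := tw_mem tw n; have [hAu1 _ _] := tw_mem tw n.+1.
have [cu cv cp] := tw_comm tw n; have [cu1 cv1 cp1] := tw_comm tw n.+1.
have [hu hv anti] := tw_qubit tw n; have [hu1 _ _] := tw_qubit tw n.+1.
have huu : symmetry (u n * u n.+1) by apply: symmetryM => //; rewrite cu1.
have inc x : A n x -> A n.+1 x := @tw_incr _ _ _ _ _ _ _ _ _ tw n x.
exists (u n * u n.+1), (v n); split.
- split; apply: SS'; last exact: (tw_sub tw hAv).
  have h1 := tw_incr tw hAu; apply: (tw_sub tw (n := n.+2)).
  by apply: subM => //; exact: tower_subalg.
- split=> //; rewrite -mulrA cu1// mulrA anti mulNr -mulrA.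
  by [].
- move=> x /hn[y [z [hy hz ->]]].
  have cuu t : A n t -> u n * u n.+1 * t = t * (u n * u n.+1).
    by move=> ht; rewrite -mulrA (cu1 _ (inc _ ht)) mulrA (cu _ ht) mulrA.
  split.
    rewrite mulrDr mulrDl cuu//; congr (_ + _).
    by rewrite mulrA cuu// -(mulrA z) -tower_uu_twist [LHS]mulrA.
  rewrite mulrDr mulrDl cv//; congr (_ + _).
  by rewrite mulrA cv// -(mulrA z) -tower_v_twist [LHS]mulrA.
have hfix : (u n * u n.+1) * (p n.+1 * p n) = p n.+1 * p n.
  rewrite mulrA -(mulrA (u n)) (tw_fix tw n.+1) -cp1// -mulrA (tw_fix tw n).
  by [].
apply: le_trans (gnsnorm_specproj pf huu hfix) _; apply: le_trans (gnsnormM1 pf _ (tw_proj tw n.+1)) _.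
apply: le_trans (hn0 n n0n); apply: lerD (tw_p tw n).
by apply: le_trans (tw_p tw n.+1) _; rewrite tower_epsS; have := tower_eps_gt0 R n; lra.
Qed.

(* [p c l p = c p (v p v) l = 0] for [c] in [A n]. *)
Lemma tower_state_extension h c : posfun h -> (forall x, S x -> h x = f x) -> S c -> h (c * l) = 0.
Proof.
move=> ph hf Sc; have [n0 hc] := tw_exh tw Sc.
have hp n := gns_psd ph.
pose K := gnsnorm h (c * l) + gnsnorm h (adj (c * l)).
have bound n : (n0 <= n)%N -> nr (h (c * l)) <= tower_eps R n * K.
  move=> n0n; have cn := tower_mono n0n hc; have [_ _ cp] := tw_comm tw n.
  have [ap pp] := tw_proj tw n; have [_ _ hAp] := tw_mem tw n.
  have z0 : p n * (c * l) * p n = 0.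
    transitivity (p n * c * (l * p n)); first by rewrite !mulrA.
    rewrite tower_q_twist (cp _ cn); transitivity (c * (p n * q n) * l); first by rewrite !mulrA.
    by rewrite tower_pq mulr0 mul0r.
  have S1p : S (1 - p n).
    apply: (tw_sub tw (n := n.+1)); have sA := tower_subalg n.+1; apply: subB => //; exact: sub1.
  have hN : gnsnorm h (1 - p n) <= tower_eps R n.
    rewrite (_ : gnsnorm h _ = gnsnorm f (1 - p n)) ?(tw_p tw n)//.
    rewrite /gnsnorm /qn /gnsform hf//; have sA := tower_subalg n.+1.
    have A1p : A n.+1 (1 - p n) by apply: subB => //; exact: sub1.
    by apply: (tw_sub tw (n := n.+1)); apply: subM => //; exact: subJ.
  have [aq qq] := projC (tw_proj tw n).
  have e x : p n * x * p n = 0 -> h x = h (adj (1 - p n) * x) + h (adj (adj x * p n) * (1 - p n)).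
    move=> x0; rewrite -(pfD ph); congr h; rewrite aq adjM adjK ap mulrBl mul1r mulrBr mulr1.
    by rewrite x0 subr0 subrK.
  rewrite (e _ z0); apply: le_trans (nrD _ _) _; rewrite [X in _ <= X]mulrDr; apply: lerD.
    apply: le_trans (form_CS (gns_psd ph) (c * l) (1 - p n)) _.
    by rewrite mulrC ler_wpM2r// qn_ge0.
  apply: le_trans (form_CS (gns_psd ph) (1 - p n) (adj (c * l) * p n)) _.
  rewrite ler_pM ?qn_ge0//; have [al _] := hl.
  have sA := tower_subalg n; have cj : A n (adj c) by exact: subJ.
  rewrite adjM al -mulrA -(cp _ cj) -!/(gnsnorm h _) !(gnsnorm_sym ph _ hl).
  exact: gnsnorm_proj (tw_proj tw n).
have K0 : 0 <= K by rewrite addr_ge0// gnsnorm_ge0.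
apply/nr_le0; rewrite leNgt; apply/negP => h0.
have h1 : 0 < nr (h (c * l)) / (K + 1) by rewrite divr_gt0//; lra.
have [m hm] := tower_eps_small h1; have := bound (maxn n0 m) (leq_maxl _ _).
have := hm (maxn n0 m) (leq_maxr _ _); set t := tower_eps R _.
have t0 : 0 < t by exact: tower_eps_gt0.
rewrite ler_pdivlMr; last by lra.
by nra.
Qed.
End TowerStep.

(** * The order of letters: omega followed by omega_1 *)

Definition letter (W : Type) : Type := (nat + W)%type.
HB.instance Definition _ (W : choiceType) := Choice.copy (letter W) (nat + W)%type.

Fact letter_display : Order.disp_t. Proof. exact: (Order.Disp tt tt). Qed.

Section LetterOrder.
Variables (d : Order.disp_t) (W : orderType d).

Definition le_letter (x y : letter W) := match x, y with
  | inl m, inl n => (m <= n)%N | inl _, inr _ => true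
  | inr _, inl _ => false | inr a, inr b => (a <= b)%O end.
Definition lt_letter (x y : letter W) := (y != x) && le_letter x y.
Definition meet_letter (x y : letter W) := if lt_letter x y then x else y.
Definition join_letter (x y : letter W) := if lt_letter x y then y else x.

Lemma le_letter_anti : antisymmetric le_letter.
Proof.
move=> [m|a] [n|b] //= h; first by congr inl; apply/eqP; rewrite eqn_leq.
by congr inr; apply: le_anti.
Qed.

Lemma le_letter_trans : transitive le_letter.
Proof.
by move=> [m|a] [n|b] [k|c] //=; [exact: leq_trans|exact: le_trans].
Qed.

Lemma le_letter_total : total le_letter.
Proof. by move=> [m|a] [n|b] //=; [exact: leq_total|exact: le_total]. Qed.

HB.instance Definition _ := @Order.isOrder.Build letter_display (letter W)
  le_letter lt_letter meet_letter join_letter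
  (fun _ _ => erefl) (fun _ _ => erefl) (fun _ _ => erefl)
  le_letter_anti le_letter_trans le_letter_total.

Local Notation X := (letter W).

Lemma lt_inl m n : ((inl m : X) < inl n)%O = (m < n)%N.
Proof.
rewrite lt_def -[X in _ && X]/(m <= n)%N ltn_neqAle eq_sym; congr (~~ _ && _).
Qed.
Lemma lt_inlr m (a : W) : ((inl m : X) < inr a)%O. Proof. by []. Qed.
Lemma lt_inrl m (a : W) : ((inr a : X) < inl m)%O = false.
Proof. by rewrite lt_def -[X in _ && X]/false andbF. Qed.
Lemma lt_inr (a b : W) : ((inr a : X) < inr b)%O = (a < b)%O.
Proof. by rewrite !lt_def. Qed.
Lemma le_inr (a b : W) : ((inr a : X) <= inr b)%O = (a <= b)%O.
Proof. by []. Qed.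
Lemma le_inl m n : ((inl m : X) <= inl n)%O = (m <= n)%N.
Proof. by []. Qed.

Lemma letter_wf : well_founded (fun a b : W => (a < b)%O) ->
  well_founded (fun a b : X => (a < b)%O).
Proof.
move=> wf; have hn n : Acc (fun a b : X => (a < b)%O) (inl n).
  elim/ltn_ind: n => n IH; constructor => -[m|a]; last by rewrite lt_inrl.
  by rewrite lt_inl => /IH.
move=> [n|a]; first exact: hn.
elim/(well_founded_ind wf): a => a IH; constructor => -[m|b]; first by move=> _; exact: hn.
by rewrite lt_inr => /IH.
Qed.
End LetterOrder.

(** * The finite letters: an infinite tensor product of 2 x 2 matrices *)

Section BaseLetters.
Variables (R : realType) (d : Order.disp_t) (W : orderType d).
Local Notation C := R[i].
Local Notation X := (letter W).
Local Notation words := (words R X).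
Implicit Types (x y z : words) (n m : nat) (w s : seq X) (c : X).

(** An odd letter anticommutes with its predecessor and commutes with all other smaller letters; an
    even letter commutes with all smaller ones. Thus 2k and 2k+1 form the k-th qubit. *)
Definition chi n w : C := if odd n && ((inl n.-1 : X) \in w) then -1 else 1.

Lemma chi_sqr n w : chi n w * chi n w = 1.
Proof. by rewrite /chi; case: ifP => _; rewrite ?mulrNN mulr1. Qed.

Lemma chi_conj n w : (chi n w)^*%C = chi n w.
Proof. by rewrite /chi; case: ifP => _; rewrite ?cjN conjc1. Qed.

Lemma chi_cons n c s : desc (c :: s) -> chi n (c :: s) = chi n [:: c] * chi n s.
Proof.
rewrite desc_cons => /andP[/allP cs _]; rewrite /chi !inE.
case: (odd n) => /=; last by rewrite mulr1.
have [e|_] := eqVneq (inl n.-1 : X) c; last by rewrite mul1r.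
by rewrite e; case: ifP => [/cs|]; rewrite ?ltxx ?mulr1.
Qed.

Lemma chi_neq0 n w : chi n w != 0.
Proof. by rewrite /chi; case: ifP => _; rewrite ?oppr_eq0 oner_neq0. Qed.

Lemma sgnwP n x : (fun w => chi n w * x w : C^o) \in finitely_supported (fun w : seq X => desc w).
Proof.
have [s [_ hs]] := supp_ex x; apply/mem_set; split=> [w|].
  by rewrite mulf_eq0 negb_or => /andP[_]; exact: coef_dom.
by exists s => w; rewrite mulf_eq0 negb_or => /andP[_]; exact: hs.
Qed.
Definition sgnw n x : words := Fspan (sgnwP n x).

Lemma sgnwE n x w : sgnw n x w = chi n w * x w. Proof. by []. Qed.

Lemma sgnw_linear n : linear_map (sgnw n).
Proof.
move=> k x y; apply: fspan_ext => w; rewrite sgnwE !coefD !coefZ !sgnwE mulrDr.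
by rewrite mulrCA.
Qed.

Lemma sgnw_below n c x : below c x -> below c (sgnw n x).
Proof. by move=> hx w; rewrite sgnwE mulf_eq0 negb_or => /andP[_ /hx]. Qed.

Lemma sgnw_inv n x : sgnw n (sgnw n x) = x.
Proof. by apply: fspan_ext => w; rewrite !sgnwE mulrA chi_sqr mul1r. Qed.

Lemma sgnw_comm n m x : sgnw n (sgnw m x) = sgnw m (sgnw n x).
Proof. by apply: fspan_ext => w; rewrite !sgnwE mulrCA. Qed.

Lemma sgnw_unit n : sgnw n (unitw R X) = unitw R X.
Proof.
apply: fspan_ext => w; rewrite sgnwE deltaE; case: ifP => [/andP[_ /eqP ->]|]; last by rewrite mulr0.
by rewrite /chi in_nil andbF mulr1.
Qed.

Lemma sgnw_delta n w : sgnw n (delta w) = chi n w *: (delta w : words).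
Proof.
apply: fspan_ext => v; rewrite sgnwE coefZ deltaE.
by case: ifP => [/andP[_ /eqP ->]//|]; rewrite !mulr0.
Qed.

Lemma sgnw_fip n x y : fip (sgnw n x) (sgnw n y) = fip x y.
Proof.
rewrite (fip_sum (x := x) y (supp_uniq x)); last exact: mem_supp.
rewrite (fip_sum (x := sgnw n x) _ (supp_uniq x)) => [|w]; last first.
  by rewrite sgnwE mulf_eq0 negb_or => /andP[_ /mem_supp].
by apply: eq_bigr => w _; rewrite !sgnwE cjM chi_conj mulrACA chi_sqr mul1r.
Qed.

Lemma sgnw_consV n c x : sgnw n (consV c x) = chi n [:: c] *: consV c (sgnw n x).
Proof.
apply: fspan_ext => -[|b s]; rewrite sgnwE coefZ !consVE ?mulr0//.
case: ifP => [/andP[/eqP -> h]|]; rewrite ?mulr0//.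
by rewrite sgnwE mulrA (chi_cons _ h).
Qed.

Section SignLetter.
Variables (th : X -> words -> words) (gd : good_family th) (m : nat).
Hypothesis hm : th (inl m) = sgnw m.

Lemma sgnw_L n y : sgnw n (L th (inl m) y) = chi n [:: (inl m : X)] *: L th (inl m) (sgnw n y).
Proof.
have lL := L_linear th (inl m).
apply: (lmap_ext (F := fun y => sgnw n (L th (inl m) y))
   (G := fun y => chi n [:: (inl m : X)] *: L th (inl m) (sgnw n y))).
- exact: lmap_comp (sgnw_linear n) lL.
- by move=> k u v; rewrite sgnw_linear lL scalerDr !scalerA (mulrC k).
move=> w /coef_dom; move: w; apply: (@word_ind3 _ X _ (inl m : X)).
- move=> w aw dw; have hw : below (inl m : X) (delta w : words) := below_delta aw.
  by rewrite (L_gt gd hw) (L_gt gd (sgnw_below hw)) hm sgnw_consV sgnw_comm.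
- move=> s sa ds; have hs : below (inl m : X) (delta s : words) := below_delta sa.
  rewrite -consV_delta// (L_eq gd hs) sgnw_consV (lmapZ lL) (L_eq gd (sgnw_below hs)) hm.
  by rewrite scalerA chi_sqr scale1r sgnw_comm.
- move=> c s ac cs ds IH; have hs : below c (delta s : words) := below_delta cs.
  rewrite -consV_delta// (L_lt th ac hs) !sgnw_consV IH (lmapZ lL) (L_lt th ac (sgnw_below hs)).
  by rewrite (lmapZ (consV_linear c)) !scalerA mulrC.
Qed.
End SignLetter.

(** The sign [chi n] is multiplicative along words, so it defines an automorphism. The induction on
    n is strong because the product below n involves the smaller letters, which have to be good
    already. *)
Lemma base_good_at th : (forall m, th (inl m : X) = sgnw m) -> forall n, good_at th (inl n).
Proof.
move=> hth n; elim/ltn_ind: n => n IH.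
have gd : good_family (trunc (inl n : X) th).
  by apply: good_trunc => -[m|a]; rewrite ?lt_inrl// lt_inl => /IH.
have ht b : (b < (inl n : X))%O -> trunc (inl n : X) th b = th b by move=> h; rewrite trunc_lt.
split; rewrite hth.
- exact: sgnw_linear.
- by move=> x; exact: sgnw_below.
- exact: sgnw_unit.
- move=> x y hx hy; rewrite -(cmulw_local y ht hx) -(cmulw_local _ ht (sgnw_below hx)).
  set T := trunc _ _ in gd ht *.
  apply: (lmap_ext (F := fun x => sgnw n (cmulw T x y)) (G := fun x => cmulw T (sgnw n x) (sgnw n y))).
  + exact: lmap_comp (sgnw_linear n) (cmulw_linearl T y).
  + exact: lmap_comp (cmulw_linearl T _) (sgnw_linear n).
  move=> w xw; have dw := coef_dom xw; have aw := hx _ xw.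
  rewrite sgnw_delta (lmapZ (cmulw_linearl T _)) !cmulw_delta//.
  elim: w {xw hx x} dw aw y hy => [|c s IHs] dw aw y hy /=.
    by rewrite /chi in_nil andbF scale1r.
  move: (dw) (aw); rewrite desc_cons => /andP[cs ds] /= /andP[cn sn].
  case: c dw aw cs cn => [m|a]; last by rewrite lt_inrl.
  move=> dw aw cs cn; have hm : T (inl m) = sgnw m by rewrite ht// hth.
  rewrite IHs//; last exact: L_below.
  by rewrite (sgnw_L gd hm) (lmapZ (Lw_linear T s)) scalerA (chi_cons n dw) mulrC.
- by move=> x _; exact: sgnw_inv.
- by move=> x y _ _; exact: sgnw_fip.
Qed.

Section BaseState.
Variables (th : X -> words -> words) (gd : good_family th).
Hypothesis hth : forall m, th (inl m) = sgnw m.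
Local Notation U := (crossed gd).
Local Notation lam := (lam gd).

Definition evenl c := if c is inl n then ~~ odd n else false.
(** On the finite letters this is the product of the pure states at which the even letters take the
    value 1; it vanishes on words containing any letter of another kind. *)
Definition fstate x : C := lin (fun w => (all evenl w)%:R : C^o) x.

Lemma fstate_linear : @linear_map R words C^o fstate.
Proof. exact: lin_linear. Qed.

Lemma fstate_consV c x : below c x -> fstate (consV c x) = (evenl c)%:R * fstate x.
Proof.
move=> hx; apply: (@lmap_ext R _ _ C^o (fun x => fstate (consV c x)) (fun x => (evenl c)%:R * fstate x) x).
- exact: lmap_comp fstate_linear (consV_linear c).
- by move=> k u v; rewrite fstate_linear mulrDr /GRing.scale/= mulrCA.
move=> w xw; have dw := coef_dom xw; rewrite consV_delta; last exact: hx.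
rewrite /fstate !lin_delta//; last by rewrite desc_cons dw andbT; exact: hx.
by rewrite /=; case: (evenl c); rewrite ?mul1r ?mul0r.
Qed.

Lemma fstate_lam c (x : U) : below c x -> fstate (x * lam c) = (evenl c)%:R * fstate x.
Proof. by move=> hx; rewrite lam_mulr// fstate_consV. Qed.

Lemma fstate1 : fstate (1 : U) = 1.
Proof. by rewrite -[1]/(unitw R X) /fstate lin_delta. Qed.

Hypothesis wf : well_founded (fun a b : W => (a < b)%O).

Lemma below0_scalar x : below (inl 0 : X) x -> x = x [::] *: unitw R X.
Proof.
move=> hx; apply: fspan_ext => -[|c s]; rewrite coefZ deltaE/= ?mulr1// mulr0.
by apply: (below_coef hx); case: c => [m|a] /=; rewrite ?lt_inl ?lt_inrl.
Qed.

(** Even letters fall under the second alternative of [expects], all others under the first. *)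
Lemma fstate_posfun : posfun (fstate : U -> C).
Proof.
apply: (@posfun_letters R _ X th gd fstate fstate_linear (inl 0) (letter_wf wf) fstate1) => [x|c _].
- move=> /below0_scalar ->; set k := x [::].
  rewrite -[unitw R X]/(1 : U) adjZ adj1 -scalerAl mul1r scalerA.
  by rewrite (lmapZ fstate_linear) fstate1 /GRing.scale/= mulr1 mulrC; exact: mul_conjC_ge0.
case: (boolP (evenl c)) => hc; last by left => y hy; rewrite fstate_lam// (negbTE hc) mul0r.
right; split=> [x hx|y hy]; last by rewrite fstate_lam// hc mul1r.
case: c hc hx => // n /= hn _; rewrite hth; apply: fspan_ext => w.
by rewrite sgnwE /chi (negbTE hn) mul1r.
Qed.

Definition base x := exists n, below (inl n : X) x.

Lemma base_sgn k x : below (inl k.*2 : X) x -> sgnw k.*2.+1 x = x.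
Proof.
move=> hx; apply: fspan_ext => w; rewrite sgnwE; have [->|/hx /allP aw] := eqVneq (x w) 0.
  by rewrite mulr0.
by rewrite /chi; case: ifP => [/andP[_ /aw]|]; rewrite ?mul1r//= ltxx.
Qed.

Lemma base_even k x : sgnw k.*2 x = x.
Proof. by apply: fspan_ext => w; rewrite sgnwE /chi odd_double mul1r. Qed.

Lemma base_qubit k : qubit (lam (inl k.*2)) (lam (inl k.*2.+1)).
Proof.
have h : below (inl k.*2.+1 : X) (lam (inl k.*2)) by apply: lam_below; rewrite lt_inl.
split; [exact: lam_symmetry|exact: lam_symmetry|].
rewrite (lam_comm h) hth -[lam (inl k.*2)]/(delta [:: (inl k.*2 : X)] : words) sgnw_delta.
by rewrite /chi /= odd_double inE eqxx scaleN1r mulNr opprK.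
Qed.

Lemma base_comm k (x : U) : below (inl k.*2 : X) x ->
  lam (inl k.*2) * x = x * lam (inl k.*2) /\ lam (inl k.*2.+1) * x = x * lam (inl k.*2.+1).
Proof.
move=> hx; have hx' : below (inl k.*2.+1 : X) x by apply: below_le hx; rewrite le_inl.
by rewrite (lam_comm hx) (lam_comm hx') !hth base_even base_sgn.
Qed.

Lemma base_specproj k : gnsnorm (fstate : U -> C) (1 - specproj (lam (inl k.*2))) = 0.
Proof.
have pf := fstate_posfun; have hZ := lam_symmetry gd (inl k.*2).
have e := gnsnorm_proj_sqr pf (specproj_proj hZ).
have fZ : fstate (lam (inl k.*2)) = 1.
  rewrite -[lam _]mul1r fstate_lam; last exact: unit_below.
  by rewrite /= odd_double mul1r fstate1.
have fP : fstate (specproj (lam (inl k.*2))) = 1.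
  by rewrite /specproj (pfZ pf) (pfD pf) fZ (pf1 pf) -[X in _ * X = _]/(2 : C) mulVf ?pnatr_eq0.
rewrite fP /= in e; apply/eqP; rewrite -sqrf_eq0; apply/eqP; lra.
Qed.

(** Each pair of letters is adjoined by [matalg_qubit]. On these algebras f is exactly, not just
    approximately, the pure state of the minimal projection. *)
Lemma base_matalg k : exists (A : U -> Prop) (r : U), [/\ matalg A r,
  forall x, A x <-> below (inl k.*2 : X) x & gnsnorm (fstate : U -> C) (1 - r) = 0].
Proof.
have pf := fstate_posfun.
elim: k => [|k [A [r [mA AE fr]]]].
  exists (below (inl 0 : X)), 1; split => //; last first.
    by rewrite subrr; exact: (qn0 (gns_psd pf)).
  exists unit, (fun=> 1); split; last by move=> _; exact: unit_below.
  split.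
  - by move=> [] []; rewrite adj1 mulr1 eqxx scale1r.
  - by rewrite (big_pred1 tt) ?adj1 ?mulr1// => -[].
  move=> x; split=> [/below0_scalar ex|[c ->]].
    exists (fun _ _ => x [::]); rewrite {1}ex (big_pred1 tt); last by case.
    by rewrite (big_pred1 tt) ?adj1 ?mulr1//; case.
  rewrite (big_pred1 tt); last by case.
  rewrite (big_pred1 tt); last by case.
  by rewrite adj1 mulr1; apply: subZ (below_subalg gd _) _ _ _; exact: unit_below.
have lez : ((inl k.*2 : X) <= inl k.*2.+2)%O by rewrite le_inl; lia.
have le1 : ((inl k.*2 : X) < inl k.*2.+1)%O by rewrite lt_inl.
have le2 : ((inl k.*2.+1 : X) < inl k.*2.+2)%O by rewrite lt_inl.
have [||A' [mA' AA' A'u A'v minA']] := matalg_qubit mA (base_qubit k).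
- by move=> x /AE/base_comm[].
- by move=> x /AE/base_comm[].
have sA' := matalg_subalg mA'.
exists A', (r * specproj (lam (inl k.*2))); split=> // [x|].
  split.
    apply: (minA' _ (below_subalg gd (inl k.*2.+2))).
    - by move=> y /AE; exact: below_le.
    - by apply: lam_below; exact: lt_trans le2.
    - exact: lam_below.
  rewrite doubleS => hx.
  have [|y [z [hy hz ->]]] := @belowS_decomp _ _ _ _ gd (inl k.*2.+1) x.
    move=> w /hx; apply: sub_all => -[m|a]; last by rewrite lt_inrl.
    by rewrite lt_inl ltnS.
  have dec t : below (inl k.*2.+1 : X) t -> A' t.
    move=> ht; have [|y' [z' [hy' hz' ->]]] := @belowS_decomp _ _ _ _ gd (inl k.*2) t.
      move=> w /ht; apply: sub_all => -[m|a]; last by rewrite lt_inrl.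
      by rewrite lt_inl ltnS.
    by apply: subD => //; [apply/AA'/AE|apply: subM => //; apply/AA'/AE].
  by apply: subD => //; [exact: dec|apply: subM => //; exact: dec].
apply/eqP; rewrite eq_le gnsnorm_ge0 andbT.
have [_ ar rr] := matalg_r mA.
by apply: le_trans (gnsnormM1 pf _ (Projection ar rr)) _; rewrite fr base_specproj addr0.
Qed.

Lemma base_seq (L : seq U) : (forall x : U, x \in L -> base x) ->
  exists k, forall x : U, x \in L -> below (inl k.*2 : X) x.
Proof.
elim: L => [|y L IH] h; first by exists 0%N.
have [k hk] := IH (fun x xL => h x (@mem_behead _ (y :: L) x xL)).
have [n hn] := h y (mem_head _ _); exists (maxn k n) => x; rewrite inE => /orP[/eqP ->|/hk].
  by apply: below_le hn; rewrite le_inl; lia.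
by apply: below_le; rewrite le_inl; lia.
Qed.

Variable S : U -> Prop.
Hypothesis baseS : forall x, base x -> S x.

Lemma base_locally_matricial (L : seq U) (eps : R) :
  (forall x : U, x \in L -> base x) -> 0 < eps -> exists (A : U -> Prop) (r : U),
  [/\ matalg A r, forall x : U, A x -> S x, forall x : U, x \in L -> A x &
      gnsnorm (fstate : U -> C) (1 - r) <= eps].
Proof.
move=> /base_seq[k hk] e0; have [A [r [mA AE fr]]] := base_matalg k.
exists A, r; split=> //; last by rewrite fr ltW.
  by move=> x /AE hx; apply: baseS; exists k.*2.
by move=> x /hk/AE.
Qed.

Lemma base_free_qubits (L : seq U) (eps : R) :
  (forall x : U, x \in L -> base x) -> 0 < eps -> exists u v : U,
  [/\ S u /\ S v, qubit u v, forall x : U, x \in L -> u * x = x * u /\ v * x = x * v &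
      gnsnorm (fstate : U -> C) (1 - specproj u) <= eps].
Proof.
move=> /base_seq[k hk] e0; exists (lam (inl k.*2)), (lam (inl k.*2.+1)); split.
- by split; apply: baseS; exists k.*2.+2; apply: lam_below; rewrite lt_inl.
- exact: base_qubit.
- by move=> x /hk/base_comm.
- by rewrite base_specproj ltW.
Qed.

End BaseState.
End BaseLetters.

(** * Combinatorics of omega_1 *)

Lemma countable_img (T T' : Type) (f : T -> T') (A : set T) : countable A -> countable (f @` A).
Proof. exact: sub_countable (card_image_le f A). Qed.

Lemma countable_setU (T : Type) (A B : set T) : countable A -> countable B -> countable (A `|` B).
Proof.
move=> cA cB; have -> : A `|` B = \bigcup_(b in [set: bool]) (if b then A else B).
  apply/seteqP; split=> x; first by case=> h; [exists true|exists false].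
  by case=> -[] _ h; [left|right].
by apply: bigcup_countable => // -[].
Qed.

(** Recursion with a nondependent functional: G is handed a total function but is insensitive to its
    values not below a, where [dft] is filled in. *)
Lemma wf_rec (W T : Type) (lt : W -> W -> Prop) (wf : well_founded lt) (dft : T)
    (G : W -> (W -> T) -> T) :
  (forall a u v, (forall b, lt b a -> u b = v b) -> G a u = G a v) ->
  exists F : W -> T, forall a, F a = G a F.
Proof.
move=> loc; pose ext a (rec : forall b, lt b a -> T) b :=
  match pselect (lt b a) with left h => rec b h | right _ => dft end.
pose F := Fix wf (fun=> T) (fun a rec => G a (ext a rec)).
exists F => a; rewrite /F Fix_eq => [|x f g fg].
  by apply: loc => b ba; rewrite /ext; case: pselect.
congr G; apply/funext => b; rewrite /ext; case: pselect => // h; exact: fg.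
Qed.

Section Omega1.
Variables (d : Order.disp_t) (W : orderType d).
Hypothesis hW : is_omega1 W.

Lemma omega1_min (P : W -> Prop) : (exists a, P a) -> exists a, P a /\ forall b, P b -> (a <= b)%O.
Proof.
have [wo _ _] := hW; move=> [a Pa].
have [|z [[Pz minz] _]] := wo (fun a => `[< P a >]).
  by exists a; rewrite unfold_in; apply/asboolP.
exists z; split; first by move: Pz; rewrite unfold_in => /asboolP.
by move=> b Pb; apply: minz; rewrite unfold_in; apply/asboolP.
Qed.

Lemma omega1_wf : well_founded (fun a b : W => (a < b)%O).
Proof.
move=> a; apply: contrapT => na.
have [b [nb minb]] := omega1_min (ex_intro (fun a => ~ Acc (fun a b : W => (a < b)%O) a) a na).
apply: nb; constructor => c cb; apply: contrapT => /minb.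
by rewrite leNgt cb.
Qed.

Lemma omega1_countable_le (a : W) : countable [set b : W | (b <= a)%O].
Proof.
have [_ _ cI] := hW; have -> : [set b : W | (b <= a)%O] = [set b | (b < a)%O] `|` [set a].
  apply/seteqP; split=> b /=; first by rewrite le_eqVlt => /orP[/eqP ->|]; [right|left].
  by case=> [/ltW|->].
by apply: countable_setU.
Qed.

Lemma omega1_bound (A : set W) : countable A -> exists a, forall b, A b -> (b < a)%O.
Proof.
move=> cA; have [_ nW _] := hW; apply: contrapT => h; apply: nW.
have : countable (\bigcup_(b in A) [set c : W | (c <= b)%O]).
  by apply: bigcup_countable => // b _; exact: omega1_countable_le.
apply: sub_countable; apply: subset_card_le => a _.
apply: contrapT => na; apply: h; exists a => b Ab; rewrite ltNge; apply/negP => ab.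
by apply: na; exists b.
Qed.

Lemma omega1_inh : exists a : W, True.
Proof.
have [_ nW _] := hW; apply: contrapT => h; apply: nW.
have -> : [set: W] = set0 by apply/seteqP; split=> // a _; apply: h; exists a.
exact: countable0.
Qed.

Definition above (A : set W) : W := xget (projT1 (cid omega1_inh)) [set a | forall b, A b -> (b < a)%O].

Lemma aboveP A b : countable A -> A b -> (b < above A)%O.
Proof.
by move=> cA; apply: (@xgetPex _ _ [set a | forall b, A b -> (b < a)%O] (omega1_bound cA)).
Qed.

Lemma lt_above1 a : (a < above [set a])%O.
Proof. by apply: aboveP => //; exact: countable1. Qed.

(** Each a receives an increasing sequence of values that starts above all the values given to
    smaller elements; these are countably many, hence bounded. *)
Lemma omega1_pairing : exists h : W -> nat -> W, forall a b m n, h a m = h b n -> a = b /\ m = n.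
Proof.
have [a0 _] := omega1_inh.
pose G a (u : W -> nat -> W) (n : nat) :=
  iter n (fun c => above [set c]) (above [set c | exists b k, (b < a)%O /\ c = u b k]).
have [a u v uv|h hh] := wf_rec omega1_wf (fun=> a0) (G := G).
  apply/funext => n; rewrite /G; congr (iter n _ (above _)); apply/seteqP.
  by split=> c [b [k [ba ->]]]; exists b, k; rewrite uv.
have inc a m n : (m < n)%N -> (h a m < h a n)%O.
  elim: n => // n IH; rewrite ltnS leq_eqVlt => /orP[/eqP ->|/IH mn].
    by rewrite hh /G iterS; exact: lt_above1.
  by apply: lt_trans mn _; rewrite hh /G iterS; exact: lt_above1.
have far a b m n : (a < b)%O -> (h a m < h b n)%O.
  move=> ab; suff h0 : (h a m < h b 0%N)%O.
    by case: n => // n; apply: lt_trans h0 _; exact: inc.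
  have -> : h b 0%N = G b h 0%N by rewrite -hh.
  rewrite /G /=; apply: aboveP; last by exists a, m.
  have [_ _ cI] := hW.
  apply: (@sub_countable _ _ _ (\bigcup_(c in [set c | (c < b)%O]) (h c @` setT))); last first.
    apply: bigcup_countable => [|c _]; first exact: cI.
    exact: countable_img.
  by apply: subset_card_le => c [e [k [eb ->]]]; exists e => //; exists k.
exists h => a b m n e; have [ab|ba|ab] := ltgtP a b.
- by have := far _ _ m n ab; rewrite e ltxx.
- by have := far _ _ n m ba; rewrite e ltxx.
split=> //; rewrite -ab in e; have [mn|nm|//] := ltngtP m n.
- by have := inc a _ _ mn; rewrite e ltxx.
- by have := inc a _ _ nm; rewrite e ltxx.
Qed.

Section Closing.
Variables (T : choiceType) (Ts : W -> set T) (h : T -> W).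
Hypothesis mono : forall a b, (a <= b)%O -> Ts a `<=` Ts b.
Hypothesis cTs : forall a, countable (Ts a).
Hypothesis contTs : forall a, (exists b, (b < a)%O) ->
  (forall b, (b < a)%O -> exists c, (b < c)%O /\ (c < a)%O) ->
  forall t, Ts a t -> exists b, (b < a)%O /\ Ts b t.

(** Starting anywhere, pass omega times beyond the h-values of the current set. At the least upper
    bound c of the iterates each element of [Ts c] already occurs below c by continuity, so its
    h-value has been passed. *)
Lemma club_closing : club [set a | forall t, Ts a t -> (h t < a)%O].
Proof.
split=> [a|a lim1 lim2]; last first.
  move=> t /contTs[||b [ba Tb]] //.
    by move=> b /lim2[c [_ bc ca]]; exists c.
  have [c [Cc bc ca]] := lim2 _ ba.
  by apply: lt_trans ca; apply: Cc; apply: mono Tb; exact: ltW.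
pose nxt c := above ([set c] `|` h @` Ts c).
have cN c : countable ([set c] `|` h @` Ts c).
  by apply: countable_setU => //; exact: countable_img.
have n1 c : (c < nxt c)%O by apply: aboveP => //; left.
have n2 c t : Ts c t -> (h t < nxt c)%O by move=> Tt; apply: aboveP => //; right; exists t.
pose s n := iter n nxt (nxt a).
have [b0 hb0] : exists b, forall n, (s n < b)%O.
  have [|b hb] := @omega1_bound (s @` setT); first exact: countable_img.
  by exists b => n; apply: hb; exists n.
have [c [hc minc]] := omega1_min (ex_intro (fun b => forall n, (s n < b)%O) b0 hb0).
have lim b : (b < c)%O -> exists n, (b < s n)%O.
  move=> bc; apply: contrapT => nb; have : (c <= b)%O; last by rewrite leNgt bc.
  apply: minc => n; rewrite lt_neqAle; apply/andP; split.
    apply/eqP => e; apply: nb; exists n.+1; rewrite -e; exact: n1.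
  by rewrite leNgt; apply/negP => h1; apply: nb; exists n.
exists c; last by apply: lt_trans (n1 a) (hc 0%N).
move=> t /contTs[||b [bc Tb]].
- by exists (s 0%N).
- by move=> b /lim[n bn]; exists (s n).
have [n bn] := lim _ bc.
by apply: lt_trans (hc n.+1); apply: n2; apply: mono Tb; exact: ltW.
Qed.
End Closing.

Local Notation X := (letter W).

Definition enc (f : W -> nat) (c : X) : nat + nat :=
  match c with inl m => inl m | inr b => inr (f b) end.

Lemma enc_inj (f : W -> nat) (A : set W) (s t : seq X) : {in A &, injective f} ->
  (forall b, inr b \in s -> A b) -> (forall b, inr b \in t -> A b) ->
  map (enc f) s = map (enc f) t -> s = t.
Proof.
move=> fi; elim: s t => [|c s IH] [|e t] //= hs ht [ce est]; congr (_ :: _); last first.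
  by apply: IH => // b hb; [apply: hs|apply: ht]; rewrite inE hb orbT.
case: c e ce hs ht {est} => [m|b] [n|b'] //=; first by case=> ->.
case=> e hs ht; congr inr; apply: fi => //; rewrite inE; [apply: hs|apply: ht]; exact: mem_head.
Qed.

Definition topW (a0 : W) (w : seq X) : W :=
  foldr (fun c m => if c is inr b then Order.max b m else m) a0 w.

Lemma topWP a0 w b : inr b \in w -> (b <= topW a0 w)%O.
Proof.
elim: w => //= c w IH; rewrite inE => /orP[/eqP <-|/IH h]; first by rewrite le_max lexx.
by case: c => // b'; rewrite le_max h orbT.
Qed.

(** With this coding a functional on words becomes a subset of omega_1. A word is coded by a bound
    on its letters together with a natural number, found by means of an enumeration of the ordinals
    up to the bound; [omega1_pairing] merges the two. *)
Lemma word_coding : exists kappa : seq X -> nat -> W,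
  forall w v m n, kappa w m = kappa v n -> w = v /\ m = n.
Proof.
have [a0 _] := omega1_inh; have [h hh] := omega1_pairing.
have cf (a : W) : exists f : W -> nat, {in [set b | (b <= a)%O] &, injective f}.
  by have /countable_injP := omega1_countable_le a.
have [f hf] := choice cf.
exists (fun w n => h (topW a0 w) (pickle (map (enc (f (topW a0 w))) w, n))) => w v m n /hh[e].
rewrite -e => /(pcan_inj (@pickleK _))[ew ->]; split=> //.
apply: (enc_inj (hf (topW a0 w))) ew => b /=; first exact: topWP.
by rewrite e; exact: topWP.
Qed.

(** Finite lists of words below a, paired with an index n that will stand for the tolerance
    1/(n+1). *)
Definition listW (a : W) : set (seq (seq X) * nat) :=
  [set t : seq (seq X) * nat | forall w, w \in t.1 -> wbelow (inr a : X) w].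

Lemma listW_countable a : countable (listW a).
Proof.
have [_ _ cI] := hW; have /countable_injP[f hf] := cI a.
apply/countable_injP; exists (fun t => pickle (map (map (enc f)) t.1, t.2)) => -[l m] [k n].
rewrite !inE /listW /= => hl hk /(pcan_inj (@pickleK _))[el ->]; congr (_, _).
elim: l k hl hk el => [|w l IH] [|v k] //= hl hk [ew el].
have mem (u : seq X) b : wbelow (inr a : X) u -> inr b \in u -> (b < a)%O.
  by move=> /allP h /h; rewrite lt_inr.
congr (_ :: _); last first.
  by apply: IH el => u hu; [apply: hl|apply: hk]; rewrite inE hu orbT.
by apply: (enc_inj hf) ew => b /=; apply: mem; [apply: hl|apply: hk]; exact: mem_head.
Qed.

Lemma club_words (h : seq (seq X) * nat -> W) : club [set a | forall t, listW a t -> (h t < a)%O].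
Proof.
apply: club_closing; last 1 first.
- move=> a [b0 b0a] lim [l n]; rewrite /listW /=.
  elim: l => [|w l IH] hl; first by exists b0.
  have [|b [ba hb]] := IH; first by move=> v hv; apply: hl; rewrite inE hv orbT.
  have [c [ca hc]] : exists c, (c < a)%O /\ wbelow (inr c : X) w.
    have : wbelow (inr a : X) w by apply: hl; exact: mem_head.
    elim: w {hl} => [|e w IHw] /=; first by exists b0.
    move=> /andP[ea /IHw[c [ca hc]]]; case: e ea => [m _|e]; first by exists c.
    rewrite lt_inr => ea; have [ec|ce] := ltP e c; first by exists c; rewrite lt_inr ec hc.
    have [g [eg ga]] := lim _ ea; exists g; rewrite lt_inr eg; split=> //=.
    by apply: wbelow_le hc; rewrite le_inr; exact: le_trans ce (ltW eg).
  exists (Order.max b c); split; first by rewrite gt_max ba ca.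
  move=> v; rewrite inE => /orP[/eqP ->|/hb h1].
    by apply: wbelow_le hc; rewrite le_inr le_max lexx orbT.
  by apply: wbelow_le h1; rewrite le_inr le_max lexx.
- by move=> a b ab [l n] hl w /hl; apply: wbelow_le; rewrite le_inr.
- exact: listW_countable.
Qed.

End Omega1.

(** * Transfer between families that agree below a *)

Section Transfer.
Variables (R : realType) (d : Order.disp_t) (X : orderType d).
Local Notation words := (words R X).
Local Notation C := R[i].
Variables (th th' : X -> words -> words) (gd : good_family th) (gd' : good_family th').
Variable a : X.
Hypothesis agree : forall b, (b < a)%O -> th b = th' b.
Local Notation U := (crossed gd).
Local Notation U' := (crossed gd').
Implicit Types (x y z : words).

Lemma mul_transfer x y : below a x -> ((x : U') * (y : U') : U') = ((x : U) * (y : U) : U).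
Proof. by move=> hx; rewrite [LHS](_ : _ = cmulw th' x y)// -(cmulw_local y agree hx). Qed.

Lemma adj_transfer x : below a x -> (adj (x : U') : U') = (adj (x : U) : U).
Proof. by move=> hx; rewrite [LHS](_ : _ = starw th' x)// -(starw_local agree hx). Qed.

Lemma adj_below x : below a x -> below a (adj (x : U)).
Proof. exact: starw_below. Qed.

Lemma mul_below x y : below a x -> below a y -> below a ((x : U) * (y : U)).
Proof. exact: cmulw_below. Qed.

Lemma frame_transfer (I : finType) (b : I -> words) (r : words) (A : words -> Prop) :
  (forall i, below a (b i)) -> frame (U := U) b r A -> frame (U := U') b r A.
Proof.
move=> hb [h1 h2 h3].
have E i j : ((b i : U') * adj (b j : U') : U') = ((b i : U) * adj (b j : U) : U).
  by rewrite adj_transfer// mul_transfer.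
split.
- by move=> i j; rewrite adj_transfer// mul_transfer; [exact: h1|exact: adj_below].
- by rewrite (eq_bigr _ (fun i _ => E i i)); exact: h2.
- move=> x; rewrite h3; split=> -[c ->]; exists c; apply: eq_bigr => i _; apply: eq_bigr => j _.
    by rewrite E.
  by rewrite E.
Qed.

Lemma matalg_transfer (A : words -> Prop) (r : words) : (forall x, A x -> below a x) ->
  matalg (U := U) A r -> matalg (U := U') A r.
Proof.
by move=> hA [I [b [fr hb]]]; exists I, b; split=> //; apply: frame_transfer fr => i; exact/hA/hb.
Qed.

Lemma symmetry_transfer x : below a x -> symmetry (x : U) -> symmetry (x : U').
Proof. by move=> hx [h1 h2]; split; rewrite ?adj_transfer ?mul_transfer. Qed.

Lemma projection_transfer x : below a x -> projection (x : U) -> projection (x : U').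
Proof. by move=> hx [h1 h2]; split; rewrite ?adj_transfer ?mul_transfer. Qed.

Lemma qubit_transfer x y : below a x -> below a y -> qubit (x : U) (y : U) -> qubit (x : U') (y : U').
Proof.
move=> hx hy [h1 h2 h3]; split; [exact: symmetry_transfer|exact: symmetry_transfer|].
by rewrite (mul_transfer _ hx) (mul_transfer _ hy).
Qed.

Lemma commutes_transfer x (A : words -> Prop) : below a x -> (forall y, A y -> below a y) ->
  commutes (x : U) A -> commutes (x : U') A.
Proof.
by move=> hx hA c y Ay; rewrite (mul_transfer _ hx) (mul_transfer _ (hA _ Ay)); exact: c.
Qed.

Lemma linked_transfer (A : words -> Prop) r s y : (forall x, A x -> below a x) -> below a r ->
  linked (U := U) A r s y -> linked (U := U') A r s y.
Proof.
move=> hA hr [h1 h2 h3 h4]; have hy := hA _ h1; split=> //.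
- by rewrite mul_transfer.
- by rewrite adj_transfer// mul_transfer.
- by rewrite adj_transfer// mul_transfer//; exact: adj_below.
Qed.

Lemma gnsnorm_transfer (f : words -> C) x : below a x -> gnsnorm (U := U') f x = gnsnorm (U := U) f x.
Proof.
move=> hx; rewrite /gnsnorm /qn /gnsform; congr (Num.sqrt (complex.Re (f _))).
by rewrite adj_transfer// mul_transfer//; exact: adj_below.
Qed.

Lemma one_sub_below x : below a x -> below a (1 - (x : U) : U).
Proof. by move=> hx; apply: (subB (below_subalg gd a)) => //; exact: sub1 (below_subalg gd a). Qed.

Lemma gnsnorm1_transfer (f : words -> C) x : below a x ->
  gnsnorm (U := U') f (1 - (x : U')) = gnsnorm (U := U) f (1 - (x : U)).
Proof. by move=> hx; exact: gnsnorm_transfer (one_sub_below hx). Qed.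

Lemma tower_transfer f A r u v p : tower (U := U) (below a) f A r u v p ->
  tower (U := U') (below a) f A r u v p.
Proof.
move=> tw; have S n x : A n x -> below a x := tw_sub tw (n := n) (x := x).
have Sr n : below a (r n) by apply: (S n); case: (matalg_r (tw_mat tw n)).
have Su n : below a (u n) by apply: (S n.+1); case: (tw_mem tw n).
have Sv n : below a (v n) by apply: (S n.+1); case: (tw_mem tw n).
have Sp n : below a (p n) by apply: (S n.+1); case: (tw_mem tw n).
split.
- by move=> n; apply: matalg_transfer (tw_mat tw n); exact: S.
- exact: tw_sub tw.
- exact: tw_incr tw.
- exact: tw_exh tw.
- exact: tw_mem tw.
- by move=> n; case: (tw_comm tw n) => *; split; apply: commutes_transfer => //; exact: S.
- by move=> n; apply: qubit_transfer => //; exact: tw_qubit tw n.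
- by move=> n; apply: projection_transfer => //; exact: tw_proj tw n.
- by move=> n; rewrite mul_transfer//; exact: tw_fix tw n.
- by move=> n; rewrite gnsnorm1_transfer//; exact: tw_r tw n.
- by move=> n; rewrite gnsnorm1_transfer//; exact: tw_p tw n.
Qed.

Lemma linked_tower_transfer f g A r u v p s0 y0 : tower (U := U) (below a) f A r u v p ->
  linked_tower (U := U) g A r v p s0 y0 -> linked_tower (U := U') g A r v p s0 y0.
Proof.
move=> tw [h1 h2 h3 h4]; have S n x : A n x -> below a x := tw_sub tw (n := n) (x := x).
have Sr n : below a (r n) by apply: (S n); case: (matalg_r (tw_mat tw n)).
have Sv n : below a (v n) by apply: (S n.+1); case: (tw_mem tw n).
have Sp n : below a (p n) by apply: (S n.+1); case: (tw_mem tw n).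
have Ss : below a s0.
  have Sy := S _ _ (link_mem h1).
  by rewrite -(link_s h1); apply: mul_below => //; exact: adj_below.
split.
- by apply: linked_transfer => //; exact: S.
- by rewrite gnsnorm1_transfer.
- move=> n x Ax; have [z Az e] := h3 n x Ax; exists z => //.
  have Sz := S _ _ Az; have Sx := S _ _ Ax.
  by rewrite (mul_transfer _ (Sp n)) (mul_transfer _ Sz) mul_transfer//; exact: mul_below.
- move=> n; rewrite (mul_transfer _ (Sv n)) mul_transfer; last exact: mul_below.
  by rewrite gnsnorm1_transfer//; do 2?[apply: mul_below => //].
Qed.

Lemma separated_transfer f g : separated (U := U) (below a) f g -> separated (U := U') (below a) f g.
Proof.
move=> sep L eps LS e0; have [A [r [s [y [[mA l] AS LA o [fr gs]]]]]] := sep L eps LS e0.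
have [Ar _ _] := matalg_r mA.
have Ss : below a s.
  by rewrite -(link_s l); apply: mul_below; [apply: adj_below|]; exact/AS/(link_mem l).
exists A, r, s, y; split=> //.
- split; first exact: matalg_transfer mA.
  by apply: linked_transfer l => //; exact: AS.
- move=> x xL; rewrite (mul_transfer _ (AS _ Ar)) mul_transfer; last by apply: mul_below; [exact: AS|exact: LS].
  exact: o.
- by rewrite !gnsnorm1_transfer//; exact: AS.
Qed.

End Transfer.

(** * The limit automorphism of a tower *)

Section Automorphism.
Variables (R : realType) (d : Order.disp_t) (X : orderType d).
Local Notation words := (words R X).
Local Notation C := R[i].
Variables (th : X -> words -> words) (gd : good_family th) (a : X).
Local Notation U := (crossed gd).
Implicit Types (x y z : words).

Record stage_map (T : words -> words) : Prop := StageMap {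
  sm_lin : linear_map T ;
  sm_below : forall x, below a x -> below a (T x) ;
  sm_unit : T (unitw R X) = unitw R X ;
  sm_mul : forall x y, below a x -> below a y -> T (cmulw th x y) = cmulw th (T x) (T y) ;
  sm_inv : forall x, below a x -> T (T x) = x ;
  sm_fip : forall x y, below a x -> below a y -> fip (T x) (T y) = fip x y }.

(** Define T on each basis word by a conjugation that has stabilized there and extend linearly. All
    properties are checked in one A_n; isometry is the trace property for conjugation by a
    symmetry. *)
Lemma tower_automorphism f (A : nat -> U -> Prop) (r u v p : nat -> U) :
  tower (U := U) (below a) f A r u v p -> exists2 T, stage_map T &
    forall n (x : U), A n x -> T x = wprod v n * x * wprod v n.
Proof.
move=> tw; have sA n := tower_subalg tw n.
pose w n := wprod v n.
have ww n : w n * w n = 1 := wprod_sqr tw n.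
have aw n : adj (w n) = w n by have [] := wprod_sym tw n.
have Aw n : A n (w n) := wprod_mem tw n.
have conjM n (x y : U) : w n * (x * y) * w n = (w n * x * w n) * (w n * y * w n).
  transitivity (w n * x * (w n * w n) * y * w n); first by rewrite ww mulr1 !mulrA.
  by rewrite !mulrA.
have H s : exists t : words, wbelow a s -> exists2 n, A n (delta s) & t = (w n * delta s * w n : U).
  have [hs|hs] := boolP (wbelow a s); last by exists 0.
  have [n hn] := tw_exh tw (below_delta hs : below a (delta s : words)).
  by exists (w n * delta s * w n : U) => _; exists n.
have [t ht] := choice H.
have TE n (x : U) : A n x -> lin t x = (w n * x * w n : U).
  move=> Ax; have hx : below a x := tw_sub tw Ax.
  have [m [nm hm]] : exists m, (n <= m)%N /\ forall s, s \in supp x -> x s != 0 -> A m (delta s).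
    elim: (supp x) => [|s l [m [nm hm]]]; first by exists n.
    have [xs|xs] := eqVneq (x s) 0.
      exists m; split=> // s'; rewrite inE => /orP[/eqP ->|]; [by rewrite xs eqxx|exact: hm].
    have [k Ak] := tw_exh tw (below_delta (hx _ xs) : below a (delta s : words)).
    exists (maxn m k); split; first by rewrite (leq_trans nm)// leq_maxl.
    move=> s'; rewrite inE => /orP[/eqP -> _|h1 h2].
      by apply: (tower_mono tw) Ak; exact: leq_maxr.
    by apply: (tower_mono tw) (hm _ h1 h2); exact: leq_maxl.
  rewrite -[RHS](wprod_stable tw nm Ax).
  apply: (lmap_ext (F := lin t) (G := fun x : words => (wprod v m * (x : U) * wprod v m : U))).
  - exact: lin_linear.
  - by move=> k y z; rewrite mulrDr mulrDl -scalerAr -scalerAl.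
  move=> s xs; rewrite (lin_delta t (coef_dom xs)).
  have [k Ak ->] := ht s (hx _ xs); have Am := hm s (mem_supp xs) xs.
  have [km|mk] := leqP k m; first by rewrite (wprod_stable tw km Ak).
  by rewrite -(wprod_stable tw (ltnW mk) Am).
exists (lin t) => //; split.
- exact: lin_linear.
- move=> x /(tw_exh tw)[n An]; rewrite (TE n)//; apply: (tw_sub tw (n := n)).
  by apply: (subM (sA n)) => //; apply: (subM (sA n)).
- by rewrite -[unitw R X]/(1 : U) (TE 0%N (1 : U)) /= ?mul1r ?mulr1//; exact: sub1 (sA 0%N).
- move=> x y hx hy; have [n [Ax Ay]] := tower_common tw hx hy.
  rewrite -[cmulw th x y]/((x : U) * (y : U)) (TE n) ?conjM; last exact: (subM (sA n)).
  by rewrite (TE n x)// (TE n y).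
- move=> x /(tw_exh tw)[n An]; rewrite (TE n x An) (TE n).
    transitivity ((w n * w n) * (x : U) * (w n * w n)); first by rewrite !mulrA.
    by rewrite ww mul1r mulr1.
  by apply: (subM (sA n)) => //; apply: (subM (sA n)).
- move=> x y hx hy; have [n [Ax Ay]] := tower_common tw hx hy.
  rewrite (TE n x)// (TE n y)// -!(@tau_fip _ _ _ _ gd).
  have -> : adj (w n * (y : U) * w n) = w n * adj (y : U) * w n by rewrite !adjM aw mulrA.
  by rewrite -conjM tauC mulrA ww mul1r.
Qed.

End Automorphism.

(** * Stages of the construction *)

Section Stages.
Variables (R : realType) (d : Order.disp_t) (X : orderType d).
Local Notation words := (words R X).
Local Notation C := R[i].
Variable f : words -> C.
Implicit Types (x y z : words) (g : words -> C).

(** The automorphism T comes from a tower for f, and the tower is linked to the guessed functional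
    whenever that one happens to be a state separated from f below a. *)
Record stage (th : X -> words -> words) (gd : good_family th) (a : X) (guess : (words -> C) -> Prop)
    (T : words -> words) : Prop := Stage {
  st_map : stage_map th a T ;
  st_tower : exists (A : nat -> crossed gd -> Prop) (r u v p : nat -> crossed gd),
    [/\ tower (U := crossed gd) (below a) f A r u v p,
      forall n (x : crossed gd), A n x -> T x = wprod v n * x * wprod v n &
      forall g, guess g -> posfun (g : crossed gd -> C) ->
        separated (U := crossed gd) (below a) f g -> exists s0 y0 : crossed gd, linked_tower (U := crossed gd) g A r v p s0 y0] }.

(** By [gs_zero] the guessed functional lives below a, so its positivity does not depend on
    automorphisms chosen later ([posfun_transfer]). By [gs_uniq] a single tower can satisfy the
    linking clause of [stage]. *)
Record guessing (a : X) (guess : (words -> C) -> Prop) : Prop := Guessing {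
  gs_lin : forall g, guess g -> @linear_map R words C^o g ;
  gs_zero : forall g, guess g -> forall b, (a <= b)%O -> forall y, below b y -> g (consV b y) = 0 ;
  gs_uniq : forall g g', guess g -> guess g' -> g = g' }.

Hypothesis wfX : well_founded (fun a b : X => (a < b)%O).

Lemma stage_map_local (th th' : X -> words -> words) a T : (forall b, (b < a)%O -> th b = th' b) ->
  stage_map th a T -> stage_map th' a T.
Proof.
move=> e [h1 h2 h3 h4 h5 h6]; split=> // x y hx hy.
by rewrite -(cmulw_local y e hx) -(cmulw_local (T y) e (h2 x hx)); exact: h4.
Qed.

Lemma posfun_transfer (th th' : X -> words -> words) (gd : good_family th) (gd' : good_family th') a guess g :
  (forall b, (b < a)%O -> th b = th' b) -> guessing a guess -> guess g ->
  posfun (g : crossed gd -> C) -> posfun (g : crossed gd' -> C).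
Proof.
move=> e [hl hz _] gg pg; apply: (@posfun_letters R _ X th' gd' g (hl g gg) a wfX).
- exact: (pf1 pg).
- move=> x hx; rewrite (adj_transfer gd gd' e hx) (mul_transfer gd gd' e) ?(pf_ge0 pg)//.
  exact: adj_below.
- by move=> b ab; left => y hy; rewrite lam_mulr//; exact: (hz g gg b ab).
Qed.

Lemma stage_transfer (th th' : X -> words -> words) (gd : good_family th) (gd' : good_family th') a guess T :
  (forall b, (b < a)%O -> th b = th' b) -> guessing a guess ->
  stage gd a guess T -> stage gd' a guess T.
Proof.
move=> e gg [sm [A [r [u [v [p [tw hT link]]]]]]].
have e' b : (b < a)%O -> th' b = th b by move=> /e.
split; first exact: stage_map_local e sm.
exists A, r, u, v, p; have S n x : A n x -> below a x := tw_sub tw (n := n) (x := x).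
split; first exact: (@tower_transfer _ _ _ _ _ gd gd' a e _ _ _ _ _ _ tw).
- have we n : wprod (U := crossed gd') v n = wprod (U := crossed gd) v n.
    elim: n => //= n ->; rewrite (mul_transfer gd gd' e)//.
    apply: (S n); exact: wprod_mem tw n.
  move=> n x Ax; rewrite we (hT n x Ax); have Sw := S _ _ (wprod_mem tw n).
  rewrite [in RHS](mul_transfer gd gd' e _ Sw) (mul_transfer gd gd' e)//.
  by apply: mul_below => //; exact: S Ax.
- move=> g hg pg sep.
  have [s0 [y0 lt]] := link g hg (posfun_transfer gd e' gg hg pg) (@separated_transfer _ _ _ _ _ gd' gd a e' f g sep).
  by exists s0, y0; exact: (@linked_tower_transfer _ _ _ _ _ gd gd' a e _ _ _ _ _ _ _ _ _ tw lt).
Qed.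

(** If the guess is a state separated from f take a linked tower, otherwise a free one, for which
    the linking clause holds vacuously. *)
Lemma stage_exists (th : X -> words -> words) (gd : good_family th) a guess :
  guessing a guess -> posfun (f : crossed gd -> C) ->
  countably_spanned (U := crossed gd) (below a) ->
  locally_matricial (U := crossed gd) (below a) f ->
  free_qubits (U := crossed gd) (below a) f -> exists T, stage gd a guess T.
Proof.
move=> gg pf cs lm fq; have sB := below_subalg gd a.
have [[g [hg pg sep]]|nog] := pselect (exists g, [/\ guess g, posfun (g : crossed gd -> C) &
    separated (U := crossed gd) (below a) f g]).
- have [A [r [u [v [p [s0 [y0 [tw lt]]]]]]]] := linked_tower_exists cs pf pg fq sep.
  have [T sm hT] := tower_automorphism tw.
  exists T; split=> //; exists A, r, u, v, p; split=> // g' hg' _ _.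
  by exists s0, y0; rewrite (gs_uniq gg hg' hg).
- have [A [r [u [v [p tw]]]]] := free_tower cs pf lm fq.
  have [T sm hT] := tower_automorphism tw.
  exists T; split=> //; exists A, r, u, v, p; split=> // g hg pg sep.
  by exfalso; apply: nog; exists g.
Qed.

Lemma belowS_subalg (th : X -> words -> words) (gd : good_family th) a :
  subalg (belowS a : crossed gd -> Prop).
Proof.
have sB := below_subalg gd a.
have comp (y z : crossed gd) : below a y -> below a z -> belowS a (y + z * lam gd a).
  move=> hy hz w; rewrite lam_mulr// coefD; have [->|/hy yw _] := eqVneq (y w) 0; last first.
    by apply: sub_all yw => c /ltW.
  rewrite add0r consVE; case: w => [|c s]; first by rewrite eqxx.
  case: ifP => [/andP[/eqP -> ds] _|]; last by rewrite eqxx.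
  move: ds; rewrite desc_cons => /andP[h _] /=; rewrite lexx.
  by apply: sub_all h => b /ltW.
have [al ll] := lam_symmetry gd a.
have dec x := @belowS_decomp _ _ _ _ gd a x.
split.
- by rewrite -[1]addr0 -(mul0r (lam gd a)); apply: comp; [exact: sub1 sB|exact: below0].
- move=> x y /dec[x1 [x2 [h1 h2 ->]]] /dec[y1 [y2 [k1 k2 ->]]].
  by rewrite addrACA -mulrDl; apply: comp; exact: (subD sB).
- move=> k x /dec[x1 [x2 [h1 h2 ->]]].
  by rewrite scalerDr scalerAl; apply: comp; exact: (subZ sB).
- move=> x y /dec[x1 [x2 [h1 h2 ->]]] /dec[y1 [y2 [k1 k2 ->]]].
  have t1 : below a (th a y1 : crossed gd) := th_below gd k1.
  have t2 : below a (th a y2 : crossed gd) := th_below gd k2.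
  have -> : (x1 + x2 * lam gd a) * (y1 + y2 * lam gd a) =
      (x1 * y1 + x2 * (th a y2 : crossed gd)) + (x1 * y2 + x2 * (th a y1 : crossed gd)) * lam gd a.
    rewrite mulrDl !mulrDr -!(mulrA x2) lam_comm// (mulrA (lam gd a) y2) lam_comm//.
    rewrite -(mulrA (th a y2 : crossed gd)) ll mulr1 mulrDl !mulrA.
    by rewrite -!addrA; congr (_ + _); rewrite addrCA addrC -addrA [RHS]addrCA; congr (_ + _); rewrite addrC.
  by apply: comp; apply: (subD sB); exact: (subM sB).
- move=> x /dec[x1 [x2 [h1 h2 ->]]]; rewrite adjD adjM al lam_comm; last exact: (subJ sB).
  apply: comp; first exact: (subJ sB).
  by apply: th_below => //; exact: (subJ sB).
Qed.

Lemma stage_invariants (th : X -> words -> words) (gd : good_family th) a guess :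
  posfun (f : crossed gd -> C) -> stage gd a guess (th a) ->
  locally_matricial (U := crossed gd) (belowS a) f /\ free_qubits (U := crossed gd) (belowS a) f.
Proof.
move=> pf [sm [A [r [u [v [p [tw hT _]]]]]]].
have hl := lam_symmetry gd a.
have hw n (x : crossed gd) : A n x -> lam gd a * x = wprod v n * x * wprod v n * lam gd a.
  by move=> Ax; rewrite lam_comm; [rewrite (hT n x Ax)|exact: (tw_sub tw Ax)].
have SS x : below a x -> belowS a x by move=> hx w /hx; apply: sub_all => c /ltW.
have Sl : belowS a (lam gd a).
  move=> w; rewrite deltaE; case: ifP => [/andP[_ /eqP ->] _|]; last by rewrite eqxx.
  by rewrite /= lexx.
have dec x := @belowS_decomp _ _ _ _ gd a x.
split; first exact: (tower_locally_matricial pf tw hl hw (belowS_subalg gd a) SS Sl dec).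
exact: (tower_free_qubits pf tw hw SS dec).
Qed.

End Stages.

(** * Transfinite recursion along omega_1 *)

Section Recursion.
Variables (R : realType) (d : Order.disp_t) (W : orderType d).
Hypothesis hW : is_omega1 W.
Local Notation C := R[i].
Local Notation X := (letter W).
Local Notation words := (words R X).
Local Notation f := (@fstate R d W).
Implicit Types (x y z : words) (a b : W).

Let wf := omega1_wf hW.
Let wfX := letter_wf wf.

Lemma belowS_le (c c' : X) x : (c <= c')%O -> belowS c x -> belowS c' x.
Proof. by move=> cc hx w /hx; apply: sub_all => b bc; exact: le_trans cc. Qed.

Lemma base_belowS b x : base x -> belowS (inr b : X) x.
Proof.
move=> [n hx] w /hx; apply: sub_all => -[m|c]; last by rewrite lt_inrl.
by move=> _; exact: ltW (lt_inlr _ _).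
Qed.

Lemma base_or_belowS x : base x \/ exists b, belowS (inr b : X) x /\ exists2 w, x w != 0 & (inr b : X) \in w.
Proof.
have [[k ->]|[[n|b] [hb h]]] := max_letter x; [left|left|right].
- exists 0%N => w; rewrite coefZ deltaE; case: ifP => [/andP[_ /eqP ->] //|_].
  by rewrite mulr0 eqxx.
- exists n.+1 => w /hb; apply: sub_all => -[m|c]; last by [].
  by rewrite lt_inl ltnS.
- by exists b.
Qed.

Lemma belowS_seq (P : W -> Prop) (L : seq words) :
  (forall x, x \in L -> base x \/ exists b, P b /\ belowS (inr b : X) x) ->
  (forall x, x \in L -> base x) \/ exists b, P b /\ forall x, x \in L -> belowS (inr b : X) x.
Proof.
elim: L => [|y L IH] h; first by left.
have [hL|[b [Pb hL]]] := IH (fun x xL => h x (@mem_behead _ (y :: L) x xL)).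
  have [hy|[b [Pb hy]]] := h y (mem_head _ _).
    by left => x; rewrite inE => /orP[/eqP ->|/hL].
  right; exists b; split=> // x; rewrite inE => /orP[/eqP -> //|/hL].
  exact: base_belowS.
right; have [hy|[c [Pc hy]]] := h y (mem_head _ _).
  exists b; split=> // x; rewrite inE => /orP[/eqP ->|/hL //].
  exact: base_belowS.
have [bc|cb] := leP b c.
  exists c; split=> // x; rewrite inE => /orP[/eqP -> //|/hL].
  by apply: belowS_le; rewrite le_inr.
exists b; split=> // x; rewrite inE => /orP[/eqP ->|/hL //].
by apply: belowS_le hy; rewrite le_inr ltW.
Qed.

Variable guess : W -> (words -> C) -> Prop.
Hypothesis hguess : forall a, guessing (inr a : X) (guess a).

Section Invariants.
Variables (th : X -> words -> words) (gd : good_family th).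
Hypothesis hth : forall m, th (inl m : X) = sgnw m.
Variables (P : W -> Prop) (S : crossed gd -> Prop).
Hypothesis hst : forall b, P b -> stage f gd (inr b : X) (guess b) (th (inr b)).
Hypothesis baseS : forall x, base x -> S x.
Hypothesis belowSS : forall b, P b -> forall x, belowS (inr b : X) x -> S x.
Hypothesis Sdec : forall x, S x -> base x \/ exists b, P b /\ belowS (inr b : X) x.

(** Both properties speak of finite lists, and a finite list lies in the base algebra or in the
    algebra up to one earlier letter, where [stage_invariants] applies. Limit and successor stages
    are thereby treated alike. *)
Lemma words_invariants : locally_matricial S f /\ free_qubits S f.
Proof.
have pf := fstate_posfun gd hth wf.
split=> L eps LS e0.
  have [hb|[b [Pb hb]]] := belowS_seq (P := P) (fun x xL => Sdec (LS x xL)).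
    by have := base_locally_matricial hth wf baseS hb e0.
  have [lm _] := stage_invariants pf (hst Pb).
  have [A [r [mA AS LA fr]]] := lm L eps hb e0.
  by exists A, r; split=> // x /AS; exact: belowSS Pb x.
have [hb|[b [Pb hb]]] := belowS_seq (P := P) (fun x xL => Sdec (LS x xL)).
  by have := base_free_qubits hth wf baseS hb e0.
have [_ fq] := stage_invariants pf (hst Pb).
have [u [v [[Su Sv] q c fu]]] := fq L eps hb e0.
by exists u, v; split=> //; split; exact: belowSS Pb _ _.
Qed.
End Invariants.

(** Only countably many words lie below a, since a has countably many predecessors; they are
    enumerated through their codes, with 0 for numbers that are not codes. *)
Lemma below_countably_spanned (th : X -> words -> words) (gd : good_family th) a :
  countably_spanned (U := crossed gd) (below (inr a : X)).
Proof.
have [_ _ cI] := hW; have /countable_injP[g hg] := cI a.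
pose code (w : seq X) : nat := pickle (map (enc g) w).
have H n : exists x : words, below (inr a : X) x /\
    forall w, wbelow (inr a : X) w -> code w = n -> x = delta w.
  have [[w [hw e]]|no] := pselect (exists w, wbelow (inr a : X) w /\ code w = n); last first.
    by exists 0; split=> [|w hw e]; [exact: below0|exfalso; apply: no; exists w].
  exists (delta w); split=> [|v hv ev]; first exact: below_delta.
  congr delta; move: e; rewrite -ev => /(pcan_inj (@pickleK _)).
  by apply: (enc_inj hg) => b /=; [move/allP: hw => h /h|move/allP: hv => h /h]; rewrite lt_inr.
have [wd hwd] := choice H; exists wd; split=> [n|x hx]; first by case: (hwd n).
exists (\max_(w <- supp x) code w)%N => B sB hB.
have hs w : w \in supp x -> x w != 0 -> B (delta w : crossed gd).
  move=> ws xw; have [_ e] := hwd (code w); rewrite -(e w (hx _ xw) erefl).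
  by apply: hB; exact: (leq_bigmax_seq (F := code)).
rewrite [x]fspan_expand; elim: (supp x) hs => [|w s IH] hs; first by rewrite big_nil; exact: (sub0 sB).
rewrite big_cons; apply: (subD sB); last by apply: IH => v vs; apply: hs; rewrite inE vs orbT.
have [->|xw] := eqVneq (x w) 0; first by rewrite scale0r; exact: (sub0 sB).
by apply: (subZ sB); apply: hs => //; exact: mem_head.
Qed.

Definition combine (F : W -> words -> words) (c : X) : words -> words :=
  match c with inl n => sgnw n | inr a => F a end.

(** G chooses some automorphism making the family truncated at a into a stage, and the identity if
    none exists. The induction [main] shows that one exists at each a: the earlier stages supply the
    invariants that [stage_exists] requires. *)
Lemma crossed_tower : exists (th : X -> words -> words) (gd : good_family th),
  (forall m, th (inl m) = sgnw m) /\ forall a, stage f gd (inr a : X) (guess a) (th (inr a)).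
Proof.
pose Q a (t : X -> words -> words) (T : words -> words) :=
  exists gd : good_family t, stage f gd (inr a : X) (guess a) T.
pose G a (u : W -> words -> words) : words -> words :=
  if pselect (exists T, Q a (trunc (inr a : X) (combine u)) T) is left h then projT1 (cid h) else id.
have [a u v uv|F hF] := wf_rec wf (id : words -> words) (G := G).
  rewrite /G; suff -> : trunc (inr a : X) (combine u) = trunc (inr a : X) (combine v) by [].
  apply/funext => -[n|b]; rewrite /trunc//; case: ifP => //.
  by rewrite lt_inr => /uv.
pose th := combine F.
have hth m : th (inl m) = sgnw m by [].
have main a : good_at th (inr a) /\ exists gd : good_family (trunc (inr a : X) th),
    stage f gd (inr a : X) (guess a) (F a).
  elim/(well_founded_ind wf): a => a IH.
  have gd : good_family (trunc (inr a : X) th).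
    apply: good_trunc => -[n|b]; first by move=> _; exact: base_good_at hth n.
    by rewrite lt_inr => /IH[].
  have hth' m : trunc (inr a : X) th (inl m) = sgnw m by [].
  have sg b : (b < a)%O -> stage f gd (inr b : X) (guess b) (trunc (inr a : X) th (inr b)).
    move=> ba; have [_ [gdb st]] := IH b ba; rewrite trunc_lt ?lt_inr//.
    apply: (stage_transfer wfX gd _ (hguess b) st) => c cb.
    by rewrite !trunc_lt//; apply: lt_trans cb _; rewrite lt_inr.
  have [||x hx|lm fq] := words_invariants hth' (P := fun b => (b < a)%O) (S := below (inr a : X)) sg.
  - move=> x [n hx]; apply: below_le hx; exact: ltW (lt_inlr _ _).
  - by move=> b ba x hx w /hx; apply: sub_all => c cb; apply: le_lt_trans cb _; rewrite lt_inr.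
  - have [|[b [hb [w xw bw]]]] := base_or_belowS x; [by left|right; exists b; split=> //].
    by have /allP/(_ _ bw) := hx _ xw; rewrite lt_inr.
  have [T hT] := stage_exists (hguess a) (fstate_posfun gd hth' wf) (below_countably_spanned gd a) lm fq.
  have [gd' st] : exists gd : good_family (trunc (inr a : X) th), stage f gd (inr a : X) (guess a) (F a).
    rewrite hF /G; case: pselect => [h|no]; first exact: projT2 (cid h).
    by exfalso; apply: no; exists T, gd.
  split; last by exists gd'.
  have loc c : (c < (inr a : X))%O -> trunc (inr a : X) th c = th c by move=> h; rewrite trunc_lt.
  have [h1 h2 h3 h4 h5 h6] := stage_map_local loc (st_map st).
  by split.
have gd : good_family th.
  apply/good_familyP => -[n|a]; first exact: base_good_at hth n.
  by have [] := main a.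
exists th, gd; split=> // a; have [_ [gda st]] := main a.
by apply: (stage_transfer wfX gd _ (hguess a) st) => c ca; rewrite trunc_lt.
Qed.

End Recursion.

(** * Diamond guesses every separated state at some stage *)

Section Guess.
Variables (R : realType) (d : Order.disp_t) (W : orderType d).
Hypothesis hW : is_omega1 W.
Variable Sd : W -> set W.
Hypothesis hSd : forall S : set W, stationary [set a | S `&` [set b | (b < a)%O] = Sd a].
Local Notation C := R[i].
Local Notation X := (letter W).
Local Notation words := (words R X).
Local Notation f := (@fstate R d W).
Implicit Types (x y z : words) (a b : W) (w : seq X) (n : nat) (g : words -> C).

Variable kappa : seq X -> nat -> W.
Hypothesis kappa_inj : forall w v m n, kappa w m = kappa v n -> w = v /\ m = n.

(* Rational cuts of the real and imaginary parts. *)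
Definition cut n (c : C) : Prop :=
  if unpickle n is Some (b, q) then
    (ratr (q : rat) < (if b : bool then complex.Re c else complex.Im c)) : Prop
  else False.

Lemma cut_inj (c c' : C) : (forall n, cut n c <-> cut n c') -> c = c'.
Proof.
move=> h; have H (b : bool) (r r' : R) : r = (if b then complex.Re c else complex.Im c) ->
    r' = (if b then complex.Re c' else complex.Im c') -> r = r'.
  move=> er er'; have [rr|rr|//] := ltgtP r r'.
    have [q] := rat_in_itvoo rr; rewrite in_itv/= => /andP[h1 h2].
    have := h (pickle (b, q)); rewrite /cut pickleK -er -er' => -[_ /(_ h2)].
    by rewrite ltNge (ltW h1).
  have [q] := rat_in_itvoo rr; rewrite in_itv/= => /andP[h1 h2].
  have := h (pickle (b, q)); rewrite /cut pickleK -er -er' => -[/(_ h2)].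
  by rewrite ltNge (ltW h1).
have h1 := H true _ _ erefl erefl; have h2 := H false _ _ erefl erefl.
by move: h1 h2; case: (c) => ? ?; case: (c') => ? ? /= -> ->.
Qed.

(** [Sd a], read through the coding [kappa], is the set of rational cuts of the values of g on words
    below a. The third clause asks that a be closed under the coding. *)
Definition guess a g : Prop := [/\ @linear_map R words C^o g,
  forall w, ~~ wbelow (inr a : X) w -> g (delta w) = 0,
  forall w n, wbelow (inr a : X) w -> (kappa w n < a)%O &
  forall w n, wbelow (inr a : X) w -> (Sd a (kappa w n) <-> cut n (g (delta w)))].

Lemma guess_guessing a : guessing (inr a : X) (guess a).
Proof.
split=> [g []//|g [lg g0 _ _] b ab y hy|g g' [lg g0 _ hg] [lg' g0' _ hg']].
  apply: (@lmap_ext R _ _ C^o (fun y => g (consV b y)) (fun=> 0) y).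
  - exact: lmap_comp lg (consV_linear b).
  - by move=> k u v; rewrite scaler0 addr0.
  move=> w yw; rewrite consV_delta; last exact: hy.
  by apply: g0; exact: head_not_below.
apply/funext => x; apply: (@lmap_ext R _ _ C^o g g' x) => // w _.
have [aw|aw] := boolP (wbelow (inr a : X) w); last by rewrite g0// g0'.
by apply: cut_inj => n; rewrite -hg// -hg'.
Qed.

(** The part of g that a guess at stage a can see. Extension by 0 keeps it positive, by the first
    alternative of [expects]. *)
Definition gtrunc a g x : C := lin (fun w => (if wbelow (inr a : X) w then g (delta w) else 0) : C^o) x.

Lemma gtruncE a g x : @linear_map R words C^o g -> below (inr a : X) x -> gtrunc a g x = g x.
Proof.
move=> lg hx; apply: (@lmap_ext R _ _ C^o (gtrunc a g) g x) => //; first exact: lin_linear.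
by move=> w xw; rewrite /gtrunc (lin_delta _ (coef_dom xw)) hx.
Qed.

Lemma gtrunc_delta a g w : ~~ wbelow (inr a : X) w -> gtrunc a g (delta w) = 0.
Proof.
move=> aw; have [dw|dw] := boolP (desc w); first by rewrite /gtrunc lin_delta// (negbTE aw).
by rewrite delta_out// /gtrunc lin0.
Qed.

Let wfX := letter_wf (omega1_wf hW).
Variables (th : X -> words -> words) (gd : good_family th).
Hypothesis hth : forall m, th (inl m : X) = sgnw m.
Hypothesis hst : forall a, stage f gd (inr a : X) (guess a) (th (inr a)).
Local Notation U := (crossed gd).

Lemma gtrunc_posfun a g : posfun (g : U -> C) -> posfun (gtrunc a g : U -> C).
Proof.
move=> pg; have lg : @linear_map R words C^o g by move=> k x y; rewrite (pfD pg) (pfZ pg).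
have sB := below_subalg gd (inr a : X).
apply: (@posfun_letters R _ X th gd (gtrunc a g) (lin_linear _) (inr a : X) wfX).
- by rewrite gtruncE ?(pf1 pg)//; exact: sub1 sB.
- by move=> x hx; rewrite gtruncE ?(pf_ge0 pg)//; apply: (subM sB) => //; exact: (subJ sB).
move=> b ab; left => y hy; rewrite lam_mulr//.
apply: (@lmap_ext R _ _ C^o (fun y => gtrunc a g (consV b y)) (fun=> 0) y).
- exact: lmap_comp (lin_linear _) (consV_linear b).
- by move=> k u v; rewrite scaler0 addr0.
move=> w yw; rewrite consV_delta; last exact: hy.
by apply: gtrunc_delta; exact: head_not_below.
Qed.

Lemma words_bounded x : exists b, below (inr b : X) x.
Proof.
have [a0 _] := omega1_inh hW.
exists (above hW (\bigcup_(w in [set` supp x]) [set topW a0 w])) => w xw; apply/allP => -[m|c] //.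
move=> cw; rewrite lt_inr; apply: le_lt_trans (topWP a0 cw) _; apply: aboveP.
  apply: bigcup_countable; last by move=> v _; exact: countable1.
  by apply: finite_set_countable; exact: finite_seq.
by exists w => //=; exact: mem_supp.
Qed.

Lemma words_seq_bounded (L : seq words) : exists b, forall x, x \in L -> below (inr b : X) x.
Proof.
elim: L => [|y L [b hb]]; first by have [b _] := omega1_inh hW; exists b.
have [c hc] := words_bounded y; exists (Order.max b c) => x; rewrite inE => /orP[/eqP ->|/hb].
  by apply: below_le hc; rewrite le_inr le_max lexx orbT.
by apply: below_le; rewrite le_inr le_max lexx.
Qed.

Lemma gnsnorm_gtrunc a g (x : U) : @linear_map R words C^o g -> below (inr a : X) x ->
  gnsnorm (gtrunc a g : U -> C) x = gnsnorm (g : U -> C) x.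
Proof.
move=> lg hx; rewrite /gnsnorm /qn /gnsform gtruncE//.
have sB := below_subalg gd (inr a : X).
by apply: (subM sB) => //; exact: (subJ sB).
Qed.

(** For each finite list of words and each tolerance 1/(n+1) a separating matrix algebra lies below
    some b = h(list, n). A stage closed under h contains the witnesses for all its lists. *)
Lemma separated_reflects g : @linear_map R words C^o g -> separated (U := U) (fun=> True) f g ->
  exists h : seq (seq X) * nat -> W, forall a, (forall t, listW a t -> (h t < a)%O) ->
    separated (U := U) (below (inr a : X)) f (gtrunc a g).
Proof.
move=> lg sep.
have H (t : seq (seq X) * nat) : exists b, exists (A : U -> Prop) (r s y : U),
    [/\ matalg A r /\ linked A r s y, forall x, A x -> below (inr b : X) x,
      forall w, w \in t.1 -> A (delta w), forall w, w \in t.1 -> r * (delta w : U) * s = 0 &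
      gnsnorm (f : U -> C) (1 - r) <= t.2.+1%:R^-1 /\ gnsnorm (g : U -> C) (1 - s) <= t.2.+1%:R^-1].
  have [||A [r [s [y [[mA l] _ LA o fg]]]]] := sep (map (fun w => delta w : U) t.1) t.2.+1%:R^-1.
  - by [].
  - by rewrite invr_gt0.
  have [L [LA' gen _ _]] := matalg_findim mA.
  have [b hb] := words_seq_bounded L.
  exists b, A, r, s, y; split=> //.
  - by apply: gen => //; exact: below_subalg.
  - by move=> w wt; apply: LA; exact: map_f.
  - by move=> w wt; apply: o; exact: map_f.
have [h hh] := choice H; exists h => a ha L eps LS e0.
have [n hn] : exists n, n.+1%:R^-1 <= eps.
  have [N hN] := null_inv 1 e0; exists N; have := hN N (leqnn _); rewrite ?div1r; exact: ltW.
pose l := flatten [seq [seq w <- supp x | x w != 0] | x <- (L : seq words)].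
have hl (x : words) w : x \in L -> x w != 0 -> w \in l.
  move=> xL xw; apply/flattenP; exists [seq w <- supp x | x w != 0]; last first.
    by rewrite mem_filter xw mem_supp.
  by apply/mapP; exists x.
have lla : listW a (l, n).
  move=> w /= /flattenP[s /mapP[x xL ->]]; rewrite mem_filter => /andP[xw _].
  exact: (LS x xL).
have [A [r [s [y [[mA lk] AS lA lo [fr gs]]]]]] := hh (l, n).
have sA := matalg_subalg mA.
have AS' x : A x -> below (inr a : X) x.
  by move=> /AS; apply: below_le; rewrite le_inr; apply/ltW/ha.
have Ss : A s by have [_ _ _] := linked_projections mA lk.
have sB := below_subalg gd (inr a : X).
exists A, r, s, y; split=> //.
- move=> x xL; rewrite [x : words]fspan_expand.
  have : forall w, x w != 0 -> A (delta w) by move=> w /(hl _ _ xL) wl; exact: lA.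
  elim: (supp x) => [|w q IH] hx; first by rewrite big_nil; exact: (sub0 sA).
  rewrite big_cons; apply: (subD sA); last exact: IH.
  have [->|xw] := eqVneq ((x : words) w) 0; first by rewrite scale0r; exact: (sub0 sA).
  by apply: (subZ sA); exact: hx.
- move=> x xL; apply: (lmap_ext (F := fun x : words => (r * (x : U) * s : words)) (G := fun=> 0)).
  + by move=> k u v; rewrite mulrDr mulrDl -scalerAr -scalerAl.
  + by move=> k u v; rewrite scaler0 addr0.
  by move=> w xw; apply: lo; exact: hl xL xw.
split; first by apply: le_trans hn.
rewrite gnsnorm_gtrunc//; first by apply: le_trans hn.
by apply: (subB sB); [exact: (sub1 sB)|exact: AS'].
Qed.

(** Let S be the set of codes of the cuts of g. By stationarity some a in the club below has S cut
    down to a equal to [Sd a]; there the guess is [gtrunc a g], still separated from f, and the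
    stage linked its tower to it. *)
Lemma stage_guessed g : posfun (g : U -> C) -> separated (U := U) (fun=> True) f g ->
  exists a (A : nat -> U -> Prop) (r u v p : nat -> U) (s0 y0 : U),
  [/\ tower (U := U) (below (inr a : X)) f A r u v p,
    forall n x, A n x -> lam gd (inr a) * x = wprod v n * x * wprod v n * lam gd (inr a) &
    linked_tower (U := U) g A r v p s0 y0].
Proof.
move=> pg sep; have lg : @linear_map R words C^o g by move=> k x y; rewrite (pfD pg) (pfZ pg).
have [h2 hh2] := separated_reflects lg sep.
have [a0 _] := omega1_inh hW.
(* Closure under [h1], applied to lists of length one, keeps the codes of the words below a inside
   a; closure under [h2] keeps the separating algebras there. *)
pose h1 (t : seq (seq X) * nat) := if t.1 is w :: _ then kappa w t.2 else a0.
have cl := club_words hW (fun t => Order.max (h1 t) (h2 t)).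
pose S := [set b | exists w n, cut n (g (delta w)) /\ b = kappa w n].
have [a [/= ha Sa]] := hSd S cl.
have ka w n : wbelow (inr a : X) w -> (kappa w n < a)%O.
  move=> aw; have : listW a ([:: w], n) by move=> v /=; rewrite inE => /eqP ->.
  by move=> /ha; rewrite gt_max => /andP[].
have gg : guess a (gtrunc a g).
  split; [exact: lin_linear|exact: gtrunc_delta|exact: ka|].
  move=> w n aw; rewrite -Sa gtruncE//; last exact: below_delta.
  split; first by move=> [[v [m [cm e]]] _]; have [-> ->] := kappa_inj e.
  by move=> cn; split; [exists w, n|exact: ka].
have sp : separated (U := U) (below (inr a : X)) f (gtrunc a g).
  by apply: hh2 => t /ha; rewrite gt_max => /andP[].
have [_ [A [r [u [v [p [tw hT link]]]]]]] := hst a.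
have [s0 [y0 [l1 l2 l3 l4]]] := link _ gg (gtrunc_posfun a pg) sp.
have sB := below_subalg gd (inr a : X).
exists a, A, r, u, v, p, s0, y0; split=> //.
  move=> n x Ax; rewrite lam_comm; last exact: (tw_sub tw Ax).
  by rewrite (hT n x Ax).
have [_ _ _ As] := linked_projections (tw_mat tw 0%N) l1.
split=> //.
  by rewrite -(gnsnorm_gtrunc (a := a))//; apply: (subB sB); [exact: (sub1 sB)|exact: (tw_sub tw As)].
move=> n; rewrite -(gnsnorm_gtrunc (a := a))//.
have [_ hv hp] := tw_mem tw n; have Sv := tw_sub tw hv; have Sp := tw_sub tw hp.
by apply: (subB sB); [exact: (sub1 sB)|do 2?[apply: (subM sB) => //]].
Qed.

Lemma stage_towers a : exists (A : nat -> U -> Prop) (r u v p : nat -> U),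
  tower (U := U) (below (inr a : X)) f A r u v p /\
  forall n x, A n x -> lam gd (inr a) * x = wprod v n * x * wprod v n * lam gd (inr a).
Proof.
have [_ [A [r [u [v [p [tw hT link]]]]]]] := hst a.
exists A, r, u, v, p; split=> // n x Ax; rewrite lam_comm; last exact: (tw_sub tw Ax).
by rewrite (hT n x Ax).
Qed.

Lemma words_locally_matricial : locally_matricial (U := U) (fun=> True) f.
Proof.
apply: (proj1 (@words_invariants R d W hW guess th gd hth (fun=> True) (fun=> True)
  (fun b _ => hst b) (fun _ _ => I) (fun _ _ _ _ => I) _)) => x _.
by have [h|[b [h _]]] := base_or_belowS x; [left|right; exists b].
Qed.

(* A state of the whole algebra agreeing with [f] on some stage is [f]. *)
Lemma state_determined a g : posfun (g : U -> C) -> (forall x, below (inr a : X) x -> g x = f x) ->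
  forall x, g x = f x.
Proof.
move=> pg ga; have pf := fstate_posfun gd hth (omega1_wf hW).
apply: (words_ind wfX (a0 := inr a : X)) => // -[m|b] ab; first by rewrite leNgt lt_inlr in ab.
move=> IH x hx; have [y [z [hy hz ->]]] := @belowS_decomp _ _ _ _ gd _ x hx.
have [A [r [u [v [p [tw hw]]]]]] := stage_towers b.
rewrite (pfD pg) (pfD pf) IH//; congr (_ + _).
have hl := lam_symmetry gd (inr b : X).
by rewrite (tower_state_extension tw hl hw pg IH hz) (tower_state_extension tw hl hw pf (fun _ _ => erefl) hz).
Qed.

End Guess.

(* The completion of [E] for the seminorm [sup_p |io p x|], realized by functions on [P]. *)
Section Completion.
Variables (R : realType) (E : lmodType R[i]) (P : Type) (p0 : P) (io : P -> E -> R[i]).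
Local Notation C := R[i].

Definition approximable : {pred P -> C^o} :=
  mem [set F : P -> C^o | forall e : R, 0 < e -> exists x, forall p, nr (F p - io p x) <= e].

Record completion (lio : forall p, @linear_map R E C^o (io p))
    (bio : forall x, exists M, forall p, nr (io p x) <= M) :=
  Completion { cfun :> P -> C^o ; cfunP : cfun \in approximable }.
Arguments Completion {lio bio} cfun cfunP.

Variables (lio : forall p, @linear_map R E C^o (io p))
  (bio : forall x, exists M, forall p, nr (io p x) <= M).
Local Notation T := (completion lio bio).

HB.instance Definition _ := [isSub for @cfun lio bio].
HB.instance Definition _ := [Choice of T by <:].

Lemma approximable_submod : submod_closed approximable.
Proof.
split.
  apply/mem_set => e e0; exists 0 => p; rewrite (lmap0 (lio p)) subrr nr0; exact: ltW.
move=> k F G /set_mem hF /set_mem hG; apply/mem_set => e e0.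
have k0 : 0 < nr k + 1 by have := nr_ge0 k; lra.
have [x hx] := hF (e / 2 / (nr k + 1)) (divr_gt0 (divr_gt0 e0 (ltr0Sn _ _)) k0).
have [y hy] := hG (e / 2) (divr_gt0 e0 (ltr0Sn _ _)).
exists (k *: x + y) => p; rewrite (lio p).
have -> : (k *: F + G) p - (k *: io p x + io p y : C^o) = k * (F p - io p x) + (G p - io p y).
  by rewrite !fctE mulrBr opprD addrACA.
apply: le_trans (nrD _ _) _; rewrite nrM.
have h1 : nr k * nr (F p - io p x) <= (nr k + 1) * (e / 2 / (nr k + 1)).
  by apply: ler_pM; rewrite ?nr_ge0//; have := nr_ge0 k; lra.
rewrite mulrCA divff ?gt_eqF// mulr1 in h1; have := hy p; lra.
Qed.

HB.instance Definition _ := GRing.isSubmodClosed.Build C (P -> C^o)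
  approximable approximable_submod.
HB.instance Definition _ := [SubChoice_isSubLmodule of T by <:].

Implicit Types F G : T.

Definition cvals F : set R := [set nr (F p) | p in setT].
Definition cnr F : R := sup (cvals F).

Lemma has_sup_cvals F : has_sup (cvals F).
Proof.
split; first by exists (nr (F p0)), p0.
have /set_mem/(_ 1 ltr01)[x hx] := cfunP F; have [M hM] := bio x.
exists (1 + M) => _ [p _ <-]; rewrite -(subrK (io p x) (F p)).
by apply: le_trans (nrD _ _) _; apply: lerD.
Qed.

Lemma le_cnr F p : nr (F p) <= cnr F.
Proof. by apply: sup_upper_bound; [exact: has_sup_cvals|exists p]. Qed.

Lemma cnr_le F M : (forall p, nr (F p) <= M) -> cnr F <= M.
Proof. by move=> h; apply: ge_sup => [|_ [p _ <-]//]; case: (has_sup_cvals F). Qed.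

Lemma cnr_ge0 F : 0 <= cnr F.
Proof. exact: le_trans (nr_ge0 _) (le_cnr F p0). Qed.

Definition cnorm F : C := (cnr F)%:C.

Lemma cnormD F G : cnorm (F + G) <= cnorm F + cnorm G.
Proof.
rewrite /cnorm -rcD lecR; apply: cnr_le => p; apply: le_trans (nrD _ _) _.
by apply: lerD; exact: le_cnr.
Qed.

Lemma cnormZ k F : cnorm (k *: F) = `|k| * cnorm F.
Proof.
rewrite /cnorm nrE -rcM; congr (_%:C); apply/le_anti/andP; split.
  apply: cnr_le => p; rewrite -[X in nr X]/(k * F p) nrM ler_wpM2l ?nr_ge0//.
  exact: le_cnr.
have [->|k0] := eqVneq k 0; first by rewrite nr0 mul0r cnr_ge0.
have kp : 0 < nr k by rewrite nr_gt0.
rewrite -ler_pdivlMl//; apply: cnr_le => p; rewrite ler_pdivlMl// -nrM.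
exact: (le_cnr (k *: F) p).
Qed.

Lemma cnorm0_eq0 F : cnorm F = 0 -> F = 0.
Proof.
move=> /(congr1 (@complex.Re R)) /= h; apply/val_inj/funext => p; apply: nr_le0.
by rewrite -h; exact: le_cnr.
Qed.

HB.instance Definition _ := Lmodule_isNormed.Build C T cnormD cnormZ cnorm0_eq0.

Lemma completion_nr F : nr F = cnr F. Proof. by []. Qed.

Lemma completion_cauchy_cvg (F : set_system T) : ProperFilter F -> cauchy F -> cvg F.
Proof.
move=> FF /cauchyP hF.
have [x hx] : exists x : nat -> T, forall n, F (ball (x n) (n.+1%:R^-1)%:C).
  have H n : exists y : T, F (ball y (n.+1%:R^-1)%:C).
    by apply: hF; rewrite ltr0c invr_gt0.
  by have [x hx] := choice H; exists x.
have near m n : nr (x m - x n) <= m.+1%:R^-1 + n.+1%:R^-1.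
  have [y [/=]] := filter_ex (filterI (hx m) (hx n)); rewrite !ball_nr => h1 h2.
  by apply: le_trans (nr_tri _ y _) _; rewrite [X in _ + X]nr_distC; apply: lerD; exact: ltW.
have cx p : scauchy (fun n => (x n : T) p : C).
  move=> e e0; have e2 : 0 < e / 2 by lra.
  have [N hN] := null_inv 1 e2; exists N => m n Nm Nn.
  have := le_trans (le_cnr (x m - x n) p) (near m n).
  move=> h; apply: le_lt_trans h _.
  have := hN m Nm; rewrite div1r => h1; have := hN n Nn; rewrite div1r => h2.
  by rewrite [ltRHS](splitr e) ltrD.
have [g hg] := choice (fun p => complex_cauchy_cvg (cx p)).
have lim m p : nr (((x m : T) p : C) - g p) <= m.+1%:R^-1.
  apply/ler_addgt0Pr => e e0; have e2 : 0 < e / 2 by rewrite divr_gt0.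
  have [N1 h1] := hg p _ e2; have [N2 h2] := null_inv 1 e2; pose n := maxn N1 N2.
  have := h2 n (leq_maxr _ _); rewrite div1r => k2; have k1 := h1 n (leq_maxl _ _).
  apply: le_trans (nr_tri ((x m : T) p : C) ((x n : T) p : C) (g p)) _.
  rewrite [in leRHS](splitr e) addrA; apply: lerD; last exact: ltW.
  apply: le_trans (le_trans (le_cnr (x m - x n) p) (near m n)) _.
  by rewrite lerD2l ltW.
have gP : (g : P -> C^o) \in approximable.
  apply/mem_set => e e0; have e2 : 0 < e / 2 by lra.
  have [N hN] := null_inv 1 e2; have := hN N (leqnn _); rewrite div1r => h1.
  have /set_mem/(_ _ e2)[y hy] := cfunP (x N); exists y => p.
  apply: le_trans (nr_tri (g p) ((x N : T) p : C) _) _; rewrite nr_distC (splitr e).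
  by apply: lerD; [apply: le_trans (lim N p) (ltW h1)|exact: hy].
apply/cvg_ex; exists (Completion _ gP : T) => B /nbhs_ballP[e /= /gt0_cReal[-> e0] hB].
have e2 : 0 < complex.Re e / 2 by lra.
have [N hN] := null_inv 1 e2; have := hN N (leqnn _); rewrite div1r => h1.
apply: filterS (hx N) => y; rewrite ball_nr => h2; apply: hB; rewrite ball_nr.
apply: le_lt_trans (nr_tri _ (x N) _) _.
have : nr ((Completion _ gP : T) - x N) <= N.+1%:R^-1.
  by apply: cnr_le => p; rewrite -[X in nr X]/(g p - (x N : T) p) nr_distC; exact: lim.
move=> h3; rewrite [ltRHS](splitr (complex.Re e)); apply: ltrD; first exact: le_lt_trans h3 h1.
exact: lt_trans h2 h1.
Qed.

HB.instance Definition _ := Uniform_isComplete.Build T completion_cauchy_cvg.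

Lemma iotaP x : (fun p => io p x : C^o) \in approximable.
Proof. by apply/mem_set => e e0; exists x => p; rewrite subrr nr0 ltW. Qed.

Definition iota x : T := Completion _ (iotaP x).

Lemma iota_linear : linear_map iota.
Proof. by move=> k x y; apply/val_inj/funext => p; exact: (lio p). Qed.

Lemma iota_dense F (e : R) : 0 < e -> exists x, nr (F - iota x) < e.
Proof.
move=> e0; have e2 : 0 < e / 2 by lra.
have /set_mem/(_ _ e2)[x hx] := cfunP F; exists x.
by apply: (@le_lt_trans _ _ (e / 2)); [exact: cnr_le|lra].
Qed.

Lemma le_nr_iota p x : nr (io p x) <= nr (iota x). Proof. exact: (le_cnr (iota x) p). Qed.
Lemma nr_iota_le x M : (forall p, nr (io p x) <= M) -> nr (iota x) <= M.
Proof. exact: (cnr_le (F := iota x)). Qed.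

Definition completion_space : completeNormedModType C := T.

End Completion.

(** * Bounded extension from a dense subspace *)

Section DenseExtension.
Variables (R : realType) (E : lmodType R[i]).
Local Notation C := R[i].

Definition dense_map (V : normedModType C) (j : E -> V) :=
  forall v (e : R), 0 < e -> exists x, nr (v - j x) < e.

Lemma dense_seq (V : normedModType C) (j : E -> V) : dense_map j ->
  forall v, exists a : nat -> E, scvg (fun n => j (a n)) v.
Proof.
move=> dj v; have H n : exists x, nr (v - j x) < n.+1%:R^-1 by apply: dj; rewrite invr_gt0.
have [a ha] := choice H; exists a; apply: null_le (null_inv 1) => n.
by rewrite nr_distC div1r ltW.
Qed.

Lemma scvg_scauchy (V : normedModType C) (u : nat -> V) v : scvg u v -> scauchy u.
Proof.
move=> uv e e0; have e2 : 0 < e / 2 by lra.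
have [N hN] := uv _ e2; exists N => m n /hN h1 /hN h2.
by apply: le_lt_trans (nr_tri _ v _) _; rewrite [X in _ + X]nr_distC; lra.
Qed.

Variables (V : normedModType C) (j : E -> V).
Hypotheses (lj : linear_map j) (dj : dense_map j).

Lemma dense_extend (W : completeNormedModType C) (phi : E -> W) (M : R) :
  linear_map phi -> 0 <= M -> (forall x, nr (phi x) <= M * nr (j x)) ->
  exists phi' : V -> W, [/\ bop phi', forall x, phi' (j x) = phi x &
    forall v, nr (phi' v) <= M * nr v].
Proof.
move=> lp M0 hM.
have H v : exists w, forall a, scvg (fun n => j (a n)) v -> scvg (fun n => phi (a n)) w.
  have [a ha] := dense_seq dj v.
  have [|w hw] := @scauchy_cvg _ W (fun n => phi (a n)).
    move=> e e0; have M1 : 0 < M + 1 by lra.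
    have [N hN] := scvg_scauchy ha (divr_gt0 e0 M1); exists N => m n Nm Nn.
    rewrite -(lmapB lp); apply: le_lt_trans (hM _) _; rewrite (lmapB lj).
    have := hN m n Nm Nn; rewrite ltr_pdivlMr//.
    have := nr_ge0 (j (a m) - j (a n)); nra.
  exists w => b hb; have h1 := scvgB hb ha; rewrite subrr in h1.
  have h2 : scvg (fun n => phi (b n) - phi (a n)) 0.
    apply: null_le (nullM M0 h1) => n; rewrite !subr0 -(lmapB lp) -(lmapB lj); exact: hM.
  have := scvgD h2 hw; rewrite add0r; apply: scvg_ext => n.
  by rewrite subrK.
have [phi' hphi] := choice H.
have bd v : nr (phi' v) <= M * nr v.
  have [a ha] := dense_seq dj v; have ha' := hphi v a ha.
  rewrite leNgt; apply/negP => h; pose e := nr (phi' v) - M * nr v.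
  have e0 : 0 < e / 2 / (M + 1) by rewrite !divr_gt0//; rewrite /e; lra.
  have e1 : 0 < e / 2 by rewrite /e; lra.
  have [N1 h1] := scvg_nr ha e0; have [N2 h2] := scvg_nr ha' e1.
  have := h1 _ (leq_maxl N1 N2); have := h2 _ (leq_maxr N1 N2); set n := maxn _ _.
  rewrite !ltr_norml => /andP[k1 _] /andP[_]; rewrite ltr_pdivlMr; last by lra.
  have := hM (a n); have := nr_ge0 v; rewrite /e in k1 *; nra.
exists phi'; split=> //.
  split; last by exists M.
  move=> k x y; have [a ha] := dense_seq dj x; have [b hb] := dense_seq dj y.
  apply: (scvg_unique (u := fun n => phi (k *: a n + b n))).
    by apply: hphi; have := scvgD (scvgZ k ha) hb; apply: scvg_ext => n; rewrite lj.
  have := scvgD (scvgZ k (hphi _ _ ha)) (hphi _ _ hb); apply: scvg_ext => n.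
  by rewrite lp.
move=> x; have := hphi (j x) (fun=> x) (scvg_cst _) => h.
exact: scvg_unique h (scvg_cst _).
Qed.

(* Bounded operators are determined by their values on a dense subspace. *)
Lemma dense_bop_eq (W : normedModType C) (f g : V -> W) : bop f -> bop g ->
  (forall x, f (j x) = g (j x)) -> forall v, f v = g v.
Proof.
move=> bf bg h v; have [a ha] := dense_seq dj v.
apply: scvg_unique (bop_scvg bf ha) _.
by have := bop_scvg bg ha; apply: scvg_ext => n.
Qed.

End DenseExtension.

Lemma bil_bound (R : realType) (x y a b c d K : R) : x <= a * b -> y <= c * d -> 0 <= a -> 0 <= d ->
  b <= K -> c <= K -> x + y <= K * (a + d).
Proof.
move=> xa yc a0 d0 bK cK; rewrite mulrDr; apply: lerD.
  by apply: le_trans xa _; rewrite mulrC ler_wpM2r.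
by apply: le_trans yc _; rewrite ler_wpM2r.
Qed.

(* The Hilbert space of a positive semidefinite form. *)
Section FormCompletion.
Variables (R : realType) (E : lmodType R[i]) (B : E -> E -> R[i]).
Local Notation C := R[i].
Hypothesis hB : psd_form B.

Lemma form_polar a b a' b' : B a b - B a' b' = B (a - a') b + B a' (b - b').
Proof. by rewrite (formBl hB) (formBr hB) addrA subrK. Qed.

(** Pairing with this ball turns the seminorm [qn B] into a supremum of moduli, the shape that the
    completion by functions requires. *)
Definition qball := {y : E | qn B y <= 1}.
Definition qio (p : qball) (x : E) : C := B x (projT1 p).

Lemma qball0 : qn B 0 <= 1. Proof. by rewrite (qn0 hB). Qed.

Lemma qio_linear p : @linear_map R E C^o (qio p).
Proof. by move=> k x y; rewrite /qio (formDl hB) (formZl hB). Qed.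

Lemma qio_le p x : nr (qio p x) <= qn B x.
Proof.
apply: le_trans (form_CS hB x (projT1 p)) _; rewrite ler_piMr ?qn_ge0//.
exact: (projT2 p).
Qed.

Lemma qio_bound x : exists M, forall p, nr (qio p x) <= M.
Proof. by exists (qn B x) => p; exact: qio_le. Qed.

Definition form_space := completion_space (exist _ 0 qball0 : qball) qio_linear qio_bound.
Definition form_map (x : E) : form_space := iota qio_linear qio_bound x.
Local Notation j := form_map.

Lemma form_map_linear : linear_map j. Proof. exact: iota_linear. Qed.
Lemma form_map_dense : dense_map j.
Proof. by move=> v e; exact: (@iota_dense R E qball (exist _ 0 qball0) qio qio_linear qio_bound v e). Qed.

Lemma nr_form_map x : nr (j x) = qn B x.
Proof.
apply/le_anti/andP; split.
  by apply: (@nr_iota_le R E qball (exist _ 0 qball0) qio qio_linear qio_bound) => p; exact: qio_le.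
have [->|q0] := eqVneq (qn B x) 0; first exact: nr_ge0.
have qp : 0 < qn B x by rewrite lt_def q0 qn_ge0.
pose k : C := ((qn B x)^-1)%:C.
have kn : nr k = (qn B x)^-1 by rewrite nrR ger0_norm// invr_ge0 ltW.
have h : qn B (k *: x) <= 1 by rewrite (qnZ hB) kn mulVf.
pose p : qball := exist _ (k *: x) h.
have h2 : nr (qio p x) <= nr (j x).
  exact: (@le_nr_iota R E qball (exist _ 0 qball0) qio qio_linear qio_bound p x).
apply: le_trans h2; rewrite /qio /= (formZr hB) nrM nr_conj kn (form_xx hB) nrR ger0_norm ?sqr_ge0//.
by rewrite expr2 mulrA mulVf// mul1r.
Qed.

Lemma form_cvg a b a' b' F G : scvg (fun n => j (a n)) F -> scvg (fun n => j (b n)) G ->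
  scvg (fun n => j (a' n)) F -> scvg (fun n => j (b' n)) G ->
  null (fun n => nr (B (a n) (b n) - B (a' n) (b' n))).
Proof.
move=> ha hb ha' hb'; have [N1 h1] := scvg_nr hb ltr01; have [N2 h2] := scvg_nr ha' ltr01.
pose K := nr F + nr G + 1; have K0 : 0 <= K by have := nr_ge0 F; have := nr_ge0 G; rewrite /K; lra.
have da : null (fun n => nr (j (a n) - j (a' n))).
  by have := scvgB ha ha'; rewrite subrr; apply: null_le => n; rewrite subr0.
have db : null (fun n => nr (j (b n) - j (b' n))).
  by have := scvgB hb hb'; rewrite subrr; apply: null_le => n; rewrite subr0.
apply: (null_le_near (N0 := maxn N1 N2)) (nullM K0 (nullD da db)) => n nN.
have -> : B (a n) (b n) - B (a' n) (b' n) = B (a n - a' n) (b n) + B (a' n) (b n - b' n).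
  exact: form_polar.
apply: le_trans (nrD _ _) _.
have c1 := form_CS hB (a n - a' n) (b n); have c2 := form_CS hB (a' n) (b n - b' n).
rewrite -!nr_form_map !(lmapB form_map_linear) in c1 c2.
apply: (bil_bound c1 c2); rewrite ?nr_ge0//.
  have := h1 n (leq_trans (leq_maxl _ _) nN); rewrite ltr_norml => /andP[_ k1].
  have := nr_ge0 F; rewrite /K; lra.
have := h2 n (leq_trans (leq_maxr _ _) nN); rewrite ltr_norml => /andP[_ k1].
have := nr_ge0 G; rewrite /K; lra.
Qed.

Lemma form_inner_ex F G : exists c : C, forall a b, scvg (fun n => j (a n)) F ->
  scvg (fun n => j (b n)) G -> scvg (fun n => B (a n) (b n)) c.
Proof.
have [a ha] := dense_seq form_map_dense F; have [b hb] := dense_seq form_map_dense G.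
have [|c hc] := @complex_cauchy_cvg R (fun n => B (a n) (b n)).
  have [K hK] : exists K, 0 <= K /\ exists N, forall n, (N <= n)%N -> nr (j (a n)) <= K /\ nr (j (b n)) <= K.
    have [N1 h1] := scvg_nr ha ltr01; have [N2 h2] := scvg_nr hb ltr01.
    exists (nr F + nr G + 1); split; first by have := nr_ge0 F; have := nr_ge0 G; lra.
    exists (maxn N1 N2) => n nN.
    have := h1 n (leq_trans (leq_maxl _ _) nN); have := h2 n (leq_trans (leq_maxr _ _) nN).
    rewrite !ltr_norml => /andP[_ k2] /andP[_ k1]; have := nr_ge0 F; have := nr_ge0 G; lra.
  case: hK => K0 [N hN] e e0; have _ := e0; have e2 : 0 < e / 2 / (K + 1) by rewrite !divr_gt0//; lra.
  have [N1 h1] := scvg_scauchy ha e2; have [N2 h2] := scvg_scauchy hb e2.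
  exists (maxn N (maxn N1 N2)) => m n; rewrite !geq_max => /and3P[m0 m1 m2] /and3P[n0 n1 n2].
  have -> : B (a m) (b m) - B (a n) (b n) = B (a m - a n) (b m) + B (a n) (b m - b n).
    exact: form_polar.
  apply: le_lt_trans (nrD _ _) _.
  have c1 := form_CS hB (a m - a n) (b m); have c2 := form_CS hB (a n) (b m - b n).
  rewrite -!nr_form_map !(lmapB form_map_linear) in c1 c2.
  have [k1 k2] := hN m m0; have [k3 k4] := hN n n0.
  apply: le_lt_trans (bil_bound c1 c2 (nr_ge0 _) (nr_ge0 _) k2 k3) _.
  have K1 : 0 < K + 1 by lra.
  apply: (@le_lt_trans _ _ ((K + 1) * (nr (j (a m) - j (a n)) + nr (j (b m) - j (b n))))).
    by rewrite ler_wpM2r ?addr_ge0 ?nr_ge0//; lra.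
  rewrite mulrC -ltr_pdivlMr//; apply: lt_le_trans (ltrD (h1 m n m1 n1) (h2 m n m2 n2)) _.
  by rewrite -mulrDl -splitr.
exists c => a' b' ha' hb'; have h := form_cvg ha' hb' ha hb.
apply: null_le (nullD h hc) => n.
by rewrite -[X in nr X <= _](subrKA (B (a n) (b n))); exact: nrD.
Qed.

Definition form_inner F G : C := projT1 (cid (form_inner_ex F G)).

Lemma form_innerP F G a b : scvg (fun n => j (a n)) F ->
  scvg (fun n => j (b n)) G -> scvg (fun n => B (a n) (b n)) (form_inner F G).
Proof. exact: (projT2 (cid (form_inner_ex F G))). Qed.

Lemma form_innerDl F F' G : form_inner (F + F') G = form_inner F G + form_inner F' G.
Proof.
have [a ha] := dense_seq form_map_dense F; have [a' ha'] := dense_seq form_map_dense F'.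
have [b hb] := dense_seq form_map_dense G.
apply: (scvg_unique (u := fun n => B (a n + a' n) (b n))).
  apply: form_innerP => //; have := scvgD ha ha'; apply: scvg_ext => n.
  by rewrite (lmapD form_map_linear).
have := scvgD (form_innerP ha hb) (form_innerP ha' hb); apply: scvg_ext => n.
by rewrite (formDl hB).
Qed.

Lemma form_innerZl k F G : form_inner (k *: F) G = k * form_inner F G.
Proof.
have [a ha] := dense_seq form_map_dense F; have [b hb] := dense_seq form_map_dense G.
apply: (scvg_unique (u := fun n => B (k *: a n) (b n))).
  apply: form_innerP => //; have := scvgZ k ha; apply: scvg_ext => n.
  by rewrite (lmapZ form_map_linear).
have := @scvgZ R C^o k _ _ (form_innerP ha hb); apply: scvg_ext => n.
by rewrite (formZl hB).
Qed.

Lemma form_inner_sym F G : form_inner G F = (form_inner F G)^*%C.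
Proof.
have [a ha] := dense_seq form_map_dense F; have [b hb] := dense_seq form_map_dense G.
apply: scvg_unique (form_innerP hb ha) _.
by have := scvg_conj (form_innerP ha hb); apply: scvg_ext => n; rewrite -(form_sym hB).
Qed.

Lemma form_inner_norm F : form_inner F F = `|F| ^+ 2.
Proof.
have [a ha] := dense_seq form_map_dense F.
apply: scvg_unique (form_innerP ha ha) _; rewrite nrE -rcX.
have d : null (fun n => `|nr (j (a n)) - nr F|).
  by move=> e e0; exact: scvg_nr ha e e0.
have [N1 h1] := scvg_nr ha ltr01.
have K0 : 0 <= 2 * nr F + 1 by have := nr_ge0 F; lra.
apply: (null_le_near (N0 := N1)) (nullM K0 d) => n nN.
rewrite (form_xx hB) -nr_form_map -rcN -rcD nrR subr_sqr normrM mulrC ler_wpM2r//.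
have := h1 n nN; rewrite ltr_norml => /andP[_ k]; have := nr_ge0 F; have := nr_ge0 (j (a n)).
move=> p1 p2; rewrite ger0_norm; lra.
Qed.

Definition form_hilbert : hilbertType R :=
  @Hilbert R form_space form_inner form_innerDl form_innerZl form_inner_sym form_inner_norm.

Lemma form_hilbert_inner x y : @inner R form_hilbert (j x) (j y) = B x y.
Proof.
apply: scvg_unique (form_innerP (a := fun=> x) (b := fun=> y) (scvg_cst _) (scvg_cst _)) _.
exact: scvg_cst.
Qed.

End FormCompletion.

(** * The GNS representation of a bounded state *)

Section GNS.
Variables (R : realType) (U : starAlgType R) (f : U -> R[i]).
Local Notation C := R[i].
Hypothesis pf : posfun f.
Hypothesis bnd : forall a : U, exists2 M, 0 <= M & forall x, gnsnorm f (a * x) <= M * gnsnorm f x.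

Definition gns_space : hilbertType R := form_hilbert (gns_psd pf).
Definition gns_map (x : U) : gns_space := form_map (gns_psd pf) x.

Lemma gns_map_linear : linear_map gns_map. Proof. exact: form_map_linear. Qed.
Lemma gns_map_dense : dense_map gns_map. Proof. exact: form_map_dense. Qed.
Lemma gns_inner x y : inner (gns_map x) (gns_map y) = f (adj y * x).
Proof. exact: form_hilbert_inner. Qed.
Lemma nr_gns_map x : nr (gns_map x) = gnsnorm f x. Proof. exact: nr_form_map. Qed.

Lemma gns_rep_ex a : exists T : gns_space -> gns_space, bop T /\ forall x, T (gns_map x) = gns_map (a * x).
Proof.
have [M M0 hM] := bnd a.
have [|x|T [bT hT _]] := @dense_extend R U _ gns_map gns_map_linear gns_map_dense gns_space
    (fun x => gns_map (a * x)) M _ M0.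
- by move=> k x y; rewrite mulrDr -scalerAr gns_map_linear.
- by rewrite !nr_gns_map.
by exists T.
Qed.

Definition gns_rep a : gns_space -> gns_space := projT1 (cid (gns_rep_ex a)).
Lemma gns_rep_bop a : bop (gns_rep a). Proof. by rewrite /gns_rep; case: cid => T []. Qed.
Lemma gns_repE a x : gns_rep a (gns_map x) = gns_map (a * x).
Proof. by rewrite /gns_rep; case: cid => T []. Qed.

Let eq_on (T T' : gns_space -> gns_space) : bop T -> bop T' ->
  (forall x, T (gns_map x) = T' (gns_map x)) -> forall v, T v = T' v.
Proof. exact: (dense_bop_eq gns_map_dense). Qed.

Lemma gns_starrep : starrep gns_rep.
Proof.
have b := gns_rep_bop; have lm := gns_map_linear.
split=> //.
- apply: (@eq_on _ (fun x => x)) => [//||x]; first exact: bop_id.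
  by rewrite gns_repE mul1r.
- move=> a c; apply: (@eq_on _ (fun x => gns_rep a (gns_rep c x))) => [//||x]; first exact: bop_comp.
  by rewrite !gns_repE mulrA.
- move=> a c; apply: (@eq_on _ (fun x => gns_rep a x + gns_rep c x)) => [//||x].
    by have := bop_lin 1 1 (b a) (b c); congr bop; apply/funext => x; rewrite !scale1r.
  by rewrite !gns_repE mulrDl (lmapD lm).
- move=> k a; apply: (@eq_on _ (fun x => k *: gns_rep a x)) => [//||x].
    have [lT [M M0 hM]] := b a; split; first by move=> l x y; rewrite lT scalerDr !scalerA mulrC.
    exists (nr k * M); first by rewrite mulr_ge0// nr_ge0.
    by move=> x; rewrite nrZ -mulrA ler_wpM2l ?nr_ge0.
  by rewrite !gns_repE -scalerAl (lmapZ lm).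
- move=> a v w; have [x hx] := dense_seq gns_map_dense v; have [y hy] := dense_seq gns_map_dense w.
  have h1 := scvg_inner (bop_scvg (b a) hx) hy.
  have h2 := scvg_inner hx (bop_scvg (b (adj a)) hy).
  apply: (scvg_unique h1); move: h2; apply: scvg_ext => n.
  by rewrite !gns_repE !gns_inner adjM adjK mulrA.
Qed.

End GNS.

(* Intertwiners between the GNS representation of a locally matricial state [f]
   and an irreducible representation containing no vector with state [f] vanish. *)
Section Disjointness.
Variables (R : realType) (U : starAlgType R) (f : U -> R[i]).
Local Notation C := R[i].
Hypothesis pf : posfun f.
Hypothesis bnd : forall a : U, exists2 M, 0 <= M & forall x, gnsnorm f (a * x) <= M * gnsnorm f x.
Hypothesis lm : locally_matricial (fun=> True) f.

Local Notation Hf := (gns_space pf).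
Local Notation j := (gns_map pf).
Local Notation pi := (@gns_rep R U f pf bnd).
Let hpi : starrep pi := gns_starrep pf bnd.

Lemma scvg_mul (u v : nat -> C) x y : scvg u x -> scvg v y -> scvg (fun n => u n * v n) (x * y).
Proof.
move=> ux vy; have [N hN] := scvg_nr vy ltr01.
have K0 : 0 <= nr x + nr y + 1 by have := nr_ge0 x; have := nr_ge0 y; lra.
apply: (null_le_near (N0 := N)) (nullM K0 (nullD ux vy)) => n /hN.
rewrite ltr_norml => /andP[_ k1].
have -> : u n * v n - x * y = (u n - x) * v n + x * (v n - y).
  by rewrite mulrBl mulrBr addrA subrK.
apply: le_trans (nrD _ _) _; rewrite !nrM; apply: (bil_bound (lexx _) (lexx _)); rewrite ?nr_ge0//.
  by have := nr_ge0 x; lra.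
by have := nr_ge0 y; lra.
Qed.

(* Approximating the vacuum by minimal projections [r], both sides are read off [r (adj b * a) r]. *)
Lemma gns_commutant (D : Hf -> Hf) : bop D -> (forall a x, D (pi a x) = pi a (D x)) ->
  exists c : C, forall x, D x = c *: x.
Proof.
move=> bD cD; pose v := D (j 1); pose c := inner v (j 1); exists c.
have Dj a : D (j a) = pi a v by rewrite /v -cD gns_repE mulr1.
have basic a b : inner (D (j a)) (j b) = c * inner (j a) (j b).
  pose x := adj b * a.
  have H n : exists r (w : C), [/\ projection r, r * x * r = w *: r & gnsnorm f (1 - r) <= n.+1%:R^-1].
    have [||A [r [mA _ LA fr]]] := lm (L := [:: x]) (eps := n.+1%:R^-1); [by []|by rewrite invr_gt0|].
    have [Ar ar rr] := matalg_r mA; have [w hw] := matalg_min mA (LA x (mem_head _ _)).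
    by exists r, w; split.
  have [r hr'] := choice H; have [w hr] := choice hr'.
  have jr : scvg (fun n => j (r n)) (j 1).
    apply: null_le (null_inv 1) => n; rewrite nr_distC -(lmapB (gns_map_linear pf)) nr_gns_map div1r.
    by case: (hr n).
  have E1 : inner (D (j a)) (j b) = inner (pi x v) (j 1).
    by rewrite Dj /x (repM hpi) [RHS](rep_adj hpi) adjK gns_repE mulr1.
  have E2 : inner (j a) (j b) = inner (pi x (j 1)) (j 1).
    by rewrite gns_repE !gns_inner mulr1 adj1 mul1r.
  have key (y : Hf) n : inner (pi x (pi (r n) y)) (j (r n)) = w n * inner (pi (r n) y) (j 1).
    have [[ar rr] hw _] := hr n.
    rewrite -[j (r n)](_ : pi (r n) (j 1) = _); last by rewrite gns_repE mulr1.
    transitivity (inner (pi (r n * x * r n) y) (j 1)); last by rewrite hw (repZl hpi) innerZl.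
    by rewrite [LHS](rep_adjr hpi) ar -!mulrA !(repM hpi).
  have F1 : scvg (fun n => w n * inner (pi (r n) v) (j 1)) (inner (pi x v) (j 1)).
    have h : scvg (fun n => pi (r n) v) v.
      by have := bop_scvg bD jr; apply: scvg_ext => n; rewrite Dj.
    have := scvg_inner (bop_scvg (rep_bop hpi x) h) jr; apply: scvg_ext => n; exact: key.
  have F2 : scvg (fun n => w n * inner (pi (r n) (j 1)) (j 1)) (inner (pi x (j 1)) (j 1)).
    have h : scvg (fun n => pi (r n) (j 1)) (j 1).
      by move: jr; apply: scvg_ext => n; rewrite gns_repE mulr1.
    have := scvg_inner (bop_scvg (rep_bop hpi x) h) jr; apply: scvg_ext => n; exact: key.
  have G1 : scvg (fun n => inner (pi (r n) v) (j 1)) c.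
    have h : scvg (fun n => pi (r n) v) v.
      by have := bop_scvg bD jr; apply: scvg_ext => n; rewrite Dj.
    exact: scvg_inner h (scvg_cst _).
  have G2 : scvg (fun n => inner (pi (r n) (j 1)) (j 1)) 1.
    have h : scvg (fun n => pi (r n) (j 1)) (j 1).
      by move: jr; apply: scvg_ext => n; rewrite gns_repE mulr1.
    have := scvg_inner h (scvg_cst (j 1)); rewrite gns_inner adj1 mulr1 (pf1 pf); exact.
  rewrite E1 E2; apply: (scvg_unique (u := fun n => w n * inner (pi (r n) v) (j 1) * inner (pi (r n) (j 1)) (j 1))).
    by have := scvg_mul F1 G2; rewrite mulr1.
  by have := scvg_mul G1 F2; apply: scvg_ext => n; rewrite mulrCA mulrA.
have bc : bop (fun x : Hf => c *: x).
  split; first by move=> k x y; rewrite scalerDr !scalerA mulrC.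
  by exists (nr c); rewrite ?nr_ge0// => x; rewrite nrZ.
have gd := @gns_map_dense R U f pf.
apply: (@dense_bop_eq R U Hf j gd Hf D (fun x : Hf => c *: x) bD bc) => a.
apply: inner_inj => z; have [b hb] := dense_seq gd z.
apply: scvg_unique (scvg_inner (scvg_cst _) hb) _.
by have := scvg_inner (scvg_cst (c *: j a)) hb; apply: scvg_ext => n; rewrite innerZl basic.
Qed.

Variables (H : hilbertType R) (rho : U -> H -> H).
Hypothesis hr : starrep rho.
Hypothesis scal : forall D : H -> H, bop D ->
  (forall a x, D (rho a x) = rho a (D x)) -> exists g : C, forall x, D x = g *: x.
Hypothesis novec : ~ exists y, forall a, inner (rho a y) y = f a.

(** D^* D commutes with the GNS representation, hence is a scalar c. If D sends the vacuum to a
    nonzero vector y, then <a y, y> = c f(a) and c = |y|^2, so y normalized would have the state f,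
    contrary to [novec]. *)
Lemma intertwiner_from_gns (D : Hf -> H) : bop D -> (forall a x, D (pi a x) = rho a (D x)) ->
  forall x, D x = 0.
Proof.
move=> bD cD; have [S bS hS] := adjoint_exists bD.
have cS a y : S (rho a y) = pi a (S y).
  by apply: inner_inj => z; rewrite [LHS]inner_sym [RHS]inner_sym -hS (rep_adjr hpi) -hS cD -(rep_adjr hr).
have [||c hc] := gns_commutant (D := fun x => S (D x)); first exact: bop_comp.
  by move=> a x; rewrite cD cS.
have bZ : bop (fun _ : Hf => 0 : H).
  by split=> [k x y|]; [rewrite scaler0 addr0|exists 0 => // x; rewrite nr0 mul0r].
have cE : c = inner (D (j 1)) (D (j 1)).
  by rewrite inner_sym hS hc innerZr gns_inner adj1 mulr1 (pf1 pf) mulr1 conjcK.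
have cr : c^*%C = c by rewrite cE innerxx conjc_real.
have [y0|y0] := eqVneq (D (j 1)) 0.
  have h a : D (j a) = (fun _ : Hf => 0 : H) (j a).
    by rewrite -[j a](_ : pi a (j 1) = _); [rewrite cD y0 (rep0r hr)|rewrite gns_repE mulr1].
  have gd := @gns_map_dense R U f pf.
  exact: (@dense_bop_eq R U Hf j gd H D (fun=> 0) bD bZ h).
exfalso; apply: novec; pose y := D (j 1); pose k := ((nr y)^-1)%:C : C.
have ny : 0 < nr y by rewrite nr_gt0.
exists (k *: y) => a; rewrite (repZr hr) innerZl innerZr mulrA nr_sqr.
have -> : inner (rho a y) y = c * f a.
  by rewrite /y -cD gns_repE mulr1 hS hc innerZr cr gns_inner adj1 mul1r.
rewrite cE innerxx -/y nrR ger0_norm ?invr_ge0 ?nr_ge0// mulrA -rcM -exprMn mulVf ?gt_eqF//.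
by rewrite expr1n mul1r.
Qed.

Lemma intertwiner_to_gns (D : H -> Hf) : bop D -> (forall a x, D (rho a x) = pi a (D x)) ->
  forall x, D x = 0.
Proof.
move=> bD cD; have [S bS hS] := adjoint_exists bD.
have cS a y : S (pi a y) = rho a (S y).
  by apply: inner_inj => z; rewrite [LHS]inner_sym [RHS]inner_sym -hS (rep_adjr hr) -hS cD -(rep_adjr hpi).
by move=> x; apply: inner_eq0 => y; rewrite hS (intertwiner_from_gns bS cS) inner_sym inner0l conjc0.
Qed.

(** [joint_density] for the pair of representations. On the side of rho the involution exchanges h k
    and g k; on the GNS side it fixes the single normalized vector of q. *)
Lemma swap_density (m : nat) (h g : 'I_m -> H) (q : U) (del : R) :
  (forall k l, inner (h k) (h l) = (k == l)%:R) -> (forall k l, inner (g k) (g l) = (k == l)%:R) ->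
  (forall k l, inner (g k) (h l) = 0) -> 0 < gnsnorm f q <= 1 -> 0 < del ->
  exists T, [/\ adj T = T, forall k, nr (rho T (h k) - g k) < del,
    forall k, nr (rho T (g k) - h k) < del & gnsnorm f ((T - 1) * q) < del].
Proof.
move=> hh gg gh /andP[q0 q1] d0.
pose HH (b : bool) : hilbertType R := if b then Hf else H.
pose RR (b : bool) : U -> HH b -> HH b := if b return U -> HH b -> HH b then pi else rho.
pose II (b : bool) : finType := if b then (unit : finType) else (('I_m + 'I_m)%type : finType).
pose kq : C := ((gnsnorm f q)^-1)%:C.
pose ee (b : bool) : II b -> HH b := if b return II b -> HH b then (fun _ => kq *: j q)
  else (fun i : ('I_m + 'I_m)%type => match i with inl k => h k | inr k => g k end).
pose ss (b : bool) : II b -> II b := if b return II b -> II b then id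
  else (fun i : ('I_m + 'I_m)%type => match i with inl k => inr k | inr k => inl k end).
have nkq : nr kq = (gnsnorm f q)^-1 by rewrite nrR ger0_norm// invr_ge0 ltW.
have e1 : inner (kq *: j q) (kq *: j q) = 1.
  rewrite innerZl innerZr mulrA nr_sqr innerxx nr_gns_map nkq -rcM -exprMn mulVf ?gt_eqF//.
  by rewrite expr1n.
have [|||||T aT hT] := @joint_density R U HH RR _ _ _ II ee ss _ _ del d0.
- by case.
- by case=> D; [exact: gns_commutant|exact: scal].
- by case; case=> D // _; [exact: intertwiner_from_gns|exact: intertwiner_to_gns].
- by case=> //; case.
- case=> [[] []|[k|k] [l|l]]; [exact: e1|rewrite /= hh//|rewrite /= inner_sym gh conjc0//|rewrite /= gh//|rewrite /= gg//].
exists T; split=> // [k|k|]; [exact: (hT false (inl k))|exact: (hT false (inr k))|].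
have := hT true tt; rewrite /= (repZr hpi) gns_repE -scalerBr nrZ nkq.
have -> : j (T * q) - j q = j ((T - 1) * q).
  by rewrite -(lmapB (gns_map_linear pf)) mulrBl mul1r.
rewrite nr_gns_map ltr_pdivrMl// => lt.
by apply: lt_le_trans lt _; rewrite ler_piMl// ltW.
Qed.

End Disjointness.

(** * Orthonormalization, inverses in matrix algebras, Cayley transforms *)

Lemma nonzero_kernel_vector (F : fieldType) (n m : nat) (Y : 'M[F]_(n, m)) : (m < n)%N ->
  exists2 x : 'rV[F]_n, x != 0 & x *m Y = 0.
Proof.
move=> mn; have : kermx Y != 0.
  rewrite kermx_eq0 /row_free; apply/eqP => e; have := rank_leq_col Y.
  by rewrite e leqNgt mn.
by case/rowV0Pn => x /sub_kermxP h x0; exists x.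
Qed.

Section GramSchmidt.
Variables (R : realType) (H : hilbertType R).
Local Notation C := R[i].
Implicit Types (x y : H) (Q : H -> Prop).

Lemma gram_schmidt (n : nat) (x : 'I_n -> H) (Q : H -> Prop) :
  (forall k y z, Q y -> Q z -> Q (k *: y + z)) -> Q 0 -> (forall i, Q (x i)) ->
  exists m (h : 'I_m -> H) (t : 'I_n -> 'I_m -> C),
  [/\ forall k l, inner (h k) (h l) = (k == l)%:R, forall k, Q (h k) &
      forall i, x i = \sum_k t i k *: h k].
Proof.
move=> QD Q0; elim: n x => [|n IH] x Qx.
  by exists 0%N, (fun=> 0), (fun _ _ => 0); split=> [[]//|[]//|[]].
have [m [h [t [hh Qh ht]]]] := IH (fun i => x (lift ord0 i)) (fun i => Qx _).
pose y := x ord0 - \sum_k inner (x ord0) (h k) *: h k.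
have Qsum (c : 'I_m -> C) : Q (\sum_k c k *: h k).
  by elim/big_rec: _ => // k z _ Qz; apply: QD.
have Qy : Q y.
  by rewrite /y addrC -scaleN1r; apply: QD => //; exact: Qsum.
have yh l : inner y (h l) = 0.
  rewrite /y innerBl inner_suml (bigD1 l)//= big1 ?addr0 => [|k kl].
    by rewrite innerZl hh eqxx mulr1 subrr.
  by rewrite innerZl hh (negbTE kl) mulr0.
have [y0|y0] := eqVneq y 0.
  exists m, h, (fun i k => if unlift ord0 i is Some i' then t i' k else inner (x ord0) (h k)).
  split=> // i; case: (unliftP ord0 i) => [i' ->|->]; first exact: ht.
  by apply/eqP; rewrite -subr_eq0; apply/eqP.
have ny : 0 < nr y by rewrite nr_gt0.
pose h0 := ((nr y)^-1)%:C *: y.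
have h00 : inner h0 h0 = 1.
  rewrite innerZl innerZr mulrA nr_sqr nrR ger0_norm ?invr_ge0 ?ltW// innerxx -rcM -exprMn.
  by rewrite mulVf ?gt_eqF// expr1n.
have h0h k : inner h0 (h k) = 0 by rewrite innerZl yh mulr0.
pose h' (k : 'I_m.+1) := if unlift ord0 k is Some k' then h k' else h0.
pose t' (i : 'I_n.+1) (k : 'I_m.+1) : C := match unlift ord0 i, unlift ord0 k with
  | Some i', Some k' => t i' k' | Some i', None => 0
  | None, Some k' => inner (x ord0) (h k') | None, None => (nr y)%:C end.
have hl k : h' (lift ord0 k) = h k by rewrite /h' liftK.
have hz : h' ord0 = h0 by rewrite /h' unlift_none.
exists m.+1, h', t'; split.
- move=> k l; case: (unliftP ord0 k) => [k' ->|->]; case: (unliftP ord0 l) => [l' ->|->]; rewrite ?hl ?hz.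
  + by rewrite hh (inj_eq (@lift_inj _ _)).
  + by rewrite inner_sym h0h conjc0.
  + by rewrite h0h.
  + by rewrite h00 eqxx.
- move=> k; case: (unliftP ord0 k) => [k' ->|->]; rewrite ?hl ?hz//.
  by rewrite /h0 -[_ *: y]addr0; apply: QD.
move=> i; rewrite big_ord_recl hz; under eq_bigr => k _ do rewrite hl.
case: (unliftP ord0 i) => [i' ->|->]; rewrite /t' ?liftK !unlift_none.
  by rewrite scale0r add0r ht; apply: eq_bigr => k _; rewrite liftK.
rewrite /h0 scalerA -rcM divff ?gt_eqF// scale1r.
under eq_bigr => k _ do rewrite liftK.
by rewrite /y subrK.
Qed.

Lemma nr_orthonormal_sum (m : nat) (h : 'I_m -> H) (c : 'I_m -> C) :
  (forall k l, inner (h k) (h l) = (k == l)%:R) ->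
  inner (\sum_k c k *: h k) (\sum_k c k *: h k) = \sum_k c k * (c k)^*%C.
Proof.
move=> hh; rewrite inner_suml; apply: eq_bigr => k _; rewrite innerZl inner_sumr (bigD1 k)//=.
rewrite big1 ?addr0 => [|l lk]; first by rewrite innerZr hh eqxx mulr1.
by rewrite innerZr hh eq_sym (negbTE lk) mulr0.
Qed.
End GramSchmidt.

Section MatrixInverse.
Variables (R : realType) (U : starAlgType R).
Local Notation C := R[i].
Implicit Types (x y r u v : U) (A : U -> Prop).

(** Left multiplication by x is an injective endomorphism of the finite-dimensional space A; its
    matrix in the matrix units is invertible, which gives a right inverse of x, and injectivity
    makes it two-sided. *)
Lemma matalg_inverse A r x : matalg A r -> A x -> (forall y, A y -> x * y = 0 -> y = 0) ->
  exists2 y, A y & x * y = 1 /\ y * x = 1.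
Proof.
move=> mA Ax inj; have hA := matalg_subalg mA; have [I [a [hf ha]]] := mA.
have r0 : r != 0.
  apply/eqP => e; have := frame_sum hf; rewrite big1 => [/eqP|i _].
    by rewrite eq_sym oner_eq0.
  by rewrite -(frame_ar hf) e mulr0 mul0r.
suff [y Ay xy] : exists2 y, A y & x * y = 1.
  exists y => //; split=> //; apply/eqP; rewrite -subr_eq0; apply/eqP.
  apply: inj; first by apply: subB => //; [exact: subM|exact: sub1].
  by rewrite mulrBr mulr1 mulrA xy mul1r subrr.
pose J : finType := (I * I)%type; pose n := #|J|.
pose b (i : 'I_n) : U := let p := enum_val i in a p.1 * adj (a p.2).
have sumE (c : I -> I -> C) : \sum_i \sum_j c i j *: (a i * adj (a j)) =
    \sum_(k < n) c (enum_val k).1 (enum_val k).2 *: b k.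
  rewrite pair_bigA /= (reindex (@enum_val J J)) /=; last first.
    by exists enum_rank => k _; rewrite ?enum_valK ?enum_rankK.
  by apply: eq_big => // k; rewrite enum_valP.
have span z : A z -> exists c : 'rV[C]_n, z = \sum_k c 0 k *: b k.
  move=> /(frame_span hf)[c ->]; exists (\row_k c (enum_val k).1 (enum_val k).2).
  by rewrite sumE; apply: eq_bigr => k _; rewrite mxE.
have Ab k : A (b k) by exact: (frame_unit hf).
have Asum (c : 'rV[C]_n) : A (\sum_k c 0 k *: b k).
  by elim/big_rec: _ => [|k z _ Az]; [exact: sub0|apply: subD => //; exact: subZ].
have indep (c : 'rV[C]_n) : \sum_k c 0 k *: b k = 0 -> c = 0.
  move=> e; apply/rowP => k; rewrite mxE; pose p := enum_val k.
  have : adj (a p.1) * (\sum_k c 0 k *: b k) * a p.2 = c 0 k *: r.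
    rewrite mulr_sumr mulr_suml (bigD1 k)//= big1 ?addr0 => [|l lk].
      rewrite -scalerAr -scalerAl /b -/p (frame_orthM hf) eqxx scale1r -mulrA (frame_orth hf).
      by rewrite eqxx scale1r (frame_rr hf).
    rewrite -scalerAr -scalerAl /b (frame_orthM hf) -scalerAl -mulrA (frame_orth hf).
    have [e1|] := eqVneq p.1 (enum_val l).1; last by rewrite scale0r scaler0.
    have [e2|] := eqVneq (enum_val l).2 p.2; last by rewrite !(scale0r, mulr0, scaler0).
    case/negP: lk; apply/eqP; apply: enum_val_inj; rewrite -/p.
    by move: e1 e2; case: (enum_val l) p => ? ? [? ?] /= -> ->.
  rewrite e mulr0 mul0r => /esym/eqP; rewrite scaler_eq0 (negbTE r0) orbF => /eqP.
  by [].
have [M hM] := choice (fun k => span _ (subM hA Ax (Ab k))).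
pose MM : 'M[C]_n := \matrix_(k, l) M k 0 l.
have act (c : 'rV[C]_n) : x * (\sum_k c 0 k *: b k) = \sum_l (c *m MM) 0 l *: b l.
  rewrite mulr_sumr; under eq_bigr => k _ do rewrite -scalerAr hM scaler_sumr.
  rewrite exchange_big; apply: eq_bigr => l _; rewrite mxE scaler_suml.
  by apply: eq_bigr => k _; rewrite mxE scalerA.
have uM : MM \in unitmx.
  rewrite -row_free_unit -kermx_eq0; apply/eqP/row_matrixP => i; rewrite row0.
  apply: indep; apply: inj => //; rewrite act -row_mul mulmx_ker row0.
  by rewrite big1// => l _; rewrite mxE scale0r.
have [c hc] := span _ (sub1 hA).
exists (\sum_k (c *m invmx MM) 0 k *: b k); first exact: Asum.
by rewrite act mulmxKV// -hc.
Qed.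

(* The Cayley transform of [T]. *)
Lemma cayley A r T : (forall y z, adj y * y + adj z * z = 0 -> y = 0) ->
  matalg A r -> A T -> adj T = T -> exists u, [/\ adj u * u = 1, u * adj u = 1,
    u * (T + 'i *: 1) = T - 'i *: 1 & forall x, T * x = x * T -> u * x = x * u].
Proof.
move=> faith mA AT aT; have hA := matalg_subalg mA.
have i2 : ('i : C) * 'i = -1 by rewrite -expr2 sqr_i.
have ic : ('i : C)^*%C = - 'i by apply/eqP; rewrite eq_complex /= oppr0 !eqxx.
pose z := T + 'i *: 1; have az : adj z = T - 'i *: 1.
  by rewrite adjD aT adjZ adj1 ic scaleNr.
have Az : A z by apply: subD => //; apply: subZ => //; exact: sub1.
have zz : adj z * z = T * T + 1.
  rewrite az mulrBl mulrDr mulrDr -!scalerAl -!scalerAr !mul1r !mulr1 scalerA i2 scaleN1r.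
  by rewrite opprB addrA addrAC addrK.
have comT x : T * x = x * T -> z * x = x * z.
  by move=> h; rewrite mulrDl mulrDr h -scalerAl -scalerAr mul1r mulr1.
have comT' x : T * x = x * T -> adj z * x = x * adj z.
  by move=> h; rewrite az mulrBl mulrBr h -scalerAl -scalerAr mul1r mulr1.
have Tz : T * adj z = adj z * T by rewrite comT'.
have nz : z * adj z = adj z * z := comT _ Tz.
have [|y Ay [zy yz]] := matalg_inverse mA Az.
  move=> y Ay e; apply: (faith y (T * y)).
  transitivity (adj y * (adj z * z) * y).
    by rewrite zz adjM aT mulrDr mulrDl mulr1 [LHS]addrC !mulrA.
  by rewrite -!mulrA e !mulr0.
have ycom x : z * x = x * z -> y * x = x * y.
  by move=> h; rewrite -[LHS]mulr1 -zy -mulrA (mulrA x) -h !mulrA yz mul1r.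
have yaz := ycom _ nz.
exists (adj z * y); split.
- transitivity (adj y * (z * adj z) * y); first by rewrite adjM adjK !mulrA.
  by rewrite nz mulrA -mulrA zy mulr1 -adjM zy adj1.
- have zay : z * adj y = adj y * z by rewrite -[LHS]adjK adjM adjK yaz adjM adjK.
  transitivity (adj z * y * (z * adj y)); first by rewrite adjM adjK zay.
  by rewrite mulrA -(mulrA (adj z)) yz mulr1 -adjM yz adj1.
- by rewrite -/z -mulrA yz mulr1.
- by move=> x h; rewrite -mulrA (ycom _ (comT _ h)) mulrA (comT' _ h) mulrA.
Qed.
End MatrixInverse.

(** * Families of mutually orthogonal flips *)

Section QubitList.
Variables (R : realType) (U : starAlgType R) (f : U -> R[i]).
Local Notation C := R[i].
Hypothesis pf : posfun f.
Hypothesis fq : free_qubits (fun=> True) f.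

(** Adjoin n free qubits one after the other, collecting their flips as the v k and multiplying r by
    their spectral projections. Each flip then moves the range of r' to a subspace orthogonal to it,
    and different flips to mutually orthogonal ones. *)
Lemma free_flips (A : U -> Prop) (r : U) (n : nat) (eps : R) : matalg A r -> 0 < eps ->
  exists (v : nat -> U) (A' : U -> Prop) (r' : U),
  [/\ matalg A' r', forall x, A x -> A' x,
      [/\ r * r' = r', r' * r = r' & gnsnorm f (1 - r') <= gnsnorm f (1 - r) + eps],
      forall k, (k < n)%N -> [/\ A' (v k), commutes (v k) A & adj (v k) = v k] &
      forall k l, (k < n)%N -> (l < n)%N ->
        r' * v k * v l * r' = (k == l)%:R *: r' /\ r' * v k * r' = 0].
Proof.
move=> mA; elim: n eps => [|n IH] eps e0.
  have [_ ar rr] := matalg_r mA; exists (fun=> 1), A, r; split=> //.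
  by split=> //; rewrite lerDl ltW.
have e2 : 0 < eps / 2 by rewrite divr_gt0.
have [v [A' [r' [mA' AA' [r1 r2 fr] hv hvv]]]] := IH _ e2.
have sA' := matalg_subalg mA'; have [Ar' ar' rr'] := matalg_r mA'.
have [L [LA' gen com _]] := matalg_findim mA'.
have [||u [w [_ quw cuw fu]]] := fq (L := L) (eps := eps / 2); [by []|by []|].
have cu : commutes u A' by apply: com => x /cuw[].
have cw : commutes w A' by apply: com => x /cuw[].
have [A2 [mA2 A'A2 A2u A2w _]] := matalg_qubit mA' quw cu cw.
have [hu hw _] := quw; have [aw ww] := hw.
pose p := specproj u; have hp : projection p := specproj_proj hu; have [ap pp] := hp.
have cp x : A' x -> p * x = x * p.
  by move=> Ax; rewrite /p /specproj -scalerAl -scalerAr mulrDl mulrDr mul1r mulr1 cu.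
have pwp : p * w * p = 0 by rewrite -mulrA; exact: specproj_anti quw.
exists (fun k => if (k < n)%N then v k else w), A2, (r' * p); split=> //.
- by move=> x /AA'/A'A2.
- split; first by rewrite mulrA r1.
    by rewrite -mulrA cp ?mulrA ?r2//; apply: AA'; case: (matalg_r mA).
  apply: le_trans (gnsnormM1 pf _ (Projection ar' rr')) _; rewrite (splitr eps) addrA.
  exact: lerD.
- move=> k; rewrite ltnS; case: ifP => [kn _|_ _]; last first.
    by split=> // x /AA'; exact: cw.
  by have [h1 h2 h3] := hv k kn; split=> //; exact: A'A2.
have mid x : A' x -> (r' * p) * x * (r' * p) = (r' * x * r') * p.
  move=> Ax; transitivity (r' * (p * x) * (r' * p)); first by rewrite !mulrA.
  by rewrite cp// !mulrA -(mulrA _ p r') cp// !mulrA -(mulrA _ p p) pp.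
have flip k : (k < n)%N -> r' * p * v k * (r' * p) = 0.
  by move=> kn; have [h1 _ _] := hv k kn; rewrite mid// (hvv k k kn kn).2 mul0r.
have wmid : r' * p * w * (r' * p) = 0.
  transitivity (r' * r' * (p * w * p)); last by rewrite pwp mulr0.
  rewrite -(mulrA r') -(mulrA r' (p * w)) (mulrA (p * w)) -!mulrA; congr (_ * _).
  by rewrite (mulrA w) cw// -!mulrA (mulrA p) cp// -mulrA.
have wv k : (k < n)%N -> r' * p * w * v k * (r' * p) = 0.
  move=> kn; have [h1 _ _] := hv k kn.
  transitivity (r' * (p * w) * (v k * r' * p)); first by rewrite !mulrA.
  rewrite -(cp _ (subM sA' h1 Ar')).
  transitivity (r' * (p * w * p) * (v k * r')); first by rewrite !mulrA.
  by rewrite pwp mulr0 mul0r.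
have ww' : r' * p * w * w * (r' * p) = r' * p.
  by rewrite -(mulrA (r' * p) w) ww (mid 1 (sub1 sA')) mulr1 rr'.
move=> k l; rewrite !ltnS => kn ln; case: (ltnP k n) => k1; case: (ltnP l n) => l1.
- have [h1 _ _] := hv k k1; have [h2 _ _] := hv l l1; split; last exact: flip.
  rewrite -(mulrA (r' * p)) mid; last exact: subM.
  by rewrite mulrA (hvv k l k1 l1).1 -scalerAl.
- have [h1 _ _] := hv k k1; split; last exact: flip.
  rewrite -(mulrA (r' * p)) -(cw _ h1) (mulrA (r' * p) w) wv// ltn_eqF ?scale0r//; exact: leq_trans l1.
- split=> //; rewrite wv// gtn_eqF ?scale0r//; exact: leq_trans k1.
- split=> //; rewrite ww'; have -> : k == l by apply/eqP; lia.
  by rewrite scale1r.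
Qed.
End QubitList.

(** * Vectors in general position *)

Section Separated.
Variables (R : realType) (U : starAlgType R) (f : U -> R[i]).
Local Notation C := R[i].
Hypothesis pf : posfun f.
Hypothesis lm : locally_matricial (fun=> True) f.
Hypothesis fq : free_qubits (fun=> True) f.
Hypothesis faith : forall y z : U, adj y * y + adj z * z = 0 -> y = 0.
Variables (H : hilbertType R) (rho : U -> H -> H).
Hypothesis hr : starrep rho.
Hypothesis swap : forall (m : nat) (h g : 'I_m -> H) (q : U) (del : R),
  (forall k l, inner (h k) (h l) = (k == l)%:R) -> (forall k l, inner (g k) (g l) = (k == l)%:R) ->
  (forall k l, inner (g k) (h l) = 0) -> 0 < gnsnorm f q <= 1 -> 0 < del ->
  exists T, [/\ adj T = T, forall k, nr (rho T (h k) - g k) < del,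
    forall k, nr (rho T (g k) - h k) < del & gnsnorm f ((T - 1) * q) < del].
Variable xi : H.
Hypothesis xi1 : inner xi xi = 1.

(** As the sum of the a_i a_i^* is 1, some a_i^* xi is nonzero, and it lies in the range of r. *)
Lemma min_vector (A : U -> Prop) (r : U) : matalg A r -> exists eta, inner eta eta = 1 /\ rho r eta = eta.
Proof.
move=> mA; have [I [a [hf ha]]] := mA; have [i hi] : exists i, rho (adj (a i)) xi != 0.
  apply: contrapT => no; have : xi = 0.
    rewrite -[LHS](rep1 hr) -(frame_sum hf) (rep_suml hr) big1// => i _.
    rewrite (repM hr); have [->|h] := eqVneq (rho (adj (a i)) xi) 0; first exact: rep0r hr _.
    by exfalso; apply: no; exists i.
  by move=> e; move/eqP: xi1; rewrite e inner0l eq_sym oner_eq0.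
pose y := rho (adj (a i)) xi; have ny : 0 < nr y by rewrite nr_gt0.
exists (((nr y)^-1)%:C *: y); split.
  rewrite innerZl innerZr mulrA nr_sqr nrR ger0_norm ?invr_ge0 ?ltW// innerxx -rcM -exprMn.
  by rewrite mulVf ?gt_eqF// expr1n.
by rewrite (repZr hr) /y -(repM hr) (frame_ra hf).
Qed.

(* A unit vector in the range of [r] such that the flips [v k] move it into
   pairwise orthogonal vectors, all orthogonal to the family [h]. *)
Lemma generic_vector (A : U -> Prop) (r : U) (m : nat) (v : nat -> U) (h : 'I_m -> H) : matalg A r ->
  (forall k, (k < m)%N -> A (v k)) ->
  exists zeta, [/\ inner zeta zeta = 1, rho r zeta = zeta &
    forall (k l : 'I_m), inner (rho (v k) zeta) (h l) = 0].
Proof.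
move=> mA Av; have sA := matalg_subalg mA; have [Ar ar rr] := matalg_r mA.
(* One more flip than there are orthogonality conditions, so some nontrivial combination of the
   flipped vectors meets them all. *)
pose J : finType := ('I_m * 'I_m)%type; pose D := #|J|.+1.
have [v' [A' [r' [mA' AA' [r1 r2 _] hv hvv]]]] := free_flips pf fq D mA ltr01.
have [eta [eta1 reta]] := min_vector mA'.
have [Ar' ar' rr'] := matalg_r mA'.
pose e (l : 'I_D) := rho (v' l) eta.
pose Y : 'M[C]_(D, #|J|) := \matrix_(l, k) inner (rho (v (@enum_val J J k).1) (e l)) (h (@enum_val J J k).2).
have [x x0 xY] := nonzero_kernel_vector Y (ltnSn _).
pose z := \sum_l x 0 l *: e l.
have ee k l : inner (e k) (e l) = (k == l)%:R.
  have [_ _ a'] := hv l (ltn_ord l).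
  rewrite /e (rep_adjr hr) a' -(repM hr) -{1}reta -{2}reta (rep_adjr hr) ar' -!(repM hr) !mulrA.
  by rewrite (hvv l k _ _).1 ?ltn_ord// (repZl hr) reta innerZl eta1 mulr1 eq_sym.
have zz : inner z z = (nr z ^+ 2)%:C by exact: innerxx.
have z0 : 0 < nr z.
  rewrite nr_gt0; apply/eqP => ez; move/eqP: x0; apply.
  apply/rowP => l; rewrite mxE; have : inner z (e l) = x 0 l.
    rewrite /z inner_suml (bigD1 l)//= big1 ?addr0 => [|k kl].
      by rewrite innerZl ee eqxx mulr1.
    by rewrite innerZl ee (negbTE kl) mulr0.
  by rewrite ez inner0l.
pose c : C := ((nr z)^-1)%:C.
exists (c *: z); split.
- rewrite innerZl innerZr mulrA nr_sqr nrR ger0_norm ?invr_ge0 ?ltW// zz -rcM -exprMn.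
  by rewrite mulVf ?gt_eqF// expr1n.
- rewrite (repZr hr) /z (rep_sumr hr); congr (_ *: _); apply: eq_bigr => l _.
  have [_ cv _] := hv l (ltn_ord l).
  have req : rho r eta = eta by rewrite -{1}reta -(repM hr) r1 reta.
  by rewrite (repZr hr) /e -(repM hr) -(cv _ Ar) (repM hr) req.
move=> k l; rewrite (repZr hr) innerZl /z (rep_sumr hr) inner_suml.
have := congr1 (fun M : 'rV_(#|J|) => M 0 (enum_rank (k, l))) xY; rewrite !mxE.
move=> h0; rewrite [X in _ * X](_ : _ = 0) ?mulr0// -[RHS]h0; apply: eq_bigr => i _.
by rewrite (repZr hr) innerZl mxE enum_rankK.
Qed.

End Separated.

(** * Cayley transforms of approximate symmetries *)

Section CayleyVectors.
Variables (R : realType).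
Local Notation C := R[i].

Let i2 : ('i : C) * 'i = -1. Proof. by rewrite -expr2 sqr_i. Qed.

Lemma nr_i : nr ('i : C) = 1.
Proof. by apply/eqP; rewrite -(@eqrXn2 _ 2%N) ?nr_ge0// -nrX sqr_i nrN nr1 expr1n. Qed.

Lemma cayley_solve2 (V : lmodType C) (h g p q d1 e1 d2 e2 : V) :
  q + e1 + 'i *: p = g + d1 - 'i *: h -> p + e2 + 'i *: q = h + d2 - 'i *: g ->
  p + 'i *: g = (2^-1 : C) *: (d2 - e2 - 'i *: (d1 - e1)).
Proof.
have aux (x e y z w d : V) : x + e + y = w + d - z -> d - e = x + y + z - w.
  move=> E; have -> : d = x + e + y + z - w by rewrite E subrK addrC addKr.
  by rewrite (addrAC x e) (addrAC (x + y) e) (addrAC (x + y + z) e) addrK.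
move=> /aux -> /aux ->.
have -> : 'i *: (q + 'i *: p + 'i *: h - g) = 'i *: q - p - h - 'i *: g.
  by rewrite scalerBr !scalerDr !scalerA i2 !scaleN1r.
rewrite (addrAC p) -(addrA (p + 'i *: g)) (addrAC ('i *: q) (- p)) -(addrA _ (- p)) -opprD.
by rewrite opprB addrACA subrr addr0 scalerDr -scalerDl half_half scale1r.
Qed.

Lemma cayley_solve1 (V : lmodType C) (p r d e : V) :
  e + p + 'i *: p = d + r - 'i *: r -> p + 'i *: r = ((1 - 'i) / 2) *: (d - e).
Proof.
move=> E; have -> : d = e + p + 'i *: p + 'i *: r - r by rewrite E subrK addrK.
have -> : e + p + 'i *: p + 'i *: r - r - e = (1 + 'i) *: p - (1 - 'i) *: r.
  by rewrite -!(addrA e) addrC subrK scalerDl scalerBl !scale1r opprB !addrA.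
rewrite scalerBr !scalerA; have -> : (1 - 'i) / 2 * (1 + 'i) = 1 :> C.
  by rewrite mulrAC -subr_sqr expr1n sqr_i opprK divff.
have -> : (1 - 'i) / 2 * (1 - 'i) = - 'i :> C.
  rewrite mulrAC -expr2 sqrrB expr1n mul1r sqr_i addrAC subrr add0r -mulr_natr mulNr.
  by rewrite mulfK// pnatr_eq0.
by rewrite scale1r scaleNr opprK.
Qed.

(** Where T squares to 1 its Cayley transform is -i T, so a T exchanging h and g gives a u with u h
    = -i g. [cayley_solve2] expresses the deviation exactly through the two errors of T. *)
Lemma cayley_vector (U : starAlgType R) (H : hilbertType R) (rho : U -> H -> H) (u T : U)
    (h g : H) (del : R) : starrep rho -> adj u * u = 1 -> u * (T + 'i *: 1) = T - 'i *: 1 ->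
  nr (rho T h - g) < del -> nr (rho T g - h) < del -> nr (rho u h + 'i *: g) <= 2 * del.
Proof.
move=> hr uu uT; pose d1 := rho T h - g; pose d2 := rho T g - h; rewrite -/d1 -/d2 => h1 h2.
have ue y : rho u (rho T y) + 'i *: rho u y = rho T y - 'i *: y.
  have := congr1 (rho ^~ y) uT; rewrite (repM hr) (repDl hr) (repBl hr) !(repZl hr) !(rep1 hr).
  by rewrite (repDr hr) (repZr hr).
have E1 := ue h; have E2 := ue g.
have T1 : rho T h = g + d1 by rewrite /d1 addrC subrK.
have T2 : rho T g = h + d2 by rewrite /d2 addrC subrK.
rewrite T1 (repDr hr) in E1; rewrite T2 (repDr hr) in E2.
rewrite (cayley_solve2 E1 E2) nrZ halfC nrR ger0_norm ?invr_ge0//.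
have ud x : nr (rho u x) = nr x by exact: rep_isometry.
have a1 := nrB d1 (rho u d1); have a2 := nrB d2 (rho u d2); rewrite !ud in a1 a2.
have := nrB (d2 - rho u d2) ('i *: (d1 - rho u d1)); rewrite nrZ nr_i mul1r.
move: h1 h2 a1 a2; lra.
Qed.
End CayleyVectors.

Lemma matalg_conj (R : realType) (U : starAlgType R) (A : U -> Prop) (r u : U) :
  matalg A r -> adj u * u = 1 -> u * adj u = 1 ->
  matalg (fun x => A (u * x * adj u)) (adj u * r * u).
Proof.
move=> [I [b [hb Ab]]] uu uu'; pose conj x := adj u * x * u.
have conjM x y : conj x * conj y = conj (x * y).
  by rewrite /conj !mulrA -(mulrA (adj u * x) u) uu' mulr1.
have conjA x : adj (conj x) = conj (adj x) by rewrite /conj !adjM adjK mulrA.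
have conjK x : u * conj x * adj u = x.
  by rewrite /conj !mulrA uu' mul1r -mulrA uu' mulr1.
have conjZ k x : conj (k *: x) = k *: conj x by rewrite /conj -scalerAr -scalerAl.
have csum (J : finType) (F : J -> U) : conj (\sum_i F i) = \sum_i conj (F i).
  by rewrite /conj mulr_sumr mulr_suml.
exists I, (fun i => conj (b i)); split; last by move=> i; rewrite conjK.
split.
- by move=> i j; rewrite conjA conjM (frame_orth hb) conjZ.
- rewrite -[RHS]uu -[adj u]mulr1 -(frame_sum hb) -/(conj _) csum.
  by apply: eq_bigr => i _; rewrite -conjM -conjA.
have cs (c : I -> I -> R[i]) : conj (\sum_i \sum_j c i j *: (b i * adj (b j))) =
    \sum_i \sum_j c i j *: (conj (b i) * adj (conj (b j))).
  rewrite csum; apply: eq_bigr => i _; rewrite csum.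
  by apply: eq_bigr => j _; rewrite conjZ -conjM -conjA.
move=> x; split=> [/(frame_span hb)[c hc]|[c hc]].
  by exists c; rewrite -cs -hc /conj !mulrA uu mul1r -mulrA uu mulr1.
by apply/(frame_span hb); exists c; rewrite hc -cs conjK.
Qed.

(** * Separating f from a vector state *)

Section SeparatedState.
Variables (R : realType) (U : starAlgType R) (f : U -> R[i]).
Local Notation C := R[i].
Hypothesis pf : posfun f.
Hypothesis lm : locally_matricial (fun=> True) f.
Hypothesis fq : free_qubits (fun=> True) f.
Hypothesis faith : forall y z : U, adj y * y + adj z * z = 0 -> y = 0.
Variables (H : hilbertType R) (rho : U -> H -> H).
Hypothesis hr : starrep rho.
Hypothesis swap : forall (m : nat) (h g : 'I_m -> H) (q : U) (del : R),
  (forall k l, inner (h k) (h l) = (k == l)%:R) -> (forall k l, inner (g k) (g l) = (k == l)%:R) ->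
  (forall k l, inner (g k) (h l) = 0) -> 0 < gnsnorm f q <= 1 -> 0 < del ->
  exists T, [/\ adj T = T, forall k, nr (rho T (h k) - g k) < del,
    forall k, nr (rho T (g k) - h k) < del & gnsnorm f ((T - 1) * q) < del].
Variable xi : H.
Hypothesis xi1 : inner xi xi = 1.

Let gn := gns_psd pf.

Let gnsnorm_isom u x : adj u * u = 1 -> gnsnorm f (u * x) = gnsnorm f x.
Proof.
move=> uu; apply/eqP; rewrite -(@eqrXn2 _ 2%N)// ?qn_ge0//; apply/eqP.
by rewrite !(gnsnorm_sqr pf) adjM mulrA -(mulrA (adj x)) uu mulr1.
Qed.

Let gD x y : gnsnorm f (x + y) <= gnsnorm f x + gnsnorm f y. Proof. exact: qnD gn _ _. Qed.
Let gB x y : gnsnorm f (x - y) <= gnsnorm f x + gnsnorm f y. Proof. exact: qnB gn _ _. Qed.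
Let gZ k x : gnsnorm f (k *: x) = nr k * gnsnorm f x. Proof. exact: qnZ gn _ _. Qed.

Let cayley_gns (r u T : U) (del : R) : adj u * u = 1 -> u * (T + 'i *: 1) = T - 'i *: 1 ->
  gnsnorm f (T * r - r) <= del -> gnsnorm f (u * r + 'i *: r) <= 2 * del.
Proof.
move=> uu uT; set d := T * r - r => fd.
have E : u * d + u * r + 'i *: (u * r) = d + r - 'i *: r.
  have := congr1 ( *%R^~ r) uT; rewrite /= mulrBl -mulrA mulrDl -!scalerAl !mul1r mulrDr.
  by rewrite -scalerAr -mulrDr /d subrK.
rewrite (cayley_solve1 E) gZ.
have h2 : nr ((1 - 'i) / 2 : R[i]) <= 1.
  apply: le_trans (nr_le_ReIm _) _; rewrite halfC mulrC cReZ.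
  have -> : complex.Im ((2^-1)%:C * (1 - 'i)) = 2^-1 * -1 :> R by rewrite /=; ring.
  have -> : complex.Re (1 - 'i : R[i]) = 1 by rewrite /= oppr0 addr0.
  by rewrite mulr1 mulrN1 normrN ger0_norm ?invr_ge0//; lra.
have h3 := gB d (u * d); rewrite (gnsnorm_isom _ uu) in h3.
have h4 : 0 <= gnsnorm f (d - u * d) := qn_ge0 _ _.
by apply: le_trans (ler_piMl h4 h2) _; lra.
Qed.

(* The matrix algebra separating [f] from the vector state at [xi] is obtained by
   conjugating with the Cayley transform of an element that nearly exchanges the
   components [h k] of [xi] with generic vectors [g k] while nearly fixing the
   minimal projection [r1]. *)
Theorem separated_vector_state : separated (fun=> True) f (fun a => inner (rho a xi) xi).
Proof.
(* The errors on the side of f will add up to at most 6 e, and e <= 1/8 keeps the seminorm of [r1]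
   positive. *)
move=> L eps _ eps0; pose e := Num.min eps 1 / 8.
have e0 : 0 < e by rewrite /e divr_gt0// /Num.min; case: ifP.
have e8 : 8 * e <= eps by rewrite /e mulrC divfK// ge_min lexx.
have e1 : 8 * e <= 1 by rewrite /e mulrC divfK// ge_min lexx orbT.
have [||A1 [r1 [mA1 _ LA1 f1]]] := lm (L := L) (eps := e); [by []|by []|].
have sA1 := matalg_subalg mA1; have [Ar1 ar1 rr1] := matalg_r mA1.
have pr1 : projection r1 by split.
have [I [a [hf ha]]] := mA1.
(* The components of xi as seen from the corner [r1]; the h k are an orthonormal family spanning
   them. *)
pose xs (i : 'I_#|I|) := rho (adj (a (enum_val i))) xi.
have [|||m [h [t' [hh Qh ht]]]] := @gram_schmidt R H _ xs (fun y => rho r1 y = y).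
- by move=> k y z hy hz; rewrite (repDr hr) (repZr hr) hy hz.
- exact: rep0r hr _.
- by move=> i; rewrite /xs -(repM hr) (frame_ra hf).
pose t (i : I) k := t' (enum_rank i) k.
have xiE i : rho (adj (a i)) xi = \sum_k t i k *: h k.
  by rewrite /t -ht /xs enum_rankK.
have xi_sum : xi = \sum_i \sum_k t i k *: rho (a i) (h k).
  rewrite -[LHS](rep1 hr) -(frame_sum hf) (rep_suml hr); apply: eq_bigr => i _.
  by rewrite (repM hr) xiE (rep_sumr hr); apply: eq_bigr => k _; rewrite (repZr hr).
have tt : \sum_i \sum_k (t i k)^*%C * t i k = 1.
  rewrite -xi1 -{1}(rep1 hr xi) -(frame_sum hf) (rep_suml hr) inner_suml.
  apply: eq_bigr => i _; rewrite (repM hr) (rep_adj hr) xiE nr_orthonormal_sum//.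
  by apply: eq_bigr => k _; rewrite mulrC.
have [v [A0 [r0 [mA0 A10 [r10 r01 f0] hv hvv]]]] := free_flips pf fq m mA1 e0.
have sA0 := matalg_subalg mA0; have [Ar0 ar0 rr0] := matalg_r mA0.
have pr0 : projection r0 by split.
have hv1 (k : 'I_m) := hv k (ltn_ord k).
have [zeta [z1 rz hz]] := generic_vector pf fq hr xi1 h mA0 (fun k km => let: And3 p _ _ := hv k km in p).
pose g (k : 'I_m) := rho (v k) zeta.
have gg k l : inner (g k) (g l) = (k == l)%:R.
  have [_ _ al] := hv1 l.
  rewrite /g (rep_adjr hr) al -(repM hr) -{1}rz -{2}rz (rep_adjr hr) ar0 -!(repM hr) !mulrA.
  by rewrite (hvv l k _ _).1 ?ltn_ord// (repZl hr) rz innerZl z1 mulr1 eq_sym.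
have r1g k : rho r1 (g k) = g k.
  by have [_ cv _] := hv1 k; rewrite /g -(repM hr) -cv// (repM hr); congr (rho _ _); rewrite -{1}rz -(repM hr) r10 rz.
pose K := \sum_i \sum_k nr (t i k).
have K0 : 0 <= K by apply: sumr_ge0 => i _; apply: sumr_ge0 => k _; exact: nr_ge0.
have K1 : 0 < 1 + 2 * K by lra.
pose del := e / (1 + 2 * K).
have d0 : 0 < del by rewrite divr_gt0.
have de : del * (1 + 2 * K) = e by rewrite divfK// gt_eqF.
have dK : 0 <= del * K by rewrite mulr_ge0// ltW.
have [|T0 [aT0 hT0 gT0 fT0]] := @swap m h g r1 del hh gg hz _ d0.
  have h1 := gD (1 - r1) r1; rewrite subrK (gnsnorm1 pf) in h1.
  have := gnsnorm_proj pf 1 pr1; rewrite mulr1 (gnsnorm1 pf) => ->; rewrite andbT; lra.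
(* The amplification of the corner [r1 * T0 * r1] to the commutant of A1, and so to the commutant of
   L; on the range of [r1] it still acts as the corner. *)
pose T := \sum_i a i * T0 * adj (a i).
have aT : adj T = T.
  by rewrite /T adj_sum; apply: eq_bigr => i _; rewrite !adjM adjK aT0 mulrA.
have Tc : commutes T A1.
  apply: (frame_commutes hf) => k l; rewrite /T mulr_suml mulr_sumr (bigD1 k)//= big1 ?addr0 => [|i ik].
    rewrite (bigD1 l)//= big1 ?addr0 => [|i il].
      transitivity (a k * T0 * (adj (a k) * a k) * adj (a l)); first by rewrite !mulrA.
      rewrite (frame_orth hf) eqxx scale1r -mulrA (frame_ra hf).
      transitivity (a k * (adj (a l) * a l) * T0 * adj (a l)); last by rewrite !mulrA.
      by rewrite (frame_orth hf) eqxx scale1r (frame_ar hf).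
    transitivity (a k * (adj (a l) * a i) * T0 * adj (a i)); first by rewrite !mulrA.
    by rewrite (frame_orth hf) eq_sym (negbTE il) scale0r mulr0 !mul0r.
  transitivity (a i * T0 * (adj (a i) * a k) * adj (a l)); first by rewrite !mulrA.
  by rewrite (frame_orth hf) (negbTE ik) scale0r mulr0 !mul0r.
have Tr : T * r1 = r1 * T0 * r1.
  have [w hw] := choice (fun i => matalg_min mA1 (ha i)).
  have ra i : r1 * a i = w i *: r1 by rewrite -hw -mulrA (frame_ar hf).
  have ar i : adj (a i) * r1 = (w i)^*%C *: r1 by rewrite -[LHS]adjK adjM adjK ar1 ra adjZ ar1.
  rewrite -{1}rr1 mulrA (Tc _ Ar1) /T mulr_sumr mulr_suml.
  transitivity ((\sum_i (w i * (w i)^*%C)) *: (r1 * T0 * r1)).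
    rewrite scaler_suml; apply: eq_bigr => i _; transitivity (r1 * a i * T0 * (adj (a i) * r1)).
      by rewrite !mulrA.
    by rewrite ra ar -!scalerAl -scalerAr scalerA.
  rewrite -!mulrA scalerAl; congr (_ * _).
  transitivity (r1 * (\sum_i a i * adj (a i)) * r1); last by rewrite (frame_sum hf) mulr1 rr1.
  rewrite mulr_sumr mulr_suml scaler_suml; apply: eq_bigr => i _.
  by rewrite mulrA ra -mulrA ar -scalerAl -scalerAr scalerA rr1.
have Trho y z : rho r1 y = y -> rho r1 z = z -> nr (rho T y - z) <= nr (rho T0 y - z).
  move=> ry rz'; rewrite -{1}ry -(repM hr) Tr !(repM hr) ry -{1}rz' -(repBr hr).
  exact: rep_proj_le.
(* A matrix algebra containing T, in which T + i can be inverted. *)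
have [||A2 [r2 [mA2 _ TA2 _]]] := lm (L := [:: T]) (eps := 1); [by []|by []|].
have [u [uu uu' uT ucom]] := cayley faith mA2 (TA2 T (mem_head _ _)) aT.
have uc x : A1 x -> u * x = x * u by move=> /Tc/ucom.
have uc' x : A1 x -> adj u * x = x * adj u.
  move=> Ax; rewrite -[LHS]adjK adjM adjK -uc ?adjM ?adjK//; exact: (subJ sA1).
have uh k : nr (rho u (h k) + 'i *: g k) <= 2 * del.
  apply: (cayley_vector hr uu uT); first exact: le_lt_trans (Trho _ _ (Qh k) (r1g k)) (hT0 k).
  exact: le_lt_trans (Trho _ _ (r1g k) (Qh k)) (gT0 k).
have fu : gnsnorm f (u * r1 + 'i *: r1) <= 2 * del.
  apply: (cayley_gns uu uT); rewrite Tr -{3}rr1 -mulrA -mulrBr.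
  by apply: le_trans (gnsnorm_proj pf _ pr1) _; rewrite -{2}[r1]mul1r -mulrBl ltW.
(* A partial isometry of A0 with initial projection r0. It maps zeta to the vector obtained from xi
   when every h k is replaced by g k. *)
pose y0 := \sum_i \sum_k t i k *: (a i * v k * r0).
have Ay0 : A0 y0.
  apply: (sub_sum sA0) => i _; apply: (sub_sum sA0) => k _; apply: (subZ sA0).
  by apply: (subM sA0) => //; apply: (subM sA0); [exact/A10|case: (hv1 k)].
have y0r : y0 * r0 = y0.
  rewrite mulr_suml; apply: eq_bigr => i _; rewrite mulr_suml; apply: eq_bigr => k _.
  by rewrite -scalerAl -(mulrA _ r0 r0) rr0.
have y0a : adj y0 = \sum_i \sum_k (t i k)^*%C *: (r0 * v k * adj (a i)).
  rewrite adj_sum; apply: eq_bigr => i _; rewrite adj_sum; apply: eq_bigr => k _.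
  by have [_ _ av] := hv1 k; rewrite adjZ !adjM ar0 av mulrA.
have vr (k : 'I_m) : v k * r1 * v k = v k * v k * r1.
  by have [_ cv _] := hv1 k; rewrite -mulrA -cv// mulrA.
have y0y0 : adj y0 * y0 = r0.
  rewrite y0a mulr_suml -[RHS]scale1r -tt scaler_suml; apply: eq_bigr => i _.
  rewrite mulr_suml scaler_suml; apply: eq_bigr => k _.
  rewrite mulr_sumr (bigD1 i)//= [X in _ + X = _]big1 ?addr0 => [|j ji].
    rewrite mulr_sumr (bigD1 k)//= big1 ?addr0 => [|l lk].
      rewrite -scalerAl -scalerAr scalerA; congr (_ *: _).
      transitivity (r0 * v k * (adj (a i) * a i) * v k * r0); first by rewrite !mulrA.
      rewrite (frame_orth hf) eqxx scale1r -(mulrA r0 (v k)) -(mulrA r0) vr mulrA -mulrA r10.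
      by rewrite mulrA (hvv k k _ _).1 ?ltn_ord// eqxx scale1r.
    rewrite -scalerAl -scalerAr; have [_ cl _] := hv1 l.
    rewrite (_ : _ * _ = 0) ?scaler0//.
    transitivity (r0 * v k * (adj (a i) * a i) * v l * r0); first by rewrite !mulrA.
    rewrite (frame_orth hf) eqxx scale1r -!mulrA (mulrA r1) -cl// -!mulrA r10 !mulrA.
    rewrite (hvv k l _ _).1 ?ltn_ord//; have := negbTE lk.
    by rewrite -val_eqE /= eq_sym => ->; rewrite scale0r.
  rewrite mulr_sumr big1// => l _; rewrite -scalerAl -scalerAr.
  rewrite (_ : _ * _ = 0) ?scaler0//.
  transitivity (r0 * v k * (adj (a i) * a j) * v l * r0); first by rewrite !mulrA.
  by rewrite (frame_orth hf) eq_sym (negbTE ji) scale0r mulr0 !mul0r.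
pose conj x := adj u * x * u.
have conjM x y : conj x * conj y = conj (x * y).
  by rewrite /conj !mulrA -(mulrA (adj u * x) u) uu' mulr1.
have conjA x : adj (conj x) = conj (adj x) by rewrite /conj !adjM adjK mulrA.
have conjK x : u * conj x * adj u = x.
  by rewrite /conj !mulrA uu' mul1r -mulrA uu' mulr1.
have conjE x : A1 x -> conj x = x by move=> Ax; rewrite /conj uc'// -mulrA uu mulr1.
(* Conjugation by u leaves L fixed, so the required r x s = 0 comes down to [r0 * x * y0 = 0], a
   consequence of r0 v_k r0 = 0. *)
exists (fun x => A0 (u * x * adj u)), (conj r0), (conj (y0 * adj y0)), (conj (adj y0)).
split.
- split; first exact: matalg_conj.
  split; first by rewrite conjK; exact: (subJ sA0).
  - by rewrite conjM -{1}ar0 -adjM y0r.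
  - by rewrite conjA adjK conjM y0y0.
  - by rewrite conjA adjK conjM.
- by [].
- by move=> x /LA1 Ax; rewrite uc// -mulrA uu' mulr1; exact: A10.
- move=> x /LA1 Ax; rewrite -{1}(conjE _ Ax) !conjM mulrA.
  rewrite (_ : r0 * x * y0 = 0) ?mul0r; first by rewrite /conj mulr0 mul0r.
  rewrite mulr_sumr big1// => i _; rewrite mulr_sumr big1// => k _; rewrite -scalerAr.
  have [_ cv _] := hv1 k; have [w hw] := matalg_min mA1 (subM sA1 Ax (ha i)).
  transitivity (t i k *: (r0 * (r1 * (x * a i) * r1) * v k * r0)).
    congr (_ *: _); rewrite -!mulrA (mulrA r1 (v k)) -cv// -!mulrA r10 !mulrA r01.
    by [].
  by rewrite hw -scalerAr r01 -!scalerAl (hvv k k _ _).2 ?ltn_ord// !scaler0.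
have f0' : gnsnorm f (1 - r0) <= 2 * e by move: f0 f1; lra.
split.
  have -> : 1 - conj r0 = adj u * ((1 - r0) * u).
    by rewrite mulrA mulrBr mulrBl mulr1 uu.
  rewrite gnsnorm_isom ?adjK//.
  have -> : (1 - r0) * u = (1 - r0) * (u * r1 + 'i *: r1) - 'i *: ((1 - r0) * r1) + (1 - r0) * (u * (1 - r1)).
    by rewrite mulrDr -scalerAr addrK -mulrDr -mulrDr (addrC r1) subrK mulr1.
  have h1 := gD ((1 - r0) * (u * r1 + 'i *: r1) - 'i *: ((1 - r0) * r1)) ((1 - r0) * (u * (1 - r1))).
  have h2 := gB ((1 - r0) * (u * r1 + 'i *: r1)) ('i *: ((1 - r0) * r1)).
  have h3 := gnsnorm_proj pf (u * r1 + 'i *: r1) (projC pr0).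
  have h4 := gnsnorm_proj pf (u * (1 - r1)) (projC pr0).
  rewrite (gnsnorm_isom _ uu) in h4.
  have h5 : gnsnorm f ('i *: ((1 - r0) * r1)) <= 3 * e.
    rewrite gZ nr_i mul1r mulrBl mul1r r01; have -> : r1 - r0 = (1 - r0) - (1 - r1).
      by rewrite opprB [RHS]addrC addrA subrK.
    by apply: le_trans (gB _ _) _; lra.
  lra.
have gN x : gnsnorm (fun a => inner (rho a xi) xi) x = nr (rho x xi).
  apply/eqP; rewrite -(@eqrXn2 _ 2%N) ?nr_ge0 ?qn_ge0//.
  by rewrite rep_nr // /gnsnorm /qn sqr_sqrtr// -rep_nr// sqr_ge0.
(* u xi is near -i times the vector with g k for h k, so eta is near xi; and eta is fixed by the
   projection s. *)
rewrite gN; pose eta := rho (adj u) (- 'i *: rho y0 zeta).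
have seta : rho (conj (y0 * adj y0)) eta = eta.
  rewrite /eta !(repZr hr) -!(repM hr); congr (_ *: rho _ _).
  by rewrite /conj -!mulrA (mulrA u) uu' mul1r y0y0 y0r.
have -> : rho (1 - conj (y0 * adj y0)) xi = rho (1 - conj (y0 * adj y0)) (xi - eta).
  by rewrite (repBr hr) [X in _ = _ - X](repBl hr) seta (rep1 hr) subrr subr0.
have ps : projection (conj (y0 * adj y0)).
  split; first by rewrite conjA adjM adjK.
  by rewrite conjM mulrA -(mulrA y0) y0y0 y0r.
have [aps sps] := projC ps.
apply: le_trans (rep_proj_le hr _ aps sps) _.
rewrite -(rep_isometry hr _ uu) (repBr hr) /eta -(repM hr) uu' (rep1 hr) scaleNr opprK.
have -> : rho y0 zeta = \sum_i \sum_k t i k *: rho (a i) (g k).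
  rewrite (rep_suml hr); apply: eq_bigr => i _; rewrite (rep_suml hr); apply: eq_bigr => k _.
  by rewrite (repZl hr) !(repM hr) rz.
have -> : rho u xi = \sum_i \sum_k t i k *: rho (a i) (rho u (h k)).
  rewrite {1}xi_sum (rep_sumr hr); apply: eq_bigr => i _; rewrite (rep_sumr hr); apply: eq_bigr => k _.
  by rewrite (repZr hr) -!(repM hr) uc.
rewrite scaler_sumr -big_split /=; apply: le_trans (nr_sum _ _ _) _.
apply: (@le_trans _ _ (\sum_i \sum_k nr (t i k) * (2 * del))); last first.
  have -> : \sum_i \sum_k nr (t i k) * (2 * del) = K * (2 * del).
    by rewrite /K mulr_suml; apply: eq_bigr => i _; rewrite mulr_suml.
  lra.
apply: ler_sum => i _; rewrite scaler_sumr -big_split /=; apply: le_trans (nr_sum _ _ _) _.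
apply: ler_sum => k _; rewrite scalerA mulrC -scalerA -scalerDr -(repZr hr) -(repDr hr) nrZ.
rewrite ler_wpM2l ?nr_ge0//; apply: le_trans (uh k).
rewrite -(@ler_pXn2r _ 2%N) ?nnegrE ?nr_ge0// rep_nr// (frame_orth hf) eqxx scale1r.
rewrite (repDr hr) (repZr hr) r1g -(repM hr) -uc// (repM hr) Qh.
by rewrite -nr_eq_sqr.
Qed.

End SeparatedState.

(* A Banach space in which a *-algebra sits densely, with the norm inequalities of
   an operator norm, carries a C*-algebra structure. *)
Section CStarCompletion.
Variables (R : realType) (U : starAlgType R) (V : completeNormedModType R[i]) (j : U -> V).
Local Notation C := R[i].
Hypothesis lj : linear_map j.
Hypothesis dj : dense_map j.
Hypothesis jM : forall a b, nr (j (a * b)) <= nr (j a) * nr (j b).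
Hypothesis jS : forall a, nr (j (adj a)) <= nr (j a).
Hypothesis jC : forall a, nr (j a) ^+ 2 <= nr (j (adj a * a)).
Implicit Types (x y z : V) (a b : U).

Definition dense_mul_ex : exists m : V -> V -> V, [/\ forall y, bop (m ^~ y),
  forall x, bop (m x), forall a b, m (j a) (j b) = j (a * b) &
  forall x y, nr (m x y) <= nr x * nr y].
Proof.
have left a : exists L : V -> V, [/\ bop L, forall b, L (j b) = j (a * b) &
    forall y, nr (L y) <= nr (j a) * nr y].
  apply: (dense_extend lj dj) => //; first by move=> k x y; rewrite mulrDr -scalerAr lj.
  exact: nr_ge0.
have [L hL] := choice left; have bL a := let: And3 p _ _ := hL a in p.
have Lj a b : L a (j b) = j (a * b) by case: (hL a).
have nL a y : nr (L a y) <= nr (j a) * nr y by case: (hL a).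
have linL y : linear_map (fun a => L a y).
  move=> k a b; have bb := bop_lin k 1 (bL a) (bL b).
  have -> : k *: L a y + L b y = k *: L a y + 1 *: L b y by rewrite scale1r.
  apply: (@dense_bop_eq R U V j dj V (L (k *: a + b)) (fun y => k *: L a y + 1 *: L b y) (bL _) bb) => c.
  by rewrite !Lj scale1r mulrDl -scalerAl lj.
have right y : exists M : V -> V, [/\ bop M, forall a, M (j a) = L a y &
    forall x, nr (M x) <= nr y * nr x].
  apply: (dense_extend lj dj (linL y) (nr_ge0 y)) => a; rewrite mulrC; exact: nL.
have [M hM] := choice right; have bM y := let: And3 p _ _ := hM y in p.
have Mj y a : M y (j a) = L a y by case: (hM y).
exists (fun x y => M y x); split=> //.
- move=> x; split; last first.
    exists (nr x); rewrite ?nr_ge0// => y; rewrite mulrC; by case: (hM y).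
  move=> k y z; have bb := bop_lin k 1 (bM y) (bM z).
  have -> : k *: M y x + M z x = k *: M y x + 1 *: M z x by rewrite scale1r.
  apply: (@dense_bop_eq R U V j dj V (M (k *: y + z)) (fun x => k *: M y x + 1 *: M z x) (bM _) bb) => a.
  by rewrite !Mj scale1r; case: (bL a) => l _; rewrite l.
- by move=> a b; rewrite Mj Lj.
- by move=> x y; rewrite mulrC; case: (hM y).
Qed.

Definition dense_mul : V -> V -> V := projT1 (cid dense_mul_ex).
Local Notation m := dense_mul.
Let mul_l y : bop (m ^~ y). Proof. by rewrite /m; case: cid => ? []. Qed.
Let mul_r x : bop (m x). Proof. by rewrite /m; case: cid => ? []. Qed.
Let mul_j a b : m (j a) (j b) = j (a * b). Proof. by rewrite /m; case: cid => ? []. Qed.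
Let mul_nr x y : nr (m x y) <= nr x * nr y. Proof. by rewrite /m; case: cid => ? []. Qed.

Let mulA_ : associative m.
Proof.
move=> x y z.
pose f1 z := m x (m y z); pose f2 z := m (m x y) z.
apply: (@dense_bop_eq R U V j dj V f1 f2 (bop_comp (mul_r x) (mul_r y)) (mul_r _)) => c; rewrite /f1 /f2 {z f1 f2}.
pose f1 y := m x (m y (j c)); pose f2 y := m (m x y) (j c).
apply: (@dense_bop_eq R U V j dj V f1 f2 (bop_comp (mul_r x) (mul_l _)) (bop_comp (mul_l _) (mul_r x))) => b; rewrite /f1 /f2 {y f1 f2}.
pose f1 x := m x (m (j b) (j c)); pose f2 x := m (m x (j b)) (j c).
apply: (@dense_bop_eq R U V j dj V f1 f2 (mul_l _) (bop_comp (mul_l _) (mul_l _))) => a.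
by rewrite /f1 /f2 !mul_j mulrA.
Qed.

Let star_ex v : exists w, forall a : nat -> U, scvg (fun n => j (a n)) v -> scvg (fun n => j (adj (a n))) w.
Proof.
have jB a b : nr (j (adj a) - j (adj b)) <= nr (j a - j b) by rewrite -!(lmapB lj) -adjB.
have [a0 h0] := dense_seq dj v.
have [w hw] : exists w, scvg (fun n => j (adj (a0 n))) w.
  apply: scauchy_cvg => e e0; have [N hN] := scvg_scauchy h0 e0.
  by exists N => k n Nk Nn; apply: le_lt_trans (jB _ _) (hN _ _ Nk Nn).
exists w => a ha; have h : null (fun n => nr (j (a n) - j (a0 n))).
  by apply: null_le (scvgB ha h0) => n; rewrite subrr subr0.
apply: null_le (nullD h hw) => n.
apply: le_trans (nr_tri _ (j (adj (a0 n))) _) _; rewrite lerD//; exact: jB.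
Qed.

Definition dense_star v : V := projT1 (cid (star_ex v)).
Local Notation st := dense_star.
Let starP v (a : nat -> U) : scvg (fun n => j (a n)) v -> scvg (fun n => j (adj (a n))) (st v).
Proof. by rewrite /st; case: cid => ? /= h; exact: h. Qed.

Let star_j a : st (j a) = j (adj a).
Proof. by have := @starP (j a) (fun=> a) (scvg_cst _) => h; apply: scvg_unique h (scvg_cst _). Qed.

Let starK_ : involutive st.
Proof.
move=> v; have [a ha] := dense_seq dj v; apply: scvg_unique (starP (starP ha)) _.
by apply: scvg_ext ha => n; rewrite adjK.
Qed.

Let starD_ : {morph st : x y / x + y}.
Proof.
move=> x y; have [a ha] := dense_seq dj x; have [b hb] := dense_seq dj y.
have h : scvg (fun n => j (a n + b n)) (x + y) by apply: scvg_ext (scvgD ha hb) => n; rewrite (lmapD lj).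
apply: scvg_unique (starP h) _; apply: scvg_ext (scvgD (starP ha) (starP hb)) => n.
by rewrite adjD (lmapD lj).
Qed.

Let starZ_ (k : C) x : st (k *: x) = k^*%C *: st x.
Proof.
have [a ha] := dense_seq dj x.
have h : scvg (fun n => j (k *: a n)) (k *: x) by apply: scvg_ext (scvgZ k ha) => n; rewrite (lmapZ lj).
apply: scvg_unique (starP h) _; apply: scvg_ext (scvgZ k^*%C (starP ha)) => n.
by rewrite adjZ (lmapZ lj).
Qed.

Let mul_scvg (u v : nat -> V) x y : scvg u x -> scvg v y -> scvg (fun n => m (u n) (v n)) (m x y).
Proof.
move=> ux vy; have [N hN] := scvg_nr vy ltr01.
have K0 : 0 <= nr x + nr y + 1 by have := nr_ge0 x; have := nr_ge0 y; lra.
apply: (null_le_near (N0 := N)) (nullM K0 (nullD ux vy)) => n /hN.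
rewrite ltr_norml => /andP[_ k1].
have -> : m (u n) (v n) - m x y = m (u n - x) (v n) + m x (v n - y).
  by rewrite (bopB (mul_l _)) (bopB (mul_r _)) addrA subrK.
apply: le_trans (nrD _ _) _.
apply: (bil_bound (mul_nr _ _) (mul_nr _ _)); rewrite ?nr_ge0//.
  by have := nr_ge0 x; lra.
by have := nr_ge0 y; lra.
Qed.

Let starM_ x y : st (m x y) = m (st y) (st x).
Proof.
have [a ha] := dense_seq dj x; have [b hb] := dense_seq dj y.
have h : scvg (fun n => j (a n * b n)) (m x y) by apply: scvg_ext (mul_scvg ha hb) => n; rewrite mul_j.
apply: scvg_unique (starP h) _; apply: scvg_ext (mul_scvg (starP hb) (starP ha)) => n.
by rewrite mul_j adjM.
Qed.

Let star_nr v : nr (st v) <= nr v.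
Proof.
have [a ha] := dense_seq dj v; rewrite -subr_le0; apply: null_const.
apply: null_le (nullD (starP ha) ha) => n.
have h1 := nr_tri (st v) (j (adj (a n))) 0; have h2 := nr_tri (j (a n)) v 0.
have h3 := jS (a n); rewrite !subr0 in h1 h2; rewrite nr_distC in h1; move: h1 h2 h3.
by move: (nr (j (adj (a n)) - st v)) (nr (j (a n) - v)) (nr (st v)) (nr v) (nr (j (adj (a n)))) (nr (j (a n))) => ? ? ? ? ? ?; lra.
Qed.

Let norm_star_ v : nr (m (st v) v) = nr v ^+ 2.
Proof.
apply/le_anti/andP; split.
  by apply: le_trans (mul_nr _ _) _; rewrite expr2 ler_wpM2r ?nr_ge0.
have [a ha] := dense_seq dj v; have hm := mul_scvg (starP ha) ha.
have [N hN] := scvg_nr ha ltr01; rewrite -subr_le0; apply: null_const.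
have K0 : 0 <= 2 * nr v + 1 by have := nr_ge0 v; lra.
apply: (null_le_near (N0 := N)) (nullD (nullM K0 ha) hm) => n /hN.
rewrite ltr_norml => /andP[_ k1]; rewrite mul_j.
have h1 := jC (a n); have h2 := nr_subr (j (adj (a n) * a n)) (m (st v) v).
have h3 : nr v - nr (j (a n)) <= nr (j (a n) - v) by rewrite nr_distC; exact: nr_subr.
have h4 := nr_ge0 (j (a n)); have h5 := nr_ge0 v; have h6 := nr_ge0 (j (a n) - v).
have h7 : nr v ^+ 2 - nr (j (a n)) ^+ 2 <= (2 * nr v + 1) * nr (j (a n) - v).
  rewrite subr_sqr mulrC; have [hn|hn] := lerP (nr v) (nr (j (a n))).
    apply: le_trans (_ : 0 <= _); last by rewrite mulr_ge0.
    by rewrite mulr_ge0_le0 ?subr_le0// addr_ge0.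
  by apply: ler_pM; [rewrite addr_ge0|rewrite subr_ge0 ltW| |exact: h3]; lra.
lra.
Qed.

Definition cstar_completion : Type := V.
HB.instance Definition _ := CompleteNormedModule.copy cstar_completion V.

Let cnM (x y : cstar_completion) : `|m x y| <= `|x| * `|y|.
Proof. by rewrite !nrE -rcM lecR; exact: mul_nr. Qed.
Let cnS (x : cstar_completion) : `|m (st x) x| = `|x| ^+ 2.
Proof. by rewrite !nrE -rcX; congr (_%:C); exact: norm_star_. Qed.
Let mDl : left_distributive m +%R. Proof. by move=> x y z; rewrite (bopD (mul_l _)). Qed.
Let mDr : right_distributive m +%R. Proof. by move=> x y z; rewrite (bopD (mul_r _)). Qed.
Let mZl (k : C) x y : m (k *: x) y = k *: m x y. Proof. by rewrite (bopZ (mul_l _)). Qed.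
Let mZr (k : C) x y : m x (k *: y) = k *: m x y. Proof. by rewrite (bopZ (mul_r _)). Qed.

HB.instance Definition _ := @isCStarAlgebra.Build R cstar_completion m st
  mulA_ mDl mDr mZl mZr starK_ starD_ starZ_ starM_ cnM cnS.

Lemma cstar_completion_exists : exists (A : cstarAlgType R) (i : U -> A),
  [/\ linear_map i, dense_map i, forall a b, i (a * b) = cmul (i a) (i b),
      forall a, i (adj a) = cstar (i a) & forall a, nr (i a) = nr (j a)].
Proof.
exists cstar_completion, j; split=> //.
Qed.
End CStarCompletion.

(** * The operator norm of a GNS representation as a C*-norm *)

Section OperatorNorm.
Variables (R : realType) (U : starAlgType R) (t : U -> R[i]).
Local Notation C := R[i].
Hypothesis pt : posfun t.
Hypothesis bnd : forall a : U, exists2 M, 0 <= M & forall x, gnsnorm t (a * x) <= M * gnsnorm t x.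
Local Notation N := (gnsnorm t).

Let ball := {y : U | N y <= 1}.
(** Matrix coefficients between vectors of the unit ball; the supremum of their moduli is the
    operator norm of a on the GNS space. *)
Let io (p : ball * ball) (a : U) : C := gnsform t (a * projT1 p.1) (projT1 p.2).
Let gp := gns_psd pt.

Let lio p : @linear_map R U C^o (io p).
Proof. by move=> k x y; rewrite /io mulrDl -scalerAl /gnsform mulrDr -scalerAr (pfD pt) (pfZ pt). Qed.

Let io_le p a M : (forall x, N (a * x) <= M * N x) -> 0 <= M -> nr (io p a) <= M.
Proof.
move=> h M0; apply: le_trans (form_CS gp _ _) _; rewrite -!/(gnsnorm t _).
rewrite -[leRHS]mulr1; apply: ler_pM; rewrite ?qn_ge0//; last exact: (projT2 p.2).
by apply: le_trans (h _) _; rewrite ler_piMr//; exact: (projT2 p.1).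
Qed.

Let bio a : exists M, forall p, nr (io p a) <= M.
Proof. by have [M M0 h] := bnd a; exists M => p; exact: io_le. Qed.

Let ball0 : ball. Proof. by exists 0; rewrite /gnsnorm (qn0 gp). Defined.
Let V := completion_space (ball0, ball0) lio bio.
Let j (a : U) : V := iota lio bio a.

Let j_le a M : (forall x, N (a * x) <= M * N x) -> 0 <= M -> nr (j a) <= M.
Proof. by move=> h M0; apply: (@nr_iota_le R U _ (ball0, ball0) io lio bio) => p; exact: io_le. Qed.

Let j_op a x : N (a * x) <= nr (j a) * N x.
Proof.
have [x0|x0] := eqVneq (N x) 0.
  have [M M0 h] := bnd a; rewrite x0 mulr0; apply: le_trans (h x) _; by rewrite x0 mulr0.
have px : 0 < N x by rewrite lt_neqAle eq_sym x0 qn_ge0.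
have [y0|y0] := eqVneq (N (a * x)) 0; first by rewrite y0 mulr_ge0 ?nr_ge0 ?qn_ge0.
have py : 0 < N (a * x) by rewrite lt_neqAle eq_sym y0 qn_ge0.
have unit z : 0 < N z -> N (((N z)^-1)%:C *: z) <= 1.
  by move=> z0; rewrite /gnsnorm (qnZ gp) nrR ger0_norm ?invr_ge0 ?qn_ge0// mulVf ?gt_eqF.
pose p : ball * ball := (@exist U (fun y => N y <= 1) _ (unit _ px), @exist U (fun y => N y <= 1) _ (unit _ py)).
have := @le_nr_iota R U _ (ball0, ball0) io lio bio p a.
rewrite /io /= -scalerAr (formZr gp) /gnsform -scalerAr (pfZ pt) -/(gnsform t _ _) (form_xx gp).
rewrite -/(N _) conjc_real -!rcM nrR ger0_norm; last first.
  by rewrite !mulr_ge0 ?invr_ge0 ?sqr_ge0 ?qn_ge0.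
move=> h; rewrite -ler_pdivrMr//; apply: le_trans h.
by rewrite expr2 mulrCA mulKf ?gt_eqF// [X in _ <= X]mulrC lexx.
Qed.

Lemma cstar_of_state : exists (A : cstarAlgType R) (i : U -> A),
  [/\ linear_map i, dense_map i, forall a b, i (a * b) = cmul (i a) (i b),
      forall a, i (adj a) = cstar (i a) & (forall a x, N (a * x) <= nr (i a) * N x) /\
      forall a M, 0 <= M -> (forall x, N (a * x) <= M * N x) -> nr (i a) <= M].
Proof.
have sq a : nr (j a) ^+ 2 <= nr (j (adj a * a)).
  rewrite -[leRHS]sqr_sqrtr ?nr_ge0// ler_pXn2r ?nnegrE ?nr_ge0 ?sqrtr_ge0//.
  apply: j_le; rewrite ?sqrtr_ge0// => x.
  rewrite -(@ler_pXn2r _ 2%N) ?nnegrE ?mulr_ge0 ?qn_ge0 ?sqrtr_ge0// exprMn [X in _ <= X * _]sqr_sqrtr ?nr_ge0//.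
  rewrite (gnsnorm_sqr pt) adjM -mulrA (mulrA (adj a)).
  have h := form_CS gp (adj a * a * x) x; rewrite -!/(gnsnorm t _) in h.
  apply: le_trans (ler_norm _) _; apply: le_trans (Re_le_nr _) _; apply: le_trans h _.
  by rewrite expr2 mulrA ler_wpM2r ?qn_ge0//; exact: j_op.
have jM a b : nr (j (a * b)) <= nr (j a) * nr (j b).
  apply: j_le; rewrite ?mulr_ge0 ?nr_ge0// => x.
  by rewrite -mulrA; apply: le_trans (j_op _ _) _; rewrite -mulrA ler_wpM2l ?nr_ge0//; exact: j_op.
have jS a : nr (j (adj a)) <= nr (j a).
  suff h b : nr (j b) <= nr (j (adj b)) by have := h (adj a); rewrite adjK.
  have := le_trans (sq b) (jM _ _); have [->|b0] := eqVneq (nr (j b)) 0; first by rewrite nr_ge0.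
  by rewrite expr2 ler_pM2r// lt_neqAle eq_sym b0 nr_ge0.
have lj : linear_map j by exact: iota_linear.
have dj : dense_map j by move=> v e e0; exact: iota_dense.
have [A [i [h1 h2 h3 h4 h5]]] := cstar_completion_exists lj dj jM jS sq.
by exists A, i; split=> //; split=> [a x|a M M0 h]; rewrite h5; [exact: j_op|exact: j_le].
Qed.
End OperatorNorm.

(** * Vectors fixed by the projections of a linked tower *)

Section TowerVector.
Variables (R : realType) (U : starAlgType R) (S : U -> Prop) (f g : U -> R[i]).
Local Notation C := R[i].
Variables (A : nat -> U -> Prop) (r u v p : nat -> U) (l s0 y0 : U).
Hypothesis pf : posfun f.
Hypothesis tw : tower S f A r u v p.
Hypothesis hl : symmetry l.
Hypothesis hw : forall n x, A n x -> l * x = wprod v n * x * wprod v n * l.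
Hypothesis hlink : linked_tower g A r v p s0 y0.
Variables (H : hilbertType R) (rho : U -> H -> H) (xi : H).
Hypothesis hr : starrep rho.
Hypothesis xi1 : inner xi xi = 1.
Hypothesis hg : forall x, gnsnorm g x = nr (rho x xi).

Let q n := v n * p n * v n.
Let sA n : subalg (A n) := matalg_subalg (tw_mat tw n).
Let gD x y : gnsnorm f (x + y) <= gnsnorm f x + gnsnorm f y. Proof. exact: qnD (gns_psd pf) _ _. Qed.
Let gZ k x : gnsnorm f (k *: x) = nr k * gnsnorm f x. Proof. exact: qnZ (gns_psd pf) _ _. Qed.
Let g0 x : 0 <= gnsnorm f x := qn_ge0 _ _.
Let pr n : projection (r n). Proof. by have [_ ? ?] := matalg_r (tw_mat tw n). Qed.

Let q_proj n : projection (q n).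
Proof.
have [_ [av vv] _] := tw_qubit tw n; have [ap pp] := tw_proj tw n; split.
  by rewrite /q !adjM av ap mulrA.
transitivity (v n * p n * (v n * v n) * p n * v n); first by rewrite /q !mulrA.
by rewrite vv mulr1 -(mulrA (v n)) pp.
Qed.

Let q_mem n : A n.+1 (q n).
Proof. by have [_ vA pA] := tw_mem tw n; apply: subM => //; apply: subM. Qed.

Let q_comm n : commutes (q n) (A n).
Proof.
have [_ cv cp] := tw_comm tw n; move=> x Ax.
by rewrite /q -mulrA (cv _ Ax) !mulrA -(mulrA (v n) (p n) x) (cp _ Ax) !mulrA (cv _ Ax).
Qed.

(** Each q_m moves xi by at most tower_eps m, so these words converge on xi, to a nonzero vector
    fixed by s0 and by every q_n. *)
Fixpoint linked_word n : U := if n is m.+1 then q m * linked_word m else s0.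
Local Notation w := linked_word.

Let s0_proj : projection s0.
Proof.
have [Ay ry yr ys] := lt_link hlink; split; first by rewrite -ys adjM adjK.
by rewrite -ys mulrA -(mulrA (adj y0) y0) yr -mulrA ry.
Qed.

Let s0_mem : A 0 s0.
Proof. by have [Ay _ _ <-] := lt_link hlink; apply: subM => //; exact: subJ. Qed.

Let w_mem n : A n (w n).
Proof. by elim: n => //= n IH; apply: subM => //; exact: tw_incr tw _ _ IH. Qed.

Let w_contr n x : nr (rho (w n) x) <= nr x.
Proof.
elim: n => [|n IH] /=; first by case: s0_proj => a s; exact: rep_proj_le.
by have [a s] := q_proj n; rewrite (repM hr); apply: le_trans (rep_proj_le hr _ a s) IH.
Qed.

Let x n : H := rho (w n) xi.

Let x_step n : nr (x n.+1 - x n) <= tower_eps R n.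
Proof.
rewrite /x /= q_comm// -[X in _ - X](_ : rho (w n * 1) xi = _) ?mulr1// -{2}[w n]mulr1 -(repBl hr) -mulrBr (repM hr).
apply: le_trans (w_contr _ _) _; rewrite -nrN -(repNl hr) opprB -hg.
exact: lt_q hlink n.
Qed.

Let x_near n : nr (x n - xi) <= 3 / 16 - 1 / 8 / 2 ^+ n.
Proof.
elim: n => [|n IH].
  rewrite /x /= -nrN opprB -{1}(rep1 hr xi) -(repBl hr) -hg expr0; have := lt_s0 hlink; lra.
apply: le_trans (nr_tri _ (x n) _) _; have := x_step n; rewrite /tower_eps exprS.
have e2 : (0 : R) < 2 ^+ n by exact: exprn_gt0.
have -> : (1 / 8 / (2 * 2 ^+ n) : R) = 1 / 16 / 2 ^+ n by field; rewrite gt_eqF.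
have : (1 / 8 / 2 ^+ n : R) = 1 / 16 / 2 ^+ n + 1 / 16 / 2 ^+ n by field; rewrite gt_eqF.
by move: IH; lra.
Qed.

Let half_tail n : (0 : R) <= 1 / 8 / 2 ^+ n.
Proof. by rewrite !divr_ge0// exprn_ge0. Qed.

(** Let x0 be the limit of the [linked_word]s at xi. The letter l satisfies p_n l = l q_n and
    commutes with A_0, and y0 leads from s0 to r_0; so y0 l x0 is fixed by r_0 and by all p_n. *)
Lemma linked_limit : exists2 y : H, y != 0 &
  [/\ rho (r 0%N) y = y & forall n, rho (p n) y = y].
Proof.
have [x0 hx] : exists x0, scvg x x0.
  by apply: scauchy_cvg; apply: (scauchy_geom (c := 1 / 16)) => n; exact: x_step.
have nx0 : 1 / 2 <= nr x0.
  apply: scvg_nr_ge hx _ => n; have := nr_subr xi (xi - x n); rewrite subKr nr_distC.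
  have := x_near n; have := half_tail n.
  have -> : nr xi = 1 by apply/eqP; rewrite -(eqrXn2 (n := 2)) ?nr_ge0// -nr_eq_sqr xi1 expr1n.
  lra.
have fix_lim a n0 : (forall n, (n0 <= n)%N -> a * w n = w n) -> rho a x0 = x0.
  move=> h; have h1 := scvg_shift (s := fun k => (k + n0)%N) (fun k => leq_addr _ _) (rep_scvg hr a hx).
  have h2 := scvg_shift (s := fun k => (k + n0)%N) (fun k => leq_addr _ _) hx.
  apply: scvg_unique h1 _; apply: scvg_ext h2 => k.
  by rewrite /x -(repM hr) h// leq_addl.
have ss0 : rho s0 x0 = x0.
  apply: (fix_lim _ 0%N) => n _; elim: n => [|n IH] /=; first by case: s0_proj.
  have c := q_comm (tower_mono tw (leq0n n) s0_mem).
  by rewrite mulrA -c -mulrA IH.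
have sq n : rho (q n) x0 = x0.
  apply: (fix_lim _ n.+1) => k; elim: k => // k IH; rewrite ltnS leq_eqVlt => /orP[/eqP <-|nk] /=.
    by have [_ qq] := q_proj n; rewrite mulrA qq.
  have c := q_comm (tower_mono tw nk (q_mem n)).
  by rewrite mulrA -c -mulrA IH.
have [Ay ry yr ys] := lt_link hlink; have [al ll] := hl.
have lc z : A 0 z -> l * z = z * l by move=> Az; rewrite (hw Az) mul1r mulr1.
have lq n : p n * l = l * q n.
  have := tower_q_twist tw hw n; rewrite -/(q n) => e.
  transitivity (l * (l * p n) * l); first by rewrite !mulrA ll mul1r.
  by rewrite e mulrA -(mulrA (l * q n)) ll mulr1.
exists (rho (y0 * l) x0).
  apply/eqP => e; have := congr1 (rho (adj y0)) e; rewrite (rep0r hr) -(repM hr) mulrA ys -lc// (repM hr) ss0.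
  move=> /(congr1 (@nr R H)); rewrite nr0 rep_isometry ?al// => e'; move: nx0; rewrite e'; lra.
split=> [|n]; first by rewrite -(repM hr) mulrA ry.
have [_ _ cp] := tw_comm tw n; have Ay0 := tower_mono tw (leq0n n) Ay.
by rewrite -(repM hr) mulrA cp// -mulrA lq mulrA (repM hr) sq.
Qed.

End TowerVector.

(** * Recovering the state f from the corners of a linked tower *)

Section TowerCorner.
Variables (R : realType) (U : starAlgType R) (S : U -> Prop) (f g : U -> R[i]).
Local Notation C := R[i].
Variables (A : nat -> U -> Prop) (r u v p : nat -> U) (l s0 y0 : U).
Hypothesis pf : posfun f.
Hypothesis bnd : forall a : U, exists2 M, 0 <= M & forall x, gnsnorm f (a * x) <= M * gnsnorm f x.
Hypothesis tw : tower S f A r u v p.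
Hypothesis hl : symmetry l.
Hypothesis hw : forall n x, A n x -> l * x = wprod v n * x * wprod v n * l.
Hypothesis hlink : linked_tower g A r v p s0 y0.
Variables (H : hilbertType R) (rho : U -> H -> H) (xi : H).
Hypothesis hr : starrep rho.
Hypothesis xi1 : inner xi xi = 1.
Hypothesis hg : forall x, gnsnorm g x = nr (rho x xi).

Let sA n : subalg (A n) := matalg_subalg (tw_mat tw n).
Let gD x y : gnsnorm f (x + y) <= gnsnorm f x + gnsnorm f y. Proof. exact: qnD (gns_psd pf) _ _. Qed.
Let gZ k x : gnsnorm f (k *: x) = nr k * gnsnorm f x. Proof. exact: qnZ (gns_psd pf) _ _. Qed.
Let g0 x : 0 <= gnsnorm f x := qn_ge0 _ _.
Let pr n : projection (r n). Proof. by have [_ ? ?] := matalg_r (tw_mat tw n). Qed.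

Let half_tail n : (0 : R) <= 1 / 8 / 2 ^+ n.
Proof. by rewrite !divr_ge0// exprn_ge0. Qed.

(** By [lt_min] these decreasing products are minimal projections of the A_n; f stays bounded below
    on them, since the tolerances are summable and small. *)
Fixpoint corner n : U := if n is m.+1 then corner m * p m else r 0%N.
Local Notation rh := corner.

Let rh_mem n : A n (rh n).
Proof.
elim: n => /= [|n IH]; first by have [] := matalg_r (tw_mat tw 0%N).
by apply: subM => //; [exact: tw_incr tw _ _ IH|case: (tw_mem tw n)].
Qed.

Let rh_comm n : p n * rh n = rh n * p n.
Proof. by have [_ _ cp] := tw_comm tw n; rewrite cp. Qed.

Let rh_proj n : projection (rh n).
Proof.
elim: n => /= [|n [a s]]; first exact: pr.
have [ap pp] := tw_proj tw n; split; first by rewrite adjM a ap rh_comm.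
by rewrite -mulrA (mulrA (p n)) rh_comm -mulrA pp mulrA s.
Qed.

Let rh_min n z : A n z -> exists c : C, rh n * z * rh n = c *: rh n.
Proof.
elim: n z => /= [|n IH] z Az; first exact: matalg_min (tw_mat tw 0%N) Az.
have [y Ay hy] := lt_min hlink Az; have [c hc] := IH y Ay; exists c.
rewrite -[in X in _ * X]rh_comm.
transitivity (rh n * (p n * z * p n) * rh n); first by rewrite !mulrA.
by rewrite hy -!mulrA rh_comm !mulrA hc scalerAl.
Qed.

Let rh_near n : gnsnorm f (1 - rh n) <= 3 / 16 - 1 / 8 / 2 ^+ n.
Proof.
elim: n => /= [|n IH].
  by have := tw_r tw 0%N; rewrite /tower_eps expr0; lra.
apply: le_trans (gnsnormM1 pf _ (rh_proj n)) _; have := tw_p tw n; rewrite /tower_eps exprS.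
have e2 : (0 : R) < 2 ^+ n by exact: exprn_gt0.
have -> : (1 / 8 / (2 * 2 ^+ n) : R) = 1 / 16 / 2 ^+ n by field; rewrite gt_eqF.
have : (1 / 8 / 2 ^+ n : R) = 1 / 16 / 2 ^+ n + 1 / 16 / 2 ^+ n by field; rewrite gt_eqF.
by move: IH; lra.
Qed.

Let rh_ge n : 1 / 2 <= gnsnorm f (rh n).
Proof.
have := gD (1 - rh n) (rh n); rewrite subrK (gnsnorm1 pf); have := rh_near n; have := half_tail n.
by move: (1 / 8 / 2 ^+ n) => k; lra.
Qed.

Let eps_le n : tower_eps R n <= 1 / 16.
Proof.
have h : (1 : R) <= 2 ^+ n by apply: exprn_ege1; rewrite ler1n.
rewrite /tower_eps ler_pdivrMr ?exprn_gt0//; lra.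
Qed.

Let eps_ge0 n : 0 <= tower_eps R n. Proof. by rewrite /tower_eps !divr_ge0// exprn_ge0. Qed.

(* [r n / t] compressed by the corner is close to the vacuum. *)
Let renorm n : exists2 b, A n b & gnsnorm f (b * rh n - 1) <= 3 * tower_eps R n /\
  forall z, gnsnorm f (b * z) <= 2 * gnsnorm f z.
Proof.
have [Ar ar rr] := matalg_r (tw_mat tw n); have [ah hh] := rh_proj n; have epr := pr n.
have [c hc] := matalg_min (tw_mat tw n) (rh_mem n).
have fr := tw_r tw n; have e16 := eps_le n; have e0 := eps_ge0 n.
have N1 : gnsnorm f (r n) <= 1 by have := gnsnorm_proj pf 1 epr; rewrite mulr1 (gnsnorm1 pf).
have N2 : 3 / 4 <= gnsnorm f (rh n * r n).
  have h1 := gD (rh n * r n) (1 - rh n * r n); rewrite addrC subrK (gnsnorm1 pf) in h1.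
  have h2 := gnsnormM1 pf (r n) (rh_proj n); have := rh_near n; have := half_tail n.
  by move: (1 / 8 / 2 ^+ n) => k; lra.
have N3 : 0 < gnsnorm f (r n).
  have h1 := gD (1 - r n) (r n); rewrite subrK (gnsnorm1 pf) in h1; lra.
pose t := (gnsnorm f (rh n * r n) / gnsnorm f (r n)) ^+ 2.
have ct : c = t%:C.
  have e1 := form_xx (gns_psd pf) (rh n * r n); have e2 := form_xx (gns_psd pf) (r n).
  move: e1 e2; rewrite /gnsform adjM ar ah rr => e1 e2.
  have e3 : adj (rh n * r n) * (rh n * r n) = c *: r n.
    by rewrite adjM ar ah -hc !mulrA -(mulrA (r n) (rh n) (rh n)) hh.
  rewrite adjM ar ah in e3; rewrite e3 (pfZ pf) e2 in e1.
  have n0 : ((gnsnorm f (r n) ^+ 2)%:C : C) != 0 by rewrite gt_eqF// ltr0c exprn_gt0.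
  by apply: (mulIf n0); rewrite /t -rcM -exprMn divfK ?gt_eqF//; exact: e1.
have t2 : 1 / 2 <= t.
  have h : 3 / 4 <= gnsnorm f (rh n * r n) / gnsnorm f (r n).
    by rewrite ler_pdivlMr//; apply: le_trans N2; rewrite ler_piMr//; lra.
  rewrite /t expr2; apply: le_trans (_ : 3 / 4 * (3 / 4) <= _); first lra.
  by apply: ler_pM => //; lra.
have t0 : 0 < t by lra.
have tV' : t^-1 <= 2 by rewrite -[t^-1]div1r ler_pdivrMr//; lra.
have tV : nr ((t^-1)%:C : C) <= 2 by rewrite nrR ger0_norm// invr_ge0 ltW.
have bz z : gnsnorm f ((t^-1)%:C *: r n * z) <= 2 * gnsnorm f z.
  rewrite -scalerAl gZ; apply: ler_pM; rewrite ?nr_ge0 ?g0//; exact: gnsnorm_proj.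
exists ((t^-1)%:C *: r n); first exact: subZ.
split=> //; have -> : (t^-1)%:C *: r n * rh n - 1 = (t^-1)%:C *: r n * (rh n * (1 - r n)) - (1 - r n).
  have e : (t^-1)%:C *: r n * (rh n * r n) = r n.
    by rewrite -scalerAl mulrA hc ct scalerA -rcM mulVf ?gt_eqF// scale1r.
  by rewrite mulrBr mulr1 mulrBr e opprB addrA subrK.
apply: le_trans (qnB (gns_psd pf) _ _) _; rewrite -!/(gnsnorm f _).
have h1 := bz (rh n * (1 - r n)); have h2 := gnsnorm_proj pf (1 - r n) (rh_proj n); lra.
Qed.

(** The vector eta of [linked_limit] is fixed by all corners, on which A_n is scalar, so |z eta| is
    proportional to N(z rh_n) for z in A_n ([key]). The corner is only part of the vacuum; the
    elements b_n of [renorm], with b_n rh_n tending to 1, undo this. The limit y of b_n eta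
    satisfies |z y|^2 = |y|^2 f(z^* z), and the claim follows by polarization. *)
Lemma tower_state_vector : exists y : H, forall a, S a -> inner (rho a y) y = f a.
Proof.
have [eta eta0 [re pe]] := linked_limit tw hl hw hlink hr xi1 hg.
have rhe n : rho (rh n) eta = eta.
  by elim: n => //= n IH; rewrite (repM hr) pe.
have key n z : A n z -> nr (rho z eta) * gnsnorm f (rh n) = nr eta * gnsnorm f (z * rh n).
  move=> Az; have [c hc] := rh_min (subM (sA n) (subJ (sA n) Az) Az); have [ah hh] := rh_proj n.
  apply/eqP; rewrite -(eqrXn2 (n := 2)) ?mulr_ge0 ?nr_ge0 ?g0//; apply/eqP.
  have e2 := form_xx (gns_psd pf) (rh n); rewrite /gnsform ah hh -/(gnsnorm f _) in e2.
  rewrite !exprMn rep_nr// (gnsnorm_sqr pf (z * rh n)) adjM ah.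
  have -> : rh n * adj z * (z * rh n) = c *: rh n by rewrite -hc !mulrA.
  rewrite (pfZ pf) e2 mulrC [in RHS]mulrC.
  have -> : inner (rho (adj z * z) eta) eta = c * (nr eta ^+ 2)%:C.
    transitivity (inner (rho (rh n * (adj z * z) * rh n) eta) eta).
      by rewrite !(repM hr) rhe (rep_adj hr (rh n)) ah rhe.
    by rewrite hc (repZl hr) rhe innerZl innerxx.
  by rewrite ![c * _]mulrC !cReZ mulrCA mulrC.
have ne : 0 < nr eta by rewrite nr_gt0.
have [b hb'] := choice (fun n => let: ex_intro2 b p1 p2 := renorm n in ex_intro _ b (conj p1 p2)).
have Ab n := (hb' n).1; have b1 n := (hb' n).2.1; have bz n := (hb' n).2.2.
have bstep n : nr (rho (b n.+1) eta - rho (b n) eta) <= nr eta / 2 ^+ n.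
  rewrite -(repBl hr); have Abn := tw_incr tw (Ab n).
  have k := key n.+1 _ (subB (sA n.+1) (Ab n.+1) Abn); have h := rh_ge n.+1.
  have e : gnsnorm f ((b n.+1 - b n) * rh n.+1) <= 8 * tower_eps R n.
    have -> : (b n.+1 - b n) * rh n.+1 = (b n.+1 * rh n.+1 - 1) - (b n * rh n - 1) + b n * (rh n - rh n.+1).
      by rewrite opprB addrA subrK mulrBl mulrBr addrA subrK.
    have h1 := gD ((b n.+1 * rh n.+1 - 1) - (b n * rh n - 1)) (b n * (rh n - rh n.+1)).
    have h2 := gnsnormB pf (b n.+1 * rh n.+1 - 1) (b n * rh n - 1).
    have h3 := bz n (rh n - rh n.+1); have h4 := b1 n; have h5 := b1 n.+1.
    have h6 : gnsnorm f (rh n - rh n.+1) <= tower_eps R n.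
      rewrite /= -{1}[rh n]mulr1 -mulrBr; exact: le_trans (gnsnorm_proj pf _ (rh_proj n)) (tw_p tw n).
    have h7 := tower_epsS R n; have h8 := eps_ge0 n; have h9 := eps_ge0 n.+1; lra.
  have h2 : nr (rho (b n.+1 - b n) eta) * (1 / 2) <= nr eta * (8 * tower_eps R n).
    by apply: le_trans (ler_wpM2l (nr_ge0 _) h) _; rewrite k ler_wpM2l// ltW.
  move: h2; rewrite /tower_eps.
  have -> : nr eta * (8 * (1 / 16 / 2 ^+ n)) = nr eta / 2 ^+ n * (1 / 2) by field; rewrite gt_eqF// exprn_gt0.
  by rewrite ler_pM2r//; lra.
have [y hy] : exists y, scvg (fun n => rho (b n) eta) y.
  by apply: scauchy_cvg; apply: (scauchy_geom (c := nr eta)).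
have y0' : 0 < nr y.
  apply: lt_le_trans (_ : 0 < nr eta * (1 / 2)) _; first by rewrite mulr_gt0//; lra.
  apply: scvg_nr_ge hy _ => n.
  have h1 : gnsnorm f (rh n) <= 1.
    by have := gnsnorm_proj pf 1 (rh_proj n); rewrite mulr1 (gnsnorm1 pf).
  apply: le_trans (_ : nr (rho (b n) eta) * gnsnorm f (rh n) <= _); last by rewrite ler_piMr ?nr_ge0.
  rewrite (key n _ (Ab n)) ler_wpM2l ?nr_ge0//.
  have := gD (1 - b n * rh n) (b n * rh n); rewrite subrK (gnsnorm1 pf).
  have -> : gnsnorm f (1 - b n * rh n) = gnsnorm f (b n * rh n - 1) by rewrite -(gnsnormN pf) opprB.
  by have := b1 n; have := eps_le n; lra.
pose j := gns_map pf; pose pi := @gns_rep R U f pf bnd.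
have jb : scvg (fun n => j (b n * rh n)) (j 1).
  apply: null_le (null_geom (3 * (1 / 16))) => n; rewrite /j -(lmapB (gns_map_linear pf)) nr_gns_map.
  have -> : 3 * (1 / 16) / 2 ^+ n = 3 * tower_eps R n by rewrite /tower_eps -mulrA.
  exact: b1.
have norm_eq n z : A n z -> inner (rho z y) (rho z y) = inner y y * f (adj z * z).
  move=> Az; pose s k := (k + n)%N; have sn k : (n <= s k)%N by exact: leq_addl.
  have ks k : (k <= s k)%N by exact: leq_addr.
  have hb2 := rep_scvg hr z hy; have jz := rep_scvg (gns_starrep pf bnd) z jb.
  have L1 := scvg_mul (scvg_shift ks (scvg_inner hb2 hb2)) (scvg_shift ks (scvg_inner jb jb)).
  have L2 := scvg_mul (scvg_shift ks (scvg_inner hy hy)) (scvg_shift ks (scvg_inner jz jz)).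
  have e1 : inner (j 1) (j 1) = 1 by rewrite /j gns_inner adj1 mulr1 (pf1 pf).
  have ez : inner (pi z (j 1)) (pi z (j 1)) = f (adj z * z) by rewrite /pi /j !gns_repE gns_inner mulr1.
  rewrite e1 mulr1 in L1; rewrite -/pi ez in L2; apply: scvg_unique L1 _.
  apply: scvg_ext L2 => k; rewrite /pi /j !gns_repE !innerxx !nr_gns_map -!rcM -!exprMn; congr ((_ ^+ 2)%:C).
  set m := s k; have Az' := tower_mono tw (sn k) Az; rewrite -/m in Az'.
  apply: (mulIf (_ : gnsnorm f (rh m) != 0)); first by rewrite gt_eqF//; have := rh_ge m; lra.
  rewrite mulrAC (key m _ (Ab m)) -mulrA [in RHS]mulrAC -(repM hr) (key m _ (subM (sA m) Az' (Ab m))).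
  by rewrite -(mulrA z) mulrA mulrAC.
pose D a := inner (rho a y) y - inner y y * f a.
have DD a c : D (a + c) = D a + D c.
  by rewrite /D (repDl hr) innerDl (pfD pf) mulrDr opprD addrACA.
have DZ k a : D (k *: a) = k * D a.
  by rewrite /D (repZl hr) innerZl (pfZ pf) mulrBr mulrCA.
have Dz n z : A n z -> D (adj z * z) = 0.
  by move=> Az; rewrite /D (repM hr) (rep_adj hr) adjK (norm_eq n)// subrr.
have D2 n z : A n z -> D (adj z) + D z = 0.
  move=> Az; have A1 := sub1 (sA n); have D1 : D 1 = 0 by have := Dz n _ A1; rewrite adj1 mulr1.
  have := Dz n _ (subD (sA n) Az A1).
  rewrite adjD adj1 mulrDl !mulrDr !mulr1 !mul1r !DD (Dz n _ Az) D1.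
  by rewrite add0r addr0.
have D0 n z : A n z -> D z = 0.
  move=> Az; have e1 := D2 n _ Az; have := D2 n _ (subZ (sA n) 'i Az).
  rewrite adjZ !DZ cji mulNr addrC -mulrBr => /eqP; rewrite mulf_eq0 => /orP[|].
    by rewrite eq_complex /= oner_eq0 andbF.
  move: e1 => /eqP; rewrite addrC addr_eq0 => /eqP ->; rewrite -opprD oppr_eq0 -mulr2n -mulr_natr mulf_eq0 pnatr_eq0 orbF.
  by move=> /eqP ->; rewrite oppr0.
exists (((nr y)^-1)%:C *: y) => a Sa; have [n An] := tw_exh tw Sa.
have /eqP := D0 n a An; rewrite subr_eq0 => /eqP e.
rewrite (repZr hr) innerZl innerZr e innerxx conjc_real !mulrA -!rcM expr2 !mulrA.
by rewrite divfK ?gt_eqF// mulVf ?gt_eqF// mul1r.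
Qed.

End TowerCorner.

(* Representations of a C*-algebra containing a dense unital *-subalgebra. *)
Section DenseSubalgebra.
Variables (R : realType) (U : starAlgType R) (A : cstarAlgType R) (i : U -> A).
Local Notation C := R[i].
Hypothesis li : linear_map i.
Hypothesis di : dense_map i.
Hypothesis iM : forall a b, i (a * b) = cmul (i a) (i b).
Hypothesis iS : forall a, i (adj a) = cstar (i a).
Implicit Types (x y : A).
Local Notation e := (i 1).

Let nrM x y : nr (cmul x y) <= nr x * nr y.
Proof. by rewrite -lecR rcM -!nrE; exact: cnormM. Qed.

Let nr_starM x : nr (cmul (cstar x) x) = nr x ^+ 2.
Proof. by have := cnorm_star x; rewrite !nrE -rcX => -[]. Qed.

Let star_le x : nr (cstar x) <= nr x.
Proof.
suff h y : nr y <= nr (cstar y) by have := h (cstar x); rewrite cstarK.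
have := nrM (cstar y) y; rewrite nr_starM; have [->|y0] := eqVneq (nr y) 0; first by rewrite nr_ge0.
by rewrite expr2 ler_pM2r// lt_neqAle eq_sym y0 nr_ge0.
Qed.

Let mul_l y : bop (cmul ^~ y).
Proof.
split; first by move=> k x z; rewrite cmulDl cmulZl.
by exists (nr y); rewrite ?nr_ge0// => x; rewrite mulrC; exact: nrM.
Qed.

Let mul_r x : bop (cmul x).
Proof.
split; first by move=> k y z; rewrite cmulDr cmulZr.
by exists (nr x); rewrite ?nr_ge0// => y; exact: nrM.
Qed.

Let mul1 x : cmul e x = x.
Proof.
apply: (@dense_bop_eq R U A i di A (cmul e) id (mul_r e) (bop_id A)) => a.
by rewrite -iM mul1r.
Qed.

Let star1 : cstar e = e. Proof. by rewrite -iS adj1. Qed.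

Let cstar_scvg (u : nat -> A) x : scvg u x -> scvg (fun n => cstar (u n)) (cstar x).
Proof.
apply: null_le => n; have -> : cstar (u n) - cstar x = cstar (u n - x); last exact: star_le.
by rewrite cstarD -[- x]scaleN1r cstarZ rmorphN rmorph1 scaleN1r.
Qed.

(** The equation says (1 - s)^2 = 1 - b: for b self-adjoint of norm at most 1, the element 1 - b is
    the square of a self-adjoint one. *)
Lemma sqrt_element (b : A) : cstar b = b -> nr b <= 1 ->
  exists2 s, cstar s = s & s = (2^-1 : C) *: (b + cmul s s).
Proof.
move=> sb b1; have lb : linear (cmul b) by exact: (mul_r b).1.
have [|X [_ _ XE Xc]] := sqrt_iter_cvg lb.
  by move=> x; apply: le_trans (nrM _ _) _; rewrite ler_piMl ?nr_ge0.
have it n x : sqrt_iter (cmul b) n x = cmul (sqrt_iter (cmul b) n e) x.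
  elim: n x => [|n IH] x; first by rewrite /= (bop0 (mul_l x)).
  rewrite /= (IH x) (IH (cmul _ x)) (IH (sqrt_iter (cmul b) n e)) cmulZl cmulDl !cmulA.
  by rewrite -(cmulA b) mul1.
have its n : cstar (sqrt_iter (cmul b) n e) = sqrt_iter (cmul b) n e.
  elim: n => [|n IH] /=; first by rewrite -[X in cstar X](scale0r (0 : A)) cstarZ conjc0 scale0r.
  rewrite it cstarZ cj_half cstarD !cstarM IH star1 sb mul1; congr (_ *: (_ + _)).
  have -> : cmul b e = b by rewrite -[LHS]cstarK cstarM star1 sb mul1.
  by [].
have Xe x : X x = cmul (X e) x.
  apply: scvg_unique (Xc x) _; apply: scvg_ext (bop_scvg (mul_l x) (Xc e)) => n; by rewrite -it.
exists (X e).
  by apply: scvg_unique (cstar_scvg (Xc e)) _; apply: scvg_ext (Xc e) => n; rewrite its.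
have be : cmul b e = b by rewrite -[LHS]cstarK cstarM star1 sb mul1.
by rewrite {1}XE {1}Xe be.
Qed.

Section Rep.
Variables (H : hilbertType R) (rho : A -> H -> H).
Hypothesis hs : star_representation rho.

Let rbop a : bop (rho a). Proof. by case: hs => h _ _ _; have [l c] := h a; exact: bopP. Qed.
Let rD a b (x : H) : rho (a + b) x = rho a x + rho b x.
Proof. by case: hs => _ h _ _; have := h 1 a b x; rewrite !scale1r. Qed.
Let r0 (x : H) : rho 0 x = 0.
Proof. by apply: (addIr (rho 0 x)); rewrite -rD !add0r. Qed.
Let rZ k a (x : H) : rho (k *: a) x = k *: rho a x.
Proof. by case: hs => _ h _ _; rewrite -[k *: a]addr0 h r0 addr0. Qed.
Let rM a b (x : H) : rho (cmul a b) x = rho a (rho b x). Proof. by case: hs. Qed.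
Let rS a (x y : H) : inner (rho a x) y = inner x (rho (cstar a) y). Proof. by case: hs. Qed.

(** The vectors fixed by the image of the unit form a closed invariant subspace containing all
    [rho a x], so it is not 0. *)
Lemma irrep_unit : irreducible_representation rho -> forall x : H, rho e x = x.
Proof.
move=> [[a [x nz]] irr]; have inv b (y : H) : rho e (rho b y) = rho b y by rewrite -rM mul1.
have [|b y _|V0|VT] := irr [set y : H | rho e y = y].
- split => [|k y z hy hz|]; first by rewrite /= (bop0 (rbop e)).
    by rewrite /= (bopD (rbop e)) (bopZ (rbop e)) hy hz.
  apply: scvg_closed => u y hu uy; have h : scvg u (rho e y).
    by apply: scvg_ext (bop_scvg (rbop e) uy) => n; rewrite hu.
  exact: scvg_unique h uy.
- exact: inv.
- exfalso; apply: nz; have h : [set y : H | rho e y = y] (rho a x) := inv a x.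
  by rewrite V0 in h.
- by move=> y; have : [set y : H | rho e y = y] y by rewrite VT.
Qed.

Hypothesis unital : forall x : H, rho e x = x.

(** Continuity in a is not part of [star_representation]. For b self-adjoint of norm at most 1, 1 -
    b is a square by [sqrt_element], whence <b x, x> <= |x|^2; take b = a^* a / |a|^2. *)
Lemma rep_contractive a (x : H) : nr (rho a x) <= nr a * nr x.
Proof.
have step b : cstar b = b -> nr b <= 1 -> complex.Re (inner (rho b x) x) <= nr x ^+ 2.
  move=> sb b1; have [s ss hs'] := sqrt_element sb b1.
  have e2 : rho b x = rho s x + rho s x - rho s (rho s x).
    have -> : rho s x + rho s x = rho (b + cmul s s) x.
      have h2 : (2^-1 : C) != 0 by rewrite invr_eq0 pnatr_eq0.
      by apply: (scalerI h2); rewrite -rZ -hs' scalerDr -scalerDl half_half scale1r.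
    by rewrite rD rM addrK.
  have pos : 0 <= nr (x - rho s x) ^+ 2 by exact: sqr_ge0.
  move: pos; rewrite -!nr_eq_sqr innerBl !innerBr (rS s x (rho s x)) ss e2 innerBl innerDl.
  rewrite (rS s (rho s x) x) ss.
  rewrite [inner x (rho s x)]inner_sym; set c := inner (rho s x) x.
  have ex : inner x (rho s (rho s x)) = inner (rho s x) (rho s x) by rewrite [RHS]rS ss.
  by rewrite ex !(cReB, cReD, cRe_conj); lra.
have [->|a0] := eqVneq a 0; first by rewrite r0 !nr0 mul0r.
have na : 0 < nr a by rewrite nr_gt0.
pose b := ((nr a ^- 2)%:C : C) *: cmul (cstar a) a.
have sb : cstar b = b by rewrite cstarZ conjc_real cstarM cstarK.
have b1 : nr b <= 1.
  by rewrite nrZ nr_starM nrR ger0_norm ?invr_ge0 ?sqr_ge0// mulVf// expf_neq0// gt_eqF.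
have := step b sb b1; rewrite /b rZ innerZl rM rS cstarK innerxx -rcM /= mulrC ler_pdivrMr ?exprn_gt0//.
by rewrite -exprMn ler_pXn2r ?nnegrE ?mulr_ge0 ?nr_ge0// mulrC.
Qed.

Lemma rep_scvg_left (u : nat -> A) a (x : H) : scvg u a -> scvg (fun n => rho (u n) x) (rho a x).
Proof.
move=> ua; apply: null_le (nullM (nr_ge0 x) ua) => n.
have -> : rho (u n) x - rho a x = rho (u n - a) x by rewrite rD -[- a]scaleN1r rZ scaleN1r.
by rewrite mulrC; exact: rep_contractive.
Qed.

Lemma restricted_starrep : starrep (fun a => rho (i a)).
Proof.
split=> //.
- by move=> a b x; rewrite iM rM.
- by move=> a b x; rewrite (lmapD li) rD.
- by move=> k a x; rewrite (lmapZ li) rZ.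
- by move=> a x y; rewrite iS rS.
Qed.

Lemma restricted_irreducible : irreducible_representation rho ->
  irreducible_family (fun a => rho (i a)).
Proof.
move=> [_ irr] V cV inv; apply: irr => // a x Vx; have [u hu] := dense_seq di a.
have [_ _ clV] := cV; apply: closed_scvg clV _ (rep_scvg_left x hu) => n; exact: inv.
Qed.
End Rep.

(* A vector with the state of a cyclic vector is cyclic. *)
Lemma irreducible_dense (H : hilbertType R) (rho : U -> H -> H) (y : H) : starrep rho ->
  irreducible_family rho -> y != 0 -> dense_map (fun a => rho a y).
Proof.
have ltr02 : (0 : R) < 2 by rewrite ltr0n.
move=> hr irr y0; pose W := [set x : H | forall d : R, 0 < d -> exists a, nr (x - rho a y) < d].
have [|a x Wx d d0|W0|WT] := irr W.
- split.
  + by move=> d d0; exists 0; rewrite (rep0l hr) subrr nr0.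
  + move=> k x z Wx Wz d d0; have k0 : 0 < nr k + 1 by have := nr_ge0 k; lra.
    have [a ha] := Wx (d / 2 / (nr k + 1)) (divr_gt0 (divr_gt0 d0 ltr02) k0).
    have [b hb] := Wz (d / 2) (divr_gt0 d0 ltr02); exists (k *: a + b).
    rewrite (repDl hr) (repZl hr) opprD addrACA -scalerBr (splitr d).
    apply: le_lt_trans (nrD _ _) _; apply: ler_ltD => //.
    rewrite nrZ; apply: le_trans (_ : (nr k + 1) * (d / 2 / (nr k + 1)) <= _).
      by apply: ler_pM; rewrite ?nr_ge0// ?ltW// ltrDl.
    by rewrite mulrC divfK// gt_eqF.
  + apply: scvg_closed => u x hu ux d d0; have [N hN] := ux _ (divr_gt0 d0 ltr02).
    have [a ha] := hu N _ (divr_gt0 d0 ltr02); exists a; rewrite (splitr d).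
    apply: le_lt_trans (nr_tri _ (u N) _) _; apply: ltrD => //.
    by rewrite nr_distC; exact: hN.
- have [M M0 hM] := (rep_bop hr a).2; have k0 : 0 < M + 1 by lra.
  have [b hb] := Wx (d / (M + 1)) (divr_gt0 d0 k0); exists (a * b).
  rewrite (repM hr) -(repBr hr); apply: le_lt_trans (hM _) _.
  apply: le_lt_trans (_ : (M + 1) * nr (x - rho b y) < _); last by rewrite mulrC -ltr_pdivlMr.
  by rewrite ler_wpM2r ?nr_ge0//; lra.
- exfalso; have : W y by move=> d d0; exists 1; rewrite (rep1 hr) subrr nr0.
  by rewrite W0 /= => e'; move: y0; rewrite e' eqxx.
by move=> x; have : W x by rewrite WT.
Qed.

Variable f : U -> C.
Hypothesis f1 : f 1 = 1.
Hypothesis allvec : forall (H : hilbertType R) (rho : U -> H -> H) (x : H), starrep rho ->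
  irreducible_family rho -> x != 0 -> exists y : H, forall a, inner (rho a y) y = f a.

(** Uniqueness of the GNS representation: both have a vector with state f, cyclic by irreducibility,
    and sending a y to a z is isometric with dense range. *)
Lemma irreps_equivalent (p q : irrep A) : unitarily_equivalent p q.
Proof.
have up := irrep_unit (irrep_star p) (irrep_irreducible p).
have uq := irrep_unit (irrep_star q) (irrep_irreducible q).
have hp := restricted_starrep (irrep_star p) up; have hq := restricted_starrep (irrep_star q) uq.
have ip := restricted_irreducible (irrep_star p) (irrep_irreducible p).
have iq := restricted_irreducible (irrep_star q) (irrep_irreducible q).
have nz (s : irrep A) : exists x : irrep_space s, x != 0.
  by have [[a [x nz]] _] := irrep_irreducible s; exists (s a x); apply/eqP.
have [xp xp0] := nz p; have [xq xq0] := nz q.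
have [y hy] := allvec hp ip xp0; have [z hz] := allvec hq iq xq0.
have ne0 (H : hilbertType R) (rho : U -> H -> H) (t : H) : starrep rho ->
    (forall a, inner (rho a t) t = f a) -> t != 0.
  move=> hr ht; apply/eqP => t0; have := ht 1; rewrite t0 inner0r f1 => /eqP.
  by rewrite eq_sym oner_eq0.
have dp := irreducible_dense hp ip (ne0 _ _ _ hp hy).
have dq := irreducible_dense hq iq (ne0 _ _ _ hq hz).
have lp : linear_map (fun a => p (i a) y) by move=> k a b; rewrite (repDl hp) (repZl hp).
have lq : linear_map (fun a => q (i a) z) by move=> k a b; rewrite (repDl hq) (repZl hq).
have ip_ a b : inner (p (i a) y) (p (i b) y) = f (adj b * a).
  by rewrite (rep_adjr hp) -(repM hp) hy.
have iq_ a b : inner (q (i a) z) (q (i b) z) = f (adj b * a).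
  by rewrite (rep_adjr hq) -(repM hq) hz.
have nn a : nr (q (i a) z) = nr (p (i a) y).
  by apply/eqP; rewrite -(eqrXn2 (n := 2)) ?nr_ge0// -!nr_eq_sqr ip_ iq_.
have [|u [bu hu _]] := dense_extend lp dp lq ler01; first by move=> a; rewrite mul1r nn.
have [|v [bv hv _]] := dense_extend lq dq lp ler01; first by move=> a; rewrite mul1r nn.
exists u; split.
- exact: bu.1.
- move=> s t; have [a ha] := dense_seq dp s; have [b hb] := dense_seq dp t.
  have := scvg_inner (bop_scvg bu ha) (bop_scvg bu hb) => h; apply: scvg_unique h _.
  by apply: scvg_ext (scvg_inner ha hb) => n; rewrite !hu ip_ iq_.
- apply/seteqP; split=> // t _; exists (v t) => //.
  apply: (@dense_bop_eq R U _ _ dq _ (fun t => u (v t)) id (bop_comp bu bv) (bop_id _)) => a.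
  by rewrite hv hu.
move=> a x; have [c hc] := dense_seq di a.
have h1 := bop_scvg bu (rep_scvg_left (irrep_star p) x hc).
have h2 := rep_scvg_left (irrep_star q) (u x) hc.
apply: scvg_unique h1 _; apply: scvg_ext h2 => n.
have B1 : bop (fun t : irrep_space p => q (i (c n)) (u t)) := bop_comp (rep_bop hq (c n)) bu.
have B2 : bop (fun t : irrep_space p => u (p (i (c n)) t)) := bop_comp bu (rep_bop hp (c n)).
apply: (@dense_bop_eq R U _ _ dp _ _ _ B1 B2) => d.
by rewrite hu -(repM hq) -(repM hp) hu.
Qed.

(** There is at most one equivalence class, so every set of classes is empty or everything. *)
Lemma discrete_of_equivalent : (forall p q : irrep A, unitarily_equivalent p q) ->
  discrete_spectrum A.
Proof.
move=> eqv O; have all1 (c d : spectrum A) : c = d.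
  case: c => c hc; case: d => d hd.
  have cT (k : irrep A -> Prop) : (exists p, k = unitarily_equivalent p) -> k = fun=> True.
    by move=> [p ->]; apply/funext => q; apply/propext; split.
  have e' : c = d by rewrite (cT _ hc) (cT _ hd).
  by subst d; congr Spectrum; exact: Prop_irrelevance.
have [[c0 Oc]|no] := pselect (exists c, O c).
  exists setT; first exact: openT.
  by move=> c; split=> // _; rewrite (all1 c c0).
exists set0; first exact: open0.
by move=> c; split=> // Oc; apply: no; exists c.
Qed.
End DenseSubalgebra.

(** * Bounded states on the crossed product, and the trace *)

Section CrossedState.
Variables (R : realType) (d : Order.disp_t) (X : orderType d) (th : X -> words R X -> words R X).
Variable gd : good_family th.
Local Notation C := R[i].
Local Notation U := (crossed gd).
Local Notation tau := (@tau R d X th gd).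

Lemma gnsnorm_word (g : U -> C) w (x : U) : posfun g -> desc w -> gnsnorm g ((delta w : U) * x) = gnsnorm g x.
Proof.
move=> pg; elim: w x => [|b s IH] x; first by rewrite -[delta [::]]/(1 : U) mul1r.
rewrite desc_cons => /andP[bs ds].
have -> : (delta (b :: s) : U) = (delta s : U) * lam gd b.
  by rewrite lam_mulr ?consV_delta//; exact: below_delta.
by rewrite -mulrA IH// (gnsnorm_sym pg)//; exact: lam_symmetry.
Qed.

(** A word is a product of symmetries and so preserves the seminorm of any state; the sum of the
    moduli of the coefficients of a is then a bound. *)
Lemma crossed_bounded (g : U -> C) : posfun g ->
  forall a : U, exists2 M, 0 <= M & forall x, gnsnorm g (a * x) <= M * gnsnorm g x.
Proof.
move=> pg a; exists (\sum_(w <- supp a) nr (a w)); first by apply: sumr_ge0 => w _; exact: nr_ge0.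
move=> x; have -> : a * x = \sum_(w <- supp a) (a w *: (delta w : U)) * x.
  by rewrite -mulr_suml; congr (_ * _); exact: fspan_expand.
rewrite mulr_suml; elim: (supp a) => [|w s IH].
  by rewrite !big_nil /gnsnorm (qn0 (gns_psd pg)).
rewrite !big_cons; apply: le_trans (qnD (gns_psd pg) _ _) _; apply: lerD; last exact: IH.
have [->|aw] := eqVneq (a w) 0.
  by rewrite scale0r mul0r (qn0 (gns_psd pg)) mulr_ge0 ?nr_ge0 ?qn_ge0.
by rewrite -scalerAl (qnZ (gns_psd pg)) -/(gnsnorm g _) gnsnorm_word// (coef_dom aw).
Qed.

Lemma tau_posfun : posfun tau.
Proof.
by split=> [x y|k x||x] //; rewrite tau_fip; exact: fip_ge0.
Qed.

Lemma gnsnorm_tau x : gnsnorm tau x = qn (@fip R _ (fun s : seq X => desc s)) x.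
Proof. by rewrite /gnsnorm /qn /gnsform tau_fip. Qed.

Lemma coef_le_gnsnorm (x : U) w : nr (x w) <= gnsnorm tau x.
Proof.
have [->|xw] := eqVneq (x w) 0; first by rewrite nr0 qn_ge0.
rewrite -fip_coef gnsnorm_tau; apply: le_trans (form_CS (@fip_psd _ _ _) _ _) _.
rewrite ler_piMr ?qn_ge0// /qn fip_delta deltaE eqxx (coef_dom xw) /=.
by rewrite sqrtr1.
Qed.

(** Needed for the Cayley transform: it makes T + i injective when T is self-adjoint. The trace of
    either summand is a nonnegative square norm. *)
Lemma crossed_faithful (y z : U) : adj y * y + adj z * z = 0 -> y = 0.
Proof.
move=> e; have := congr1 (fun x : U => complex.Re (tau x)) e.
rewrite (pfD tau_posfun) !tau_fip cReD /= => e'.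
have hy := form_Re_ge0 (@fip_psd R _ (fun s : seq X => desc s)) y.
have hz := form_Re_ge0 (@fip_psd R _ (fun s : seq X => desc s)) z.
have y0 : complex.Re (fip y y) = 0 by lra.
apply: fspan_ext => w; apply: nr_le0; apply: le_trans (coef_le_gnsnorm _ _) _.
by rewrite gnsnorm_tau /qn y0 sqrtr0.
Qed.
End CrossedState.

Lemma rep_posfun (R : realType) (U : starAlgType R) (H : hilbertType R) (rho : U -> H -> H) (y : H) :
  starrep rho -> inner y y = 1 -> posfun (fun a => inner (rho a y) y).
Proof.
move=> hr y1; split=> [a b|k a||a].
- by rewrite (repDl hr) innerDl.
- by rewrite (repZl hr) innerZl.
- by rewrite (rep1 hr).
- by rewrite (repM hr) (rep_adj hr) adjK innerxx ler0c sqr_ge0.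
Qed.

Lemma not_separable_of_family (R : realType) (V : normedModType R[i]) (W : choiceType) (x : W -> V) :
  ~ countable [set: W] -> (forall a b, a <> b -> 1 <= nr (x a - x b)) -> ~ separable V.
Proof.
move=> nc sep [D cD dD]; apply: nc; have h2 : 0 < (1 / 2)%:C :> R[i] by rewrite ltr0c.
have H a : exists e, D e /\ nr (x a - e) < 1 / 2.
  have [||e [he De]] := dD (ball (x a) (1 / 2)%:C); [by exists (x a); exact: ballxx|exact: ball_open|].
  by exists e; split=> //; rewrite -ball_nr.
have [e he] := choice H; have /countable_injP[f fi] := cD.
apply/countable_injP; exists (f \o e) => a b _ _ /= fab.
have eab : e a = e b by apply: fi => //; apply/mem_set; case: (he a) (he b) => ? _ [? _].
apply: contrapT => /sep; apply/negP; rewrite -ltNge.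
apply: le_lt_trans (nr_tri _ (e a) _) _; have [_ h1] := he a; have [_ h3] := he b.
rewrite (nr_distC (e a)) {2}eab; lra.
Qed.

(* Every nonzero irreducible representation of the algebra built from a diamond
   sequence contains a vector with state [fstate]. *)
Section DiamondAlgebra.
Variables (R : realType) (d : Order.disp_t) (W : orderType d).
Hypothesis hW : is_omega1 W.
Variable Sd : W -> set W.
Hypothesis hSd : forall S : set W, stationary [set a | S `&` [set b | (b < a)%O] = Sd a].
Local Notation C := R[i].
Local Notation X := (letter W).
Local Notation words := (words R X).
Local Notation f := (@fstate R d W).
Variable kappa : seq X -> nat -> W.
Hypothesis kappa_inj : forall w v m n, kappa w m = kappa v n -> w = v /\ m = n.
Variables (th : X -> words -> words) (gd : good_family th).
Hypothesis hth : forall m, th (inl m : X) = sgnw m.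
Hypothesis hst : forall a, stage f gd (inr a : X) (guess Sd kappa a) (th (inr a)).
Local Notation U := (crossed gd).

(** Otherwise rho is disjoint from the GNS representation of f, so its vector states are separated
    from f. Diamond guesses one of them at some stage a, the linked tower yields a vector with state
    f below a, and [state_determined] extends this to the whole algebra. *)
Lemma diamond_state_vector (H : hilbertType R) (rho : U -> H -> H) (x : H) : starrep rho ->
  irreducible_family rho -> x != 0 -> exists y : H, forall a, inner (rho a y) y = f a.
Proof.
move=> hr irr x0; apply: contrapT => novec.
have pf : posfun (f : U -> C) := fstate_posfun gd hth (omega1_wf hW).
have bnd := crossed_bounded pf.
have lm := words_locally_matricial hW hth hst.
have fq : free_qubits (U := U) (fun=> True) f.
  apply: (proj2 (@words_invariants R d W hW (guess Sd kappa) th gd hth (fun=> True) (fun=> True)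
    (fun b _ => hst b) (fun _ _ => I) (fun _ _ _ _ => I) _)) => z _.
  by have [h|[b [h _]]] := base_or_belowS z; [left|right; exists b].
have sw := swap_density pf bnd lm hr (rep_schur hr irr) novec.
pose xi := ((nr x)^-1)%:C *: x; have nx : 0 < nr x by rewrite nr_gt0.
have xi1 : inner xi xi = 1.
  rewrite innerZl innerZr mulrA nr_sqr nrR ger0_norm ?invr_ge0 ?ltW// innerxx -rcM -exprMn.
  by rewrite mulVf ?gt_eqF// expr1n.
have sep := separated_vector_state pf lm fq (@crossed_faithful _ _ _ _ gd) hr sw xi1.
pose g a := inner (rho a xi) xi; have pg : posfun g := rep_posfun hr xi1.
have [a [A [r [u [v [p [s0 [y0 [tw hw lk]]]]]]]]] := stage_guessed hW hSd kappa_inj hst pg sep.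
have hg z : gnsnorm g z = nr (rho z xi).
  apply/eqP; rewrite -(eqrXn2 (n := 2)) ?nr_ge0 ?qn_ge0//.
  by rewrite (gnsnorm_sqr pg) rep_nr.
have [y hy] := tower_state_vector pf bnd tw (lam_symmetry gd _) hw lk hr xi1 hg.
apply: novec; exists y; have y1 : inner y y = 1.
  by have := hy 1 (sub1 (below_subalg gd _)); rewrite (rep1 hr) (pf1 pf).
apply: (state_determined hW hth hst (a := a) (g := fun z => inner (rho z y) y)) => //.
exact: rep_posfun.
Qed.

Lemma tau_lam_far a b : a <> b -> 1 <= gnsnorm (@tau R _ X th gd) (lam gd (inr a : X) - lam gd (inr b)).
Proof.
move=> ab; apply: le_trans (coef_le_gnsnorm _ [:: inr a : X]).
rewrite [X in nr X](_ : _ = (delta [:: inr a : X] : words) [:: inr a] - (delta [:: inr b : X] : words) [:: inr a]).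
  by rewrite !deltaE eqxx /= [(_ == _)](_ : _ = false) ?subr0 ?nr1//; apply/eqP => -[].
by [].
Qed.
End DiamondAlgebra.

(** * Step functions on coin tosses and Alspach's map *)

Section StepFunctions.
Variable R : realType.
Implicit Types (g h : seq bool -> R) (b : bool) (s : seq bool).

(* The mean of [g] over the words of length [n]. *)
Fixpoint avg n g : R := if n is m.+1
  then 2^-1 * (avg m (fun s => g (true :: s)) + avg m (fun s => g (false :: s))) else g [::].

Lemma avg_ext n g h : (forall s, size s = n -> g s = h s) -> avg n g = avg n h.
Proof.
elim: n g h => [|n IH] g h e /=; first exact: e.
by congr (_ * (_ + _)); apply: IH => s ss; apply: e; rewrite /= ss.
Qed.

Lemma avg_lin n (k : R) g h : avg n (fun s => k * g s + h s) = k * avg n g + avg n h.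
Proof. by elim: n g h => [|n IH] g h //=; rewrite !IH; ring. Qed.

Lemma avg_ge0 n g : (forall s, 0 <= g s) -> 0 <= avg n g.
Proof.
elim: n g => [|n IH] g h /=; first exact: h.
by rewrite mulr_ge0 ?invr_ge0// addr_ge0//; apply: IH => s; exact: h.
Qed.

Lemma avg_cst n (k : R) : avg n (fun=> k) = k.
Proof. by elim: n => //= n ->; field. Qed.

Lemma avgD n g h : avg n (fun s => g s + h s) = avg n g + avg n h.
Proof. by have := avg_lin n 1 g h; rewrite mul1r => <-; apply: avg_ext => s _; rewrite mul1r. Qed.

Lemma avgZ n (k : R) g : avg n (fun s => k * g s) = k * avg n g.
Proof.
have := avg_lin n k g (fun=> 0); rewrite avg_cst addr0 => <-; apply: avg_ext => s _.
by rewrite addr0.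
Qed.

Lemma avgN n g : avg n (fun s => - g s) = - avg n g.
Proof. by rewrite -mulN1r -avgZ; apply: avg_ext => s _; rewrite mulN1r. Qed.

Lemma avgB n g h : avg n (fun s => g s - h s) = avg n g - avg n h.
Proof. by rewrite avgD avgN. Qed.

Lemma avg_le n g h : (forall s, size s = n -> g s <= h s) -> avg n g <= avg n h.
Proof.
elim: n g h => [|n IH] g h e /=; first exact: e.
by rewrite ler_wpM2l ?invr_ge0// lerD//; apply: IH => s ss; apply: e; rewrite /= ss.
Qed.

Lemma avg_drop m n g : avg (m + n) (fun s => g (drop m s)) = avg n g.
Proof.
elim: m => [|m IH]; first by apply: avg_ext => s _; rewrite drop0.
by rewrite addSn /= IH; field.
Qed.

(** Independence of disjoint blocks of coins. *)
Lemma avg_take_drop m n g h : avg (m + n) (fun s => g (take m s) * h (drop m s)) = avg m g * avg n h.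
Proof.
elim: m g => [|m IH] g /=.
  by rewrite -avgZ; apply: avg_ext => s _; rewrite take0 drop0.
by rewrite (IH (fun s => g (true :: s))) (IH (fun s => g (false :: s))); ring.
Qed.

(* Appending a last letter [b], which selects the branch [phi b]. *)
Definition branch (phi : bool -> R -> R) g s : R := phi (last false s) (g (take (size s).-1 s)).

Lemma avg_branch2 (Q : R -> R -> R) (phi : bool -> R -> R) n g h :
  avg n.+1 (fun s => Q (branch phi g s) (branch phi h s)) =
  avg n (fun s => 2^-1 * (Q (phi true (g s)) (phi true (h s)) + Q (phi false (g s)) (phi false (h s)))).
Proof.
elim: n g h => [|n IH] g h //.
have E b : avg n.+1 (fun s => Q (branch phi g (b :: s)) (branch phi h (b :: s))) =
    avg n.+1 (fun s => Q (branch phi (fun s => g (b :: s)) s) (branch phi (fun s => h (b :: s)) s)).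
  by apply: avg_ext => -[|c s].
transitivity (2^-1 * (avg n.+1 (fun s => Q (branch phi g (true :: s)) (branch phi h (true :: s))) +
  avg n.+1 (fun s => Q (branch phi g (false :: s)) (branch phi h (false :: s))))) => //.
by rewrite !E !IH.
Qed.

Lemma avg_branch (Q : R -> R) (phi : bool -> R -> R) n g : avg n.+1 (fun s => Q (branch phi g s)) =
  avg n (fun s => 2^-1 * (Q (phi true (g s)) + Q (phi false (g s)))).
Proof. exact: (avg_branch2 (fun x _ => Q x) phi n g g). Qed.

Lemma branch_drop phi g m n s : size s = (m + n).+1 ->
  branch phi (fun s => g (drop m s)) s = branch phi g (drop m s).
Proof.
move=> ss; rewrite /branch size_drop ss -addnS addKn /= addnS /=; congr (phi _ (g _)).
  have sd : size (drop m s) = n.+1 by rewrite size_drop ss -addnS addKn.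
  by rewrite -{1}(cat_take_drop m s) last_cat; move: sd; case: (drop m s).
by rewrite take_drop addnC.
Qed.

(** In [step] the last letter of a word belongs to coin 0. So [branch] with this function shifts all
    coins by one and lets coin 0 choose between the two pieces, which is Alspach's map read on
    binary digits. *)
Definition alspach b (x : R) : R := if b then Num.min (2 * x) 1 else Num.max (2 * x - 1) 0.

Lemma alspach_bound b x : 0 <= x <= 1 -> 0 <= alspach b x <= 1.
Proof.
by move=> /andP[x0 x1]; case: b; rewrite /= /Num.min /Num.max; case: ltP => ?; apply/andP; split; lra.
Qed.

Lemma alspach_mean x : 2^-1 * (alspach true x + alspach false x) = x.
Proof. by rewrite /= /Num.min /Num.max; do 2 case: ltP => ?; lra. Qed.

(** Both pieces are nondecreasing and their mean is the identity, so for ordered arguments the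
    absolute values drop out. *)
Lemma alspach_isometry x y :
  2^-1 * (`|alspach true x - alspach true y| + `|alspach false x - alspach false y|) = `|x - y|.
Proof.
wlog xy : x y / y <= x.
  move=> H; case/orP: (le_total y x) => h; first exact: (H x y h).
  by have := H y x h; rewrite (distrC y x) (distrC (alspach true y)) (distrC (alspach false y)).
have m b : alspach b y <= alspach b x.
  by case: b; rewrite /= /Num.min /Num.max; do 2 case: ltP => ?; lra.
rewrite !ger0_norm ?subr_ge0// -[in RHS](alspach_mean x) -[in RHS](alspach_mean y); lra.
Qed.

Lemma alspach_sqr x y : 2^-1 * ((alspach true x - alspach true y) ^+ 2 +
  (alspach false x - alspach false y) ^+ 2) <= 4 * (x - y) ^+ 2.
Proof.
have := alspach_isometry x y; set a := alspach true x - _; set b := alspach false x - _ => e.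
rewrite -(real_normK (num_real a)) -(real_normK (num_real b)) -(real_normK (num_real (x - y))) -e.
have := normr_ge0 a; have := normr_ge0 b; move: `|a| `|b| => u v; nra.
Qed.

(** x(1 - x) measures how far a value is from 0 and 1, and the map lowers its mean by min(x, 1-x)^2;
    a fixed point must therefore be an indicator. *)
Lemma alspach_defect x : 0 <= x <= 1 -> 2^-1 * (alspach true x * (1 - alspach true x) +
  alspach false x * (1 - alspach false x)) = x * (1 - x) - (Num.min x (1 - x)) ^+ 2.
Proof.
by move=> /andP[x0 x1]; rewrite /= /Num.min /Num.max; do 3 case: ltP => ?; nra.
Qed.

Lemma alspach_id b x : x = 0 \/ x = 1 -> alspach b x = x.
Proof.
by case: b => -[] ->; rewrite /= /Num.min /Num.max; case: ltP => ?; lra.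
Qed.
End StepFunctions.

(** * Step functions as elements of the crossed product *)

Section StepAlgebra.
Variables (R : realType) (d : Order.disp_t) (W : orderType d).
Local Notation X := (letter W).
Local Notation words := (words R X).
Variables (th : X -> words -> words) (gd : good_family th).
Hypothesis hth : forall m, th (inl m : X) = sgnw m.
Local Notation U := (crossed gd).
Local Notation C := R[i].
Implicit Types (g h : seq bool -> R) (b : bool) (s : seq bool).

Definition coin n : U := lam gd (inl n.*2 : X).

Lemma coin_comm n (x : U) : below (inl n.*2 : X) x -> coin n * x = x * coin n.
Proof.
move=> hx; rewrite lam_comm// hth; congr (_ * _); apply: fspan_ext => w.
by rewrite sgnwE /chi odd_double /= mul1r.
Qed.

Definition face b n : U := if b then specproj (coin n) else 1 - specproj (coin n).

Arguments face : simpl never.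

Let coin_sqr n : specproj (coin n) * specproj (coin n) = specproj (coin n).
Proof. by have [_ pp] := specproj_proj (lam_symmetry gd (inl n.*2 : X)). Qed.

Lemma face_idem b n : face b n * face b n = face b n.
Proof. by case: b; rewrite /face ?mulrBr ?mulrBl ?mulr1 ?mul1r coin_sqr ?subrr ?subr0. Qed.

Lemma face_orth n : face true n * face false n = 0 /\ face false n * face true n = 0.
Proof. by rewrite /face mulrBr mulrBl mulr1 mul1r coin_sqr subrr. Qed.

Lemma face_adj b n : adj (face b n) = face b n.
Proof.
have [ap _] := specproj_proj (lam_symmetry gd (inl n.*2 : X)).
by case: b; rewrite /face ?adjB ?adj1 ap.
Qed.

Lemma face_sum n : face true n + face false n = 1. Proof. by rewrite addrC subrK. Qed.

(** The coins are the even letters, which commute, and [face] gives their spectral projections. This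
    embeds the functions on words of length n multiplicatively, the trace becoming the mean; the
    head of a word belongs to coin n-1. *)
Fixpoint step n g : U := if n is m.+1
  then step m (fun s => g (true :: s)) * face true m + step m (fun s => g (false :: s)) * face false m
  else (g [::])%:C *: 1.

Lemma face_below b n : below (inl n.+1.*2 : X) (face b n).
Proof.
have sA := below_subalg gd (inl n.+1.*2 : X).
have h : below (inl n.+1.*2 : X) (coin n) by apply: lam_below; rewrite lt_inl doubleS ltnS leqnSn.
have h2 : below (inl n.+1.*2 : X) (specproj (coin n)).
  by apply: (subZ sA); apply: (subD sA) => //; exact: sub1 sA.
by rewrite /face; case: b => //; apply: (subB sA) => //; exact: sub1 sA.
Qed.

Lemma step_below n g : below (inl n.*2 : X) (step n g).
Proof.
elim: n g => [|n IH] g /=; first exact: (subZ (below_subalg gd _) _ (sub1 (below_subalg gd _))).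
have sA := below_subalg gd (inl n.+1.*2 : X).
have up (x : U) : below (inl n.*2 : X) x -> below (inl n.+1.*2 : X) x.
  by apply: below_le; rewrite ltW// lt_inl doubleS ltnS leqnSn.
by apply: (subD sA); apply: (subM sA); [apply: up|exact: face_below|apply: up|exact: face_below].
Qed.

Lemma face_comm b n g : face b n * step n g = step n g * face b n.
Proof.
have h := @coin_comm n _ (@step_below n g).
by case: b; rewrite /face /specproj -?scalerAl ?mulrBl ?mulrBr -?scalerAl -?scalerAr ?mulrDl ?mulrDr ?mul1r ?mulr1 h.
Qed.

Lemma step_ext n g h : (forall s, size s = n -> g s = h s) -> step n g = step n h.
Proof.
elim: n g h => [|n IH] g h e /=; first by rewrite e.
by congr (_ * _ + _ * _); apply: IH => s ss; apply: e; rewrite /= ss.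
Qed.

Lemma step_lin n (k : R) g h : step n (fun s => k * g s + h s) = k%:C *: step n g + step n h.
Proof.
elim: n g h => [|n IH] g h /=; first by rewrite rcD rcM scalerDl scalerA.
by rewrite !IH !mulrDl -!scalerAl scalerDr addrACA.
Qed.

Lemma stepM n g h : step n g * step n h = step n (fun s => g s * h s).
Proof.
elim: n g h => [|n IH] g h /=; first by rewrite -scalerAl mul1r scalerA rcM.
have E b c (x y : seq bool -> R) : step n x * face b n * (step n y * face c n) =
    step n (fun s => x s * y s) * (face b n * face c n).
  by rewrite mulrA -(mulrA (step n x)) face_comm mulrA IH -mulrA.
have [z1 z2] := face_orth n.
rewrite mulrDl (mulrDr (_ * face true n)) (mulrDr (_ * face false n)) !E z1 z2.
by rewrite !mulr0 addr0 add0r !face_idem.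
Qed.

Lemma step1 n : step n (fun=> 1) = 1.
Proof. by elim: n => [|n IH] /=; rewrite ?scale1r// IH !mul1r face_sum. Qed.

Lemma step_adj n g : adj (step n g) = step n g.
Proof.
elim: n g => [|n IH] g /=; first by rewrite adjZ adj1 conjc_real.
by rewrite adjD !adjM !face_adj !IH !face_comm.
Qed.

Lemma step_drop m n g : step (m + n) (fun s => g (drop m s)) = step n g.
Proof.
elim: m => [|m IH]; first by apply: step_ext => s _; rewrite drop0.
by rewrite addSn /= !IH -mulrDr face_sum mulr1.
Qed.

Lemma tau_step n g : @tau R _ X th gd (step n g) = (avg n g)%:C.
Proof.
have pt := tau_posfun gd.
elim: n g => [|n IH] g /=; first by rewrite (pfZ pt) (pf1 pt) mulr1.
have E g' b : @tau R _ X th gd (step n g' * face b n) = (2^-1 * avg n g')%:C.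
  have e : @tau R _ X th gd (step n g' * specproj (coin n)) = (2^-1 * avg n g')%:C.
    rewrite /specproj -scalerAr (pfZ pt) mulrDr mulr1 (pfD pt) IH rcM halfC; congr (_ * _).
    rewrite lam_mulr; last exact: step_below.
    by rewrite /tau consVE addr0.
  case: b => //; rewrite /face mulrBr mulr1 (pfB pt) IH e -rcN -rcD; congr (_%:C); lra.
by rewrite (pfD pt) !E -rcD mulrDr.
Qed.
End StepAlgebra.

(** * Weak limits along ultrafilters in a Hilbert space *)

Section WeakCompactness.
Variables (R : realType) (H : hilbertType R).
Local Notation C := R[i].

Lemma riesz_vector (F : H -> C) (c : R) : (forall x y, F (x + y) = F x + F y) ->
  (forall k x, F (k *: x) = k * F x) -> (forall x, nr (F x) <= c * nr x) ->
  exists y, forall x, F x = inner x y.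
Proof.
move=> FD FZ Fc; have [|u [e [e0 ege ucau hu]]] := riesz (inner_form H) (F := F) (c := c) FD FZ.
  by move=> x; rewrite qn_inner.
have [y hy] : exists y, scvg u y.
  apply: scauchy_cvg => d d0; have [N hN] := ucau d d0; exists N => m n Nm Nn.
  by have := hN m n Nm Nn; rewrite qn_inner.
exists y => x; apply: (scvg_unique (u := fun n => inner x (u n))).
  apply: null_le (nullM (nr_ge0 x) e0) => n; rewrite mulrC.
  by have := hu n x; rewrite qn_inner.
exact: scvg_inner (scvg_cst _) hy.
Qed.

Definition real_convex (K : set H) := forall x y (t : R), K x -> K y -> 0 <= t <= 1 ->
  K (t%:C *: x + (1 - t)%:C *: y).

(* The nearest point of a closed convex set. *)
Lemma nearest_point (K : set H) (z : H) : closed K -> real_convex K -> K !=set0 ->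
  exists2 p, K p & forall x, K x -> complex.Re (inner (x - p) (z - p)) <= 0.
Proof.
move=> cK vK [x0 Kx0]; pose D := [set nr (z - x) | x in K].
have iD : has_inf D by split; [exists (nr (z - x0)), x0|exists 0 => _ [x _ <-]; exact: nr_ge0].
pose dl := inf D.
have d_le x : K x -> dl <= nr (z - x) by move=> Kx; apply: ge_inf; [exact: iD.2|exists x].
have d0 : 0 <= dl by apply: lb_le_inf; [exact: iD.1|move=> _ [x _ <-]; exact: nr_ge0].
have near n : exists x, K x /\ nr (z - x) ^+ 2 <= dl ^+ 2 + n.+1%:R^-1.
  have e0 : 0 < Num.sqrt (dl ^+ 2 + n.+1%:R^-1) - dl.
    rewrite subr_gt0 -{1}(ger0_norm d0) -sqrtr_sqr ltr_sqrt ?ltrDl ?invr_gt0//.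
    by rewrite ltr_wpDl ?sqr_ge0// invr_gt0.
  have [_ [x Kx <-] hx] := inf_adherent e0 iD; exists x; split=> //.
  rewrite -[leRHS]sqr_sqrtr ?addr_ge0 ?sqr_ge0 ?invr_ge0// ler_pXn2r ?nnegrE ?nr_ge0 ?sqrtr_ge0//.
  by apply: le_trans (ltW hx) _; rewrite -/dl addrCA subrr addr0.
have [u hu] := choice near.
have half : 0 <= (2^-1 : R) <= 1 by apply/andP; split; lra.
have par m n : nr (u m - u n) ^+ 2 <= 2 * m.+1%:R^-1 + 2 * n.+1%:R^-1.
  have [Km hm] := hu m; have [Kn hn] := hu n.
  have := qn_parallelogram (inner_form H) (z - u m) (z - u n); rewrite !qn_inner.
  have -> : z - u m - (z - u n) = - (u m - u n) by rewrite !opprB [LHS]addrC addrA subrK.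
  rewrite nrN; have -> : z - u m + (z - u n) = (2 : R)%:C *: (z - ((2^-1)%:C *: u m + (1 - 2^-1)%:C *: u n)).
    have -> : (1 - 2^-1 : R) = 2^-1 by lra.
    rewrite scalerBr scalerDr !scalerA -!rcM divff// !scale1r.
    have -> : ((2 : R)%:C : C) *: z = z + z by rewrite -[2]/(1 + 1 : R) rcD scalerDl scale1r.
    by rewrite opprD addrACA.
  rewrite nrZ nrR ger0_norm// exprMn => e.
  have h := d_le _ (vK _ _ _ Km Kn half).
  have h2 : dl ^+ 2 <= nr (z - ((2^-1)%:C *: u m + (1 - 2^-1)%:C *: u n)) ^+ 2.
    by rewrite ler_pXn2r ?nnegrE ?nr_ge0.
  move: e h2 hm hn; move: (nr (z - _) ^+ 2) (nr (z - u m) ^+ 2) (nr (z - u n) ^+ 2) (nr (u m - u n) ^+ 2) (dl ^+ 2) (m.+1%:R^-1) (n.+1%:R^-1) => ? ? ? ? ? ? ?; lra.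
have [p hp] : exists p, scvg u p.
  apply: scauchy_cvg => e e0; have e2 : 0 < e ^+ 2 by exact: exprn_gt0.
  have [N hN] := null_inv 4 e2; exists N => m n Nm Nn.
  rewrite -(@ltr_pXn2r _ 2%N) ?nnegrE ?nr_ge0 ?ltW//; apply: le_lt_trans (par m n) _.
  by have := hN m Nm; have := hN n Nn; move: (m.+1%:R^-1) (n.+1%:R^-1) => a b; lra.
have Kp : K p by apply: closed_scvg cK _ hp => n; case: (hu n).
have pd : nr (z - p) <= dl.
  apply/ler_addgt0Pr => e e0; have [N hN] := null_inv 1 (exprn_gt0 2 e0).
  apply: scvg_nr_le (scvg_shift (s := fun k => (k + N)%N) (fun k => leq_addr _ _) (scvgB (scvg_cst z) hp)) _ => n.
  rewrite -(@ler_pXn2r _ 2%N) ?nnegrE ?nr_ge0 ?addr_ge0 ?(ltW e0)//.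
  have [_ h] := hu (n + N)%N; apply: le_trans h _; have := hN _ (leq_addl n N); rewrite div1r => h.
  have := mulr_ge0 d0 (ltW e0); rewrite sqrrD; move: h; move: ((n + N).+1%:R^-1) => a; lra.
exists p => // x Kx.
have var t : 0 < t <= 1 -> 2 * complex.Re (inner (x - p) (z - p)) <= t * nr (x - p) ^+ 2.
  move=> /andP[t0 t1]; have Kt : K (t%:C *: x + (1 - t)%:C *: p) by apply: vK => //; rewrite ltW.
  have h := le_trans pd (d_le _ Kt).
  have h2 : nr (z - p) ^+ 2 <= nr (z - (t%:C *: x + (1 - t)%:C *: p)) ^+ 2 by rewrite ler_pXn2r ?nnegrE ?nr_ge0.
  move: h2; have -> : z - (t%:C *: x + (1 - t)%:C *: p) = (z - p) - t%:C *: (x - p).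
    rewrite rcD rcN scalerDl scale1r scaleNr scalerBr opprB opprD opprB addrA addrAC.
    by rewrite -!addrA; congr (_ + _); rewrite addrCA.
  rewrite -!nr_eq_sqr [in leRHS]innerBl ![inner _ (_ - t%:C *: _)]innerBr !innerZl !innerZr conjc_real.
  rewrite [inner (z - p) (x - p)]inner_sym !(cReB, cReZ, cRe_conj) => h2.
  have t2 : 0 <= t * (t * complex.Re (inner (x - p) (x - p)) - 2 * complex.Re (inner (x - p) (z - p))).
    by move: h2; move: (complex.Re _) (complex.Re _) (complex.Re _) => ? ? ?; nra.
  by rewrite pmulr_rge0// in t2; lra.
rewrite leNgt; apply/negP => h; set r := complex.Re _ in h var.
have q0 : 0 < nr (x - p) ^+ 2 + r by rewrite ltr_wpDl ?sqr_ge0.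
have := var (r / (nr (x - p) ^+ 2 + r)); rewrite divr_gt0// ler_pdivrMr// mul1r lerDr sqr_ge0 => /(_ isT).
rewrite mulrAC ler_pdivlMr// => h3; move: h3 h; have := sqr_ge0 (nr (x - p)).
by move: (nr (x - p) ^+ 2) => v; nra.
Qed.

Lemma ultra_limit_real (T : Type) (F : set_system T) (u : T -> R) (M : R) : UltraFilter F ->
  F [set x | `|u x| <= M] -> exists l, forall e, 0 < e -> F [set x | `|u x - l| < e].
Proof.
move=> uF FM; pose E := [set r : R | F [set x | r <= u x]].
have hE : has_sup E.
  split; first by exists (- M); apply: filterS FM => x /=; rewrite ler_norml => /andP[].
  exists M => r Fr; rewrite leNgt; apply/negP => Mr.
  have : F set0 by apply: filterS (filterI FM Fr) => x [/=]; rewrite ler_norml => /andP[_ a b]; lra.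
  exact: filter_not_empty.
exists (sup E) => e e0; have e2 : 0 < e / 2 by rewrite divr_gt0.
have [r Er hr] := sup_adherent e2 hE.
have nE : ~ E (sup E + e / 2).
  by move=> h; have := sup_upper_bound hE h; rewrite leNgt ltrDl e2.
have Fn : F (~` [set x | sup E + e / 2 <= u x]) by have [//|] := in_ultra_setVsetC [set x | sup E + e / 2 <= u x] uF.
apply: filterS (filterI Er Fn) => x [/= a /negP]; rewrite -ltNge => b.
by rewrite ltr_norml; apply/andP; split; lra.
Qed.

Definition ulim (T : Type) (F : set_system T) (u : T -> C) (l : C) :=
  forall e : R, 0 < e -> F [set x | nr (u x - l) < e].

Lemma ultra_limit (T : Type) (F : set_system T) (u : T -> C) (M : R) : UltraFilter F ->
  F [set x | nr (u x) <= M] -> exists l, ulim F u l.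
Proof.
move=> uF FM.
have [|a ha] := @ultra_limit_real T F (fun x => complex.Re (u x)) M uF.
  by apply: filterS FM => x /= h; exact: le_trans (Re_le_nr _) h.
have [|b hb] := @ultra_limit_real T F (fun x => complex.Im (u x)) M uF.
  by apply: filterS FM => x /= h; exact: le_trans (Im_le_nr _) h.
exists (a +i* b) => e e0; have e2 : 0 < e / 2 by rewrite divr_gt0.
apply: filterS (filterI (ha _ e2) (hb _ e2)) => x [/= h1 h2].
apply: le_lt_trans (nr_le_ReIm _) _; rewrite cReB cImB /= (splitr e); exact: ltrD.
Qed.

Lemma ulim_unique (T : Type) (F : set_system T) (u : T -> C) l l' : UltraFilter F ->
  ulim F u l -> ulim F u l' -> l = l'.
Proof.
move=> uF h h'; apply/eqP; rewrite -subr_eq0 -nr_eq0; apply/negPn/negP => n0.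
have e0 : 0 < nr (l - l') / 2 by rewrite divr_gt0// lt_neqAle eq_sym n0 nr_ge0.
have : F set0.
  apply: filterS (filterI (h _ e0) (h' _ e0)) => x [/= a b].
  suff : nr (l - l') < nr (l - l') by rewrite ltxx.
  rewrite {2}(splitr (nr (l - l'))); apply: le_lt_trans (nr_tri l (u x) l') _; apply: ltrD => //.
  by rewrite nr_distC.
exact: filter_not_empty.
Qed.

Variables (V : Type) (Phi : H -> V) (K : set H) (M : R).
Hypothesis cK : closed K.
Hypothesis vK : real_convex K.
Hypothesis bK : forall x, K x -> nr x <= M.
Variables (X : Type) (ev : V -> X -> C).
Hypothesis evD : forall t x y, ev (Phi (x + y)) t = ev (Phi x) t + ev (Phi y) t.
Hypothesis evZ : forall t (k : C) x, ev (Phi (k *: x)) t = k * ev (Phi x) t.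
Hypothesis evb : forall t, exists c, forall x, nr (ev (Phi x) t) <= c * nr x.

(** Along the ultrafilter all inner products converge, and Riesz represents the limit by some xi.
    With p the point of K nearest to xi, the inequality Re <k - p, xi - p> <= 0 for k in K passes to
    the limit and gives |xi - p|^2 <= 0, so xi is in K. *)
Lemma ultra_weak_limit (F : set_system V) : UltraFilter F -> F (Phi @` K) ->
  exists2 xi, K xi & forall t, ulim F (ev ^~ t) (ev (Phi xi) t).
Proof.
move=> uF FK; have K0 : K !=set0.
  apply: contrapT => no; apply: (@filter_not_empty _ F); apply: filterS FK => v [x Kx _].
  by exfalso; apply: no; exists x.
have Hs v : exists x, (Phi @` K) v -> K x /\ Phi x = v.
  by have [[x Kx xv]|n] := pselect ((Phi @` K) v); [exists x|exists 0 => h].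
have [s hs] := choice Hs.
have lim y : exists l, ulim F (fun v => inner y (s v)) l.
  apply: (@ultra_limit V F _ (nr y * M)); apply: filterS FK => v /= /hs[Ks _].
  by apply: le_trans (inner_CS _ _) _; rewrite ler_wpM2l ?nr_ge0//; exact: bK.
have [L hL] := choice lim.
have [|||xi hxi] := @riesz_vector L M.
- move=> x y; apply: (ulim_unique uF (hL _)) => e e0; have e2 : 0 < e / 2 by rewrite divr_gt0.
  apply: filterS (filterI (hL x _ e2) (hL y _ e2)) => v [/= a b].
  rewrite innerDl opprD addrACA (splitr e); apply: le_lt_trans (nrD _ _) _; exact: ltrD.
- move=> k x; apply: (ulim_unique uF (hL _)) => e e0; have k0 : 0 < nr k + 1 by have := nr_ge0 k; lra.
  apply: filterS (hL x _ (divr_gt0 e0 k0)) => v /= a.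
  rewrite innerZl -mulrBr nrM; apply: le_lt_trans (_ : (nr k + 1) * nr (inner x (s v) - L x) < _).
    by rewrite ler_wpM2r ?nr_ge0//; lra.
  by rewrite mulrC -ltr_pdivlMr.
- move=> x; apply/ler_addgt0Pr => e e0; have [v [/= h1 /hs[Kv _]]] := filter_ex (filterI (hL x _ e0) FK).
  have h2 := nr_subr (L x) (inner x (s v)); rewrite nr_distC in h2.
  have h3 := inner_CS x (s v); have h4 : nr x * nr (s v) <= nr x * M by rewrite ler_wpM2l ?nr_ge0//; exact: bK.
  move: h1 h2 h3 h4; rewrite [M * _]mulrC.
  by move: (nr (inner x (s v) - L x)) (nr (inner x (s v))) (nr x * nr (s v)) (nr x * M) => ? ? ? ?; lra.
have conv y : ulim F (fun v => inner y (s v)) (inner y xi) by rewrite -hxi.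
have Kxi : K xi.
  have [p Kp hp] := nearest_point xi cK vK K0.
  suff -> : xi = p by [].
  apply/eqP; rewrite -subr_eq0 -nr_eq0 -sqrf_eq0; apply/eqP/le_anti/andP; split; last exact: sqr_ge0.
  rewrite -nr_eq_sqr; apply/ler_addgt0Pr => e e0; rewrite add0r.
  have [v [/= h1 /hs[Kv _]]] := filter_ex (filterI (conv (xi - p) _ e0) FK).
  have h2 := hp _ Kv; have h3 := Re_le_nr (inner (xi - p) (s v) - inner (xi - p) xi).
  rewrite cReB in h3; have := ler_norm (complex.Re (inner (xi - p) xi) - complex.Re (inner (xi - p) (s v))).
  rewrite distrC => h4.
  rewrite innerBr cReB; have : complex.Re (inner (xi - p) (s v)) - complex.Re (inner (xi - p) p) <= 0.
    by rewrite -cReB -innerBr inner_sym cRe_conj.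
  move=> h5; lra.
exists xi => // t e e0; have [c hc] := evb t.
have [y hy] := riesz_vector (F := fun x => ev (Phi x) t) (evD t) (evZ t) hc.
apply: filterS (filterI (conv y _ e0) FK) => v [/= h1 h2]; have [Kv ev'] := hs _ h2.
by rewrite -{1}ev' !hy -nr_conj [X in nr X]rmorphB /= -!inner_sym.
Qed.
End WeakCompactness.

(** Compactness is tested by ultrafilters, and convergence in these initial topologies is pointwise;
    this form covers the weak and the weak* topology together. *)
Lemma initial_compact (S : choiceType) (X : topologicalType) (Y : uniformType)
  (g : S -> {ptws X -> Y}) (A : set S) :
  (forall F : set_system S, UltraFilter F -> F A ->
     exists2 x, A x & forall t, (fun v => g v t) @ F --> g x t) ->
  compact (A : set (initial_topology g)).
Proof.
move=> h; rewrite compact_ultra => F uF FA; have [x Ax hx] := h F uF FA.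
exists x; split=> //= B; rewrite nbhsE => -[P [Po Px] PB].
have [Q Qo QE] : exists2 Q : set {ptws X -> Y}, open Q & g @^-1` Q = P := Po.
apply: filterS PB _; rewrite -QE.
have : g @ F --> (g x : {ptws X -> Y}) by apply/pointwise_cvgP.
by move/(_ Q); apply; apply: open_nbhs_nbhs; split=> //; move: Px; rewrite -QE.
Qed.

(** * The L^1 norm on vector functionals *)

Section AlspachMap.
Variables (R : realType) (d : Order.disp_t) (W : orderType d).
Local Notation C := R[i].
Local Notation X := (letter W).
Local Notation words := (words R X).
Variables (th : X -> words -> words) (gd : good_family th).
Hypothesis hth : forall m, th (inl m : X) = sgnw m.
Local Notation U := (crossed gd).
Local Notation tau := (@tau R _ X th gd).
Local Notation N := (gnsnorm tau).
Variables (A : cstarAlgType R) (i : U -> A).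
Hypothesis li : linear_map i.
Hypothesis di : dense_map i.
Hypothesis iN : forall a x, N (a * x) <= nr (i a) * N x.
Hypothesis iB : forall a M, 0 <= M -> (forall x, N (a * x) <= M * N x) -> nr (i a) <= M.
Local Notation st := (@step R d W th gd).
Local Notation T := (branch (@alspach R)).
Implicit Types (g h : seq bool -> R).

Let pt : posfun tau := tau_posfun gd.
Let bnd := crossed_bounded pt.
Local Notation H := (gns_space pt).
Local Notation j := (gns_map pt).
Local Notation pi := (@gns_rep R U tau pt bnd).
Let hpi : starrep pi := gns_starrep pt bnd.
Let lj : linear_map j := gns_map_linear pt.
Let dj : dense_map j := @gns_map_dense R U tau pt.
Let nrj x : nr (j x) = N x := nr_gns_map pt x.

Lemma stepB n g h : st n g - st n h = st n (fun s => g s - h s).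
Proof.
have := step_lin gd n (-1) h g; rewrite rcN scaleN1r addrC => <-.
by apply: step_ext => s _; rewrite mulN1r addrC.
Qed.

Lemma step_normX2 n g : N (st n g) ^+ 2 = avg n (fun s => g s ^+ 2).
Proof. by rewrite (gnsnorm_sqr pt) (step_adj gd hth) (stepM gd hth) tau_step. Qed.

Lemma common_level n g n' g' : exists m (G G' : seq bool -> R),
  [/\ st n g = st m G /\ st n' g' = st m G',
      st n.+1 (T g) = st m.+1 (T G) /\ st n'.+1 (T g') = st m.+1 (T G'),
      avg m G = avg n g /\ avg m G' = avg n' g' &
      forall s, (exists s', G s = g s') /\ exists s', G' s = g' s'].
Proof.
have F k m (f : seq bool -> R) : st (k + m).+1 (T (fun s => f (drop k s))) = st m.+1 (T f).
  rewrite -(step_drop gd k m.+1) addnS; apply: step_ext => s ss; exact: (branch_drop _ _ ss).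
exists (n' + n)%N, (fun s => g (drop n' s)), (fun s => g' (drop n s)); split.
- by rewrite step_drop addnC step_drop.
- by rewrite F addnC F.
- by rewrite avg_drop addnC avg_drop.
- by move=> s; split; [exists (drop n' s)|exists (drop n s)].
Qed.

(** In L^2 the map is only 2-Lipschitz, which is enough to pass to limits of step functions. *)
Lemma alspach_lipschitz n g n' g' : nr (j (st n.+1 (T g)) - j (st n'.+1 (T g'))) <=
  2 * nr (j (st n g) - j (st n' g')).
Proof.
have [m [G [G' [[-> ->] [-> ->] _ _]]]] := common_level n g n' g'.
rewrite -!(lmapB lj) !nrj !stepB -(@ler_pXn2r _ 2%N) ?nnegrE ?mulr_ge0 ?qn_ge0//.
rewrite exprMn !step_normX2 (avg_branch2 (fun x y => (x - y) ^+ 2)) -avgZ.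
have -> : (2 ^+ 2 : R) = 4 by ring.
by apply: avg_le => s _; exact: alspach_sqr.
Qed.

Lemma dual_eq (phi psi : dual A) : (forall a, phi (i a) = psi (i a)) -> phi = psi.
Proof.
move=> e; apply/val_inj/funext => x.
have bf (f : dual A) : bop (f : A -> C^o) by apply: bopP; [exact: functional_linear|exact: functional_continuous].
exact: (@dense_bop_eq R U A i di C^o _ _ (bf phi) (bf psi) e).
Qed.

Lemma dual_nr_le (phi : dual A) (c : R) : 0 <= c -> (forall a, nr (phi (i a)) <= c * nr (i a)) -> nr phi <= c.
Proof.
move=> c0 h; have bf : bop (phi : A -> C^o) by apply: bopP; [exact: functional_linear|exact: functional_continuous].
rewrite -lecR -nrE; apply: (@dual_norm_le R A phi c) => x x1; rewrite nrE lecR.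
have [u hu] := dense_seq di x; have x1' : nr x <= 1 by rewrite -lecR -nrE.
have hx : nr (phi x) <= c * nr x.
  rewrite -subr_le0; apply: null_const; apply: null_le (nullD (bop_scvg bf hu) (nullM c0 hu)) => n.
  have h1 := nr_subr (phi x) (phi (i (u n))); rewrite nr_distC in h1.
  have h2 : c * nr (i (u n)) <= c * nr x + c * nr (i (u n) - x).
    by rewrite -mulrDr ler_wpM2l//; have := nr_subr (i (u n)) x; rewrite lerBlDl.
  apply: le_trans (lerB (le_trans (_ : _ <= nr (phi (i (u n)) - phi x) + nr (phi (i (u n)))) (lerD (lexx _) (h _))) (lexx _)) _.
    by rewrite -lerBlDr.
  by rewrite -addrA lerD// lerBlDl.
by apply: le_trans hx _; rewrite ler_piMr.
Qed.

Lemma le_dual_nr (phi : dual A) x : nr (phi x) <= nr phi * nr x.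
Proof. by have := le_dual_norm phi x; rewrite -[dual_norm phi]/(`|phi|) !nrE -rcM lecR. Qed.

Let pi_nr a (x : H) : nr (pi a x) <= nr (i a) * nr x.
Proof.
have [u hu] := dense_seq dj x; rewrite -subr_le0; apply: null_const.
have hp := bop_scvg (rep_bop hpi a) hu.
apply: null_le (nullD hp (nullM (nr_ge0 (i a)) hu)) => n.
have h1 := nr_subr (pi a x) (pi a (j (u n))); have h2 := nr_subr (j (u n)) x.
have h3 : nr (pi a (j (u n))) <= nr (i a) * nr (j (u n)) by rewrite gns_repE !nrj.
have h4 := ler_wpM2l (nr_ge0 (i a)) h2; rewrite mulrBr in h4; rewrite nr_distC in h1.
by apply: le_trans (lerB (lexx _) (_ : nr (i a) * nr (j (u n)) - nr (i a) * nr (j (u n) - x) <= _)) _; lra.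
Qed.

Let j11 : nr (j 1) = 1. Proof. by rewrite nrj (gnsnorm1 pt). Qed.

(** For x coming from a step function g this functional is a -> tau (a g), the element g of the
    predual of the tracial von Neumann algebra. *)
Lemma vector_functional_ex (x : H) : exists phi : dual A, forall a, phi (i a) = inner (pi a x) (j 1).
Proof.
have lp : linear_map (fun a => pi a x) by move=> k a b; rewrite (repDl hpi) (repZl hpi).
have [|E [bE hE _]] := dense_extend li di lp (nr_ge0 x); first by move=> a; rewrite mulrC.
pose F v : C^o := inner (E v) (j 1).
have bF : bop (F : A -> C^o).
  split; first by move=> k v w; rewrite /F (bE.1 k v w) innerDl innerZl.
  have [c c0 hc] := bE.2; exists c => // v; apply: le_trans (inner_CS _ _) _.
  by rewrite j11 mulr1.
have FP : F \in @bounded_functional R A.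
  by apply/mem_set; split; [exact: bF.1|exact: bop_continuous].
by exists (Dual FP) => a; rewrite -hE.
Qed.

Definition vector_functional (x : H) : dual A := projT1 (cid (vector_functional_ex x)).
Local Notation Phi := vector_functional.

Lemma vector_functionalE x a : Phi x (i a) = inner (pi a x) (j 1).
Proof. by rewrite /Phi; case: cid. Qed.

Lemma vector_functional_bop : bop Phi.
Proof.
split.
  move=> k x y; apply: dual_eq => a; rewrite vector_functionalE.
  rewrite -[RHS]/(k * Phi x (i a) + Phi y (i a)) !vector_functionalE.
  by rewrite (repDr hpi) (repZr hpi) innerDl innerZl.
exists 1 => // x; rewrite mul1r; apply: dual_nr_le => [|a]; first exact: nr_ge0.
rewrite vector_functionalE; apply: le_trans (inner_CS _ _) _.
by rewrite j11 mulr1 mulrC.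
Qed.

Lemma vector_functional_inj x y : Phi x = Phi y -> x = y.
Proof.
move=> e; have h a : inner x (j a) = inner y (j a).
  have := congr1 (fun f : dual A => f (i (adj a))) e; rewrite /= !vector_functionalE !(rep_adj hpi) adjK.
  by rewrite gns_repE mulr1.
apply: inner_inj => z; have [u hu] := dense_seq dj z.
apply: scvg_unique (scvg_inner (scvg_cst x) hu) _.
by apply: scvg_ext (scvg_inner (scvg_cst y) hu) => n; rewrite h.
Qed.

(** The upper bound is Cauchy-Schwarz after writing g as sign times the square of |g|^(1/2). The
    lower bound evaluates at the sign of g, a symmetry and thus of norm at most 1. *)
Lemma vector_functional_step n g : nr (Phi (j (st n g))) = avg n (fun s => `|g s|).
Proof.
have E a : Phi (j (st n g)) (i a) = tau (a * st n g).
  by rewrite vector_functionalE gns_repE gns_inner adj1 mul1r.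
pose rt s := Num.sqrt `|g s|; pose sg s : R := if 0 <= g s then 1 else -1.
have rr : avg n (fun s => `|g s|) = N (st n rt) ^+ 2.
  by rewrite step_normX2; apply: avg_ext => s _; rewrite sqr_sqrtr.
have sg2 s : sg s * sg s = 1 by rewrite /sg; case: ifP; rewrite ?mulrNN mulr1.
have sgg s : sg s * `|g s| = g s.
  rewrite /sg; case: (leP 0 (g s)) => h; first by rewrite mul1r ger0_norm.
  by rewrite ltr0_norm// mulN1r opprK.
have symm : symmetry (st n sg).
  split; first by rewrite (step_adj gd hth).
  by rewrite (stepM gd hth) -[RHS](step1 gd n); apply: step_ext => s _; rewrite sg2.
apply/le_anti/andP; split.
  apply: dual_nr_le => [|a]; first by rewrite rr sqr_ge0.
  rewrite E; have -> : st n g = st n sg * st n rt * st n rt.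
    rewrite -mulrA !(stepM gd hth); apply: step_ext => s _.
    by rewrite -expr2 sqr_sqrtr.
  rewrite mulrA tauC -{1}(step_adj gd hth n rt) -[tau _]/(gnsform tau (a * (st n sg * st n rt)) (st n rt)).
  apply: le_trans (form_CS (gns_psd pt) _ _) _; rewrite -!/(gnsnorm tau _) rr.
  apply: le_trans (_ : nr (i a) * N (st n rt) * N (st n rt) <= _).
    by rewrite ler_wpM2r ?qn_ge0//; apply: le_trans (iN _ _) _; rewrite (gnsnorm_sym pt).
  by rewrite -mulrA -expr2 mulrC lexx.
have i1 : nr (i (st n sg)) <= 1 by apply: iB => // x; rewrite mul1r (gnsnorm_sym pt).
have := le_dual_nr (Phi (j (st n g))) (i (st n sg)); rewrite E (stepM gd hth) tau_step.
have -> : avg n (fun s => sg s * g s) = avg n (fun s => `|g s|).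
  by apply: avg_ext => s _; rewrite -{1}sgg mulrA sg2 mul1r.
have a0 : 0 <= avg n (fun s => `|g s|) by apply: avg_ge0 => s; exact: normr_ge0.
by rewrite nrR ger0_norm// => h; apply: le_trans h _; rewrite ler_piMr ?nr_ge0.
Qed.

End AlspachMap.

(** * Alspach's convex set *)

Section StepClosure.
Variables (R : realType) (d : Order.disp_t) (W : orderType d).
Local Notation C := R[i].
Local Notation X := (letter W).
Local Notation words := (words R X).
Variables (th : X -> words -> words) (gd : good_family th).
Hypothesis hth : forall m, th (inl m : X) = sgnw m.
Local Notation U := (crossed gd).
Local Notation tau := (@tau R _ X th gd).
Local Notation N := (gnsnorm tau).
Local Notation st := (@step R d W th gd).
Local Notation T := (branch (@alspach R)).
Implicit Types (g h : seq bool -> R).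

Let pt : posfun tau := tau_posfun gd.
Let bnd := crossed_bounded pt.
Local Notation H := (gns_space pt).
Local Notation j := (gns_map pt).
Local Notation pi := (@gns_rep R U tau pt bnd).
Let hpi : starrep pi := gns_starrep pt bnd.
Let lj : linear_map j := gns_map_linear pt.
Let dj : dense_map j := @gns_map_dense R U tau pt.
Let nrj x : nr (j x) = N x := nr_gns_map pt x.

(** The mean 1/2 excludes the constants 0 and 1, the obvious fixed points of Alspach's map. *)
Definition admissible n g := (forall s, 0 <= g s <= 1) /\ avg n g = 2^-1.
Definition step_closure : set H := [set x | forall e : R, 0 < e ->
  exists n g, admissible n g /\ nr (x - j (st n g)) < e].
Local Notation K := step_closure.

Lemma step_closure_closed : closed K.
Proof.
apply: scvg_closed => u x hu ux e e0; have e2 : 0 < e / 2 by rewrite divr_gt0.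
have [n0 hn] := ux _ e2; have [n [g [ag hg]]] := hu n0 _ e2; exists n, g; split=> //.
rewrite (splitr e); apply: le_lt_trans (nr_tri _ (u n0) _) _; apply: ltrD => //.
by rewrite nr_distC; exact: hn.
Qed.

Lemma step_closure_bounded x : K x -> nr x <= 1.
Proof.
move=> Kx; apply/ler_addgt0Pr => e e0; have [n [g [[g01 _] hg]]] := Kx e e0.
have h1 : nr (j (st n g)) <= 1.
  rewrite nrj -(@ler_pXn2r _ 2%N) ?nnegrE ?qn_ge0// expr1n (step_normX2 gd hth) -[leRHS](avg_cst n).
  by apply: avg_le => s _; case/andP: (g01 s) => a b; rewrite exprn_ile1.
have := nr_tri x (j (st n g)) 0; rewrite !subr0 => /le_trans; apply.
by rewrite addrC lerD// ltW.
Qed.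

Lemma step_closure_convex : real_convex K.
Proof.
move=> x y t Kx Ky /andP[t0 t1] e e0; have e2 : 0 < e / 2 by rewrite divr_gt0.
have [n [g [[g01 gm] hg]]] := Kx _ e2; have [n' [g' [[g01' gm'] hg']]] := Ky _ e2.
have [m [G [G' [[eG eG'] _ [aG aG'] GG]]]] := common_level gd n g n' g'.
exists m, (fun s => t * G s + (1 - t) * G' s); split.
  split; last by rewrite avg_lin avgZ aG aG' gm gm'; lra.
  move=> s; have [[s1 ->] [s2 ->]] := GG s.
  by case/andP: (g01 s1) (g01' s2) => a b /andP[a' b']; apply/andP; split; nra.
have -> : j (st m (fun s => t * G s + (1 - t) * G' s)) = t%:C *: j (st n g) + (1 - t)%:C *: j (st n' g').
  rewrite step_lin lj; congr (_ + _); first by rewrite eG.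
  rewrite eG' -(lmapZ lj); congr (j _).
  have := step_lin gd m (1 - t) G' (fun=> 0); have -> : st m (fun=> 0) = 0.
    have := stepB gd m (fun=> 0) (fun=> 0); rewrite subrr => ->; apply: step_ext => s _.
    by rewrite subrr.
  by rewrite addr0 => <-; apply: step_ext => s _; rewrite addr0.
rewrite opprD addrACA -!scalerBr (splitr e); apply: le_lt_trans (nrD _ _) _.
rewrite !nrZ !nrR !ger0_norm ?subr_ge0//.
have := nr_ge0 (x - j (st n g)); have := nr_ge0 (y - j (st n' g')); move: hg hg'.
move: (nr (x - _)) (nr (y - _)) => a b ha hb b0 a0.
have h1 : t * a <= t * (e / 2) by rewrite ler_wpM2l// ltW.
have [t1'|t1'] := eqVneq t 1; first by rewrite t1' subrr mul0r addr0 mul1r; lra.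
have h2 : (1 - t) * b < (1 - t) * (e / 2).
  by rewrite ltr_pM2l// subr_gt0 lt_neqAle t1'.
lra.
Qed.

Lemma step_closure_seq x : K x -> exists (n : nat -> nat) (g : nat -> seq bool -> R),
  (forall k, admissible (n k) (g k)) /\ scvg (fun k => j (st (n k) (g k))) x.
Proof.
move=> Kx; have h k : exists p : nat * (seq bool -> R), admissible p.1 p.2 /\
    nr (x - j (st p.1 p.2)) < k.+1%:R^-1.
  by have [|n [g hg]] := Kx k.+1%:R^-1; [rewrite invr_gt0|exists (n, g)].
have [p hp] := choice h; exists (fun k => (p k).1), (fun k => (p k).2).
split=> [k|]; first by case: (hp k).
apply: null_le (null_inv 1) => k; rewrite nr_distC div1r ltW//; by case: (hp k).
Qed.

(** The extension of Alspach's map to L^2 limits, as a relation witnessed by one approximating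
    sequence; values are selected in [alspach_fixed_point_fails]. *)
Definition alspach_rel x y := exists (n : nat -> nat) (g : nat -> seq bool -> R),
  [/\ forall k, admissible (n k) (g k), scvg (fun k => j (st (n k) (g k))) x &
      scvg (fun k => j (st (n k).+1 (T (g k)))) y].

Lemma admissible_alspach n g : admissible n g -> admissible n.+1 (T g).
Proof.
move=> [g01 gm]; split; first by move=> s; exact: alspach_bound.
rewrite (avg_branch (fun x => x)) -[RHS]gm; apply: avg_ext => s _; exact: alspach_mean.
Qed.

Lemma alspach_rel_ex x : K x -> exists2 y, K y & alspach_rel x y.
Proof.
move=> Kx; have [n [g [ag hg]]] := step_closure_seq Kx.
have [y hy] : exists y, scvg (fun k => j (st (n k).+1 (T (g k)))) y.
  apply: scauchy_cvg => e e0; have e2 : 0 < e / 2 by rewrite divr_gt0.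
  have [N0 hN] := scvg_scauchy hg e2; exists N0 => m k Nm Nk.
  apply: le_lt_trans (alspach_lipschitz gd hth _ _ _ _) _; rewrite mulrC -ltr_pdivlMr//; exact: hN.
exists y; last by exists n, g.
apply: closed_scvg step_closure_closed _ hy => k e e0; exists (n k).+1, (T (g k)).
by split; [exact: admissible_alspach|rewrite subrr nr0].
Qed.

Lemma step_closure_nonempty : K !=set0.
Proof.
exists (j (st 0 (fun=> 2^-1))) => e e0; exists 0%N, (fun=> 2^-1); split; last by rewrite subrr nr0.
by split=> // s; apply/andP; split; lra.
Qed.

End StepClosure.

Section NoFixedPoint.
Variables (R : realType) (d : Order.disp_t) (W : orderType d).
Local Notation C := R[i].
Local Notation X := (letter W).
Local Notation words := (words R X).
Variables (th : X -> words -> words) (gd : good_family th).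
Hypothesis hth : forall m, th (inl m : X) = sgnw m.
Local Notation U := (crossed gd).
Local Notation tau := (@tau R _ X th gd).
Local Notation N := (gnsnorm tau).
Local Notation st := (@step R d W th gd).
Local Notation T := (branch (@alspach R)).
Implicit Types (g h : seq bool -> R).

Let pt : posfun tau := tau_posfun gd.
Let bnd := crossed_bounded pt.
Local Notation H := (gns_space pt).
Local Notation j := (gns_map pt).
Local Notation pi := (@gns_rep R U tau pt bnd).
Let hpi : starrep pi := gns_starrep pt bnd.
Let lj : linear_map j := gns_map_linear pt.
Let dj : dense_map j := @gns_map_dense R U tau pt.
Let nrj x : nr (j x) = N x := nr_gns_map pt x.

(* A fixed point would be the indicator of a tail event of mean 1/2. *)
Lemma alspach_no_fixed_point (x : H) : ~ alspach_rel x x.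
Proof.
move=> [n [g [ag gx gy]]].
have ip m G G' : inner (j (st m G)) (j (st m G')) = (avg m (fun s => G s * G' s))%:C.
  rewrite gns_inner (step_adj gd hth) (stepM gd hth) tau_step; congr (_%:C); apply: avg_ext => s _.
  by rewrite mulrC.
have ip1 m G : inner (j (st m G)) (j 1) = (avg m G)%:C by rewrite gns_inner adj1 mul1r tau_step.
(* |x|^2 can be computed along g and along its image. The means being equal, [alspach_defect] says
   that the two computations differ by mk, which therefore tends to 0. *)
pose mk k := avg (n k) (fun s => Num.min (g k s) (1 - g k s) ^+ 2).
have mk0 : null mk.
  apply: null_le (scvgB (scvg_inner gy gy) (scvg_inner gx gx)) => k.
  rewrite subrr subr0 !ip -rcN -rcD nrR; apply: le_trans (ler_norm _); rewrite le_eqVlt; apply/orP; left; apply/eqP.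
  have [g01 gm] := ag k; have [_ tm] := admissible_alspach (ag k).
  have e : avg (n k).+1 (fun s => T (g k) s * (1 - T (g k) s)) =
      avg (n k) (fun s => g k s * (1 - g k s)) - mk k.
    rewrite (avg_branch (fun x => x * (1 - x))) -avgB; apply: avg_ext => s _; exact: alspach_defect.
  have q m G : avg m (fun s => G s * (1 - G s)) = avg m G - avg m (fun s => G s * G s).
    by rewrite -avgB; apply: avg_ext => s _; rewrite mulrBr mulr1.
  by move: e; rewrite !q gm tm; lra.
(* Rounding g to an indicator moves it by exactly the square root of mk. *)
pose b k s : R := if g k s < 2^-1 then 0 else 1.
have b01 k s : b k s = 0 \/ b k s = 1 by rewrite /b; case: ifP; [left|right].
have bg k : nr (j (st (n k) (b k)) - j (st (n k) (g k))) ^+ 2 = mk k.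
  rewrite -(lmapB lj) nrj (stepB gd) (step_normX2 gd hth); apply: avg_ext => s _.
  rewrite /b /Num.min; case: (ltP (g k s) 2^-1) => h; case: (ltP (g k s) (1 - g k s)) => h'.
  - by ring.
  - by exfalso; lra.
  - by exfalso; lra.
  - by [].
have bgn : null (fun k => nr (j (st (n k) (b k)) - j (st (n k) (g k)))).
  by apply: nullX2 => [k|]; [exact: nr_ge0|apply: null_le mk0 => k; rewrite bg].
have bx : scvg (fun k => j (st (n k) (b k))) x.
  by apply: null_le (nullD bgn gx) => k; exact: nr_tri.
(* The shift of f by p coins: the last p letters are ignored. *)
pose V (f : seq bool -> R) p s := f (take (size s - p) s).
have Tb : scvg (fun k => j (st (n k).+1 (V (b k) 1%N))) x.
  apply: null_le (nullD (nullM (ler0n _ 2) bgn) gy) => k.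
  have -> : st (n k).+1 (V (b k) 1%N) = st (n k).+1 (T (b k)).
    by apply: step_ext => s _; rewrite /V /branch subn1 alspach_id.
  apply: le_trans (nr_tri _ (j (st (n k).+1 (T (g k)))) _) _; rewrite lerD//.
  exact: (alspach_lipschitz gd hth).
have Viso m p F G : nr (j (st (m + p) (V F p)) - j (st (m + p) (V G p))) = nr (j (st m F) - j (st m G)).
  rewrite -!(lmapB lj) !nrj !(stepB gd); apply/eqP; rewrite -(eqrXn2 (n := 2)) ?qn_ge0// !(step_normX2 gd hth); apply/eqP.
  have := avg_take_drop m p (fun s => (F s - G s) ^+ 2) (fun=> 1); rewrite avg_cst mulr1 => <-.
  by apply: avg_ext => s ss; rewrite /V ss addnK mulr1.
(* Alspach's pieces fix 0 and 1, so on indicators the map is the shift; hence x is also the limit of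
   the p-fold shifts of the b k. *)
have Vx p : scvg (fun k => j (st (n k + p) (V (b k) p))) x.
  elim: p => [|p IH].
    apply: scvg_ext bx => k; rewrite addn0; congr (j _); apply: step_ext => s _.
    by rewrite /V subn0 take_size.
  have D0 := scvgB Tb bx; rewrite subrr in D0.
  apply: null_le (nullD D0 IH) => k; apply: le_trans (nr_tri _ (j (st (n k + p) (V (b k) p))) _) _.
  rewrite lerD// subr0; rewrite le_eqVlt; apply/orP; left; apply/eqP.
  have e1 : st (n k) (b k) = st (n k).+1 (fun s => b k (drop 1 s)) by rewrite -[(n k).+1]add1n step_drop.
  have e2 : st (n k + p.+1) (V (b k) p.+1) = st ((n k).+1 + p) (V (V (b k) 1%N) p).
    rewrite addnS -addSn; apply: step_ext => s ss; rewrite /V size_take ss addnK.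
    have -> : ((n k).+1 + p - p.+1 = n k)%N by lia.
    have -> : ((if (n k).+1 < (n k).+1 + p then (n k).+1 else (n k).+1 + p) - 1 = n k)%N by case: ifP; lia.
    by rewrite take_takel.
  have e3 : st (n k + p) (V (b k) p) = st ((n k).+1 + p) (V (fun s => b k (drop 1 s)) p).
    rewrite -(step_drop gd 1 (n k + p)) addnA add1n; apply: step_ext => s ss; rewrite /V size_drop ss addnK.
    have -> : ((n k).+1 + p - 1 - p = n k)%N by lia.
    by rewrite take_drop addn1.
  by rewrite e2 e3 Viso -e1.
have m1 : inner x (j 1) = (2^-1)%:C.
  apply: scvg_unique (scvg_inner gx (scvg_cst (j 1))) _; apply: scvg_ext (scvg_cst _) => k.
  by rewrite ip1; case: (ag k) => _ ->.
have bm : scvg (fun k => (avg (n k) (b k))%:C : C) (2^-1)%:C.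
  by rewrite -m1; apply: scvg_ext (scvg_inner bx (scvg_cst (j 1))) => k; rewrite ip1.
(* The p-fold shifts do not involve the first p coins, so x is independent of every step function.
   Tested against the b k themselves this gives |x|^2 = 1/4, while b k being an indicator gives
   1/2. *)
have indep p f : inner x (j (st p f)) = (2^-1)%:C * (avg p f)%:C.
  apply: scvg_unique (scvg_inner (Vx p) (scvg_cst (j (st p f)))) _.
  apply: scvg_ext (scvg_mul bm (scvg_cst _)) => k.
  rewrite -(step_drop gd (n k) p) ip -rcM; congr (_%:C); rewrite -avg_take_drop.
  by apply: avg_ext => s ss; rewrite /V ss addnK.
have q1 : inner x x = (2^-1)%:C * (2^-1)%:C.
  apply: scvg_unique (scvg_inner (scvg_cst x) bx) _.
  by apply: scvg_ext (scvg_mul (scvg_cst (2^-1)%:C) bm) => k; rewrite indep.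
have q2 : inner x x = (2^-1)%:C.
  apply: scvg_unique (scvg_inner bx bx) _; apply: scvg_ext bm => k; rewrite ip; congr (_%:C).
  by apply: avg_ext => s _; case: (b01 k s) => ->; rewrite ?mulr0 ?mulr1.
by have := q2; rewrite q1 -rcM => -[]; lra.
Qed.
End NoFixedPoint.

(** * Failure of the fixed point property *)

Section AlspachFixedPoint.
Variables (R : realType) (d : Order.disp_t) (W : orderType d).
Local Notation C := R[i].
Local Notation X := (letter W).
Local Notation words := (words R X).
Variables (th : X -> words -> words) (gd : good_family th).
Hypothesis hth : forall m, th (inl m : X) = sgnw m.
Local Notation U := (crossed gd).
Local Notation tau := (@tau R _ X th gd).
Local Notation N := (gnsnorm tau).
Local Notation st := (@step R d W th gd).
Local Notation T := (branch (@alspach R)).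
Implicit Types (g h : seq bool -> R).

Let pt : posfun tau := tau_posfun gd.
Let bnd := crossed_bounded pt.
Local Notation H := (gns_space pt).
Local Notation j := (gns_map pt).
Local Notation pi := (@gns_rep R U tau pt bnd).
Let hpi : starrep pi := gns_starrep pt bnd.
Let lj : linear_map j := gns_map_linear pt.
Let dj : dense_map j := @gns_map_dense R U tau pt.
Let nrj x : nr (j x) = N x := nr_gns_map pt x.

Local Notation K := (@step_closure R d W th gd).
Variables (E : normedModType C) (Phi : H -> E).
Hypothesis bP : bop Phi.
Hypothesis Phi_step : forall n g, nr (Phi (j (st n g))) = avg n (fun s => `|g s|).

(** At a common level the norms are L^1 norms, preserved by [alspach_isometry]; limits along the two
    sequences finish. *)
Lemma alspach_rel_nonexpansive x y x' y' : alspach_rel x y -> alspach_rel x' y' ->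
  nr (Phi y - Phi y') <= nr (Phi x - Phi x').
Proof.
move=> [n [g [_ gx gy]]] [n' [g' [_ gx' gy']]].
have hy := scvgB (bop_scvg bP gy) (bop_scvg bP gy'); have hx := scvgB (bop_scvg bP gx) (bop_scvg bP gx').
rewrite -subr_le0; apply: null_const; apply: null_le (nullD hy hx) => k.
set v := Phi (j (st (n k).+1 (T (g k)))) - Phi (j (st (n' k).+1 (T (g' k)))).
set u := Phi (j (st (n k) (g k))) - Phi (j (st (n' k) (g' k))).
suff e : nr v = nr u.
  have h1 := nr_subr (Phi y - Phi y') v; have h2 := nr_subr u (Phi x - Phi x').
  rewrite (nr_distC _ v) in h1; rewrite -e in h2; apply: le_trans _ (lerD h1 h2).
  by rewrite addrA subrK.
rewrite /u /v; have [m [G [G' [[-> ->] [-> ->] _ _]]]] := common_level gd (n k) (g k) (n' k) (g' k).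
rewrite -!(bopB bP) -!(lmapB lj) !(stepB gd) !Phi_step.
rewrite (avg_branch2 (fun x y => `|x - y|)); apply: avg_ext => s _; exact: alspach_isometry.
Qed.

Lemma step_closure_image_convex : convex_set (Phi @` K).
Proof.
move=> p q l /set_mem[x Kx <-] /set_mem[y Ky <-]; apply/mem_set.
have l0 : 0 <= l%:num :> C by []; have l1 : l%:num <= 1 :> C by [].
have lE : l%:num = (complex.Re l%:num)%:C by rewrite RRe_real// ger0_real.
have r0 : 0 <= complex.Re (l%:num : C) by rewrite -lecR -lE.
have r1 : complex.Re (l%:num : C) <= 1 by rewrite -lecR -lE.
exists ((complex.Re l%:num)%:C *: x + (1 - complex.Re l%:num)%:C *: y).
  by apply: step_closure_convex => //; rewrite r0.
have e1 : (1 - complex.Re (l%:num : C))%:C = 1 - l%:num :> C by rewrite rcD rcN -lE.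
have PD (k k' : C) u w : Phi (k *: u + k' *: w) = k *: Phi u + k' *: Phi w.
  by rewrite (bopD bP) !(bopZ bP).
rewrite PD e1 -lE; reflexivity.
Qed.

Lemma alspach_fixed_point_fails : injective Phi -> ~ fixed_point_property (Phi @` K).
Proof.
move=> inj fpp; have hS phi : exists psi, (Phi @` K) phi ->
    exists x y, [/\ K y, alspach_rel x y, Phi x = phi & Phi y = psi].
  have [[x Kx <-]|n] := pselect ((Phi @` K) phi); last by exists 0.
  by have [y Ky r] := alspach_rel_ex hth Kx; exists (Phi y) => _; exists x, y.
have [S {}hS] := choice hS.
have [|p q Cp Cq|phi Cphi e] := fpp S.
- by move=> phi /hS[x [y [Ky _ _ <-]]]; exists y.
- have [x [y [_ r <- <-]]] := hS p Cp; have [x' [y' [_ r' <- <-]]] := hS q Cq.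
  by rewrite !nrE lecR; exact: alspach_rel_nonexpansive.
have [x [y [_ r e1 e2]]] := hS _ Cphi.
have xy : y = x by apply: inj; rewrite e1 e2.
by rewrite xy in r; exact: (alspach_no_fixed_point hth r).
Qed.

(** [ev] evaluates at bounded functionals on the dual or at elements of A; composed with the bounded
    map Phi it is weakly continuous on the Hilbert space, where the closed convex bounded set has
    its ultrafilter limits. *)
Lemma step_closure_image_compact (Y : topologicalType) (ev : E -> {ptws Y -> C^o}) :
  (forall t x y, ev (Phi (x + y)) t = ev (Phi x) t + ev (Phi y) t) ->
  (forall t (k : C) x, ev (Phi (k *: x)) t = k * ev (Phi x) t) ->
  (forall t, exists c, forall x, nr (ev (Phi x) t) <= c * nr x) ->
  compact ((Phi @` K) : set (initial_topology ev)).
Proof.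
move=> evD evZ evb; apply: initial_compact => F uF FK.
have [x Kx hx] := ultra_weak_limit (@step_closure_closed R d W th gd) (@step_closure_convex R d W th gd)
  (@step_closure_bounded R d W th gd hth) evD evZ evb uF FK.
exists (Phi x); first by exists x.
move=> t; apply/cvg_ballP => e e0; have [-> e0'] := gt0_cReal e0.
by apply: filterS (hx t _ e0') => v /= h; rewrite ball_nr nr_distC.
Qed.

End AlspachFixedPoint.

Theorem mainTheorem3 (R : realType) (hdiamond : diamond) :
  exists A : cstarAlgType R,
    [/\ ~ separable A,
        discrete_spectrum A,
        ~ weak_fixed_point_property (dual A) &
        ~ weak_star_fixed_point_property A].
Proof.
have [d [W [hW [Sd [_ hSd]]]]] := hdiamond.
have [kappa kappa_inj] := word_coding hW.
have [th [gd [hth hst]]] := crossed_tower hW (guess_guessing R Sd kappa).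
have [A [i [li di iM iS [iN iB]]]] := cstar_of_state (tau_posfun gd) (crossed_bounded (tau_posfun gd)).
have bP := vector_functional_bop li di iN; have Ps := vector_functional_step hth li di iN iB.
have inj : injective (vector_functional li di iN) by move=> x y; exact: vector_functional_inj.
have fails := alspach_fixed_point_fails hth bP Ps inj.
have cvx := step_closure_image_convex bP (gd := gd).
have K0 := step_closure_nonempty gd.
have C0 : vector_functional li di iN @` @step_closure R d W th gd !=set0.
  by have [x Kx] := K0; exists (vector_functional li di iN x), x.
exists A; split.
(* The letters of omega_1 are at mutual distance at least 1, as seen by applying their differences
   to the vacuum of the trace. *)
- have [_ unc _] := hW.
  apply: (@not_separable_of_family R A W (fun a => i (lam gd (inr a))) unc) => a b ab.
  rewrite -(lmapB li); apply: le_trans (tau_lam_far gd ab) _.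
  have := iN (lam gd (inr a) - lam gd (inr b)) 1.
  by rewrite mulr1 (gnsnorm1 (tau_posfun gd)) mulr1.
- apply: discrete_of_equivalent; apply: (irreps_equivalent li di iM iS (f := @fstate R d W)).
    exact: pf1 (fstate_posfun gd hth (omega1_wf hW)).
  move=> H rho x; exact: (diamond_state_vector hW hSd kappa_inj hth hst).
- move=> wf; apply: fails; apply: wf => //.
  refine (@step_closure_image_compact R d W th gd hth (dual A) _ (dual (dual A))
    (fun x : dual A => (fun f : dual (dual A) => f x)) _ _ _) => [f x y|f k x|f].
  + by rewrite (bopD bP) linearD.
  + by rewrite (bopZ bP) linearZ.
  + have bf : bop (f : dual A -> R[i]^o) by apply: bopP; [exact: functional_linear|exact: functional_continuous].
    by have [c _ hc] := (bop_comp bf bP).2; exists c.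
move=> wf; apply: fails; apply: wf => //.
refine (@step_closure_image_compact R d W th gd hth (dual A) _ A
  (fun f : dual A => (f : A -> R[i]^o)) _ _ _) => [a x y|a k x|a].
- by rewrite (bopD bP).
- by rewrite (bopZ bP).
have [c _ hc] := bP.2; exists (c * nr a) => x; apply: le_trans (le_dual_nr _ _) _.
by rewrite [leRHS]mulrAC; exact: ler_wpM2r (nr_ge0 _) _ _ (hc x).
Qed.
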